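(* Let $\Omega\subset\mathbb{R}^n$ be a bounded open set, $s\in(0,1)$, $g(x,t)\in L^\infty_{\rm loc}(\Omega\times\mathbb{R})$, and let $u\in X^1$ be a bounded weak solution of $$-\Delta u+(-\Delta)^su=g(x,u)\quad\text{in }\Omega .$$ Denote ${\rm I_u}:=[-\|u\|_{L^\infty(\Omega)},\|u\|_{L^\infty(\Omega)}]$. Let $V$ be an open domain with $\overline V\subset\Omega$, and denote $\rho:=\mathrm{dist}(V,\partial\Omega)$ and $V_\delta:=\{x\in\Omega:\mathrm{dist}(x,V)<\delta\}$. Then $u\in C^{1,\alpha}(\overline V)$ for any $\alpha\in(0,1)$. More specifically, $$\|u\|_{C^{1,\alpha}(\overline V)}\le C\Big(\|g\|_{L^\infty(V_{3\rho/4}\times{\rm I_u})}+\|u\|_{L^\infty(\mathbb{R}^n)}\Big),$$ where the constant $C>0$ depends on $n,s,\alpha,V$.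
   Context: Set $[u]_s:=\big(\iint_{\mathbb{R}^{2n}}\frac{|u(x)-u(y)|^2}{|x-y|^{n+2s}}\,dx\,dy\big)^{1/2}$. The space $X^1$ consists of Lebesgue measurable $u:\mathbb{R}^n\to\mathbb{R}$ with $u|_\Omega\in H^1(\Omega)$ and $[u]_s<\infty$; no exterior condition is imposed on $u$. The space $X_0^1$ consists of Lebesgue measurable $\varphi:\mathbb{R}^n\to\mathbb{R}$ with $\varphi|_\Omega\in H_0^1(\Omega)$ (the closure of $C_c^\infty(\Omega)$ in the $H^1(\Omega)$ norm), $[\varphi]_s<\infty$ and $\varphi=0$ a.e. in $\mathbb{R}^n\setminus\Omega$. Weak solution means $$\int_\Omega\nabla u\cdot\nabla\varphi\,dx+\iint_{\mathbb{R}^{2n}}\frac{(u(x)-u(y))(\varphi(x)-\varphi(y))}{|x-y|^{n+2s}}\,dx\,dy=\int_\Omega g(x,u(x))\varphi(x)\,dx\quad\forall\varphi\in X_0^1$$ (the normalization constant in front of the fractional term is set to $1$).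
   Formalization: The L^∞ norm and L^∞_loc condition on g use the essential supremum in x of the supremum in t (g jointly measurable), since changing g on the null graph of u defeats the joint essential supremum; the constant C may also depend on ρ. *)

(* Defs.v *)
From HB Require Import structures.
From mathcomp Require Import all_boot all_order all_algebra.
From mathcomp Require Import all_classical all_reals all_analysis.
From mathcomp Require Import lra.
Set Implicit Arguments.
Unset Strict Implicit.
Unset Printing Implicit Defensive.
Import Order.TTheory GRing.Theory Num.Theory.
Import numFieldNormedType.Exports.
Local Open Scope classical_set_scope.
Local Open Scope ring_scope.

(* R^N is 'rV[R]_n.+1 with N = n.+1 >= 1.  The library norm on row vectors is
   the sup norm (it induces the usual topology); lengths and distances below
   use the Euclidean norm enorm. *)

Section lebesgue_outer_measure.
Context {R : realType} {n : nat}.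
Local Notation E := 'rV[R]_n.+1.
Implicit Types (a b x : E).

Definition box a b : set E := [set x | forall i, a 0 i <= x 0 i <= b 0 i].

Definition box_vol a b : R := \prod_i Num.max 0 (b 0 i - a 0 i).

Definition box_cover (X : set E) : set (nat -> E * E) :=
  [set c | X `<=` \bigcup_k box (c k).1 (c k).2].

Definition leb_outer (X : set E) : \bar R :=
  ereal_inf [set (\sum_(k <oo) (box_vol (c k).1 (c k).2)%:E)%E
            | c in box_cover X].

Let bvol (c : E * E) : \bar R := (box_vol c.1 c.2)%:E.

Let bvol_ge0 c : (0 <= bvol c)%E.
Proof. by rewrite lee_fin; apply: prodr_ge0 => i _; rewrite le_max lexx. Qed.

Lemma leb_outer_ge0 X : (0 <= leb_outer X)%E.
Proof.
by apply: le_ereal_inf_tmp => _ [c _ <-]; apply: nneseries_ge0 => k _ _; exact: bvol_ge0.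
Qed.

Let bvol1 : bvol (const_mx 1, const_mx 0) = 0%E.
Proof.
rewrite /bvol /box_vol (bigD1 ord0)//= !mxE sub0r.
by rewrite (max_idPl _) ?mul0r// lerN10.
Qed.

Let box1 : box (const_mx 1) (const_mx 0) = set0 :> set E.
Proof.
apply/seteqP; split=> // x /(_ ord0); rewrite !mxE => /andP[h1 h2].
by have := le_trans h1 h2; rewrite ler10.
Qed.

Lemma leb_outer_box a b : (leb_outer (box a b) <= (box_vol a b)%:E)%E.
Proof.
pose c (k : nat) := if k == 0%N then (a, b) else (const_mx 1, const_mx 0).
apply: ereal_inf_lbound; exists c; first by move=> x abx; exists 0%N.
rewrite nneseries_recl//; last by move=> k _; exact: (bvol_ge0 (c k)).
rewrite eseries_cond/= eseries0 ?adde0//.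
by move=> [|k]//= _ _; exact: bvol1.
Qed.

Lemma leb_outer0 : leb_outer set0 = 0%E.
Proof.
apply/eqP; rewrite eq_le leb_outer_ge0 andbT -box1 -bvol1.
exact: leb_outer_box.
Qed.

Lemma le_leb_outer : {homo leb_outer : A B / A `<=` B >-> (A <= B)%E}.
Proof.
move=> A B AB; apply: ereal_inf_le_tmp => _ [c Bc <-]; exists c => //.
exact: subset_trans Bc.
Qed.

Lemma leb_outer_sigma_subadditive : sigma_subadditive leb_outer.
Proof.
move=> A; have [[i ioo]|] := pselect (exists i : nat, leb_outer (A i) = +oo%E).
  rewrite (eseries_pinfty _ _ ioo) ?leey// => k _.
  by rewrite -ltNye (lt_le_trans _ (leb_outer_ge0 _)).
rewrite -forallNE => Aoo.
suff add2e (e : {posnum R}) : (leb_outer (\bigcup_n A n) <=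
    \sum_(i <oo) leb_outer (A i) + e%:num%:E)%E.
  by apply/lee_addgt0Pr => _/posnumP[].
rewrite (le_trans _ (epsilon_trick _ _ _))//; last first.
  by move=> k; exact: leb_outer_ge0.
pose P k (c : nat -> E * E) := box_cover (A k) c /\
  (\sum_(j <oo) bvol (c j) <= leb_outer (A k) + (e%:num / (2 ^ k.+1)%:R)%:E)%E.
have [G PG] : {G : nat -> nat -> E * E & forall k, P k (G k)}.
  apply: (@choice _ _ P) => k.
  have en1 : (0 < e%:num / (2 ^ k.+1)%:R)%R by [].
  have fk : leb_outer (A k) \is a fin_num.
    by rewrite ge0_fin_numE ?leb_outer_ge0// ltey; apply/eqP => /(Aoo k).
  have [_ [c Ac <-] cl] := lb_ereal_inf_adherent en1 fk.
  by exists c; split => //; exact: ltW.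
pose H := bvol \o uncurry G.
have H0 p : (0 <= H p)%E by exact: bvol_ge0.
apply: (@le_trans _ _ (\esum_(p in setT) H p)%E).
  apply: ereal_inf_lbound => /=.
  have /card_esym/ppcard_eqP[f] := card_nat2.
  exists (uncurry G \o f).
    move=> x [k _ Akx]; have [j _ bx] := (PG k).1 _ Akx.
    by exists (f^-1%FUN (k, j)) => //=; rewrite invK ?inE.
  rewrite -(esum_pred_image H _ xpredT) ?[fun=> _]set_true//.
  by rewrite image_eq.
rewrite (_ : esum _ _ = \sum_(i <oo) \sum_(j <oo) bvol (G i j))%E; last first.
  pose J : nat -> set (nat * nat) := fun i => [set (i, j) | j in setT].
  rewrite (_ : setT = \bigcup_k J k); last first.
    by rewrite predeqE => -[k j]; split => // _; exists k => //; exists j.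
  rewrite esum_bigcupT /=; last 2 first.
  - apply/trivIsetP => i j _ _ ij.
    rewrite predeqE => -[k m] /=; split => //= -[] [_] _ [<-{k} _].
    by move=> [m' _] [] /esym/eqP; rewrite (negbTE ij).
  - by move=> p; exact: H0.
  rewrite -(image_id [set: nat]) -fun_true esum_pred_image//; last first.
    by move=> k _; exact: esum_ge0.
  apply: eq_eseriesr => /= j _.
  rewrite -(esum_pred_image H (pair j) predT)//=; last first.
    by move=> ? ? _ _; exact: (@can_inj _ _ _ snd).
  by congr esum; rewrite predeqE => -[k m]; split; move=> [i _ <-]; exists i.
apply: lee_lim.
- apply: is_cvg_nneseries => k _ _.
  by apply: nneseries_ge0 => j _ _; exact: bvol_ge0.
- by apply: is_cvg_nneseries => k _ _; apply: adde_ge0 => //; exact: leb_outer_ge0.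
- by near=> m; apply: lee_sum => i _; exact: (PG i).2.
Unshelve. all: by end_near. Qed.

HB.instance Definition _ := isOuterMeasure.Build R E leb_outer
  leb_outer0 leb_outer_ge0 le_leb_outer leb_outer_sigma_subadditive.

Lemma halfspace_caratheodory (i : 'I_n.+1) (c : R) (H : set E) :
  (forall x, H x -> x 0 i <= c) -> (forall x, ~ H x -> c <= x 0 i) ->
  leb_outer.-caratheodory H.
Proof.
move=> Hle Hge; apply: le_caratheodory_measurable => X.
apply: le_ereal_inf_tmp => _ [u Xu <-].
pose lo k : E := \row_j if j == i then Num.min ((u k).2 0 i) c else (u k).2 0 j.
pose hi k : E := \row_j if j == i then Num.max ((u k).1 0 i) c else (u k).1 0 j.
have -> : (\sum_(k <oo) bvol (u k) =
    \sum_(k <oo) bvol ((u k).1, lo k) + \sum_(k <oo) bvol (hi k, (u k).2))%E.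
  rewrite -nneseriesD; [|by move=> k _ _; exact: bvol_ge0..].
  apply: eq_eseriesr => k _; rewrite /bvol/= -EFinD; congr EFin.
  have volE a b : box_vol a b = Num.max 0 (b 0 i - a 0 i) *
      \prod_(j | j != i) Num.max 0 (b 0 j - a 0 j) by rewrite /box_vol (bigD1 i).
  rewrite !{}volE !mxE eqxx.
  under [X in _ = _ * X + _]eq_bigr => j ji do rewrite mxE (negbTE ji).
  under [X in _ = _ + _ * X]eq_bigr => j ji do rewrite mxE (negbTE ji).
  rewrite -mulrDl; congr (_ * _).
  set p := (u k).1 0 i; set q := (u k).2 0 i.
  rewrite /Num.max /Num.min.
  by case: (ltP q c) => ?; case: (ltP p c) => ?; do 3?[case: ltP => ?]; lra.
apply: leeD; apply: ereal_inf_lbound.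
- exists (fun k => ((u k).1, lo k)) => //= x [Xx Hx].
  have [k _ bx] := Xu _ Xx; exists k => //= j; have /andP[-> bj] := bx j.
  by rewrite mxE; case: eqP bj => // -> bi; rewrite le_min bi /= Hle.
- exists (fun k => (hi k, (u k).2)) => //= x [Xx Hx].
  have [k _ bx] := Xu _ Xx; exists k => //= j; have /andP[bj ->] := bx j.
  by rewrite mxE andbT; case: eqP bj => // -> bi; rewrite ge_max bi /= Hge.
Qed.

End lebesgue_outer_measure.

(* The sigma-algebra on R^N is that of all Lebesgue measurable sets. *)
Definition lebesgue_rV_display : measure_display. Proof. exact: default_measure_display. Qed.

Section lebesgue_measure_rV.
Context {R : realType} {n : nat}.
Local Notation E := 'rV[R]_n.+1.

HB.instance Definition _ := @isMeasurable.Build lebesgue_rV_display E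
  (@leb_outer R n).-caratheodory
  (caratheodory_measurable_set0 _)
  (@caratheodory_measurable_setC _ _ _)
  (@caratheodory_measurable_bigcup _ _ _).

Definition lebesgue_rV : set E -> \bar R := leb_outer.

Let lebesgue_rV0 : lebesgue_rV set0 = 0%E.
Proof. exact: leb_outer0. Qed.

Let lebesgue_rV_ge0 A : (0 <= lebesgue_rV A)%E.
Proof. exact: leb_outer_ge0. Qed.

Let lebesgue_rV_semi_sigma_additive : semi_sigma_additive lebesgue_rV.
Proof. move=> F mF tF mU.
exact: (@caratheodory_measure_sigma_additive R E leb_outer F mF tF mU). Qed.

HB.instance Definition _ := isMeasure.Build _ _ _ lebesgue_rV
  lebesgue_rV0 lebesgue_rV_ge0 lebesgue_rV_semi_sigma_additive.

Lemma measurable_box (a b : E) : measurable (box a b).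
Proof.
rewrite (_ : box a b = \bigcap_(i in [set: 'I_n.+1])
   ([set x : E | x 0 i <= b 0 i] `&` ~` [set x : E | x 0 i < a 0 i])).
  apply: fin_bigcap_measurable; first exact: finite_finset.
  move=> i _; apply: measurableI.
    apply: (@halfspace_caratheodory _ _ i (b 0 i)) => x //=.
    by move/negP; rewrite -ltNge => /ltW.
  apply: measurableC.
  apply: (@halfspace_caratheodory _ _ i (a 0 i)) => x /=; first exact: ltW.
  by move/negP; rewrite -leNgt.
apply/seteqP; split=> x /= bx i.
  by move=> _; have /andP[ax xb] := bx i; split=> //=; apply/negP; rewrite -leNgt.
by have [//= xb /negP] := bx i I; rewrite -leNgt => ->.
Qed.

Let lebesgue_rV_sigma_finite : sigma_finite setT lebesgue_rV.
Proof.
exists (fun k => box (const_mx (- k%:R)) (const_mx k%:R)).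
  apply/esym/seteqP; split=> // x _.
  exists (Num.truncn `|x|).+1 => // i; rewrite !mxE -ler_norml.
  apply: le_trans (ltW (truncnS_gt _)).
  have /mapP[j Hj ->] : `|x 0 i| \in [seq `|x y.1 y.2| | y : 'I_1 * 'I_n.+1].
    by apply/mapP; exists (0, i) => //=; rewrite mem_enum.
  by rewrite [leRHS]/Num.norm /= mx_normrE; apply/bigmax_geP; right => /=; exists j.
move=> k; split; first exact: measurable_box.
exact: le_lt_trans (leb_outer_box _ _) (ltry _).
Qed.

HB.instance Definition _ := Measure_isSigmaFinite.Build _ _ _ lebesgue_rV
  lebesgue_rV_sigma_finite.

End lebesgue_measure_rV.

Section sobolev.
Context {R : realType} {n : nat}.
Local Notation E := 'rV[R]_n.+1.
Local Notation mu := (@lebesgue_rV R n).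
Implicit Types (Om V : set E) (u v phi psi : E -> R) (s alpha : R).

Definition dot (x y : E) : R := \sum_i x 0 i * y 0 i.

Definition enorm (x : E) : R := Num.sqrt (dot x x).

Definition partial (i : 'I_n.+1) (f : E -> R) : E -> R :=
  fun x => 'D_(delta_mx 0 i) f x.

Definition smooth (f : E -> R) : Prop := forall l : seq 'I_n.+1,
  continuous (foldr partial f l) /\
  forall i x, derivable (foldr partial f l) x (delta_mx 0 i).

Definition Cc_infty Om psi : Prop :=
  [/\ smooth psi, compact (closure [set x | psi x != 0]) &
      closure [set x | psi x != 0] `<=` Om].

Definition L2 Om u : Prop :=
  measurable_fun Om u /\ (\int[mu]_(x in Om) (u x ^+ 2)%:E < +oo)%E.

Definition is_weak_gradient Om u (G : E -> E) : Prop := forall i : 'I_n.+1,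
  L2 Om (fun x => G x 0 i) /\
  forall psi, Cc_infty Om psi ->
    \int[mu]_(x in Om) (u x * partial i psi x) =
    - \int[mu]_(x in Om) (G x 0 i * psi x).

Definition H1 Om u : Prop := L2 Om u /\ exists G, is_weak_gradient Om u G.

(* The weak gradient of u in H^1(Om), which is unique up to null sets: one
   representative is selected by choice (and 0 is used outside H^1). *)
Definition wgrad Om u : E -> E := xget (fun=> 0) (is_weak_gradient Om u).

Definition H1_norm Om u : \bar R :=
  ((\int[mu]_(x in Om) (u x ^+ 2)%:E +
    \int[mu]_(x in Om) (enorm (wgrad Om u x) ^+ 2)%:E) `^ 2^-1)%E.

Definition H10 Om phi : Prop := H1 Om phi /\
  forall e : R, 0 < e ->
    exists psi, Cc_infty Om psi /\ (H1_norm Om (phi \- psi)%R < e%:E)%E.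

(* On the null set x = y the quotients below have the junk value 0. *)
Definition gagliardo s u : \bar R :=
  ((\int[mu \x mu]_p ((u p.1 - u p.2) ^+ 2 /
      enorm (p.1 - p.2) `^ (n.+1%:R + 2 * s))%:E) `^ 2^-1)%E.

Definition X1 s Om u : Prop :=
  [/\ measurable_fun setT u, H1 Om u & (gagliardo s u < +oo)%E].

Definition X10 s Om phi : Prop :=
  [/\ measurable_fun setT phi, H10 Om phi, (gagliardo s phi < +oo)%E &
      {ae mu, forall x, ~ Om x -> phi x = 0}].

(* The equation is stated in \bar R.  For u in X1 and phi in X10 the left-hand
   side is finite, so the equation includes the integrability over Om of
   g(x, u(x)) phi(x) (recall that +oo - +oo is infinite in \bar R). *)
Definition weak_solution s Om (g : E * R -> R) u : Prop :=
  forall phi, X10 s Om phi ->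
  (\int[mu]_(x in Om) (dot (wgrad Om u x) (wgrad Om phi x))%:E +
   \int[mu \x mu]_p ((u p.1 - u p.2) * (phi p.1 - phi p.2) /
      enorm (p.1 - p.2) `^ (n.+1%:R + 2 * s))%:E =
   \int[mu]_(x in Om) (g (x, u x) * phi x)%:E)%E.

Definition Linfty_norm (A : set E) u : \bar R :=
  Lnorm mu +oo%E (EFin \o (u \_ A)).

(* L^oo norm on Q of a nonlinearity g(x,t): ess sup in x of sup in t, the
   supremum running over the points (x, t) of Q.  A graph {(x, u(x))} is null
   in R^N x R, so an essential supremum over both variables would not control
   the superposition g(x, u(x)).  On A x I, with I a nondegenerate interval,
   both agree as soon as g(x, .) is continuous for almost every x. *)
Definition Linfty_norm2 (Q : set (E * R)) (g : E * R -> R) : \bar R :=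
  Lnorm mu +oo%E (fun x => ereal_sup (range (fun t : R => `|(g \_ Q) (x, t)|%:E))).

(* Joint measurability is relative to the product of the Lebesgue
   sigma-algebra in x and the Borel sigma-algebra in t, which makes
   x |-> g(x, u(x)) Lebesgue measurable. *)
Definition Linfty_loc Om (g : E * R -> R) : Prop :=
  measurable_fun (Om `*` setT) g /\
  forall Q : set (E * R), compact Q -> Q `<=` Om `*` setT ->
    (Linfty_norm2 Q g < +oo)%E.

Definition point_dist (x : E) (A : set E) : R := inf [set enorm (x - y) | y in A].

Definition set_dist (A B : set E) : R :=
  inf [set enorm (x - y) | x in A & y in B].

Definition boundary (A : set E) : set E := closure A `\` interior A.

Definition neighborhood_in Om V (delta : R) : set E :=
  [set x | Om x /\ point_dist x V < delta].

Definition grad v (x : E) : E := \row_i partial i v x.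

(* Suprema over V: by continuity they coincide with those of the extensions
   of v and grad v to the closure of V. *)
Definition C1alpha_norm V alpha v : \bar R :=
  (ereal_sup [set `|v x|%:E | x in V] +
   ereal_sup [set (enorm (grad v x))%:E | x in V] +
   ereal_sup [set r | exists x y, [/\ V x, V y, x != y &
     r = (enorm (grad v x - grad v y) / enorm (x - y) `^ alpha)%:E]])%E.

(* v is in C^{1,alpha} of the closure of V: v and its first-order derivatives
   extend continuously to the closure, and the norm is finite. *)
Definition C1alpha V alpha v : Prop :=
  [/\ {within closure V, continuous v},
      forall x i, V x -> derivable v x (delta_mx 0 i),
      exists G : E -> E, {within closure V, continuous G} /\
        forall x, V x -> G x = grad v x &
      (C1alpha_norm V alpha v < +oo)%E].

End sobolev.

(* Main.v *)
(* Let psi = mollifier and theta be the radial bumps with grad theta = - y psi(y).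
   For the frequency h, the average of u against h^N psi(h (. - x)) has as
   h-derivative minus the integral of u Delta phi, where phi is a scaled
   translate of theta; likewise for the first and second derivatives of psi and
   theta.  Testing the equation with phi bounds this integral by the right-hand
   side and by the nonlocal term, which after symmetrization is the integral of
   |z|^(-N-2s) against int u(x) (2 phi(x) - phi(x+z) - phi(x-z)) dx.

   If the second differences of u near V are at most A |z|^b with b < 2s, the
   nonlocal term is small enough for the averages to converge at rate
   h^-(b+2-2s) to a representative of u whose second differences are
   O(|z|^(b+2-2s)).  Starting from b = 0, which only uses that u is bounded,
   finitely many steps reach some b > 2s.  Then the nonlocal term is as good as a
   bounded right-hand side, and the averages of the first and second derivatives
   converge at the rates that give C^{1,alpha} for every alpha < 1. *)

Require Import Defs.
From HB Require Import structures.
From mathcomp Require Import all_boot all_order all_algebra.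
From mathcomp Require Import all_classical all_reals all_analysis.
From mathcomp Require Import measurable_realfun ess_sup_inf ring lra.
Set Implicit Arguments.
Unset Strict Implicit.
Unset Printing Implicit Defensive.
Import Order.TTheory GRing.Theory Num.Theory.
Import numFieldNormedType.Exports.
Local Open Scope classical_set_scope.
Local Open Scope ring_scope.

(** * Lebesgue measure on row vectors *)

(** For averages against derivatives of order $m$ and a decay rate $g$, the frequency derivative is
    of size $h^{m-g-1}$. Its integral converges at infinity for $m<g$ and grows like $h^{m-g}$ for
    $m>g$. A rate $g=1+\alpha$ strictly between 1 and 2 thus makes the averages of $u$ and of its
    gradient converge and controls those of the Hessian; at $g=2$ the latter would be bounded by a
    logarithm only, whence $\alpha<1$. Increments by $z$ are read off at $h=1/|z|$.

    The obstacle is the nonlocal term while $b<2s$: $|z|^b$ is not integrable against the kernel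
    near the origin. For $|z|\le 1/h$ the smoothness of the test function is used instead, and the
    factor $h^{-b}$ is saved by the symmetry of the test function about its center. So the bootstrap
    uses even test functions only, of derivative order 0 and 2; first derivatives enter at the end.

    Every estimate is linear in one number $A$ that bounds both $u$ and the right-hand side, with
    constants depending only on $n$, $s$, $\alpha$ and the widths of neighborhoods. This makes the
    final constant uniform in $\Omega$, $g$ and $u$. *)

Section rV_norm.
Context {R : realType} {n : nat}.
Local Notation E := 'rV[R]_n.+1.
Implicit Types (x y : E) (r : R).

Lemma coord_le_norm x i : `|x 0 i| <= `|x|.
Proof.
have /mapP[j Hj ->] : `|x 0 i| \in [seq `|x y.1 y.2| | y : 'I_1 * 'I_n.+1].
  by apply/mapP; exists (0, i) => //=; rewrite mem_enum.
by rewrite [leRHS]/Num.norm /= mx_normrE; apply/bigmax_geP; right => /=; exists j.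
Qed.

Lemma norm_le_coord x r : (forall i, `|x 0 i| <= r) -> `|x| <= r.
Proof.
move=> xr; have r0 : 0 <= r by exact: le_trans (xr ord0).
rewrite [leLHS]/Num.norm /= mx_normrE; apply/bigmax_leP; split => // -[i j] _ /=.
by rewrite ord1; exact: xr.
Qed.

Lemma norm_lt_coord x r : 0 < r -> (forall i, `|x 0 i| < r) -> `|x| < r.
Proof.
move=> r0 xr; rewrite [ltLHS]/Num.norm /= mx_normrE; apply/bigmax_ltP; split => //.
by move=> -[i j] _ /=; rewrite ord1; exact: xr.
Qed.

Definition cube x r : set E := [set y | `|y - x| <= r].

Lemma cube_box x r : cube x r = box (x - const_mx r) (x + const_mx r).
Proof.
apply/seteqP; split => y /= h.
  by move=> i; have := le_trans (coord_le_norm (y - x) i) h; rewrite !mxE ler_norml; lra.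
apply: norm_le_coord => i; have := h i; rewrite !mxE ler_norml; lra.
Qed.

End rV_norm.

Section lebesgue_rV_measurability.
Context {R : realType} {n : nat}.
Local Notation E := 'rV[R]_n.+1.
Local Notation mu := (@lebesgue_rV R n).

Lemma measurable_cube (x : E) (r : R) : measurable (cube x r).
Proof. by rewrite cube_box; exact: measurable_box. Qed.

Lemma cube_measure (x : E) (r : R) : 0 <= r ->
  (mu (cube x r) <= ((2 * r) ^+ n.+1)%:E)%E.
Proof.
move=> r0; rewrite cube_box (le_trans (leb_outer_box _ _))// lee_fin /box_vol.
under eq_bigr => i _ do rewrite !mxE.
rewrite (eq_bigr (fun=> 2 * r)); first by rewrite prodr_const card_ord.
by move=> i _; rewrite (_ : _ - _ = 2 * r); [apply/max_idPr; lra|lra].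
Qed.

Lemma measurable_coord (i : 'I_n.+1) : measurable_fun setT (fun x : E => x 0 i).
Proof.
apply: (measurability (@RGenOInfty.G R)); first exact: measurable_realfun.RGenOInfty.measurableE.
move=> _ [_ [c ->] <-]; rewrite setTI -[X in measurable X]setCK; apply: measurableC.
apply: (@halfspace_caratheodory _ _ i c) => x /=.
- by rewrite in_itv/= andbT => /negP; rewrite -leNgt.
- by move/contrapT; rewrite in_itv/= andbT => /ltW.
Qed.

(** The cubes with rational center and radius contained in [A] cover it: a rational radius below
    half of the available room leaves space to move the center to a rational point. *)
Lemma open_bigcup_cubes (A : set E) : open A ->
  exists c : nat -> E * R, A = \bigcup_k cube (c k).1 (c k).2.
Proof.
move=> oA; pose T : countType := ('rV[rat]_n.+1 * rat)%type.
pose F (p : T) : E * R := (map_mx ratr p.1, ratr p.2).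
(* Indices that decode to nothing, or to a cube leaving [A], receive the radius -1, whose cube is
   empty. *)
pose c k : E * R := if unpickle k is Some p then
  if `[< cube (F p).1 (F p).2 `<=` A >] then F p else (0, -1) else (0, -1).
have c0 : cube (0 : E) (-1 : R) = set0.
  apply/seteqP; split => // y; rewrite /cube/= subr0 => h.
  by have := le_trans (normr_ge0 y) h; rewrite oppr_ge0 ler10.
exists c; apply/seteqP; split => [x Ax|x [k _]]; last first.
  by rewrite /c; case: unpickle => [p|]; [case: asboolP => [FA /FA//|_]|]; rewrite c0.
have /nbhs_ballP[e /= e0 eA] : nbhs x A by exact: open_nbhs_nbhs.
have [q] := @rat_in_itvoo R 0 (e / 2) ltac:(lra).
rewrite in_itv/= => /andP[q0 qe].
have pc i : {r : rat | `|ratr r - x 0 i| < ratr q :> R}.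
  apply: cid; have [r] := @rat_in_itvoo R (x 0 i - ratr q) (x 0 i + ratr q) ltac:(lra).
  by rewrite in_itv/= => xr; exists r; rewrite ltr_norml; lra.
pose p : T := (\row_i sval (pc i), q).
have pA : cube (F p).1 (F p).2 `<=` A.
  move=> y /= yq; apply: eA; rewrite -ball_normE/=; apply: norm_lt_coord => // i.
  have := le_trans (coord_le_norm _ i) yq; rewrite !mxE.
  by case: (pc i) => r /=; rewrite ler_norml !ltr_norml; lra.
exists (pickle p) => //; rewrite /c pickleK; case: asboolP => [_|//].
apply: norm_le_coord => i; rewrite !mxE distrC.
by case: (pc i) => r /= /ltW.
Qed.

Lemma open_rV_measurable (A : set E) : open A -> measurable A.
Proof.
move=> /open_bigcup_cubes[c ->].
by apply: bigcup_measurable => k _; exact: measurable_cube.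
Qed.

Lemma continuous_rV_measurable (f : E -> R) : continuous f -> measurable_fun setT f.
Proof.
move=> cf; apply: (measurability (@RGenOpens.G R)); first exact: measurable_realfun.RGenOpens.measurableE.
move=> _ [_ [a [b ->]] <-]; rewrite setTI; apply: open_rV_measurable.
by apply: open_comp => //; exact: interval_open.
Qed.

End lebesgue_rV_measurability.

(** * Invariance of Lebesgue measure under translations and point reflections *)

Section lebesgue_rV_invariance.
Context {R : realType} {n : nat}.
Local Notation E := 'rV[R]_n.+1.
Local Notation mu := (@lebesgue_rV R n).
Implicit Types (c x : E) (b : bool).

(** Translations and point reflections are treated together because the symmetrization of the
    nonlocal form uses both substitutions $y=x+z$ and $y=x-z$. *)
Definition refl_shift b c x : E := (-1) ^+ b *: x + c.

Lemma refl_shiftK b c : cancel (refl_shift b c) (refl_shift b (- ((-1) ^+ b *: c))).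
Proof. by move=> x; rewrite /refl_shift scalerDr scalerA -expr2 sqrr_sign scale1r addrK. Qed.

Lemma leb_outer_refl_shift_le b c (X : set E) :
  (leb_outer (refl_shift b c @^-1` X) <= leb_outer X)%E.
Proof.
apply: le_ereal_inf_tmp => _ [u Xu <-].
pose T := refl_shift b (- ((-1) ^+ b *: c)).
(* A reflection exchanges the lower and the upper corner of a box. *)
pose w k : E * E := if b then (T (u k).2, T (u k).1) else (T (u k).1, T (u k).2).
apply: ereal_inf_lbound; exists w.
  move=> x /= /Xu[k _ bx]; exists k => // i; have := bx i.
  by rewrite /w /T /refl_shift; case: (b) => /=; rewrite !mxE; lra.
apply: eq_eseriesr => k _; rewrite /box_vol; congr EFin; apply: eq_bigr => i _.
by rewrite /w /T /refl_shift; case: (b) => /=; rewrite !mxE; congr Num.max; lra.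
Qed.

Lemma leb_outer_refl_shift b c (X : set E) :
  leb_outer (refl_shift b c @^-1` X) = leb_outer X.
Proof.
apply/eqP; rewrite eq_le leb_outer_refl_shift_le/=.
rewrite -{1}[X](_ : (refl_shift b (- ((-1) ^+ b *: c)) @^-1` (refl_shift b c @^-1` X)) = _).
  exact: leb_outer_refl_shift_le.
apply/seteqP; split => x /=; rewrite /refl_shift;
  by rewrite scalerDr scalerA -expr2 sqrr_sign scale1r scalerN scalerA -expr2 sqrr_sign
     scale1r addrNK.
Qed.

(** The criterion of Caratheodory involves only the outer measure, which is invariant: splitting [X]
    by the preimage of [Y] amounts to splitting the transported [X] by [Y]. *)
Lemma measurable_refl_shift b c : measurable_fun setT (refl_shift b c).
Proof.
move=> _ Y mY; rewrite setTI.
suff : leb_outer.-caratheodory (refl_shift b c @^-1` Y) by [].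
have {}mY : leb_outer.-caratheodory Y by [].
move=> X.
have pre Z : X `&` refl_shift b c @^-1` Z =
    refl_shift b c @^-1` ((refl_shift b (- ((-1) ^+ b *: c)) @^-1` X) `&` Z).
  by rewrite preimage_setI -comp_preimage (_ : _ \o _ = id)//; apply/funext => x /=;
    rewrite refl_shiftK.
rewrite preimage_setC !pre !leb_outer_refl_shift -mY.
by rewrite leb_outer_refl_shift.
Qed.

Lemma ge0_integral_refl_shift b c (f : E -> \bar R) :
  measurable_fun setT f -> (forall x, 0 <= f x)%E ->
  (\int[mu]_x f (refl_shift b c x) = \int[mu]_x f x)%E.
Proof.
move=> mf f0.
have := @ge0_integral_pushforward _ _ _ _ R _ (measurable_refl_shift b c) mu setT f
  measurableT mf (fun x _ => f0 x).
rewrite preimage_setT => <-; apply: eq_measure_integral => [|mphi A mA _].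
  exact: measurable_refl_shift.
exact: leb_outer_refl_shift.
Qed.

Lemma integral_refl_shift b c (f : E -> \bar R) : measurable_fun setT f ->
  (\int[mu]_x f (refl_shift b c x) = \int[mu]_x f x)%E.
Proof.
move=> mf; rewrite integralE [RHS]integralE; congr (_ - _)%E.
- under eq_integral do rewrite (funepos_comp f (refl_shift b c))/=.
  by apply: ge0_integral_refl_shift => //; exact: measurable_funepos.
- under eq_integral do rewrite (funeneg_comp f (refl_shift b c))/=.
  by apply: ge0_integral_refl_shift => //; exact: measurable_funeneg.
Qed.

End lebesgue_rV_invariance.

Section lebesgue_rV_unit_cube.
Context {R : realType} {n : nat}.
Local Notation E := 'rV[R]_n.+1.

(* The coordinates of the sum of indicators of a covering family of boxes are
   integrated out one at a time, which keeps it bounded below by 1. *)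
Lemma leb_outer_unit_cube :
  (1 <= leb_outer (box (const_mx 0) (const_mx 1) : set E)%R)%E.
Proof.
apply: le_ereal_inf_tmp => _ [c cov <-].
pose len k i : R := Num.max 0 ((c k).2 0 i - (c k).1 0 i).
pose seg k i : set R := `[(c k).1 0 i, (c k).2 0 i]%classic.
pose I01 : set R := `[0, 1]%classic.
pose G (m k : nat) (x : E) : R := \prod_(i < n.+1) (if (i < m)%N then len k i else \1_(seg k i) (x 0 i)).
have G0 m k x : 0 <= G m k x.
  by apply: prodr_ge0 => i _; case: ifP => _; rewrite ?le_max ?lexx.
have key m : (m <= n.+1)%N -> forall x : E, box (const_mx 0 : E) (const_mx 1 : E) x ->
    (1 <= \sum_(k <oo) (G m k x)%:E)%E.
  elim: m => [_ x /cov[k _ bk]|m IH mn x xb].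
    apply: (@le_trans _ _ (G 0 k x)%:E).
      rewrite lee_fin /G big1// => i _ /=; rewrite ?ltn0 indicE mem_set//.
      by rewrite /seg /= in_itv/=; exact: bk.
    rewrite (@nneseriesD1 _ (fun k => (G 0%N k x)%:E) k xpredT)//; last by move=> j _; rewrite lee_fin.
    by rewrite leeDl//; apply: nneseries_ge0 => j _ _; rewrite lee_fin.
  pose i0 : 'I_n.+1 := Ordinal mn.
  pose X (t : R) : E := \row_j if j == i0 then t else x 0 j.
  pose K (k : nat) : R := \prod_(i < n.+1 | i != i0) (if (i < m)%N then len k i else \1_(seg k i) (x 0 i)).
  have K0 k : 0 <= K k.
    by apply: prodr_ge0 => i _; case: ifP => _; rewrite ?le_max ?lexx.
  have GX k t : G m k (X t) = K k * \1_(seg k i0) t.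
    rewrite /G (bigD1 i0)//= ltnn mulrC !mxE eqxx; congr (_ * _).
    by apply: eq_bigr => i ii0; rewrite !mxE (negbTE ii0).
  have GS k : G m.+1 k x = K k * len k i0.
    rewrite /G (bigD1 i0)//= ltnSn mulrC; congr (_ * _).
    apply: eq_bigr => i ii0; rewrite ltnS leq_eqVlt.
    by rewrite (_ : (nat_of_ord i == m) = false)//; apply: negbTE.
  have IHX t : I01 t -> (1 <= \sum_(k <oo) (G m k (X t))%:E)%E.
    move=> t01; apply: IH; first exact: ltnW.
    move=> i; rewrite !mxE; case: eqP => _; first by move: t01; rewrite /I01/= in_itv.
    by have := xb i; rewrite !mxE.
  have mI : measurable (I01 : set R) by exact: measurable_itv.
  have mG k : measurable_fun (I01 : set R) (fun t => (G m k (X t))%:E).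
    apply/measurable_EFinP; under eq_fun do rewrite GX.
    apply: measurable_funM => //; apply: measurable_funTS.
    apply: measurable_indic; exact: measurable_itv.
  apply: (@le_trans _ _ (\int[lebesgue_measure]_(t in I01) \sum_(k <oo) (G m k (X t))%:E)%E).
    apply: (@le_trans _ _ (\int[lebesgue_measure]_(t in I01) (cst 1%E t))%E).
      rewrite integral_cst// mul1e.
      have := @lebesgue_measure_itv R `[0, 1]; rewrite /= lte_fin ltr01 oppr0 adde0.
      by move=> ->.
    apply: ge0_le_integral => //.
      apply: ge0_emeasurable_sum => //.
      by move=> k t _ _; rewrite lee_fin.
    by move=> k _; exact: mG.
  rewrite integral_nneseries//; last by move=> k t _; rewrite lee_fin.
  apply: lee_nneseries => [k _ _|k _].
    by apply: integral_ge0 => t _; rewrite lee_fin.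
  rewrite GS; under eq_integral do rewrite GX EFinM.
  have mseg : measurable (seg k i0 : set R) by exact: measurable_itv.
  rewrite ge0_integralZl//; last 2 first.
    - apply/measurable_EFinP; apply: measurable_funTS; exact: measurable_indic.
    - by rewrite lee_fin.
  rewrite EFinM lee_wpmul2l ?lee_fin// integral_indic//.
  rewrite (@le_trans _ _ (lebesgue_measure (seg k i0)))//.
    by apply: le_measure; rewrite ?inE//; apply: measurableI => //; exact: measurable_itv.
  rewrite /seg lebesgue_measure_itv/= lte_fin /len.
  case: ltP => h; first by rewrite -EFinD lee_fin le_max lexx orbT.
  by rewrite lee_fin le_max lexx.
have := key n.+1 (leqnn _) (const_mx 0).
have b0 : box (const_mx 0 : E) (const_mx 1 : E) (const_mx 0 : E).
  by move=> i; rewrite !mxE lexx ler01.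
move=> /(_ b0) /le_trans; apply; apply: lee_nneseries => [k _ _|k _].
  by rewrite lee_fin.
rewrite lee_fin le_eqVlt; apply/orP; left; apply/eqP; apply: eq_bigr => i _.
by rewrite ltn_ord.
Qed.

End lebesgue_rV_unit_cube.

(** * Smooth functions and their derivatives *)

Section smooth_bump.
Context {R : realType}.
Implicit Types (p : {poly R}) (x y : R).

(* [dbump j] is the j-th derivative of exp(-1/x) (extended by 0 to x <= 0); on
   x > 0 it has the form p(1/x) exp(-1/x) for the polynomials [bump_poly j]. *)
Fixpoint bump_poly (j : nat) : {poly R} :=
  if j is j'.+1 then 'X^2 * (bump_poly j' - (bump_poly j')^`()) else 1.

Definition dbump (j : nat) x : R :=
  if 0 < x then (bump_poly j).[x^-1] * expR (- x^-1) else 0.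

Lemma bump_le0 j x : x <= 0 -> dbump j x = 0.
Proof. by rewrite /dbump leNgt => /negbTE ->. Qed.

Lemma bump0_gt0 x : 0 < x -> 0 < dbump 0 x.
Proof. by move=> x0; rewrite /dbump x0 /= hornerC mul1r expR_gt0. Qed.

Lemma bump0_ge0 x : 0 <= dbump 0 x.
Proof.
have [/ltW|] := ltP 0 x; last by move=> /bump_le0 ->.
by rewrite le_eqVlt => /predU1P[<-|/bump0_gt0/ltW//]; rewrite bump_le0.
Qed.

Lemma bump0_le1 x : dbump 0 x <= 1.
Proof.
rewrite /dbump; case: ifP => [x0|_]; last exact: ler01.
by rewrite hornerC mul1r -expR0 ler_expR oppr_le0 invr_ge0 ltW.
Qed.

Lemma bump1_gt0 x : 0 < x -> 0 < dbump 1 x.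
Proof.
move=> x0; rewrite /dbump x0 /= derivC subr0 mulr1 hornerXn.
by rewrite mulr_gt0 ?expR_gt0// exprn_gt0// invr_gt0.
Qed.

Lemma bump1_ge0 x : 0 <= dbump 1 x.
Proof.
by have [/bump1_gt0/ltW//|/bump_le0 ->] := ltP 0 x.
Qed.

Lemma exprn_expRN_le (k : nat) y : 0 <= y -> y ^+ k * expR (- y) <= k`!%:R.
Proof.
move=> y0; rewrite expRN ler_pdivrMr ?expR_gt0// mulrC.
case: k => [|k]; first by rewrite expr0 mulr1 -expR0 ler_expR.
rewrite -ler_pdivrMr ?ltr0n ?fact_gt0//.
by apply: le_trans (expR_ge1Dxn k y0); rewrite lerDr.
Qed.

Lemma horner_expRN_bounded p :
  exists2 M : R, 0 <= M & forall y, 0 <= y -> `|p.[y] * expR (- y)| <= M.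
Proof.
exists (\sum_(i < size p) `|p`_i| * i`!%:R); first by apply: sumr_ge0 => i _.
move=> y y0; rewrite horner_coef mulr_suml.
apply: (le_trans (ler_norm_sum _ _ _)); apply: ler_sum => i _.
rewrite -mulrA normrM ler_wpM2l// ger0_norm ?exprn_expRN_le//.
by rewrite mulr_ge0 ?exprn_ge0 ?expR_ge0.
Qed.

Definition pexp p x : R := if 0 < x then p.[x^-1] * expR (- x^-1) else 0.

(** Dividing by $x$ multiplies the polynomial in $1/x$ by one more power, and the exponential beats
    every polynomial. This gives continuity of such functions at the origin. *)
Lemma pexp_lipschitz0 p : exists2 M : R, 0 <= M & forall x, `|pexp p x| <= M * `|x|.
Proof.
have [M M0 hM] := horner_expRN_bounded (p * 'X); exists M => // x; rewrite /pexp.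
case: ltP => [x0|_]; last by rewrite normr0 mulr_ge0.
have := hM x^-1; rewrite invr_ge0 hornerMX => /(_ (ltW x0)) h.
rewrite -ler_pdivrMr ?normr_gt0 ?gt_eqF//; apply: le_trans h.
by rewrite -normfV -normrM mulrAC.
Qed.

(** With $y=1/x$ one has $dy/dx=-y^2$ and $\frac{d}{dy}(p(y)e^{-y})=(p'(y)-p(y))e^{-y}$. *)
Lemma is_derive_pexp p x : is_derive x 1 (pexp p) (pexp ('X^2 * (p - p^`())) x).
Proof.
have [x0|x0|x0] := ltgtP x 0.
- apply: (@near_eq_is_derive _ _ _ (fun=> 0)).
    near=> y; rewrite /pexp ltNge; suff -> : y <= 0 by [].
    by apply: ltW; near: y; exact: lt_nbhsl.
  rewrite [X in is_derive _ _ _ X](_ : _ = 0); first exact: is_derive_cst.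
  by rewrite /pexp ltNge (ltW x0).
- apply: (@near_eq_is_derive _ _ _ (fun y => p.[y^-1] * expR (- y^-1))).
    near=> y; rewrite /pexp; suff -> : 0 < y by [].
    by near: y; exact: lt_nbhsr.
  have dV : is_derive x 1 (fun y : R => y^-1) (- x ^- 2).
    by have := @is_deriveV _ id x 1 1 (lt0r_neq0 x0) (is_derive_id _ _); rewrite scaler1.
  have dp := @is_derive1_comp _ (horner p) _ x _ _ (is_derive_poly p x^-1) dV.
  have dN : is_derive x 1 (fun y : R => - y^-1) (x ^- 2) by rewrite -[X in is_derive _ _ _ X]opprK; exact: is_deriveN.
  have de := @is_derive1_comp _ expR _ x _ _ (is_derive_expR (- x^-1)) dN.
  apply: (is_derive_eq (is_deriveM dp de)).
  rewrite /pexp x0 /= /GRing.scale/= hornerM hornerXn hornerD hornerN exprVn; ring.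
(* At the origin the difference quotient of [pexp p] is [pexp (p * 'X)], continuous there with value
   0. *)
- subst x; have [M M0 hM] := pexp_lipschitz0 (p * 'X).
  apply/is_derive1_caratheodory; exists (pexp (p * 'X)); split.
  + move=> z; rewrite /pexp ltxx !subr0; case: ltP => z0; last by rewrite mul0r.
    have z1 : z != 0 by rewrite gt_eqF.
    by rewrite hornerMX; set P := p.[_]; set e := expR _; field.
  + have p0 : pexp (p * 'X) 0 = 0 by rewrite /pexp ltxx.
    apply/cvgrPdist_le => e e0; rewrite p0.
    have M1 : 0 < M + 1 by rewrite ltr_wpDl.
    apply/nbhs_ballP; exists (e / (M + 1)); first exact: divr_gt0.
    move=> z /=; rewrite !sub0r !normrN ltr_pdivlMr// => ze.
    apply: (le_trans (hM z)); apply: le_trans (ltW ze).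
    by rewrite mulrC ler_wpM2l// lerDl.
  + by rewrite /pexp ltxx.
Unshelve. all: by end_near. Qed.

Lemma is_derive_dbump j x : is_derive x 1 (dbump j) (dbump j.+1 x).
Proof. exact: is_derive_pexp. Qed.

Lemma continuous_dbump j : continuous (dbump j).
Proof. by move=> x; apply: differentiable_continuous; apply/derivable1_diffP; have [] := is_derive_dbump j x. Qed.

End smooth_bump.

(** * Mean value inequalities in one variable *)

Section calculus.
Context {R : realType}.
Implicit Types (f g df dg : R -> R) (a b x : R).

Lemma is_derive_within_continuous f df (I : interval R) :
  (forall x, x \in I -> is_derive x 1 f (df x)) -> {within [set` I], continuous f}.
Proof.
move=> fdf; apply: derivable_within_continuous => x xI.
by have [] := fdf x xI.
Qed.

(** The mean value theorem is applied to $g-f$ and $g+f$. A comparison function instead of a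
    constant makes it possible to bound the derivative by a power of the variable. *)
Lemma increment_le f df g dg a b : a <= b ->
  (forall x, a <= x <= b -> is_derive x 1 f (df x)) ->
  (forall x, a <= x <= b -> is_derive x 1 g (dg x)) ->
  (forall x, a <= x <= b -> `|df x| <= dg x) ->
  `|f b - f a| <= g b - g a.
Proof.
move=> ab fdf gdg dfdg.
have key (h dh : R -> R) : (forall x, a <= x <= b -> is_derive x 1 h (dh x)) ->
    (forall x, a <= x <= b -> dh x <= dg x) -> h b - h a <= g b - g a.
  move=> hdh dhg.
  pose k : R -> R := fun x => g x - h x.
  have dd x : x \in `[a, b] -> is_derive x 1 k (dg x - dh x).
    by rewrite in_itv/= => xab; apply: is_deriveB; [exact: gdg|exact: hdh].
  have ck : {within `[a, b], continuous k}.
    exact: (@is_derive_within_continuous k (fun x => dg x - dh x)).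
  have dd' x : x \in `]a, b[ -> is_derive x 1 k (dg x - dh x).
    by rewrite in_itv/= => /andP[/ltW ax /ltW xb]; apply: dd; rewrite in_itv/= ax.
  have [c cab e] := MVT_segment ab dd' ck.
  rewrite -subr_ge0 (_ : _ - _ = k b - k a); last by rewrite /k; ring.
  by rewrite e mulr_ge0 ?subr_ge0// dhg//; rewrite in_itv in cab.
rewrite ler_norml; apply/andP; split; last first.
  by apply: (key f df) => // x /dfdg; exact: le_trans (ler_norm _).
have := key (fun x => - f x) (fun x => - df x); rewrite lerNl => h.
rewrite (_ : - (f b - f a) = - f b - - f a); last by ring.
apply: h => x xab; first by apply: is_deriveN; exact: fdf.
by apply: le_trans (dfdg x xab); rewrite -normrN ler_norm.
Qed.

Lemma increment_le_cst f df (B : R) a b : a <= b ->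
  (forall x, a <= x <= b -> is_derive x 1 f (df x)) ->
  (forall x, a <= x <= b -> `|df x| <= B) ->
  `|f b - f a| <= B * (b - a).
Proof.
move=> ab fdf dfB.
have := @increment_le f df (fun x => B * x) (fun=> B) a b ab fdf.
rewrite mulrBr; apply => // x _.
have := @is_deriveZ _ _ _ id B x 1 1 (is_derive_id _ _).
by rewrite /GRing.scale /= mulr1.
Qed.

(** The function $f(x)+f(-x)$ on $[0,1]$ has derivative $f'(x)-f'(-x)$, of size at most $2Bx\le 2B$.
    The factor lost in the last inequality is harmless. *)
Lemma second_difference_le f df ddf (B : R) :
  (forall x, -1 <= x <= 1 -> is_derive x 1 f (df x)) ->
  (forall x, -1 <= x <= 1 -> is_derive x 1 df (ddf x)) ->
  (forall x, -1 <= x <= 1 -> `|ddf x| <= B) ->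
  `|2 * f 0 - f 1 - f (-1)| <= 2 * B.
Proof.
move=> fdf dfddf ddfB.
pose g x := f x + f (- x).
have dg x : 0 <= x <= 1 -> is_derive x 1 g (df x - df (- x)).
  move=> x01; apply: is_deriveD; first by apply: fdf; lra.
  have dN : is_derive x 1 (fun x : R => - x) (-1) by exact: is_deriveN.
  have := @is_derive1_comp _ f (fun x => - x) x (df (- x)) (-1).
  by rewrite mulrN1; apply => //; apply: fdf; lra.
have gB x : 0 <= x <= 1 -> `|df x - df (- x)| <= 2 * B.
  move=> x01; apply: (@le_trans _ _ (B * (x - - x))).
    by apply: (@increment_le_cst df ddf) => [|y xy|y xy]; [lra|apply: dfddf; lra|apply: ddfB; lra].
  have : 0 <= B by apply: le_trans (ddfB 0 _) => //; lra.
  by nra.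
have := @increment_le_cst g (fun x => df x - df (- x)) (2 * B) 0 1 ler01 dg gB.
rewrite subr0 mulr1 /g oppr0; apply: le_trans.
by rewrite -normrN le_eqVlt; apply/orP; left; apply/eqP; congr `|_|; ring.
Qed.

Lemma is_derive_powR (p x : R) : 0 < x -> is_derive x 1 (fun y => y `^ p) (p * x `^ (p - 1)).
Proof.
move=> x0; apply: (@near_eq_is_derive _ _ _ (fun y => expR (p * ln y))).
  near=> y; have y0 : 0 < y by near: y; exact: lt_nbhsr.
  by rewrite /powR gt_eqF.
have dl : is_derive x 1 (fun y => p * ln y) (p * x^-1).
  exact: (@is_deriveZ _ _ _ _ p x 1 _ (is_derive1_ln x0)).
apply: (is_derive_eq (@is_derive1_comp _ expR _ x _ _ (is_derive_expR (p * ln x)) dl)).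
have -> : p * ln x = (p - 1) * ln x + ln x by ring.
rewrite expRD lnK ?posrE// /powR gt_eqF//.
by field; rewrite gt_eqF.
Unshelve. all: by end_near. Qed.

(** Comparison with $Bx^p/p$, for both signs of $p$: negative exponents yield convergence at high
    frequency, positive ones the controlled growth of Hessian averages. *)
Lemma increment_le_powR f df (B p : R) a b : 0 < a -> a <= b -> p != 0 ->
  (forall x, a <= x <= b -> is_derive x 1 f (df x)) ->
  (forall x, a <= x <= b -> `|df x| <= B * x `^ (p - 1)) ->
  `|f b - f a| <= B / p * (b `^ p - a `^ p).
Proof.
move=> a0 ab p0 fdf dfB.
have := @increment_le f df (fun x => B / p * x `^ p) (fun x => B * x `^ (p - 1)) a b ab fdf.
rewrite mulrBr; apply => // x xab.
have x0 : 0 < x by lra.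
have := @is_deriveZ _ _ _ _ (B / p) x 1 _ (is_derive_powR p x0).
by move=> H; apply: (is_derive_eq H); rewrite /GRing.scale/= mulrA divfK.
Qed.

End calculus.

(** * A syntax of smooth functions closed under differentiation and rescaling *)

Section smooth_expressions.
Context {R : realType} {n : nat}.
Local Notation E := 'rV[R]_n.+1.
Implicit Types (x y z : E) (r t : R).

(* Syntax for a class of smooth functions that is closed under partial
   derivatives and contains the dbump functions needed below. *)
Inductive expr :=
| Coord of 'I_n.+1
| Const of R
| Add of expr & expr
| Mul of expr & expr
| Bump of nat & expr.

Fixpoint eval (e : expr) x : R :=
  match e with
  | Coord i => x 0 i
  | Const c => c
  | Add e1 e2 => eval e1 x + eval e2 x
  | Mul e1 e2 => eval e1 x * eval e2 x
  | Bump j e1 => dbump j (eval e1 x)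
  end.

Fixpoint dexpr (i : 'I_n.+1) (e : expr) : expr :=
  match e with
  | Coord j => Const (i == j)%:R
  | Const _ => Const 0
  | Add e1 e2 => Add (dexpr i e1) (dexpr i e2)
  | Mul e1 e2 => Add (Mul (dexpr i e1) e2) (Mul e1 (dexpr i e2))
  | Bump j e1 => Mul (Bump j.+1 e1) (dexpr i e1)
  end.

(** Rescaled translates of the bumps have to remain expressions, since the test functions are drawn
    from this syntax. *)
Fixpoint subst_affine (a : R) (b : E) (e : expr) : expr :=
  match e with
  | Coord i => Add (Mul (Const a) (Coord i)) (Const (b 0 i))
  | Const c => Const c
  | Add e1 e2 => Add (subst_affine a b e1) (subst_affine a b e2)
  | Mul e1 e2 => Mul (subst_affine a b e1) (subst_affine a b e2)
  | Bump j e1 => Bump j (subst_affine a b e1)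
  end.

Lemma eval_subst_affine a b e x : eval (subst_affine a b e) x = eval e (a *: x + b).
Proof. by elim: e => //= [i|e1 -> e2 ->|e1 -> e2 ->|j e ->] //; rewrite !mxE. Qed.

Lemma eval_dexpr_subst_affine i a b e x :
  eval (dexpr i (subst_affine a b e)) x = a * eval (dexpr i e) (a *: x + b).
Proof.
elim: e => //= [j|c|e1 -> e2 ->|e1 IH1 e2 IH2|j e IH].
- ring.
- by rewrite mulr0.
- ring.
- by rewrite IH1 IH2 !eval_subst_affine; ring.
- by rewrite IH eval_subst_affine; ring.
Qed.

Lemma eval_dexprC i j e x : eval (dexpr i (dexpr j e)) x = eval (dexpr j (dexpr i e)) x.
Proof.
elim: e => //= [e1 -> e2 -> //|e1 IH1 e2 IH2|k e IH]; first by rewrite IH1 IH2; ring.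
by rewrite IH; ring.
Qed.

(** Induction on the syntax gives the chain rule along a curve from derivatives of the coordinates
    alone, without a total differential. *)
Lemma is_derive_eval_curve e (c dc : R -> E) t :
  (forall i, is_derive t 1 (fun h => c h 0 i) (dc t 0 i)) ->
  is_derive t 1 (fun h => eval e (c h)) (\sum_i dc t 0 i * eval (dexpr i e) (c t)).
Proof.
move=> dcE; elim: e => /= [j|k|e1 IH1 e2 IH2|e1 IH1 e2 IH2|j e IH].
- apply: (is_derive_eq (dcE j)).
  rewrite (bigD1 j)//= eqxx mulr1 big1 ?addr0// => i ij.
  by rewrite (negbTE ij) mulr0.
- apply: (is_derive_eq (is_derive_cst _ _ _)).
  by rewrite big1// => i _; rewrite mulr0.
- apply: (is_derive_eq (is_deriveD IH1 IH2)).
  by rewrite -big_split/=; apply: eq_bigr => i _; rewrite mulrDr.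
- apply: (is_derive_eq (is_deriveM IH1 IH2)).
  rewrite /GRing.scale/= !mulr_sumr -big_split/=; apply: eq_bigr => i _; ring.
- apply: (is_derive_eq (@is_derive1_comp _ (dbump j) _ t _ _ (is_derive_dbump j _) IH)).
  by rewrite mulr_sumr; apply: eq_bigr => i _; ring.
Qed.

Lemma is_derive_eval_line e x z t :
  is_derive t 1 (fun h => eval e (x + h *: z)) (\sum_i z 0 i * eval (dexpr i e) (x + t *: z)).
Proof.
apply: (@is_derive_eval_curve e (fun h => x + h *: z) (fun=> z) t) => i.
have -> : (fun h : R => (x + h *: z) 0 i) = (fun h : R => x 0 i + h * z 0 i).
  by apply/funext => h; rewrite !mxE.
have d1 : is_derive t 1 (fun h : R => h * z 0 i) (z 0 i).
  have := @is_deriveM _ _ id (cst (z 0 i)) t 1 1 0 (is_derive_id _ _) (is_derive_cst _ _ _).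
  by move=> H; apply: (is_derive_eq H); rewrite /GRing.scale/= mulr0 mulr1 add0r.
apply: (is_derive_eq (is_deriveD (is_derive_cst (x 0 i) t 1) d1)).
by rewrite add0r.
Qed.

Lemma is_derive_eval e x i : is_derive x (delta_mx 0 i) (eval e) (eval (dexpr i e) x).
Proof.
have := is_derive_eval_line e x (delta_mx 0 i) 0.
rewrite (bigD1 i)//= mxE !eqxx mul1r scale0r addr0 big1 ?addr0; last first.
  by move=> j ji; rewrite mxE eqxx (negbTE ji) mul0r.
set d := delta_mx 0 i; move=> [dl ll].
have fE (h : R) : h^-1 *: (eval e (x + (h%:A + 0) *: d) - eval e (x + 0 *: d)) =
    h^-1 *: (eval e (h *: d + x) - eval e x) :> R.
  have -> : h%:A = h :> R by rewrite /GRing.scale/= mulr1.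
  by rewrite scale0r !addr0 [x + _]addrC.
apply: DeriveDef.
  by move: dl; rewrite /derivable /=; under eq_fun do rewrite fE.
by rewrite -ll /derive /=; under [in RHS]eq_fun do rewrite fE.
Qed.

Lemma partial_eval e i : partial i (eval e) = eval (dexpr i e).
Proof. by apply/funext => x; have [] := is_derive_eval e x i. Qed.

Lemma continuous_eval e : continuous (eval e).
Proof.
elim: e => /= [i|c|e1 IH1 e2 IH2|e1 IH1 e2 IH2|j e IH] x.
- exact: coord_continuous.
- exact: cst_continuous.
- by apply: continuousD; [exact: IH1|exact: IH2].
- by apply: continuousM; [exact: IH1|exact: IH2].
- by apply: (@continuous_comp _ _ _ (eval e) (dbump j)); [exact: IH|exact: continuous_dbump].
Qed.

Lemma smooth_eval e : smooth (eval e).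
Proof.
move=> l; have -> : foldr (@partial R n) (eval e) l = eval (foldr dexpr e l).
  by elim: l => //= i l ->; exact: partial_eval.
split=> [|i x]; first exact: continuous_eval.
by have [] := is_derive_eval (foldr dexpr e l) x i.
Qed.

(** Stated with measurable coordinates of [h] because on [E * E], with the product of the Lebesgue
    sigma-algebras, the map $(x,y)\mapsto x-y$ need not pull Lebesgue sets back to measurable sets,
    although its coordinates are measurable. *)
Lemma measurable_eval d (T : measurableType d) (e : expr) (h : T -> E) :
  (forall i, measurable_fun setT (fun w => h w 0 i)) ->
  measurable_fun setT (fun w => eval e (h w)).
Proof.
move=> mh; elim: e => /= [i|c|e1 IH1 e2 IH2|e1 IH1 e2 IH2|j e IH].
- exact: mh.
- exact: measurable_cst.
- exact: measurable_funD.
- exact: measurable_funM.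
- apply: (@measurableT_comp _ _ _ _ _ _ (dbump j)) => //.
  by apply: continuous_measurable_fun; exact: continuous_dbump.
Qed.

Lemma eval_dexpr_far e r : (forall x, r < `|x| -> eval e x = 0) ->
  forall i x, r < `|x| -> eval (dexpr i e) x = 0.
Proof.
move=> e0 i x rx; rewrite -partial_eval /partial.
rewrite (@near_eq_derive _ _ _ _ (cst 0)); first exact: derive_cst.
near=> y; apply: e0; near: y.
have : nbhs `|x| [set t | r < t] by exact: lt_nbhsr.
by move=> /norm_continuous.
Unshelve. all: by end_near. Qed.

Lemma closed_cube x r : closed (cube x r).
Proof.
rewrite (_ : cube x r = (fun y : E => `|y - x|) @^-1` [set t | t <= r])//.
apply: preimage_closed; last exact: closed_le.
move=> y _; apply: (@continuous_comp _ _ _ (fun y : E => y - x) (fun y : E => `|y|)).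
  by apply: continuousB; [exact: cvg_id|exact: cst_continuous].
exact: norm_continuous.
Qed.

Lemma compact_cube x r : compact (cube x r).
Proof.
apply: bounded_closed_compact; last exact: closed_cube.
exists (`|x| + r); split; first exact: num_real.
move=> M rM y yr; apply: le_trans (ltW rM).
by rewrite /= -[y](addrNK x) addrC (le_trans (ler_normD _ _))// lerD2l.
Qed.

Lemma eval_bounded e r : (forall x, r < `|x| -> eval e x = 0) ->
  exists2 B : R, 0 < B & forall x, `|eval e x| <= B.
Proof.
move=> e0.
have [B [_ hB]] : bounded_set (eval e @` cube (0 : E) r).
  apply: compact_bounded; apply: continuous_compact; last exact: compact_cube.
  by apply: continuous_subspaceT => x; exact: continuous_eval.
exists (Num.max 1 (B + 1)); first by rewrite lt_max ltr01.
move=> x; have [xr|rx] := leP `|x| r; last by rewrite e0// normr0 le_max ler01.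
rewrite le_max; apply/orP; right; apply: hB; first by rewrite ltrDl.
by exists x; rewrite // /cube/= subr0.
Qed.

Lemma Cc_infty_eval (Om : set E) e x0 r : (forall x, r < `|x - x0| -> eval e x = 0) ->
  cube x0 r `<=` Om -> Cc_infty Om (eval e).
Proof.
move=> e0 rOm.
have sub : closure [set x | eval e x != 0] `<=` cube x0 r.
  rewrite [X in _ `<=` X](closure_id _).1; last exact: closed_cube.
  apply: closureS => x /=; apply: contraNP => /negP; rewrite -ltNge => /e0 ->.
  by rewrite eqxx.
split; first exact: smooth_eval; last exact: subset_trans rOm.
have cK := @compact_cube x0 r.
by apply: subclosed_compact cK sub; exact: closed_closure.
Qed.

End smooth_expressions.
Arguments expr : clear implicits.
Arguments Coord {R n} _.
Arguments Const {R n} _.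

(** * Integrals of bounded functions with compact support ([bcs]), and limits under the integral *)

Section bounded_compact_support_integrals.
Context {R : realType} {n : nat}.
Local Notation E := 'rV[R]_n.+1.
Local Notation mu := (@lebesgue_rV R n).
Local Notation J f := (\int[mu]_x f x).
Implicit Types (f u : E -> R) (x c : E) (r A B : R).

Lemma cube_measure_lty x r : (mu (cube x r) < +oo)%E.
Proof.
have [r0|r0] := leP 0 r; first exact: le_lt_trans (cube_measure _ r0) (ltry _).
rewrite (_ : cube x r = set0) ?measure0//.
by apply/seteqP; split => // y /=; rewrite /cube/= => /le_lt_trans/(_ r0); rewrite normr_lt0.
Qed.

Lemma integrable_bcs f B x r : measurable_fun setT f -> (forall y, `|f y| <= B) ->
  (forall y, r < `|y - x| -> f y = 0) -> mu.-integrable setT (EFin \o f).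
Proof.
move=> mf fB f0; have mc := measurable_cube x r.
have fc : f \_ (cube x r) = f.
  apply/funext => y; rewrite patchE; case: ifPn => // /negP; rewrite inE /cube/= => /negP.
  by rewrite -ltNge => /f0.
have : mu.-integrable (cube x r) (EFin \o f).
  apply: measurable_bounded_integrable => //; first exact: cube_measure_lty.
  - exact: measurable_funTS.
  - exists B; split; first exact: num_real.
    by move=> M BM y _ /=; apply: le_trans (fB y) (ltW BM).
move=> /(integrable_mkcond _ mc); congr (_.-integrable _ _).
by rewrite restrict_EFin fc.
Qed.

Lemma Rintegral_bcs_le f B x r : 0 <= r -> measurable_fun setT f -> (forall y, `|f y| <= B) ->
  (forall y, r < `|y - x| -> f y = 0) -> `|J f| <= B * (2 * r) ^+ n.+1.
Proof.
move=> r0 mf fB f0; have mc := measurable_cube x r.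
have B0 : 0 <= B by apply: le_trans (fB 0).
have intf := integrable_bcs mf fB f0.
apply: (le_trans (le_normr_Rintegral measurableT intf)).
rewrite -lee_fin.
have : (\int[mu]_y (`|f y|)%:E <= \int[mu]_(y in cube x r) B%:E)%E.
  rewrite [X in (_ <= X)%E]integral_mkcond; apply: ge0_le_integral => //.
  - by apply/measurable_EFinP; exact: measurableT_comp.
  - apply/(measurable_restrictT _ mc); exact: measurable_cst.
  - move=> y _; rewrite patchE; case: ifPn => [_|/negP]; first by rewrite lee_fin.
    by rewrite inE /cube/= => /negP; rewrite -ltNge => /f0 ->; rewrite normr0.
rewrite integral_cst// => h.
rewrite /Rintegral fineK; last first.
  have : mu.-integrable setT (EFin \o (fun y => `|f y|)) by exact: integrable_abse intf.
  by move=> /(integrable_fin_num measurableT).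
apply: (le_trans h); rewrite EFinM lee_wpmul2l ?lee_fin//.
exact: cube_measure.
Qed.

Lemma measurable_shift f c : measurable_fun setT f -> measurable_fun setT (fun x => f (x + c)).
Proof.
move=> mf; have ms : measurable_fun setT (fun x : E => x + c).
  have := @measurable_refl_shift R n false c; congr measurable_fun.
  by apply/funext => x; rewrite /refl_shift scale1r.
exact: (measurableT_comp mf ms).
Qed.

Lemma measurable_refl f c : measurable_fun setT f -> measurable_fun setT (fun x => f (c - x)).
Proof.
move=> mf; have ms : measurable_fun setT (fun x : E => c - x).
  have := @measurable_refl_shift R n true c; congr measurable_fun.
  by apply/funext => x; rewrite /refl_shift scaleN1r addrC.
exact: (measurableT_comp mf ms).
Qed.

Lemma Rintegral_shift f c : measurable_fun setT f -> J (fun x => f (x + c)) = J f.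
Proof.
move=> mf; rewrite /Rintegral; congr fine.
have := @integral_refl_shift R n false c (EFin \o f); rewrite /refl_shift/=.
under eq_integral do rewrite scale1r.
by apply; exact/measurable_EFinP.
Qed.

Lemma Rintegral_refl f c : measurable_fun setT f -> J (fun x => f (c - x)) = J f.
Proof.
move=> mf; rewrite /Rintegral; congr fine.
have := @integral_refl_shift R n true c (EFin \o f); rewrite /refl_shift/=.
under eq_integral do rewrite scaleN1r addrC.
by apply; exact/measurable_EFinP.
Qed.

(** One cube contains the supports of the derivatives for all parameters near [a], so [B] times its
    indicator is an integrable majorant. *)
Lemma is_derive_Rintegral (k dk : R -> E -> R) (a d B r : R) x : 0 < d ->
  (forall h, `|h - a| < d -> mu.-integrable setT (EFin \o k h)) ->
  (forall h y, `|h - a| < d -> is_derive h 1 (k ^~ y) (dk h y)) ->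
  (forall h y, `|h - a| < d -> `|dk h y| <= B) ->
  (forall h y, `|h - a| < d -> r < `|y - x| -> dk h y = 0) ->
  is_derive a 1 (fun h => J (k h)) (J (dk a)).
Proof.
move=> d0 intk kdk dkB dk0.
have inI h : `]a - d, a + d[%classic h <-> `|h - a| < d.
  by rewrite /= in_itv/= ltr_norml; split; lra.
have Ia : `]a - d, a + d[%classic a by apply/inI; rewrite subrr normr0.
have B0 : 0 <= B by apply: le_trans (dkB a 0 _) => //; rewrite subrr normr0.
have mc := measurable_cube x r.
pose G y : R := B * \1_(cube x r) y.
have G0 y : 0 <= G y by rewrite mulr_ge0.
have intG : mu.-integrable setT (EFin \o G).
  apply: (@integrable_bcs G B x r).
  - by apply: measurable_funM => //; exact: measurable_indic.
  - by move=> y; rewrite ger0_norm// ler_piMr// indicE; case: (_ \in _).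
  - move=> y ry; rewrite /G indicE memNset ?mulr0//.
    by rewrite /cube/= leNgt ry.
have p1E h y : `|h - a| < d -> partial1of2 k h y = dk h y.
  by move=> ha; rewrite partial1of2E; have [_ ->] := kdk h y ha.
have Gub h y : `]a - d, a + d[%classic h -> setT y -> `|partial1of2 k h y| <= G y.
  move=> /inI ha _; rewrite p1E// /G indicE.
  have [yc|/negP] := boolP (y \in cube x r); first by rewrite mulr1 dkB.
  by rewrite inE /cube/= mulr0 => /negP; rewrite -ltNge => ry; rewrite (dk0 h)// normr0.
have der h y : `]a - d, a + d[%classic h -> setT y -> derivable (k ^~ y) h 1.
  by move=> /inI ha _; have [] := kdk h y ha.
have intk' h : `]a - d, a + d[%classic h -> mu.-integrable setT (EFin \o k h).
  by move=> /inI; exact: intk.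
have H1 := derivable_under_integral measurableT Ia intk' der G0 intG Gub.
have H2 := differentiation_under_integral measurableT Ia intk' der G0 intG Gub.
apply: DeriveDef => //; rewrite -derive1E H2.
by apply: eq_Rintegral => y _; rewrite p1E// subrr normr0.
Qed.

Lemma Rintegral_dominated_cvg d (T : measurableType d) (m : {measure set T -> \bar R})
    (fs : nat -> T -> R) (g h : T -> R) :
  (forall k, measurable_fun setT (fs k)) -> m.-integrable setT (EFin \o h) ->
  (forall k y, `|fs k y| <= h y) -> (forall y, fs ^~ y @ \oo --> g y) ->
  m.-integrable setT (EFin \o g) /\
  \int[m]_y fs k y @[k --> \oo] --> \int[m]_y g y.
Proof.
move=> mfs ih fsh fsg.
have [] := @dominated_convergence _ T R m setT measurableT
    (fun k => EFin \o fs k) (EFin \o g) (EFin \o h).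
- by move=> k; apply/measurable_EFinP.
- apply/measurable_EFinP; apply: (measurable_fun_cvg mfs) => y _; exact: fsg.
- by apply: aeW => y _; apply: cvg_EFin; [exact: nearW|exact: fsg].
- exact: ih.
- by apply: aeW => y k _ /=; rewrite lee_fin.
move=> ig _ cv; split => //.
by apply: fine_cvg; rewrite fineK //; exact: integrable_fin_num.
Qed.

Lemma Rintegral_sum d (T : measurableType d) (m : {measure set T -> \bar R}) (D : set T)
    (I : Type) (q : seq I) (F : I -> T -> R) : measurable D ->
  (forall i, m.-integrable D (EFin \o F i)) ->
  m.-integrable D (EFin \o (fun y => \sum_(i <- q) F i y)) /\
  \int[m]_(y in D) (\sum_(i <- q) F i y) = \sum_(i <- q) \int[m]_(y in D) F i y.
Proof.
move=> mD iF; elim: q => [|i q [IHi IH]].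
  under eq_fun do rewrite big_nil.
  split; last by rewrite big_nil /Rintegral integral0.
  have -> : EFin \o (fun=> 0 : R) = cst (0%:E : \bar R) :> (T -> \bar R) by [].
  exact: integrable0.
have -> : (fun y => \sum_(j <- i :: q) F j y) = (fun y => F i y + \sum_(j <- q) F j y).
  by apply/funext => y; rewrite big_cons.
split; first exact: (integrableD mD (iF i) IHi).
by rewrite RintegralD// IH big_cons.
Qed.

End bounded_compact_support_integrals.

(** * The fundamental lemma of the calculus of variations *)

Section open_boxes.
Context {R : realType} {n : nat}.
Local Notation E := 'rV[R]_n.+1.
Local Notation mu := (@lebesgue_rV R n).
Implicit Types (a b x : E) (r : R).

Definition obox a b : set E := [set x | forall i, a 0 i < x 0 i < b 0 i].

Lemma obox_bool a b x : obox a b x \/ exists i, (x 0 i <= a 0 i) || (b 0 i <= x 0 i).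
Proof.
have [h|/existsP[i hi]] := boolP [forall i, a 0 i < x 0 i < b 0 i].
  by left => i; exact: (forallP h).
right; exists i; move: hi; rewrite negb_and -!leNgt => /orP[]->//; by rewrite orbT.
Qed.

Lemma measurable_obox a b : measurable (obox a b).
Proof.
rewrite (_ : obox a b = \bigcap_(i in [set: 'I_n.+1])
   ([set x : E | a 0 i < x 0 i] `&` [set x : E | x 0 i < b 0 i])).
  apply: fin_bigcap_measurable; first exact: finite_finset.
  move=> i _; apply: measurableI.
    rewrite -[X in measurable X]setCK; apply: measurableC.
    apply: (@halfspace_caratheodory _ _ i (a 0 i)) => x /=.
      by move/negP; rewrite -leNgt.
    by move/contrapT => /ltW.
  apply: (@halfspace_caratheodory _ _ i (b 0 i)) => x /=; first exact: ltW.
  by move/negP; rewrite -leNgt.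
apply/seteqP; split=> x /= bx i; first by move=> _; have /andP[] := bx i.
by have [/= -> ->] := bx i I.
Qed.

(** The removed points lie on finitely many faces, each of them a box with one side of length 0. *)
Lemma box_obox_negligible a b : mu.-negligible (box a b `\` obox a b).
Proof.
pose upd (c : E) i t : E := \row_j if j == i then t else c 0 j.
pose face i t : set E := box (upd a i t) (upd b i t).
have face0 i t : mu.-negligible (face i t).
  exists (face i t); split => //; first exact: measurable_box.
  apply/eqP; rewrite eq_le measure_ge0 andbT (le_trans (leb_outer_box _ _))// lee_fin.
  by rewrite /box_vol (bigD1 i)//= !mxE eqxx subrr maxxx mul0r.
apply: (@negligibleS _ _ _ mu (\bigcup_(i in [set: 'I_n.+1]) (face i (a 0 i) `|` face i (b 0 i)))).
  move=> x [bx nx]; have [//|[i xi]] := obox_bool a b x; exists i => //.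
  have /andP[ax xb] := bx i.
  case/orP: xi => xi; [left|right] => j; rewrite !mxE; case: eqP => [->|_]; try exact: bx.
  - by rewrite ax xi.
  - by rewrite xb xi.
have : finite_set [set: 'I_n.+1] by exact: finite_finset.
move=> fI; rewrite -bigsetU_fset_set//; elim/big_ind: _ => [||i _].
- exact: negligible_set0.
- by move=> ? ?; exact: negligibleU.
- exact: negligibleU.
Qed.

(** A smooth substitute for the indicator of the open box: it takes values in $[0,1]$ and is
    positive exactly there. *)
Definition wbox a b : expr R n :=
  \big[@Mul R n/Const 1%R]_i Mul (Bump 0 (Add (Coord i) (Const (- a 0 i))))
                          (Bump 0 (Add (Const (b 0 i)) (Mul (Const (-1)) (Coord i)))).

Lemma eval_bigMul (I : Type) (s : seq I) (F : I -> expr R n) x :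
  eval (\big[@Mul R n/Const 1%R]_(i <- s) F i) x = \prod_(i <- s) eval (F i) x.
Proof.
by rewrite (big_morph (fun e => eval e x) (id1 := 1) (op1 := *%R)).
Qed.

Lemma eval_wboxE a b x :
  eval (wbox a b) x = \prod_i (dbump 0 (x 0 i - a 0 i) * dbump 0 (b 0 i - x 0 i)).
Proof. by rewrite /wbox eval_bigMul; apply: eq_bigr => i _ /=; rewrite mulN1r. Qed.

Lemma eval_wbox_ge0 a b x : 0 <= eval (wbox a b) x.
Proof. by rewrite eval_wboxE; apply: prodr_ge0 => i _; rewrite mulr_ge0 ?bump0_ge0. Qed.

Lemma eval_wbox_le1 a b x : eval (wbox a b) x <= 1.
Proof.
rewrite eval_wboxE; apply: prodr_ile1 => i _.
by rewrite mulr_ge0 ?bump0_ge0//= mulr_ile1 ?bump0_ge0 ?bump0_le1.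
Qed.

Lemma eval_wbox_gt0 a b x : obox a b x -> 0 < eval (wbox a b) x.
Proof.
move=> h; rewrite eval_wboxE; apply: prodr_gt0 => i _.
by have /andP[ax xb] := h i; rewrite mulr_gt0 ?bump0_gt0 ?subr_gt0.
Qed.

Lemma eval_wbox_eq0 a b x : ~ obox a b x -> eval (wbox a b) x = 0.
Proof.
have [//|[i xi] _] := obox_bool a b x.
rewrite eval_wboxE (bigD1 i)//=; case/orP: xi => xi.
  by rewrite bump_le0 ?mul0r// subr_le0.
by rewrite (@bump_le0 _ _ (b 0 i - _)) ?mulr0 ?mul0r// subr_le0.
Qed.

Section union.
Variables (c : nat -> E * E) (K : nat).
Let U : set E := \bigcup_(k in `I_K) obox (c k).1 (c k).2.

(** The product [P] of the complements $1-w_k$ lies in $[0,1]$ and is less than 1 exactly on the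
    union of the open boxes. Hence $1-P^m$ increases to the indicator of the union and stays an
    expression supported in its closure. *)
Definition union_bump (m : nat) : expr R n :=
  let P := \big[@Mul R n/Const 1%R]_(0 <= k < K)
     Add (Const 1) (Mul (Const (-1)) (wbox (c k).1 (c k).2)) in
  Add (Const 1) (Mul (Const (-1)) (iter m (Mul P) (Const 1))).

Let P x := \prod_(0 <= k < K) (1 - eval (wbox (c k).1 (c k).2) x).

Lemma eval_union_bump m x : eval (union_bump m) x = 1 - P x ^+ m.
Proof.
rewrite /union_bump /= mulN1r; congr (1 - _).
elim: m => [|m IH] //=; rewrite IH exprS eval_bigMul; congr (_ * _).
by apply: eq_bigr => k _ /=; rewrite mulN1r.
Qed.

Let P01 x : 0 <= P x <= 1.
Proof.
have h k : 0 <= 1 - eval (wbox (c k).1 (c k).2) x <= 1.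
  by rewrite subr_ge0 eval_wbox_le1 gerBl eval_wbox_ge0.
apply/andP; split; first by apply: prodr_ge0 => k _; have /andP[] := h k.
exact: prodr_ile1.
Qed.

Lemma union_bump_eq0 m x : ~ U x -> eval (union_bump m) x = 0.
Proof.
move=> Ux; rewrite eval_union_bump /P big_nat big1 ?expr1n ?subrr// => k /andP[_ kK].
rewrite eval_wbox_eq0 ?subr0// => h; apply: Ux; exists k => //.
Qed.

Lemma union_bump01 m x : 0 <= eval (union_bump m) x <= 1.
Proof.
rewrite eval_union_bump; have /andP[p0 p1] := P01 x.
by rewrite subr_ge0 exprn_ile1// gerBl exprn_ge0.
Qed.

Lemma union_bump_cvg x : eval (union_bump m) x @[m --> \oo] --> (\1_U x : R).
Proof.
have [Ux|Ux] := pselect (U x); last first.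
  rewrite indicE memNset//; under eq_fun do rewrite union_bump_eq0//.
  exact: cvg_cst.
rewrite indicE mem_set//; under eq_fun do rewrite eval_union_bump.
suff h : P x ^+ m @[m --> \oo] --> (0 : R).
  have := cvgB (cvg_cst (1 : R)) h; rewrite subr0; exact.
apply: cvg_expr; have /andP[p0 p1] := P01 x.
rewrite ger0_norm//; case: Ux => k /= kK ok.
have kin : k \in index_iota 0 K by rewrite mem_index_iota.
rewrite /P (big_rem k)//=.
apply: (@le_lt_trans _ _ (1 - eval (wbox (c k).1 (c k).2) x)).
  rewrite ler_piMr// ?subr_ge0 ?eval_wbox_le1//.
  apply: prodr_ile1 => j _.
  by rewrite subr_ge0 eval_wbox_le1 gerBl eval_wbox_ge0.
by rewrite gtrBl eval_wbox_gt0.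
Qed.

End union.

(* The outer measure is defined by box covers; replacing boxes by open ones
   only loses a null set, so no enlargement is needed. *)
Lemma obox_approx (A : set E) (x0 : E) (r e : R) : measurable A -> A `<=` cube x0 r -> 0 < e ->
  exists c : nat -> E * E, let U := \bigcup_k obox (c k).1 (c k).2 in
    [/\ U `<=` cube x0 r, (mu (U `\` A) <= e%:E)%E & mu (A `\` U) = 0%E].
Proof.
move=> mA Ax0 e0.
have fA : mu A \is a fin_num.
  rewrite ge0_fin_numE ?measure_ge0//; apply: le_lt_trans (cube_measure_lty x0 r).
  by apply: le_measure; rewrite ?inE//; exact: measurable_cube.
have [_ [d Ad <-] dl] := lb_ereal_inf_adherent e0 fA.
(* The covering boxes are clipped to the cube, where test functions are allowed to live. *)
pose lo k : E := \row_i Num.max ((d k).1 0 i) (x0 0 i - r).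
pose hi k : E := \row_i Num.min ((d k).2 0 i) (x0 0 i + r).
exists (fun k => (lo k, hi k)) => U.
have mU : measurable U by apply: bigcup_measurable => k _; exact: measurable_obox.
have od k : obox (lo k) (hi k) `<=` box (d k).1 (d k).2.
  move=> x h i; have := h i; rewrite !mxE gt_max lt_min => /andP[/andP[? _] /andP[? _]].
  by apply/andP; split; exact: ltW.
have AU : mu.-negligible (A `\` U).
  apply: (@negligibleS _ _ _ mu (\bigcup_k (box (lo k) (hi k) `\` obox (lo k) (hi k)))).
    move=> x [Ax nUx]; have [k _ dx] := Ad _ Ax; exists k => //; split; last first.
      by move=> ox; apply: nUx; exists k.
    have := Ax0 _ Ax; rewrite cube_box => h i.
    have := h i; have := dx i; rewrite !mxE ge_max le_min => /andP[-> ->] /=; lra.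
  by apply: negligible_bigcup => k; exact: box_obox_negligible.
have AU0 : mu (A `\` U) = 0%E.
  have mD : measurable (A `\` U) by exact: measurableD.
  exact/(negligibleP mu mD).
split => //.
  move=> x [k _ h]; rewrite cube_box => i; have := h i; rewrite !mxE gt_max lt_min; lra.
have mUA : (mu U <= mu A + e%:E)%E.
  apply: le_trans (ltW dl).
  apply: (@le_trans _ _ (\sum_(k <oo) mu (obox (lo k) (hi k)))%E).
    by apply: measure_sigma_subadditive => // k; exact: measurable_obox.
  apply: lee_nneseries => // k _; apply: le_trans (leb_outer_box _ _).
  by apply: le_measure; rewrite ?inE//; [exact: measurable_obox|exact: measurable_box].
have fU : (mu U < +oo)%E by apply: le_lt_trans mUA _; rewrite lte_add_pinfty ?ltry// -ge0_fin_numE.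
have AD : (A `\` U) `|` (A `&` U) = A by rewrite setUC setUIDK.
have AUE : mu (A `&` U) = mu A.
  have h : mu ((A `\` U) `|` (A `&` U)) = (mu (A `\` U) + mu (A `&` U))%E.
    apply: measureU; [exact: measurableD|exact: measurableI|].
    by apply/seteqP; split => // x [[_ nU] [_ /nU]].
  by rewrite -[in RHS]AD h AU0 add0e.
have -> : mu (U `\` A) = (mu U - mu A)%E.
  by rewrite measureD// setIC; congr (_ - _)%E.
by rewrite leeBlDl// addeC.
Qed.

End open_boxes.

Section fundamental_lemma.
Context {R : realType} {n : nat}.
Local Notation E := 'rV[R]_n.+1.
Local Notation mu := (@lebesgue_rV R n).
Local Notation J f := (\int[mu]_x f x).
Implicit Types (x : E) (r : R).

Lemma Rintegral_indic_le (A : set E) (e : R) : measurable A -> (mu A <= e%:E)%E ->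
  mu.-integrable setT (EFin \o (\1_A : E -> R)) /\ J (\1_A : E -> R) <= e.
Proof.
move=> mA Ae; have fA : mu A \is a fin_num.
  by rewrite ge0_fin_numE ?measure_ge0//; exact: le_lt_trans (ltry e).
split.
  apply/integrableP; split; first by apply/measurable_EFinP; exact: measurable_indic.
  under eq_integral do rewrite /= ger0_norm//.
  by rewrite integral_indic// setIT; exact: le_lt_trans (ltry e).
by rewrite /Rintegral integral_indic// setIT -lee_fin fineK.
Qed.

Section in_a_cube.
Variables (Om : set E) (f : E -> R) (x0 : E) (r : R).
Hypotheses (mOm : measurable Om) (f2 : L2 Om f).
Hypothesis f_test : forall psi, Cc_infty Om psi -> \int[mu]_(x in Om) (f x * psi x) = 0.
Hypothesis x0Om : cube x0 r `<=` Om.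

Let f0 := f \_ (cube x0 r).

Let mf0 : measurable_fun setT f0.
Proof.
apply/(measurable_restrictT _ (measurable_cube x0 r)).
exact: measurable_funS f2.1.
Qed.

Let if02 : mu.-integrable setT (EFin \o (fun x => f0 x ^+ 2)).
Proof.
apply/integrableP; split.
  by apply/measurable_EFinP; exact: measurable_funX.
apply: le_lt_trans f2.2; rewrite [leRHS]integral_mkcond; apply: ge0_le_integral.
- exact: measurableT.
- by [].
- have m2 : measurable_fun setT (EFin \o (fun x => f0 x ^+ 2)).
    by apply/measurable_EFinP; exact: measurable_funX.
  exact: (measurableT_comp (@abse_measurable R setT) m2).
- apply/(measurable_restrictT _ mOm); apply/measurable_EFinP.
  by apply: measurable_funX; exact: f2.1.
- move=> x _ /=; rewrite /f0 !patchE.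
  case: ifPn => [xc|_]; last by rewrite expr0n/= normr0; case: ifP => // _; rewrite lee_fin sqr_ge0.
  rewrite mem_set; last by apply: x0Om; exact: set_mem.
  by rewrite ger0_norm ?sqr_ge0.
Qed.

Let if0 : mu.-integrable setT (EFin \o f0).
Proof.
have ic : mu.-integrable setT (EFin \o (\1_(cube x0 r) : E -> R)).
  have fc := cube_measure_lty x0 r.
  have fcn : mu (cube x0 r) \is a fin_num by rewrite ge0_fin_numE.
  have [] := @Rintegral_indic_le (cube x0 r) (fine (mu (cube x0 r))) (measurable_cube _ _).
    by rewrite fineK.
  by [].
have := integrableD measurableT ic if02.
apply: le_integrable; [exact: measurableT|exact/measurable_EFinP|].
move=> x _ /=; rewrite lee_fin /f0 patchE indicE; case: ifP => _; last first.
  by rewrite normr0.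
by rewrite [leRHS]ger0_norm ?addr_ge0 ?sqr_ge0// ler_norml/=; nra.
Qed.

Let F2 := J (fun x => f0 x ^+ 2).

Let if0i (A : set E) : measurable A -> mu.-integrable setT (EFin \o (fun x => f0 x * \1_A x)).
Proof.
move=> mA; apply: (le_integrable measurableT _ _ if0).
  by apply/measurable_EFinP; apply: measurable_funM => //; exact: measurable_indic.
move=> x _ /=; rewrite lee_fin normrM ler_piMr//.
by rewrite indicE; case: (_ \in _); rewrite ?normr1 ?normr0.
Qed.

(** Two passages to the limit by dominated convergence: the power in [union_bump] goes to infinity
    for a finite union, then the number of boxes does. *)
Let union0 (c : nat -> E * E) : (forall k, obox (c k).1 (c k).2 `<=` cube x0 r) ->
  J (fun x => f0 x * \1_(\bigcup_k obox (c k).1 (c k).2) x) = 0.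
Proof.
move=> cx0; pose U (K : nat) := \bigcup_(k in `I_K) obox (c k).1 (c k).2 : set E.
have UK K : J (fun x => f0 x * \1_(U K) x) = 0.
  have UKx0 : U K `<=` cube x0 r by move=> x [k _]; exact: cx0.
  have test0 m : J (fun x => f0 x * eval (union_bump c K m) x) = 0.
    rewrite -[RHS](f_test (psi := eval (union_bump c K m))); last first.
      apply: (@Cc_infty_eval _ _ _ _ x0 r) => // x rx.
      apply: union_bump_eq0 => /UKx0; rewrite /cube/= leNgt.
      by rewrite rx.
    rewrite [RHS]Rintegral_mkcond; congr (Rintegral _ _ _); apply/funext => x.
    rewrite /f0 !patchE; case: ifPn => [xc|/negP xc].
      by rewrite mem_set//; apply: x0Om; exact: set_mem.
    rewrite union_bump_eq0 ?mulr0; first by case: ifP.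
    by move=> /UKx0 xc'; apply: xc; exact: mem_set.
  have [] := @Rintegral_dominated_cvg _ _ _ mu (fun m x => f0 x * eval (union_bump c K m) x)
     (fun x => f0 x * \1_(U K) x) (fun x => `|f0 x|).
  - move=> m; apply: measurable_funM => //.
    by apply: continuous_rV_measurable; exact: continuous_eval.
  - exact: (integrable_abse if0).
  - move=> m x; have /andP[p0 p1] := union_bump01 c K m x.
    by rewrite normrM ler_piMr// ger0_norm.
  - by move=> x; apply: cvgM; [exact: cvg_cst|exact: union_bump_cvg].
  move=> _; under eq_fun do rewrite test0.
  move=> /cvg_lim => /(_ (@Rhausdorff R)) <-.
  by rewrite lim_cst//; exact: Rhausdorff.
have [] := @Rintegral_dominated_cvg _ _ _ mu (fun K x => f0 x * \1_(U K) x)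
     (fun x => f0 x * \1_(\bigcup_k obox (c k).1 (c k).2) x) (fun x => `|f0 x|).
- move=> K; apply: measurable_funM => //; apply: measurable_indic.
  by apply: bigcup_measurable => k _; exact: measurable_obox.
- exact: (integrable_abse if0).
- move=> K x; rewrite normrM ler_piMr//.
  by rewrite indicE; case: (_ \in _); rewrite ?normr1 ?normr0.
- move=> x; apply: cvgM; first exact: cvg_cst.
  have [[k _ xk]|nU] := pselect ((\bigcup_k obox (c k).1 (c k).2) x).
    apply: cvg_near_cst; exists k.+1 => // K /= kK.
    by rewrite !indicE !mem_set//; exists k.
  rewrite indicE memNset//; apply: cvg_near_cst; apply: nearW => K.
  by rewrite indicE memNset// => -[k _ xk]; apply: nU; exists k.
move=> _; under eq_fun do rewrite UK.
move=> /cvg_lim => /(_ (@Rhausdorff R)) <-.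
by rewrite lim_cst//; exact: Rhausdorff.
Qed.

(** [A] is replaced by a countable union of open boxes up to a set of small measure, where the
    square integrability of [f0] makes the integral small. *)
Let set0_int (A : set E) : measurable A -> A `<=` cube x0 r ->
  J (fun x => f0 x * \1_A x) = 0.
Proof.
move=> mA Ax0; apply/eqP; rewrite -normr_le0; apply/ler_addgt0Pl => e e0; rewrite addr0.
have F20 : 0 <= F2 by apply: Rintegral_ge0 => x _; exact: sqr_ge0.
(* This balances $|f_0|\le d f_0^2+1/(4d)$: on a set of measure $4d^2$ the second term costs $d$,
   for a total of $d(F_2+1)=e$. *)
pose d := e / (F2 + 1).
have d0 : 0 < d by rewrite divr_gt0// ltr_wpDl.
have [|c] := @obox_approx R n A x0 r (4 * d ^+ 2) mA Ax0; first by rewrite mulr_gt0// exprn_gt0.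
set U := \bigcup_k _ => /= -[Ux0 UA AU].
have mU : measurable U by apply: bigcup_measurable => k _; exact: measurable_obox.
have [iUA UAle] := Rintegral_indic_le (measurableD mU mA) UA.
have AU' : (mu (A `\` U) <= 0%:E)%E by rewrite AU.
have [iAU AUle] := Rintegral_indic_le (measurableD mA mU) AU'.
have U0 : J (fun x => f0 x * \1_U x) = 0.
  by apply: union0 => k x xk; apply: Ux0; exists k.
have -> : J (fun x => f0 x * \1_A x) = J (fun x => f0 x * \1_A x - f0 x * \1_U x).
  by rewrite RintegralB ?U0 ?subr0//; exact: if0i.
pose h x : R := d * f0 x ^+ 2 + (4 * d)^-1 * (\1_(U `\` A) x + \1_(A `\` U) x).
have iD := integrableD measurableT iUA iAU.
have id1 : mu.-integrable setT (EFin \o (fun x => d * f0 x ^+ 2)).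
  have := integrableZl measurableT d if02; apply: eq_integrable => //.
have id2 : mu.-integrable setT (EFin \o (fun x => (4 * d)^-1 * (\1_(U `\` A) x + \1_(A `\` U) x))).
  have := integrableZl measurableT (4 * d)^-1 iD; apply: eq_integrable => //.
have idf : mu.-integrable setT (EFin \o (fun x => f0 x * \1_A x - f0 x * \1_U x)).
  by have := integrableB measurableT (if0i mA) (if0i mU); apply: eq_integrable.
have ih : mu.-integrable setT (EFin \o h).
  by have := integrableD measurableT id1 id2; apply: eq_integrable.
apply: (le_trans (le_normr_Rintegral measurableT idf)).
apply: (@le_trans _ _ (J h)).
  apply: le_Rintegral => //; first exact: (integrable_abse idf).
  move=> x _; rewrite /h -mulrBr normrM.
  have d4 : 0 < 4 * d by rewrite mulr_gt0.
  have key : `|f0 x| <= d * f0 x ^+ 2 + (4 * d)^-1.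
    rewrite -(@ler_pM2l _ (4 * d))// mulrDr mulfV ?gt_eqF//.
    rewrite -[f0 x ^+ 2]real_normK ?num_real//.
    by have := sqr_ge0 (2 * d * `|f0 x| - 1); nra.
  have pos : 0 <= d * f0 x ^+ 2 by rewrite mulr_ge0 ?sqr_ge0// ltW.
  rewrite !indicE !in_setD; case: (x \in A); case: (x \in U) => /=;
    rewrite ?subrr ?subr0 ?sub0r ?normrN ?normr0 ?normr1 ?mulr0 ?mulr1 ?add0r ?addr0 ?mulr0 ?addr0 ?mulr1//.
rewrite /h RintegralD// RintegralZl// RintegralZl// RintegralD//.
apply: (@le_trans _ _ (d * F2 + (4 * d)^-1 * (4 * d ^+ 2 + 0))).
  rewrite lerD2l; apply: ler_wpM2l; last exact: lerD.
  by rewrite invr_ge0 mulr_ge0// ltW.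
have -> : d * F2 + (4 * d)^-1 * (4 * d ^+ 2 + 0) = d * (F2 + 1) by field; rewrite gt_eqF.
by rewrite /d divfK// gt_eqF// ltr_wpDl.
Qed.

Lemma test_ae0_cube : {ae mu, forall x, cube x0 r x -> f x = 0}.
Proof.
have mc := measurable_cube x0 r.
have := @integral_ae_eq _ _ _ mu (cube x0 r) mc (cst 0%E) (EFin \o f).
have ifc : mu.-integrable (cube x0 r) (EFin \o f).
  by apply/(integrable_mkcond _ mc); rewrite restrict_EFin.
move=> /(_ ifc (measurable_cst _)) h.
have : ae_eq mu (cube x0 r) (EFin \o f) (cst 0%E).
  apply: h => A Ax0 mA; rewrite integral0.
  have -> : (\int[mu]_(x in A) (EFin \o f) x = \int[mu]_x (f0 x * \1_A x)%:E)%E.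
    rewrite integral_mkcond; apply: eq_integral => x _; rewrite /f0 !patchE indicE.
    case: (boolP (x \in A)) => xA; last by rewrite mulr0.
    by rewrite mem_set ?mulr1//; apply: Ax0; exact: set_mem.
  have := set0_int mA Ax0; rewrite /Rintegral => e.
  have := integrable_fin_num measurableT (if0i mA).
  by move=> /fineK <-; rewrite /= e.
by apply: filterS => x /= + xc => /(_ xc) [].
Qed.

End in_a_cube.

Lemma test_ae0 (Om : set E) (f : E -> R) : open Om -> L2 Om f ->
  (forall psi, Cc_infty Om psi -> \int[mu]_(x in Om) (f x * psi x) = 0) ->
  {ae mu, forall x, Om x -> f x = 0}.
Proof.
move=> oOm f2 f_test; have mOm := open_rV_measurable oOm.
have [c Omc] := open_bigcup_cubes oOm.
have : \forall x \ae mu, forall k, cube (c k).1 (c k).2 x -> f x = 0.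
  apply: ae_foralln => k; apply: (test_ae0_cube mOm f2 f_test).
  by rewrite Omc => x xk; exists k.
by apply: filterS => x h; rewrite Omc => -[k _]; exact: h.
Qed.

End fundamental_lemma.

(** * The fractional kernel *)

Section kernel.
Context {R : realType} {n : nat}.
Local Notation E := 'rV[R]_n.+1.
Local Notation mu := (@lebesgue_rV R n).
Implicit Types (x y z : E) (r t p : R).

Lemma enorm_ge0 x : 0 <= enorm x.
Proof. exact: sqrtr_ge0. Qed.

Lemma dot_ge0 x : 0 <= dot x x.
Proof. by apply: sumr_ge0 => i _; rewrite -expr2 sqr_ge0. Qed.

Lemma enormN x : enorm (- x) = enorm x.
Proof. by rewrite /enorm /dot; congr Num.sqrt; apply: eq_bigr => i _; rewrite !mxE mulrNN. Qed.

Lemma norm_le_enorm x : `|x| <= enorm x.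
Proof.
apply: norm_le_coord => i; rewrite -sqrtr_sqr ler_wsqrtr// /dot (bigD1 i)//= -expr2 lerDl.
by apply: sumr_ge0 => j _; rewrite -expr2 sqr_ge0.
Qed.

Lemma enorm_le_norm x : enorm x <= n.+1%:R * `|x|.
Proof.
rewrite -[leRHS]ger0_norm ?mulr_ge0// -sqrtr_sqr ler_wsqrtr// /dot.
apply: (@le_trans _ _ (\sum_(i < n.+1) `|x| ^+ 2)).
  apply: ler_sum => i _; rewrite -expr2 -real_normK ?num_real//.
  by rewrite lerXn2r ?nnegrE// coord_le_norm.
rewrite sumr_const card_ord exprMn -[X in X <= _]mulr_natl ler_wpM2r ?sqr_ge0//.
by rewrite -natrX ler_nat expnS expn1 leq_pmulr.
Qed.

Lemma measurable_enorm d (T : measurableType d) (h : T -> E) :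
  (forall i, measurable_fun setT (fun w => h w 0 i)) ->
  measurable_fun setT (fun w => enorm (h w)).
Proof.
move=> mh; rewrite /enorm.
have msq : measurable_fun setT (@Num.sqrt R).
  by apply: continuous_measurable_fun; exact: sqrt_continuous.
apply: (measurableT_comp msq); apply: measurable_sum => i.
by apply: measurable_funM; exact: mh.
Qed.

Variable s : R.
Hypothesis s01 : 0 < s < 1.

Lemma kern_exponent_gt0 : 0 < n.+1%:R + 2 * s.
Proof. by case/andP: s01 => s0 _; rewrite ltr_wpDl ?ler0n// mulr_gt0. Qed.

Definition kern z : R := (enorm z `^ (n.+1%:R + 2 * s))^-1.

Lemma kern_ge0 z : 0 <= kern z.
Proof. by rewrite invr_ge0 powR_ge0. Qed.

Lemma kernN z : kern (- z) = kern z.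
Proof. by rewrite /kern enormN. Qed.

Lemma kern0 : kern 0 = 0.
Proof.
rewrite /kern (_ : enorm 0 = 0) ?powR0 ?invr0//; last first.
  by rewrite /enorm /dot big1 ?sqrtr0// => i _; rewrite mxE mul0r.
by rewrite gt_eqF// kern_exponent_gt0.
Qed.

Lemma measurable_kern d (T : measurableType d) (h : T -> E) :
  (forall i, measurable_fun setT (fun w => h w 0 i)) ->
  measurable_fun setT (fun w => kern (h w)).
Proof.
move=> mh; rewrite /kern; under eq_fun do rewrite -powRN.
apply: (measurableT_comp (measurable_powR _)); exact: measurable_enorm.
Qed.

Lemma kern_le r z : 0 < r -> r <= `|z| -> kern z <= r `^ (- (n.+1%:R + 2 * s)).
Proof.
move=> r0 rz; have rz' : r <= enorm z by exact: le_trans (norm_le_enorm z).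
rewrite /kern powRN lef_pV2 ?posrE ?powR_gt0//; last exact: lt_le_trans rz'.
apply: ge0_ler_powR => //; rewrite ?nnegrE ?enorm_ge0 ?(ltW r0)//.
exact: ltW kern_exponent_gt0.
Qed.

(* Sum over dyadic shells: the j-th cube contributes [K (2 r)^N (q b^N)^j]. *)
Lemma shells_integral (f : E -> R) (K r q b : R) :
  measurable_fun setT f -> (forall z, 0 <= f z) -> 0 <= K -> 0 <= r -> 0 <= q -> 0 <= b ->
  q * b ^+ n.+1 < 1 ->
  (forall z, f z != 0 -> exists2 j : nat, `|z| <= r * b ^+ j & f z <= K * q ^+ j) ->
  (\int[mu]_z (f z)%:E <= (K * (2 * r) ^+ n.+1 / (1 - q * b ^+ n.+1))%:E)%E.
Proof.
move=> mf f0 K0 r0 q0 b0 qb fs.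
pose g j z : \bar R := (K * q ^+ j * \1_(cube 0 (r * b ^+ j) : set E) z)%:E.
have g0 j z : (0 <= g j z)%E by rewrite lee_fin !mulr_ge0 ?exprn_ge0.
have mg j : measurable_fun setT (g j).
  by apply/measurable_EFinP; apply: measurable_funM => //; apply: measurable_indic; exact: measurable_cube.
apply: (@le_trans _ _ (\int[mu]_z \sum_(j <oo) g j z)%E).
  apply: ge0_le_integral.
  - exact: measurableT.
  - by move=> z _; rewrite lee_fin.
  - exact/measurable_EFinP.
  - by apply: ge0_emeasurable_sum => // j z _ _; exact: g0.
  - move=> z _; have [->|/fs[j zj fj]] := eqVneq (f z) 0.
      by apply: nneseries_ge0 => j _ _; exact: g0.
    apply: (@le_trans _ _ (g j z)).
      by rewrite lee_fin indicE mem_set ?mulr1// /cube/= subr0.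
    rewrite (@nneseriesD1 _ (g ^~ z) j xpredT)//.
    by rewrite leeDl//; apply: nneseries_ge0 => k _ _; exact: g0.
rewrite integral_nneseries//.
apply: (@le_trans _ _ (\sum_(j <oo) (K * (2 * r) ^+ n.+1 * (q * b ^+ n.+1) ^+ j)%:E)%E).
  apply: lee_nneseries => [j _ _|j _]; first by apply: integral_ge0 => z _; exact: g0.
  under eq_integral do rewrite /g EFinM.
  have mc := measurable_cube (0 : E) (r * b ^+ j).
  rewrite ge0_integralZl//; last 2 first.
  - apply/measurable_EFinP; exact: measurable_indic.
  - by rewrite lee_fin mulr_ge0// exprn_ge0.
  rewrite integral_indic// setIT.
  apply: (@le_trans _ _ ((K * q ^+ j)%:E * ((2 * (r * b ^+ j)) ^+ n.+1)%:E)%E).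
    by rewrite lee_wpmul2l ?lee_fin ?mulr_ge0 ?exprn_ge0// cube_measure// mulr_ge0// exprn_ge0.
  rewrite -EFinM lee_fin le_eqVlt; apply/orP; left; apply/eqP.
  by rewrite !exprMn -!exprM [(j * _)%N]mulnC; ring.
set L := K * _; set w := q * _.
have w0 : 0 <= w by rewrite mulr_ge0// exprn_ge0.
have w1 : `|w| < 1 by rewrite ger0_norm.
have := @cvg_geometric_series R L w w1.
have hE : (fun k => \sum_(0 <= j < k) (L * w ^+ j)%:E)%E = EFin \o series (geometric L w).
  by apply/funext => k; rewrite /= -sumEFin.
rewrite hE.
move=> h; rewrite (@cvg_lim _ _ _ _ _ _ ((L / (1 - w))%:E))//.
by apply: cvg_EFin => //; exact: nearW.
Qed.

End kernel.

(** * Moments of the kernel inside and outside a cube *)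

Section kernel_moments.
Context {R : realType} {n : nat}.
Local Notation E := 'rV[R]_n.+1.
Local Notation mu := (@lebesgue_rV R n).
Implicit Types (z : E) (t p x : R).

Lemma dyadic_small t x : 0 < x -> x <= t ->
  exists j : nat, t * 2^-1 ^+ j.+1 < x <= t * 2^-1 ^+ j.
Proof.
move=> x0 xt; have t0 : 0 < t by exact: lt_le_trans xt.
have cv : t * 2^-1 ^+ j @[j --> \oo] --> (0 : R).
  rewrite -(mulr0 t); apply: cvgM; first exact: cvg_cst.
  by apply: cvg_expr; rewrite gtr0_norm ?invr_gt0// invf_lt1// ltr1n.
have ex : exists j, t * 2^-1 ^+ j.+1 < x.
  have /cvgrPdist_lt/(_ x x0)[N _ hN] := cv.
  exists N; have := hN N.+1 (leqnSn N); rewrite sub0r normrN gtr0_norm//.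
  by rewrite mulr_gt0// exprn_gt0// invr_gt0.
case: (ex_minnP ex) => j jx jmin; exists j; rewrite jx /=.
case: j jx jmin => [|j] jx jmin; first by rewrite expr0 mulr1.
by rewrite leNgt; apply/negP => /jmin; rewrite ltnn.
Qed.

Lemma dyadic_large t x : 0 < t -> t < x ->
  exists j : nat, t * 2 ^+ j < x <= t * 2 ^+ j.+1.
Proof.
move=> t0 tx.
have ex : exists j, x <= t * 2 ^+ j.+1.
  exists (Num.truncn (x / t)); rewrite mulrC -ler_pdivrMr//.
  apply: (le_trans (ltW (truncnS_gt _))).
  by rewrite -natrX ler_nat ltnW// ltn_expl.
case: (ex_minnP ex) => j jx jmin; exists j; rewrite jx andbT.
case: j jx jmin => [|j] jx jmin; first by rewrite expr0 mulr1.
by rewrite ltNge; apply/negP => /jmin; rewrite ltnn.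
Qed.

Variable s : R.
Hypothesis s01 : 0 < s < 1.
Local Notation kern := (@kern R n s).
Local Notation N2s := (n.+1%:R + 2 * s : R).

Lemma powR2_lt1 p : p < 0 -> 2 `^ p < 1 :> R.
Proof.
move=> p0; rewrite /powR pnatr_eq0/= -[ltRHS]expR0 ltr_expR nmulr_rlt0//.
by rewrite ln_gt0// ltr1n.
Qed.

Lemma powR2X p (j : nat) : (2 `^ p) ^+ j = 2 `^ (p * j%:R) :> R.
Proof. by rewrite -powR_mulrn ?powR_ge0// -powRrM. Qed.

Lemma powR_scaled t p (j : nat) : 0 < t -> (t * 2 ^+ j) `^ p = t `^ p * (2 `^ p) ^+ j.
Proof.
move=> t0; rewrite powRM ?exprn_ge0 ?(ltW t0)//; congr (_ * _).
by rewrite -[2 ^+ j]powR_mulrn// -powRrM mulrC powR2X.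
Qed.

Lemma powR_scaledV t p (j : nat) : 0 < t -> (t * 2^-1 ^+ j) `^ p = t `^ p * (2 `^ (- p)) ^+ j.
Proof.
move=> t0; rewrite powRM ?exprn_ge0 ?invr_ge0 ?(ltW t0)//; congr (_ * _).
rewrite -[2^-1 ^+ j]powR_mulrn ?invr_ge0// -[2^-1]powR_inv1// -!powRrM powR2X.
by congr (_ `^ _); ring.
Qed.

Lemma measurable_kern_moment (D : set E) p : measurable D ->
  measurable_fun setT (fun z => \1_D z * (`|z| `^ p * kern z)).
Proof.
move=> mD; apply: measurable_funM; first exact: measurable_indic.
apply: measurable_funM; last first.
  by apply: (@measurable_kern _ _ s _ _ id) => i; exact: measurable_coord.
apply: (measurableT_comp (@measurable_powR R p)).
exact/continuous_rV_measurable/norm_continuous.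
Qed.

Lemma kern_moment_ge0 (D : set E) p z : 0 <= \1_D z * (`|z| `^ p * kern z).
Proof. by rewrite !mulr_ge0 ?powR_ge0 ?kern_ge0. Qed.

Lemma measurable_ncube t : measurable (~` cube (0 : E) t).
Proof. by apply: measurableC; exact: measurable_cube. Qed.

(** On the shell $|z|\approx t2^{-j}$ the kernel has mass of order $(t2^{-j})^{-2s}$, so successive
    shells contribute with ratio $2^{2s-p}<1$. *)
Lemma kern_moment_small p : 2 * s < p -> exists2 C : R, 0 < C & forall t, 0 < t ->
  (\int[mu]_z (\1_(cube (0 : E) t) z * (`|z| `^ p * kern z))%:E <= (C * t `^ (p - 2 * s))%:E)%E.
Proof.
move=> sp; have s0 : 0 < s by case/andP: s01.
have p0 : 0 <= p by rewrite ltW// (lt_trans _ sp)// mulr_gt0.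
have q1 : 2 `^ (2 * s - p) < 1 :> R.
  by rewrite powR2_lt1// subr_lt0.
pose C : R := 2 `^ N2s * 2 ^+ n.+1 / (1 - 2 `^ (2 * s - p)).
exists C; first by rewrite divr_gt0 ?subr_gt0// mulr_gt0 ?powR_gt0// exprn_gt0.
move=> t t0; have qE : 2 `^ (N2s - p) * 2^-1 ^+ n.+1 = 2 `^ (2 * s - p) :> R.
  rewrite -[2^-1 ^+ _]powR_mulrn ?invr_ge0// -[2^-1]powR_inv1// -powRrM -powRD//.
    by congr (_ `^ _); ring.
  by rewrite pnatr_eq0 implybT.
have := @shells_integral R n (fun z => \1_(cube (0 : E) t) z * (`|z| `^ p * kern z))
  (t `^ (p - N2s) * 2 `^ N2s) t (2 `^ (N2s - p)) (2^-1).
rewrite qE => H; apply: (le_trans (H _ _ _ _ _ _ _ _)).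
- exact/measurable_kern_moment/measurable_cube.
- exact: kern_moment_ge0.
- by rewrite mulr_ge0 ?powR_ge0.
- exact: ltW.
- exact: powR_ge0.
- by rewrite invr_ge0.
- exact: q1.
- move=> z; rewrite indicE; have [/set_mem zt|_] := boolP (z \in _); last by rewrite mul0r eqxx.
  rewrite mul1r; have [->|z0] := eqVneq z 0; first by rewrite kern0// mulr0 eqxx.
  have zp : 0 < `|z| by rewrite normr_gt0.
  have zt' : `|z| <= t by move: zt; rewrite /cube/= subr0.
  move=> _; have [j /andP[jz zj]] := dyadic_small zp zt'.
  exists j => //; have tj : 0 < t * 2^-1 ^+ j.+1 by rewrite mulr_gt0// exprn_gt0// invr_gt0.
  apply: (@le_trans _ _ ((t * 2^-1 ^+ j) `^ p * (t * 2^-1 ^+ j.+1) `^ (- N2s))).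
    apply: ler_pM; rewrite ?powR_ge0 ?kern_ge0//.
      by apply: ge0_ler_powR; rewrite ?nnegrE// (le_trans _ zj).
    by apply: kern_le => //; exact: ltW.
  rewrite !powR_scaledV// opprK exprS !powR2X (powRD (x := t)); last by rewrite (gt_eqF t0) implybT.
  rewrite le_eqVlt; apply/orP; left; apply/eqP.
  rewrite mulrACA -!mulrA; congr (_ * (_ * _)).
  rewrite mulrCA -[in RHS]powR2X; congr (_ * _).
  rewrite powR2X -powRD; last by rewrite pnatr_eq0 implybT.
  by congr (_ `^ _); ring.
- rewrite lee_fin le_eqVlt; apply/orP; left; apply/eqP.
  rewrite exprMn -[t ^+ _]powR_mulrn ?(ltW t0)// /C.
  have -> : p - 2 * s = (p - N2s) + n.+1%:R by ring.
  rewrite [in RHS]powRD; last by rewrite (gt_eqF t0) implybT.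
  by ring.
Qed.

(** The same shells run outwards, with ratio $2^{p-2s}<1$. *)
Lemma kern_moment_large p : 0 <= p < 2 * s -> exists2 C : R, 0 < C & forall t, 0 < t ->
  (\int[mu]_z (\1_(~` cube (0 : E) t) z * (`|z| `^ p * kern z))%:E <= (C * t `^ (p - 2 * s))%:E)%E.
Proof.
move=> /andP[p0 sp].
have q1 : 2 `^ (p - 2 * s) < 1 :> R.
  by rewrite powR2_lt1// subr_lt0.
pose C : R := 2 `^ p * 4 ^+ n.+1 / (1 - 2 `^ (p - 2 * s)).
exists C; first by rewrite divr_gt0 ?subr_gt0// mulr_gt0 ?powR_gt0// exprn_gt0.
move=> t t0; have qE : 2 `^ (p - N2s) * 2 ^+ n.+1 = 2 `^ (p - 2 * s) :> R.
  rewrite -[2 ^+ _]powR_mulrn// -powRD//.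
    by congr (_ `^ _); ring.
  by rewrite pnatr_eq0 implybT.
have := @shells_integral R n (fun z => \1_(~` cube (0 : E) t) z * (`|z| `^ p * kern z))
  (t `^ (p - N2s) * 2 `^ p) (2 * t) (2 `^ (p - N2s)) 2.
rewrite qE => H; apply: (le_trans (H _ _ _ _ _ _ _ _)).
- exact/measurable_kern_moment/measurable_ncube.
- exact: kern_moment_ge0.
- by rewrite mulr_ge0 ?powR_ge0.
- by rewrite mulr_ge0// ltW.
- exact: powR_ge0.
- by [].
- exact: q1.
- move=> z; rewrite indicE; have [/set_mem zt|_] := boolP (z \in _); last by rewrite mul0r eqxx.
  rewrite mul1r.
  have zt' : t < `|z| by move: zt; rewrite /cube/= subr0 => /negP; rewrite -ltNge.
  move=> _; have [j /andP[jz zj]] := dyadic_large t0 zt'.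
  exists j; first by rewrite -mulrA mulrCA -exprS.
  have tj : 0 < t * 2 ^+ j by rewrite mulr_gt0// exprn_gt0.
  apply: (@le_trans _ _ ((t * 2 ^+ j.+1) `^ p * (t * 2 ^+ j) `^ (- N2s))).
    apply: ler_pM; rewrite ?powR_ge0 ?kern_ge0//.
      by apply: ge0_ler_powR; rewrite ?nnegrE// (le_trans _ zj).
    by apply: kern_le => //; exact: ltW.
  rewrite !powR_scaled// exprS !powR2X (powRD (x := t)); last by rewrite (gt_eqF t0) implybT.
  rewrite le_eqVlt; apply/orP; left; apply/eqP.
  rewrite mulrACA -!mulrA; congr (_ * (_ * (_ * _))).
  rewrite -powRD; last by rewrite pnatr_eq0 implybT.
  by congr (_ `^ _); ring.
- rewrite lee_fin le_eqVlt; apply/orP; left; apply/eqP.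
  have -> : 2 * (2 * t) = 4 * t by ring.
  rewrite exprMn -[t ^+ _]powR_mulrn ?(ltW t0)// /C.
  have -> : p - 2 * s = (p - N2s) + n.+1%:R by ring.
  rewrite [in RHS](powRD (x := t)); last by rewrite (gt_eqF t0) implybT.
  by ring.
Qed.

End kernel_moments.

(** * Averages at a given frequency *)

Section averages.
Context {R : realType} {n : nat}.
Local Notation E := 'rV[R]_n.+1.
Local Notation mu := (@lebesgue_rV R n).
Local Notation J f := (\int[mu]_x f x).
Implicit Types (x z : E) (r a B : R) (u : E -> R) (e : expr R n).

Definition supported r e := forall x, r < `|x| -> eval e x = 0.

Lemma supported_dexpr r e i : supported r e -> supported r (dexpr i e).
Proof. by move=> re x rx; exact: (eval_dexpr_far re). Qed.

(* By translation invariance, the integral of e(. + h e_i) does not depend on h. *)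
Lemma Rintegral_dexpr0 e i r : supported r e -> J (eval (dexpr i e)) = 0.
Proof.
move=> re; have rde := supported_dexpr i re.
have [B B0 hB] := eval_bounded rde.
have [B' _ hB'] := eval_bounded re.
have me e' : measurable_fun setT (eval e' : E -> R) by exact/continuous_rV_measurable/continuous_eval.
pose d : E := delta_mx 0 i.
have nd : `|d| <= 1.
  apply: norm_le_coord => j; rewrite mxE eqxx /=.
  by case: (_ == _); rewrite ?normr1 ?normr0.
have mshift e' (h : R) : measurable_fun setT (fun x : E => eval e' (x + h *: d)).
  exact: (measurable_shift _ (me e')).
have far (h : R) x : `|h - 0| < 1 -> r + 1 < `|x - 0| -> r < `|x + h *: d|.
  rewrite !subr0 => h1 rx; rewrite -ltrBrDr in rx; apply: lt_le_trans rx _.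
  have : `|h *: d| <= 1 by rewrite normrZ mulr_ile1// ltW.
  by have := ler_normB (x + h *: d) (h *: d); rewrite addrK; lra.
have [r0|r0] := leP 0 (r + 1); last first.
  by rewrite /Rintegral (eq_integral (fun=> 0%E)) ?integral0// => x _;
    rewrite rde//; apply: lt_le_trans (normr_ge0 x); lra.
have := @is_derive_Rintegral R n (fun h x => eval e (x + h *: d))
  (fun h x => eval (dexpr i e) (x + h *: d)) 0 1 B (r + 1) 0 ltr01.
have -> : (fun h : R => J (fun x => eval e (x + h *: d))) = cst (J (eval e)).
  by apply/funext => h; apply: Rintegral_shift.
move=> H; have [||||_] := H.
- move=> h h1; apply: (@integrable_bcs _ _ _ B' 0 (r + 1)) => //.
  by move=> y ry; apply: re; exact: far.
- move=> h y _; apply: (is_derive_eq (is_derive_eval_line e y d h)).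
  rewrite (bigD1 i)//= mxE !eqxx mul1r big1 ?addr0// => j ji.
  by rewrite mxE eqxx (negbTE ji) mul0r.
- by [].
- by move=> h y h1 ry; apply: rde; exact: far.
rewrite derive_cst => /esym; under eq_Rintegral do rewrite scale0r addr0.
by [].
Qed.

Variables (u : E -> R) (A : R).
Hypotheses (mu_ : measurable_fun setT u) (uA : forall x, `|u x| <= A).

Let A0 : 0 <= A. Proof. by apply: le_trans (uA 0). Qed.

(** Not normalized: the power of the frequency depends on the order of the derivative and is added
    in [scaled_average]. *)
Definition average e a x := J (fun y => u y * eval e (a *: (y - x))).

Lemma measurable_eval_scaled e a x : measurable_fun setT (fun y : E => eval e (a *: (y - x))).
Proof.
apply: (@measurable_eval _ _ _ _ e (fun y : E => a *: (y - x))) => i.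
have -> : (fun y : E => (a *: (y - x)) 0 i) = (fun y : E => a * (y 0 i - x 0 i)).
  by apply/funext => y; rewrite !mxE.
apply: measurable_funM; first exact: measurable_cst.
by apply: measurable_funB; [exact: measurable_coord|exact: measurable_cst].
Qed.

Lemma scaled_far e r a x y : 0 < a -> supported r e -> r / a < `|y - x| ->
  eval e (a *: (y - x)) = 0.
Proof.
by move=> a0 re h; apply: re; rewrite normrZ gtr0_norm// mulrC -ltr_pdivrMr.
Qed.

(** The operator $y\cdot\nabla$: the derivative of $e(ay)$ in $a$ is $a^{-1}(y\cdot\nabla
    e)(ay)$. *)
Definition euler e : expr R n := \big[@Add R n/Const 0%R]_i Mul (Coord i) (dexpr i e).

Lemma eval_bigAdd (I : Type) (q : seq I) (F : I -> expr R n) x :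
  eval (\big[@Add R n/Const 0%R]_(i <- q) F i) x = \sum_(i <- q) eval (F i) x.
Proof. by rewrite (big_morph (fun e => eval e x) (id1 := 0) (op1 := +%R)). Qed.

Lemma eval_euler e x : eval (euler e) x = \sum_i x 0 i * eval (dexpr i e) x.
Proof. by rewrite /euler eval_bigAdd. Qed.

Lemma supported_euler r e : supported r e -> supported r (euler e).
Proof.
move=> re x rx; rewrite eval_euler big1// => i _.
by rewrite (supported_dexpr i re)// mulr0.
Qed.

Lemma integrable_average e r a x : supported r e -> 0 < a ->
  mu.-integrable setT (EFin \o (fun y => u y * eval e (a *: (y - x)))).
Proof.
move=> re a0; have [B B0 hB] := eval_bounded re.
apply: (@integrable_bcs _ _ _ (A * B) x (r / a)).
- exact: (measurable_funM mu_ (measurable_eval_scaled e a x)).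
- by move=> y; rewrite normrM ler_pM.
- by move=> y h; rewrite (scaled_far a0 re h) mulr0.
Qed.

Section one_kernel.
Variables (e : expr R n) (r : R).
Hypotheses (r0 : 0 <= r) (re : supported r e).

Lemma average_le B a x : 0 < a -> (forall y, `|eval e y| <= B) ->
  `|average e a x| <= A * B * (2 * (r / a)) ^+ n.+1.
Proof.
move=> a0 hB; have B0 : 0 <= B by apply: le_trans (hB 0).
apply: (@Rintegral_bcs_le _ _ _ _ x).
- by rewrite divr_ge0// ltW.
- exact: (measurable_funM mu_ (measurable_eval_scaled e a x)).
- by move=> y; rewrite normrM ler_pM.
- by move=> y h; rewrite (scaled_far a0 re h) mulr0.
Qed.

(** Frequency and center move together, so that the derivative along a line of centers and the
    derivative in the frequency are both special cases. *)
Lemma is_derive_average (a da : R -> R) (x dx : R -> E) (t d a0 a1 M : R) : 0 < d -> 0 < a0 ->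
  (forall h, `|h - t| < d -> a0 <= a h <= a1) ->
  (forall h, `|h - t| < d -> `|x h - x t| <= M /\ `|dx h| <= M /\ `|da h| <= M) ->
  (forall h, `|h - t| < d -> is_derive h 1 a (da h)) ->
  (forall h i, `|h - t| < d -> is_derive h 1 (fun h => x h 0 i) (dx h 0 i)) ->
  is_derive t 1 (fun h => average e (a h) (x h))
   (J (fun y => u y * \sum_i (da t * (y - x t) 0 i - a t * dx t 0 i) * eval (dexpr i e) (a t *: (y - x t)))).
Proof.
move=> d0 a00 aa xx dera derx.
have tt : `|t - t| < d by rewrite subrr normr0.
have M0 : 0 <= M by have [h _] := xx t tt; apply: le_trans h.
have [Bs hBs] : exists Bs : 'I_n.+1 -> R, forall i, 0 < Bs i /\ forall x, `|eval (dexpr i e) x| <= Bs i.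
  have /choice[Bs hBs] : forall i, exists b : R, 0 < b /\ forall x, `|eval (dexpr i e) x| <= b.
    by move=> i; have [b b0 hb] := eval_bounded (supported_dexpr i re); exists b.
  by exists Bs.
have dfar h y i : `|h - t| < d -> r / a0 + M < `|y - x t| -> eval (dexpr i e) (a h *: (y - x h)) = 0.
  move=> ht far; have /andP[ah _] := aa h ht.
  apply: (@scaled_far _ r); [exact: lt_le_trans ah|exact: supported_dexpr|].
  apply: (@le_lt_trans _ _ (r / a0)).
    by rewrite ler_wpM2l// lef_pV2 ?posrE//; exact: lt_le_trans ah.
  have [xM _] := xx h ht.
  have := ler_normD (y - x h) (x h - x t); rewrite addrA subrK; lra.
(* Where some derivative of the kernel does not vanish, $|y-x_h|\le r/a_0+2M$; this is the origin of
   the majorant. *)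
apply: (is_derive_eq (@is_derive_Rintegral R n (fun h y => u y * eval e (a h *: (y - x h)))
  (fun h y => u y * \sum_i (da h * (y - x h) 0 i - a h * dx h 0 i) * eval (dexpr i e) (a h *: (y - x h)))
  t d (A * \sum_i (M * (r / a0 + M + M) + a1 * M) * Bs i) (r / a0 + M) (x t) d0 _ _ _ _)) => //.
- move=> h ht; apply: (integrable_average _ re); have /andP[ah _] := aa h ht.
  exact: lt_le_trans ah.
- move=> h y ht.
  have dc i : is_derive h 1 (fun h => (a h *: (y - x h)) 0 i) ((\row_i (da h * (y - x h) 0 i - a h * dx h 0 i)) 0 i).
    have -> : (fun h => (a h *: (y - x h)) 0 i) = (fun h => a h * (y 0 i - x h 0 i)).
      by apply/funext => k; rewrite !mxE.
    have d2 : is_derive h 1 (fun h => y 0 i - x h 0 i) (- dx h 0 i).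
      by apply: (is_derive_eq (is_deriveB (is_derive_cst (y 0 i) h 1) (derx h i ht))); rewrite sub0r.
    apply: (is_derive_eq (is_deriveM (dera h ht) d2)).
    by rewrite /GRing.scale/= !mxE; ring.
  have := is_derive_eval_curve e (c := fun h => a h *: (y - x h)) (dc := fun h => \row_i (da h * (y - x h) 0 i - a h * dx h 0 i)) dc.
  move=> dE; apply: (is_derive_eq (@is_deriveZ _ _ _ _ (u y) h 1 _ dE)).
  by rewrite /GRing.scale/=; congr (_ * _); apply: eq_bigr => i _; rewrite mxE.
- move=> h y ht; rewrite normrM ler_pM//.
  apply: (le_trans (ler_norm_sum _ _ _)); apply: ler_sum => i _.
  have [b0 hb] := hBs i.
  have [far|far] := ltP (r / a0 + M) `|y - x t|.
    rewrite dfar// mulr0 normr0 mulr_ge0 ?(ltW b0)// addr_ge0//.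
      by rewrite mulr_ge0// !addr_ge0// divr_ge0// ltW.
    by rewrite mulr_ge0//; have /andP[ah1 ah2] := aa h ht; lra.
  have [xM [dxM daM]] := xx h ht; have /andP[ah1 ah2] := aa h ht.
  rewrite normrM ler_pM//; apply: (le_trans (ler_normB _ _)).
  rewrite !normrM; apply: lerD; apply: ler_pM => //.
  + apply: (le_trans (coord_le_norm _ i)).
    have := ler_normB (y - x t) (x h - x t).
    by rewrite opprB addrA subrK; lra.
  + by rewrite ger0_norm//; lra.
  + exact: le_trans (coord_le_norm _ i) dxM.
- move=> h y ht far; rewrite big1 ?mulr0// => i _.
  by rewrite dfar// mulr0.
Qed.

Lemma is_derive_average_line a x z (t : R) : 0 < a ->
  is_derive t 1 (fun h => average e a (x + h *: z))
    (- a * \sum_i z 0 i * average (dexpr i e) a (x + t *: z)).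
Proof.
move=> a0.
have dx (h : R) i : is_derive h 1 (fun h => (x + h *: z) 0 i) (z 0 i).
  have -> : (fun h : R => (x + h *: z) 0 i) = (fun h : R => x 0 i + h * z 0 i).
    by apply/funext => k; rewrite !mxE.
  have d1 : is_derive h 1 (fun h : R => h * z 0 i) (z 0 i).
    have := @is_deriveM _ _ id (cst (z 0 i)) h 1 1 0 (is_derive_id _ _) (is_derive_cst _ _ _).
    by move=> H; apply: (is_derive_eq H); rewrite /GRing.scale/= mulr0 mulr1 add0r.
  by apply: (is_derive_eq (is_deriveD (is_derive_cst (x 0 i) h 1) d1)); rewrite add0r.
have := @is_derive_average (fun=> a) (fun=> 0) (fun h => x + h *: z) (fun=> z) t 1 a a (`|z|) ltr01 a0.
move=> H.
have h1 (h : R) : `|h - t| < 1 -> a <= a <= a by rewrite lexx.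
have h2 (h : R) : `|h - t| < 1 ->
    `|x + h *: z - (x + t *: z)| <= `|z| /\ `|z| <= `|z| /\ `|0 : R| <= `|z|.
  move=> ht; rewrite normr0; split; last by split.
  by rewrite opprD addrACA subrr add0r -scalerBl normrZ ler_piMl//; exact: ltW.
have h3 (h : R) : `|h - t| < 1 -> is_derive h 1 (fun=> a) (0 : R).
  by move=> _; exact: is_derive_cst.
apply: (is_derive_eq (H h1 h2 h3 (fun h i _ => dx h i))).
rewrite mulr_sumr /average.
have [_ Js] := @Rintegral_sum R _ _ mu setT _ (index_enum 'I_n.+1)
  (fun i y => (- a * z 0 i) * (u y * eval (dexpr i e) (a *: (y - (x + t *: z)))))
  measurableT (fun i => integrableZl measurableT (- a * z 0 i) (integrable_average _ (supported_dexpr i re) a0)).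
transitivity (J (fun y => \sum_i (- a * z 0 i) * (u y * eval (dexpr i e) (a *: (y - (x + t *: z)))))).
  by apply: eq_Rintegral => y _; rewrite mulr_sumr; apply: eq_bigr => i _; ring.
rewrite Js; apply: eq_bigr => i _.
by rewrite RintegralZl ?mulrA//; exact: (integrable_average _ (supported_dexpr i re)).
Qed.

Lemma is_derive_average_freq a x : 0 < a ->
  is_derive a 1 (fun h => average e h x) (a^-1 * average (euler e) a x).
Proof.
move=> a0; have d0 : 0 < a / 2 by rewrite divr_gt0.
have := @is_derive_average id (fun=> 1) (fun=> x) (fun=> 0) a (a / 2) (a / 2) (2 * a) 1 d0 d0.
move=> H.
have h1 (h : R) : `|h - a| < a / 2 -> a / 2 <= h <= 2 * a by rewrite ltr_norml; lra.
have h2 (h : R) : `|h - a| < a / 2 -> `|x - x| <= 1 /\ `|0 : E| <= 1 /\ `|1 : R| <= 1.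
  by rewrite subrr !normr0 normr1.
have h3 (h : R) : `|h - a| < a / 2 -> is_derive h 1 id (1 : R).
  by move=> _; exact: is_derive_id.
have h4 (h : R) i : `|h - a| < a / 2 -> is_derive h 1 (fun=> x 0 i) ((0 : E) 0 i).
  by move=> _; rewrite mxE; exact: is_derive_cst.
apply: (is_derive_eq (H h1 h2 h3 h4)).
rewrite /average -RintegralZl//; last exact: (integrable_average _ (supported_euler re)).
apply: eq_Rintegral => y _; rewrite eval_euler mulrCA; congr (_ * _).
rewrite mulr_sumr; apply: eq_bigr => i _.
have -> : (a *: (y - x)) 0 i = a * (y - x) 0 i by rewrite mxE.
have -> : (0 : E) 0 i = 0 by rewrite mxE.
by rewrite mul1r mulr0 subr0 mulrA mulKf// gt_eqF.
Qed.

End one_kernel.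
End averages.

(** * Radial bumps and the pairing of the frequency derivative with a Laplacian *)

Section mollifier.
Context {R : realType} {n : nat}.
Local Notation E := 'rV[R]_n.+1.
Implicit Types (x : E) (e f : expr R n) (m : R).

Definition lap e : expr R n := \big[@Add R n/Const 0%R]_i dexpr i (dexpr i e).

Lemma eval_lap e x : eval (lap e) x = \sum_i eval (dexpr i (dexpr i e)) x.
Proof. by rewrite /lap eval_bigAdd. Qed.

Lemma eval_dexpr_ext i e f : eval e = eval f -> eval (dexpr i e) = eval (dexpr i f).
Proof. by rewrite -!partial_eval => ->. Qed.

Lemma eval_dexpr_bigAdd (I : Type) (q : seq I) (F : I -> expr R n) i x :
  eval (dexpr i (\big[@Add R n/Const 0%R]_(j <- q) F j)) x = \sum_(j <- q) eval (dexpr i (F j)) x.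
Proof.
by rewrite (big_morph (fun e => eval (dexpr i e) x) (id1 := 0) (op1 := +%R)).
Qed.

Lemma supported_lap r e : supported r e -> supported r (lap e).
Proof.
move=> re x rx; rewrite eval_lap big1// => i _.
exact: (supported_dexpr i (supported_dexpr i re)).
Qed.

Lemma eval_dexpr_euler i e x :
  eval (dexpr i (euler e)) x = eval (dexpr i e) x + eval (euler (dexpr i e)) x.
Proof.
rewrite /euler eval_dexpr_bigAdd eval_euler /= big_split/=; congr (_ + _).
  by rewrite (bigD1 i)//= eqxx mul1r big1 ?addr0// => j ji; rewrite eq_sym (negbTE ji) mul0r.
by apply: eq_bigr => j _; rewrite eval_dexprC.
Qed.

Lemma eval_dexpr_lap i e x : eval (dexpr i (lap e)) x = eval (lap (dexpr i e)) x.
Proof.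
rewrite /lap eval_dexpr_bigAdd eval_lap; apply: eq_bigr => j _.
rewrite eval_dexprC; congr (_ _); apply: eval_dexpr_ext.
by apply/funext => y; rewrite eval_dexprC.
Qed.

(* [paired m e f] expresses that the derivative of [a^m e(a y)] with respect
   to the frequency [a] is minus the Laplacian of [a^(m-3) f(a y)]. *)
Definition paired m e f := forall x, m * eval e x + eval (euler e) x = - eval (lap f) x.

(** Differentiate the identity: $\partial_i$ commutes with the Laplacian, while
    $\partial_i(y\cdot\nabla e)=\partial_i e+y\cdot\nabla\partial_i e$ raises $m$ by one. *)
Lemma paired_dexpr m e f i : paired m e f -> paired (m + 1) (dexpr i e) (dexpr i f).
Proof.
move=> ef x.
have : eval (Add (Mul (Const m) e) (euler e)) = eval (Mul (Const (-1)) (lap f)).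
  by apply/funext => y /=; rewrite mulN1r ef.
move=> /(eval_dexpr_ext i)/(congr1 (fun g => g x)) /=.
by rewrite eval_dexpr_euler eval_dexpr_lap; lra.
Qed.

(* grad theta (y) = - y mollifier (y), hence the pairing below. *)
Definition radial : expr R n :=
  Add (Const n.+2%:R) (Mul (Const (-1)) (\big[@Add R n/Const 0%R]_i Mul (Coord i) (Coord i))).

Definition theta : expr R n := Bump 0 radial.
Definition mollifier : expr R n := Mul (Const 2) (Bump 1 radial).

Lemma eval_radial x : eval radial x = n.+2%:R - \sum_i x 0 i ^+ 2.
Proof.
by rewrite /= eval_bigAdd mulN1r; congr (_ - _); apply: eq_bigr => i _; rewrite /= expr2.
Qed.

Lemma eval_dexpr_radial i x : eval (dexpr i radial) x = - 2 * x 0 i.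
Proof.
rewrite /= eval_dexpr_bigAdd /= (bigD1 i)//= eqxx big1; last first.
  by move=> j ji; rewrite eq_sym (negbTE ji) mul0r mulr0 addr0.
by rewrite (_ : true%:R = 1 :> R)//; ring.
Qed.

Lemma eval_ddexpr_radial i x : eval (dexpr i (dexpr i radial)) x = - 2.
Proof.
rewrite -partial_eval.
have -> : eval (dexpr i radial) = eval (Mul (Const (- 2)) (Coord i)).
  by apply/funext => y; rewrite eval_dexpr_radial.
by rewrite partial_eval /= eqxx (_ : true%:R = 1 :> R)//; ring.
Qed.

(** With $N$ the dimension, $N\psi+y\cdot\nabla\psi=\mathrm{div}(y\psi)=-\Delta\theta$. *)
Lemma paired_mollifier : paired n.+1%:R mollifier theta.
Proof.
move=> x; rewrite eval_euler eval_lap /mollifier /theta.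
have -> : eval (Mul (Const 2) (Bump 1 radial)) x = 2 * dbump 1 (eval radial x) by [].
have -> : \sum_i x 0 i * eval (dexpr i (Mul (Const 2) (Bump 1 radial))) x =
    - 4 * (\sum_i x 0 i ^+ 2) * dbump 2 (eval radial x).
  rewrite mulrAC mulr_sumr; apply: eq_bigr => i _.
  have -> : eval (dexpr i (Mul (Const 2) (Bump 1 radial))) x =
     2 * (dbump 2 (eval radial x) * eval (dexpr i radial) x) by rewrite /=; ring.
  by rewrite eval_dexpr_radial; ring.
have -> : \sum_i eval (dexpr i (dexpr i (Bump 0 radial))) x =
   \sum_i (4 * dbump 2 (eval radial x) * x 0 i ^+ 2 - 2 * dbump 1 (eval radial x)).
  apply: eq_bigr => i _.
  have -> : eval (dexpr i (dexpr i (Bump 0 radial))) x =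
     dbump 2 (eval radial x) * eval (dexpr i radial) x * eval (dexpr i radial) x +
     dbump 1 (eval radial x) * eval (dexpr i (dexpr i radial)) x by [].
  by rewrite eval_dexpr_radial eval_ddexpr_radial; ring.
set H1 := dbump 1 _; set H2 := dbump 2 _.
rewrite big_split/= -mulr_sumr sumr_const card_ord -mulr_natl.
by ring.
Qed.

Lemma radial_le0 x : n.+2%:R < `|x| -> eval radial x <= 0.
Proof.
move=> nx; rewrite eval_radial subr_le0; apply: (@le_trans _ _ (`|x| ^+ 2)).
  have : (1 : R) <= n.+2%:R by rewrite ler1n.
  by rewrite expr2; nra.
have : exists i, `|x| <= `|x 0 i|.
  apply: contrapT => /forallNP h; have : `|x| < `|x|; last by rewrite ltxx.
  have x0 : 0 < `|x| by apply: lt_trans nx; rewrite ltr0n.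
  by apply: norm_lt_coord => // i; rewrite ltNge; apply/negP; exact: h.
move=> [i xi]; rewrite (bigD1 i)//=; apply: (@le_trans _ _ (x 0 i ^+ 2)).
  by rewrite -[x 0 i ^+ 2]real_normK ?num_real// lerXn2r ?nnegrE.
by rewrite lerDl; apply: sumr_ge0 => j _; exact: sqr_ge0.
Qed.

Lemma supported_theta : supported n.+2%:R theta.
Proof. by move=> x /radial_le0; exact: bump_le0. Qed.

Lemma supported_mollifier : supported n.+2%:R mollifier.
Proof. by move=> x /radial_le0 h /=; rewrite bump_le0 ?mulr0. Qed.

Lemma mollifier_ge0 x : 0 <= eval mollifier x.
Proof. by rewrite mulr_ge0// bump1_ge0. Qed.

Definition even_expr e := forall x, eval e (- x) = eval e x.
Definition odd_expr e := forall x, eval e (- x) = - eval e x.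

Lemma eval_radialN x : eval radial (- x) = eval radial x.
Proof. by rewrite !eval_radial; congr (_ - _); apply: eq_bigr => i _; rewrite mxE sqrrN. Qed.

Lemma even_theta : even_expr theta.
Proof. by move=> x; rewrite /theta /eval -/(eval radial x) -/(eval radial (- x)) eval_radialN. Qed.

Lemma even_mollifier : even_expr mollifier.
Proof. by move=> x; rewrite /mollifier /eval -/(eval radial x) -/(eval radial (- x)) eval_radialN. Qed.

Lemma odd_dexpr i e : even_expr e -> odd_expr (dexpr i e).
Proof.
move=> ev x.
have /(eval_dexpr_ext i)/(congr1 (fun g => g x)) : eval (subst_affine (-1) 0 e) = eval e.
  by apply/funext => y; rewrite eval_subst_affine addr0 scaleN1r ev.
by rewrite eval_dexpr_subst_affine addr0 scaleN1r mulN1r => <-; rewrite opprK.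
Qed.

Lemma even_dexpr i e : odd_expr e -> even_expr (dexpr i e).
Proof.
move=> od x.
have /(eval_dexpr_ext i)/(congr1 (fun g => g x)) :
    eval (subst_affine (-1) 0 e) = eval (Mul (Const (-1)) e).
  by apply/funext => y; rewrite eval_subst_affine addr0 scaleN1r od /= mulN1r.
rewrite eval_dexpr_subst_affine addr0 scaleN1r mulN1r /=; lra.
Qed.

End mollifier.

Lemma eps_delta_continuous {R : realType} {n : nat} (f : 'rV[R]_n.+1 -> R) x :
  (forall e, 0 < e -> exists2 d, 0 < d & forall y, `|y - x| < d -> `|f y - f x| <= e) ->
  {for x, continuous f}.
Proof.
move=> h.
suff : forall e : R, 0 < e -> \forall y \near nbhs x, `|f x - f y| <= e.
  by move/(@cvgrPdist_le R R _ (nbhs x) (@nbhs_filter _ x) f (f x)).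
move=> e /h[d d0 hd]; apply/nbhs_ballP; exists d => // y.
by rewrite -ball_normE/= distrC [X in X <= e]distrC; exact: hd.
Qed.

(** * Dependence of averages on the center and on the frequency *)

Section average_estimates.
Context {R : realType} {n : nat}.
Local Notation E := 'rV[R]_n.+1.
Local Notation mu := (@lebesgue_rV R n).
Local Notation J f := (\int[mu]_x f x).
Implicit Types (x z : E) (e f : expr R n).

Variables (u : E -> R) (A : R).
Hypotheses (mu_ : measurable_fun setT u) (uA : forall x, `|u x| <= A).
Local Notation avg := (average u).

Section lipschitz.
Variables (e : expr R n) (r a L : R).
Hypotheses (r0 : 0 <= r) (re : supported r e) (a0 : 0 < a).

Lemma average_increment_le x z :
  (forall i t, 0 <= t <= 1 -> `|avg (dexpr i e) a (x + t *: z)| <= L) ->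
  `|avg e a (x + z) - avg e a x| <= a * (n.+1%:R * L * `|z|).
Proof.
move=> hL; have := @increment_le_cst R (fun t => avg e a (x + t *: z))
  (fun t => - a * \sum_i z 0 i * avg (dexpr i e) a (x + t *: z)) (a * (n.+1%:R * L * `|z|)) 0 1 ler01.
rewrite scale1r scale0r addr0 subr0 mulr1; apply.
  by move=> t _; exact: (is_derive_average_line mu_ uA r0 re).
move=> t t01; rewrite normrM normrN (gtr0_norm a0) ler_pM2l//.
apply: (le_trans (ler_norm_sum _ _ _)).
apply: (@le_trans _ _ (\sum_(i < n.+1) L * `|z|)).
  by apply: ler_sum => i _; rewrite normrM mulrC ler_pM// ?coord_le_norm// hL.
by rewrite sumr_const card_ord -[X in X <= _]mulr_natl mulrA.
Qed.

Lemma average_second_difference_le x z :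
  (forall i j t, -1 <= t <= 1 -> `|avg (dexpr i (dexpr j e)) a (x + t *: z)| <= L) ->
  `|2 * avg e a x - avg e a (x + z) - avg e a (x - z)| <=
    2 * (a ^+ 2 * (n.+1%:R ^+ 2 * L * `|z| ^+ 2)).
Proof.
move=> hL.
pose f t := avg e a (x + t *: z).
pose df t := - a * \sum_i z 0 i * avg (dexpr i e) a (x + t *: z).
pose ddf t := - a * \sum_i z 0 i * (- a * \sum_j z 0 j * avg (dexpr j (dexpr i e)) a (x + t *: z)).
have := @second_difference_le R f df ddf (a ^+ 2 * (n.+1%:R ^+ 2 * L * `|z| ^+ 2)).
have -> : 2 * f 0 - f 1 - f (-1) = 2 * avg e a x - avg e a (x + z) - avg e a (x - z).
  by rewrite /f scale0r addr0 scale1r scaleN1r.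
apply => t t1; first exact: (is_derive_average_line mu_ uA r0 re).
- have h i : is_derive t 1 (fun h => z 0 i * avg (dexpr i e) a (x + h *: z))
     (z 0 i * (- a * \sum_j z 0 j * avg (dexpr j (dexpr i e)) a (x + t *: z))).
    exact: (@is_deriveZ _ _ _ _ (z 0 i) t 1 _ (is_derive_average_line mu_ uA r0 (supported_dexpr i re) x z t a0)).
  have hs := is_derive_sum h.
  have -> : df = (- a) *: (\sum_(i < n.+1) fun h => z 0 i * avg (dexpr i e) a (x + h *: z)).
    by apply/funext => k; rewrite /df fctE/= fct_sumE.
  exact: is_deriveZ.
- rewrite /ddf normrM normrN (gtr0_norm a0) expr2 -mulrA ler_pM2l//.
  apply: (le_trans (ler_norm_sum _ _ _)).
  apply: (@le_trans _ _ (\sum_(i < n.+1) a * (n.+1%:R * L * `|z| ^+ 2))).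
    apply: ler_sum => i _; rewrite normrM normrM normrN (gtr0_norm a0).
    apply: (@le_trans _ _ (`|z| * (a * (n.+1%:R * L * `|z|)))); last by rewrite le_eqVlt; apply/orP; left; apply/eqP; ring.
    apply: ler_pM; [by []|by rewrite mulr_ge0// ltW|exact: coord_le_norm|].
    rewrite ler_pM2l//; apply: (le_trans (ler_norm_sum _ _ _)).
    apply: (@le_trans _ _ (\sum_(j < n.+1) L * `|z|)).
      by apply: ler_sum => j _; rewrite normrM mulrC ler_pM// ?coord_le_norm// hL.
    by rewrite sumr_const card_ord -[X in X <= _]mulr_natl mulrA.
  by rewrite sumr_const card_ord -[X in X <= _]mulr_natl le_eqVlt; apply/orP; left; apply/eqP; ring.
Qed.

End lipschitz.

Lemma average_bounded e r a : 0 <= r -> supported r e -> 0 < a ->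
  exists2 C : R, 0 <= C & forall x, `|avg e a x| <= C.
Proof.
move=> r0 re a0; have [B B0 hB] := eval_bounded re.
have A0 : 0 <= A by apply: le_trans (uA 0).
exists (A * B * (2 * (r / a)) ^+ n.+1).
  by rewrite !mulr_ge0 ?(ltW B0)// exprn_ge0// mulr_ge0// divr_ge0// ltW.
by move=> x; exact: (average_le mu_ uA r0 re).
Qed.

Lemma continuous_average e r a : 0 <= r -> supported r e -> 0 < a -> continuous (avg e a).
Proof.
move=> r0 re a0.
have /choice[L hL] : forall i : 'I_n.+1, exists L : R, 0 <= L /\ forall x, `|avg (dexpr i e) a x| <= L.
  by move=> i; have [L L0 hL] := average_bounded r0 (supported_dexpr i re) a0; exists L.
pose L' := \sum_i L i.
have hL' i x : `|avg (dexpr i e) a x| <= L'.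
  apply: (le_trans ((hL i).2 x)); rewrite /L' (bigD1 i)//= lerDl.
  by apply: sumr_ge0 => j _; exact: (hL j).1.
have lip x y : `|avg e a y - avg e a x| <= a * (n.+1%:R * L') * `|y - x|.
  have := @average_increment_le e r a L' r0 re a0 x (y - x) (fun i t _ => hL' i _).
  by rewrite [x + _]addrC subrK !mulrA.
have C0 : 0 <= a * (n.+1%:R * L').
  rewrite mulr_ge0 ?(ltW a0)// mulr_ge0//; apply: sumr_ge0 => i _; exact: (hL i).1.
have C1 : 0 < a * (n.+1%:R * L') + 1 by rewrite ltr_wpDl.
move=> x; apply: eps_delta_continuous => eps eps0.
exists (eps / (a * (n.+1%:R * L') + 1)) => [|y]; first exact: divr_gt0.
rewrite ltr_pdivlMr// => ye; apply: (le_trans (lip x y)); apply: le_trans (ltW ye).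
by rewrite mulrC ler_wpM2l// lerDl.
Qed.

(** For [e] a derivative of order $k$ of the mollifier and $m=N+k$ this is, up to the sign $(-1)^k$
    and the mass of the mollifier, the same derivative of the mollification of [u] at scale
    $1/h$. *)
Definition scaled_average (m : nat) e (h : R) x : R := h ^+ m * avg e h x.

Lemma is_derive_scaled_average m e f (r h : R) x : 0 <= r -> supported r e -> supported r f -> 0 < h ->
  paired m%:R e f -> is_derive h 1 (fun h => scaled_average m e h x)
    (- (h ^+ m * h^-1 * avg (lap f) h x)).
Proof.
move=> r0 re rf h0 ef.
have d1 := is_derive_average_freq mu_ uA r0 re x h0.
have d2 : is_derive h 1 (fun h : R => h ^+ m) (m%:R * h ^+ m.-1).
  have := is_derive_poly ('X^m : {poly R}) h.
  have -> : horner ('X^m : {poly R}) = (fun h : R => h ^+ m) by apply/funext => k; rewrite hornerXn.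
  by rewrite derivXn hornerMn hornerXn -[_ *+ m]mulr_natl.
have := is_deriveM d2 d1 => d; apply: (is_derive_eq d).
have ia e' : supported r e' -> mu.-integrable setT (EFin \o (fun y => u y * eval e' (h *: (y - x)))).
  by move=> re'; exact: (integrable_average mu_ uA x re').
have key : m%:R * avg e h x + avg (euler e) h x = - avg (lap f) h x.
  rewrite /average -[in LHS]RintegralZl//; last exact: ia.
  rewrite -RintegralD//; last 2 first.
  - by have := integrableZl measurableT m%:R (ia _ re); apply: eq_integrable.
  - exact: ia (supported_euler re).
  rewrite -mulN1r -RintegralZl//; last exact: ia (supported_lap rf).
  apply: eq_Rintegral => y _.
  by have := ef (h *: (y - x)); rewrite mulN1r -mulrN => <-; ring.
have hm : m%:R * h ^+ m.-1 = m%:R * h ^+ m * h^-1.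
  case: m {ef d1 d2 d key} => [|m]; first by rewrite !mul0r.
  by rewrite exprS /=; field; rewrite gt_eqF.
rewrite /GRing.scale/= hm.
have -> : avg (lap f) h x = - (m%:R * avg e h x + avg (euler e) h x) by rewrite key opprK.
by ring.
Qed.

End average_estimates.

(** * The nonlocal form *)

Section truncated_form.
Context {R : realType} {n : nat}.
Local Notation E := 'rV[R]_n.+1.
Local Notation mu := (@lebesgue_rV R n).
Local Notation J f := (\int[mu]_x f x).
Implicit Types (x y z : E).

(* The sign makes [D2 f z] a discrete version of - z^T (Hess f) z. *)
Definition D2 (f : E -> R) z x : R := 2 * f x - f (x + z) - f (x - z).

Lemma measurable_coord_fst (i : 'I_n.+1) : measurable_fun setT (fun p : E * E => p.1 0 i).
Proof. exact: (measurableT_comp (measurable_coord i) measurable_fst). Qed.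

Lemma measurable_coord_snd (i : 'I_n.+1) : measurable_fun setT (fun p : E * E => p.2 0 i).
Proof. exact: (measurableT_comp (measurable_coord i) measurable_snd). Qed.

Lemma measurable_coordB (i : 'I_n.+1) : measurable_fun setT (fun p : E * E => (p.1 - p.2) 0 i).
Proof.
under eq_fun do rewrite !mxE.
exact: (measurable_funB (measurable_coord_fst i) (measurable_coord_snd i)).
Qed.

Lemma measurable_coordD (i : 'I_n.+1) : measurable_fun setT (fun p : E * E => (p.1 + p.2) 0 i).
Proof.
under eq_fun do rewrite !mxE.
exact: (measurable_funD (measurable_coord_fst i) (measurable_coord_snd i)).
Qed.

Lemma integrable_bounded_mul (f k : E -> R) (B : R) :
  measurable_fun setT f -> (forall z, `|f z| <= B) ->
  mu.-integrable setT (EFin \o k) -> mu.-integrable setT (EFin \o (fun z => f z * k z)).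
Proof.
move=> mf fB ik; have mk : measurable_fun setT k.
  by apply/measurable_EFinP; exact: measurable_int ik.
have B0 : 0 <= B by apply: le_trans (fB 0).
have := integrableZl measurableT B ik; apply: le_integrable.
- exact: measurableT.
- by apply/measurable_EFinP; exact: measurable_funM.
- move=> z _ /=; rewrite lee_fin !normrM (ger0_norm B0).
  exact: ler_wpM2r.
Qed.

Lemma measurable_norm_fun d (T : measurableType d) (f : T -> R) :
  measurable_fun setT f -> measurable_fun setT (fun p => `|f p|).
Proof. by move=> mf; exact: (measurableT_comp (@normr_measurable R setT) mf). Qed.

Lemma integrable_normZ_lty (a : E -> R) (c : \bar R) : (0 <= c < +oo)%E ->
  mu.-integrable setT (EFin \o a) -> (\int[mu]_x (c * `|a x|%:E) < +oo)%E.
Proof.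
move=> /andP[c0 coo] ia.
have ma : measurable_fun setT (fun x => `|a x|%:E).
  apply/measurable_EFinP; apply: measurable_norm_fun.
  by apply/measurable_EFinP; exact: measurable_int ia.
rewrite ge0_integralZl; [|exact: measurableT|exact: ma|by []|exact: c0].
case/integrableP : ia => _ ia; rewrite lte_mul_pinfty// ge0_fin_numE//.
Qed.

Lemma integrable_prod12 (q : E * E -> R) (a : E -> R) (c : \bar R) : (0 <= c < +oo)%E ->
  measurable_fun setT q -> mu.-integrable setT (EFin \o a) ->
  (forall x, \int[mu]_y `|q (x, y)|%:E = c * `|a x|%:E)%E ->
  (mu \x mu)%E.-integrable setT (EFin \o q).
Proof.
move=> c0 mq ia qa; have mEq : measurable_fun setT (EFin \o q) by exact/measurable_EFinP.
apply/(integrable12ltyP mu mu mEq); apply: le_lt_trans (integrable_normZ_lty c0 ia).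
by rewrite (eq_integral (fun x => c * `|a x|%:E)%E)// => x _; rewrite -qa.
Qed.

Lemma integrable_prod21 (q : E * E -> R) (a : E -> R) (c : \bar R) : (0 <= c < +oo)%E ->
  measurable_fun setT q -> mu.-integrable setT (EFin \o a) ->
  (forall y, \int[mu]_x `|q (x, y)|%:E = c * `|a y|%:E)%E ->
  (mu \x mu)%E.-integrable setT (EFin \o q).
Proof.
move=> c0 mq ia qa; have mEq : measurable_fun setT (EFin \o q) by exact/measurable_EFinP.
apply/(integrable21ltyP mu mu mEq); apply: le_lt_trans (integrable_normZ_lty c0 ia).
by rewrite (eq_integral (fun x => c * `|a x|%:E)%E)// => x _; rewrite -qa.
Qed.

Lemma integrable_bounded_mul_prod (f q : E * E -> R) (B : R) :
  measurable_fun setT f -> (forall p, `|f p| <= B) ->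
  (mu \x mu)%E.-integrable setT (EFin \o q) ->
  (mu \x mu)%E.-integrable setT (EFin \o (fun p => f p * q p)).
Proof.
move=> mf fB iq; have mq : measurable_fun setT q.
  by apply/measurable_EFinP; exact: measurable_int iq.
have B0 : 0 <= B by apply: le_trans (fB (0, 0)).
have := integrableZl measurableT B iq; apply: le_integrable.
- exact: measurableT.
- by apply/measurable_EFinP; exact: measurable_funM.
- move=> z _ /=; rewrite lee_fin !normrM (ger0_norm B0).
  exact: ler_wpM2r.
Qed.

Variables (u : E -> R) (M : R) (k : E -> R) (e : expr R n) (x0 : E) (r : R).
Hypotheses (mu_ : measurable_fun setT u) (uM : forall x, `|u x| <= M).
Hypothesis kN : forall z, k (- z) = k z.
Hypotheses (mk2 : measurable_fun setT (fun p : E * E => k (p.1 - p.2))).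
Hypothesis (ik : mu.-integrable setT (EFin \o k)).
Hypothesis re : forall x, r < `|x - x0| -> eval e x = 0.
Local Notation phi := (eval e).

Let mk : measurable_fun setT k.
Proof. by apply/measurable_EFinP; exact: measurable_int ik. Qed.

Let M0 : 0 <= M. Proof. exact: le_trans (normr_ge0 _) (uM 0). Qed.

Let mphi : measurable_fun setT phi.
Proof. exact/continuous_rV_measurable/continuous_eval. Qed.

Let m1 (f : E -> R) : measurable_fun setT f -> measurable_fun setT (fun p : E * E => f p.1).
Proof. by move=> mf; exact: (measurableT_comp mf measurable_fst). Qed.

Let m2 (f : E -> R) : measurable_fun setT f -> measurable_fun setT (fun p : E * E => f p.2).
Proof. by move=> mf; exact: (measurableT_comp mf measurable_snd). Qed.

Let phiB : exists2 B : R, 0 <= B & forall x, `|phi x| <= B.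
Proof.
have [|B /ltW B0 hB] := @eval_bounded R n (subst_affine 1 x0 e) r.
  by move=> x rx; rewrite eval_subst_affine scale1r re// addrK.
exists B => // x; have := hB (x - x0); rewrite eval_subst_affine scale1r subrK.
exact.
Qed.

Let iphi : mu.-integrable setT (EFin \o phi).
Proof. by have [B _ hB] := phiB; exact: (integrable_bcs mphi hB re). Qed.

Let K : \bar R := \int[mu]_z `|k z|%:E.
Let L : \bar R := \int[mu]_z `|phi z|%:E.

Let K0 : (0 <= K < +oo)%E.
Proof. by case/integrableP : ik => _ ->; rewrite andbT; exact: integral_ge0. Qed.

Let L0 : (0 <= L < +oo)%E.
Proof. by case/integrableP : iphi => _ ->; rewrite andbT; exact: integral_ge0. Qed.

Let mnk : measurable_fun setT (fun z => `|k z|%:E).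
Proof. by apply/measurable_EFinP; exact: measurable_norm_fun. Qed.

Let mnphi : measurable_fun setT (fun z => `|phi z|%:E).
Proof. by apply/measurable_EFinP; exact: measurable_norm_fun. Qed.

Let shiftZ (a : R) (f : E -> \bar R) (b : bool) (c : E) : measurable_fun setT f ->
  (forall z, 0 <= f z)%E ->
  (\int[mu]_x (`|a|%:E * f (refl_shift b c x)) = (\int[mu]_x f x) * `|a|%:E)%E.
Proof.
move=> mf f0; rewrite ge0_integralZl ?lee_fin//; last first.
  exact: (measurableT_comp mf (measurable_refl_shift b c)).
by rewrite muleC ge0_integral_refl_shift.
Qed.

Let iG1 : (mu \x mu)%E.-integrable setT (EFin \o (fun p => phi p.1 * k (p.1 - p.2))).
Proof.
apply: (integrable_prod12 K0 _ iphi); first by apply: measurable_funM; [exact: m1|].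
move=> x; rewrite -(@shiftZ (phi x) (fun z => `|k z|%:E) true x mnk)//.
by apply: eq_integral => y _ /=; rewrite normrM EFinM /refl_shift scaleN1r addrC.
Qed.

Let iG2 : (mu \x mu)%E.-integrable setT (EFin \o (fun p => phi p.2 * k (p.1 - p.2))).
Proof.
apply: (integrable_prod21 K0 _ iphi); first by apply: measurable_funM; [exact: m2|].
move=> x; rewrite -(@shiftZ (phi x) (fun z => `|k z|%:E) false (- x) mnk)//.
by apply: eq_integral => y _ /=; rewrite normrM EFinM /refl_shift scale1r.
Qed.

Let iP (b : bool) :
  (mu \x mu)%E.-integrable setT (EFin \o (fun p => phi (p.1 + (-1) ^+ b *: p.2) * k p.2)).
Proof.
have mpb : measurable_fun setT (fun p : E * E => phi (p.1 + (-1) ^+ b *: p.2)).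
  apply: (@measurable_eval _ _ _ _ e (fun p : E * E => p.1 + (-1) ^+ b *: p.2)) => i.
  under eq_fun do rewrite !mxE; apply: measurable_funD; first exact: measurable_coord_fst.
  by apply: measurable_funM; [exact: measurable_cst|exact: measurable_coord_snd].
apply: (integrable_prod21 L0 _ ik); first by apply: measurable_funM; [exact: mpb|exact: m2].
move=> y; rewrite -(@shiftZ (k y) (fun z => `|phi z|%:E) false ((-1) ^+ b *: y) mnphi)//.
by apply: eq_integral => x _ /=; rewrite normrM EFinM muleC /refl_shift scale1r.
Qed.

Let iP0 : (mu \x mu)%E.-integrable setT (EFin \o (fun p => phi p.1 * k p.2)).
Proof.
apply: (integrable_prod21 L0 _ ik); first by apply: measurable_funM; [exact: m1|exact: m2].
move=> y; rewrite -(@shiftZ (k y) (fun z => `|phi z|%:E) false 0 mnphi)//.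
by apply: eq_integral => x _ /=; rewrite normrM EFinM muleC /refl_shift scale1r addr0.
Qed.

Let F (p : E * E) : R := u p.1 * ((phi p.1 - phi p.2) * k (p.1 - p.2)).

Let iF : (mu \x mu)%E.-integrable setT (EFin \o F).
Proof.
apply: (@integrable_bounded_mul_prod (fun p => u p.1) _ M) => //; first exact: m1.
have := integrableB measurableT iG1 iG2; apply: eq_integrable => // p _ /=.
by rewrite -EFinB; congr EFin; ring.
Qed.

Let F' (p : E * E) : R := u p.2 * ((phi p.2 - phi p.1) * k (p.1 - p.2)).

Let iF' : (mu \x mu)%E.-integrable setT (EFin \o F').
Proof.
apply: (@integrable_bounded_mul_prod (fun p => u p.2) _ M) => //; first exact: m2.
have := integrableB measurableT iG2 iG1; apply: eq_integrable => // p _ /=.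
by rewrite -EFinB; congr EFin; ring.
Qed.

Let H (p : E * E) : R := u p.1 * (D2 phi p.2 p.1 * k p.2).

Let iH : (mu \x mu)%E.-integrable setT (EFin \o H).
Proof.
apply: (@integrable_bounded_mul_prod (fun p => u p.1) _ M) => //; first exact: m1.
have i2 := integrableZl measurableT 2 iP0.
have := integrableB measurableT (integrableB measurableT i2 (iP false)) (iP true).
apply: eq_integrable => // p _ /=.
by rewrite -EFinM -!EFinB /D2; congr EFin; rewrite expr0 expr1 scale1r scaleN1r; ring.
Qed.

(* For fixed x, the substitutions y = x + z and y = x - z turn twice the inner
   integral into one against the second difference. *)
Let inner x : (\int[mu]_y (F (x, y))%:E + \int[mu]_y (F (x, y))%:E =
  \int[mu]_z (H (x, z))%:E)%E.
Proof.
have mFx : measurable_fun setT (fun y => (F (x, y))%:E).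
  apply/measurable_EFinP; rewrite /F /=.
  apply: measurable_funM; first exact: measurable_cst.
  apply: measurable_funM; last exact: measurable_refl.
  by apply: measurable_funB => //; exact: measurable_cst.
have [B B0 hB] := phiB.
have iFb (b : bool) : mu.-integrable setT (EFin \o (fun z => u x * (phi x - phi (x + (-1) ^+ b *: z)) * k z)).
  apply: (@integrable_bounded_mul _ k (M * (B + B)) _ _ ik).
    apply: measurable_funM; first exact: measurable_cst.
    apply: measurable_funB; first exact: measurable_cst.
    apply: (@measurable_eval _ _ _ _ e (fun z : E => x + (-1) ^+ b *: z)) => i.
    under eq_fun do rewrite !mxE; apply: measurable_funD; first exact: measurable_cst.
    by apply: measurable_funM; [exact: measurable_cst|exact: measurable_coord].
  move=> z; rewrite normrM ler_pM//; apply: (le_trans (ler_normB _ _)).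
  by rewrite lerD.
have FE (b : bool) : (\int[mu]_y (F (x, y))%:E =
    \int[mu]_z (u x * (phi x - phi (x + (-1) ^+ b *: z)) * k z)%:E)%E.
  rewrite -(@integral_refl_shift R n b x _ mFx); apply: eq_integral => z _.
  rewrite /F /refl_shift /= [_ + x]addrC opprD addNKr mulrA.
  by case: b => /=; rewrite ?scaleN1r ?opprK ?scale1r ?kN.
rewrite {1}(FE false) (FE true) -(integralD measurableT (iFb false) (iFb true)).
by apply: eq_integral => z _; rewrite -EFinD /H /D2 /= scale1r scaleN1r; congr EFin; ring.
Qed.

Let iuD2 z : mu.-integrable setT (EFin \o (fun x => u x * D2 phi z x)).
Proof.
have [B B0 hB] := phiB.
have mD : measurable_fun setT (D2 phi z).
  apply: measurable_funB; last exact: measurable_shift.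
  apply: measurable_funB; last exact: measurable_shift.
  by apply: measurable_funM; [exact: measurable_cst|].
apply: (@integrable_bcs _ _ _ (M * (4 * B)) x0 (r + `|z|)).
- exact: measurable_funM.
- move=> x; rewrite normrM ler_pM// /D2.
  have h2 : `|2 * phi x| <= 2 * B by rewrite normrM gtr0_norm// ler_pM2l.
  have := ler_normB (2 * phi x - phi (x + z)) (phi (x - z)).
  have := ler_normB (2 * phi x) (phi (x + z)).
  by have := hB (x + z); have := hB (x - z); lra.
- move=> x rx.
  have far y : `|x - y| <= `|z| -> phi y = 0.
    move=> xy; apply: re; have := ler_normD (x - y) (y - x0).
    by rewrite addrA subrK; lra.
  rewrite /D2 !far ?mulr0 ?subrr ?mulr0 ?normr0//.
  + by rewrite opprB addrC addrNK.
  + by rewrite opprD addNKr normrN.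
Qed.

(** For an integrable kernel the product of differences may be split into two integrable terms,
    which the exchange of variables identifies since [k] is even; with the singular kernel these
    terms need not be integrable separately. Measurability of $k(x-y)$ on the product is a
    hypothesis of its own, as it does not follow from that of [k]. *)
Lemma truncated_form :
  (\int[mu \x mu]_p ((u p.1 - u p.2) * (phi p.1 - phi p.2) * k (p.1 - p.2))%:E =
   \int[mu]_z (k z * J (fun x => u x * D2 phi z x))%:E)%E.
Proof.
transitivity (\int[mu \x mu]_p ((EFin \o F) p + (EFin \o F') p))%E.
  by apply: eq_integral => p _; rewrite /= -EFinD /F /F'; congr EFin; ring.
rewrite (integralD measurableT iF iF') -(integral12_prod_meas1 iF) -(integral21_prod_meas1 iF').
have iFF := integrable_fubini_F iF.
have -> : (\int[mu]_y \int[mu]_x (EFin \o F') (x, y) = \int[mu]_x \int[mu]_y (EFin \o F) (x, y))%E.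
  apply: eq_integral => y _; apply: eq_integral => x _.
  by rewrite /F /F' /= -(kN (y - x)) opprB.
rewrite -(integralD measurableT iFF iFF).
transitivity (\int[mu]_x \int[mu]_z (EFin \o H) (x, z))%E.
  by apply: eq_integral => x _; exact: inner.
rewrite (Fubini iH); apply: eq_integral => z _.
have fJ := integrable_fin_num measurableT (iuD2 z).
rewrite EFinM /Rintegral fineK// -integralZl; [|exact: measurableT|exact: iuD2].
by apply: eq_integral => x _; rewrite /H /= -EFinM; congr EFin; ring.
Qed.

End truncated_form.

(** * The nonlocal form with the singular kernel *)

Section nonlocal_form.
Context {R : realType} {n : nat}.
Local Notation E := 'rV[R]_n.+1.
Local Notation mu := (@lebesgue_rV R n).
Local Notation J f := (\int[mu]_x f x).
Implicit Types (x y z : E).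

Lemma D2_far (f : E -> R) x0 r z x : (forall y, r < `|y - x0| -> f y = 0) ->
  r + `|z| < `|x - x0| -> D2 f z x = 0.
Proof.
move=> f0 rx; have far y : `|x - y| <= `|z| -> f y = 0.
  move=> xy; apply: f0; have := ler_normD (x - y) (y - x0).
  by rewrite addrA subrK; lra.
rewrite /D2 !far ?mulr0 ?subrr ?mulr0 ?normr0//.
- by rewrite opprB addrC addrNK.
- by rewrite opprD addNKr normrN.
Qed.

Lemma D2_le (f : E -> R) (B : R) z x : (forall y, `|f y| <= B) -> `|D2 f z x| <= 4 * B.
Proof.
move=> fB; rewrite /D2.
have h2 : `|2 * f x| <= 2 * B by rewrite normrM gtr0_norm// ler_pM2l.
have := ler_normB (2 * f x - f (x + z)) (f (x - z)).
have := ler_normB (2 * f x) (f (x + z)).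
by have := fB (x + z); have := fB (x - z); lra.
Qed.

Lemma D2_eval_le (e : expr R n) (B : R) z x :
  (forall i j y, `|eval (dexpr i (dexpr j e)) y| <= B) ->
  `|D2 (eval e) z x| <= 2 * (n.+1%:R ^+ 2 * B * `|z| ^+ 2).
Proof.
move=> eB.
pose f t := eval e (x + t *: z).
pose df t := \sum_i z 0 i * eval (dexpr i e) (x + t *: z).
pose ddf t := \sum_i z 0 i * \sum_j z 0 j * eval (dexpr j (dexpr i e)) (x + t *: z).
have := @second_difference_le R f df ddf (n.+1%:R ^+ 2 * B * `|z| ^+ 2).
have -> : 2 * f 0 - f 1 - f (-1) = D2 (eval e) z x.
  by rewrite /f /D2 scale0r addr0 scale1r scaleN1r.
apply => t _; first exact: is_derive_eval_line.
- have h i : is_derive t 1 (fun h => z 0 i * eval (dexpr i e) (x + h *: z))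
     (z 0 i * \sum_j z 0 j * eval (dexpr j (dexpr i e)) (x + t *: z)).
    exact: (@is_deriveZ _ _ _ _ (z 0 i) t 1 _ (is_derive_eval_line (dexpr i e) x z t)).
  have := is_derive_sum h; congr is_derive.
  by apply/funext => k; rewrite fct_sumE.
- apply: (le_trans (ler_norm_sum _ _ _)).
  apply: (@le_trans _ _ (\sum_(i < n.+1) n.+1%:R * B * `|z| ^+ 2)).
    apply: ler_sum => i _; rewrite normrM.
    apply: (@le_trans _ _ (`|z| * (n.+1%:R * B * `|z|))); last by rewrite le_eqVlt; apply/orP; left; apply/eqP; ring.
    apply: ler_pM => //; first exact: coord_le_norm.
    apply: (le_trans (ler_norm_sum _ _ _)).
    apply: (@le_trans _ _ (\sum_(j < n.+1) B * `|z|)).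
      by apply: ler_sum => j _; rewrite normrM mulrC ler_pM// coord_le_norm.
    by rewrite sumr_const card_ord -[X in X <= _]mulr_natl mulrA.
  rewrite sumr_const card_ord -[X in X <= _]mulr_natl le_eqVlt; apply/orP; left; apply/eqP; ring.
Qed.

Variable s : R.
Hypothesis s01 : 0 < s < 1.
Local Notation kern := (@kern R n s).

Lemma measurable_kern_id : measurable_fun setT kern.
Proof. by apply: (@measurable_kern _ _ s _ _ id) => i; exact: measurable_coord. Qed.

(** The kernel times $\min(1,|z|^2)$, written as a sum of two moments so that the moment bounds give
    its integrability. *)
Definition kern_majorant z : R :=
  \1_(cube (0 : E) 1) z * (`|z| `^ 2 * kern z) + \1_(~` cube (0 : E) 1) z * (`|z| `^ 0 * kern z).

Lemma kern_majorantE z :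
  kern_majorant z = (if `|z| <= 1 then `|z| ^+ 2 else 1) * kern z.
Proof.
rewrite /kern_majorant !indicE in_setC; have [z1|z1] := leP `|z| 1.
  rewrite mem_set /=; last by rewrite /cube/= subr0.
  by rewrite mul0r addr0 powR_mulrn// mul1r.
rewrite memNset /=; last by rewrite /cube/= subr0 leNgt z1.
by rewrite mul0r add0r powRr0 !mul1r.
Qed.

Lemma integrable_moment (D : set E) (p C : R) : measurable D ->
  (\int[mu]_z (\1_D z * (`|z| `^ p * kern z))%:E <= C%:E)%E ->
  mu.-integrable setT (EFin \o (fun z => \1_D z * (`|z| `^ p * kern z))).
Proof.
move=> mD h; apply/integrableP; split; first by apply/measurable_EFinP; exact: measurable_kern_moment.
apply: le_lt_trans (ltry C); apply: le_trans h; rewrite le_eqVlt; apply/orP; left; apply/eqP.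
by apply: eq_integral => z _ /=; rewrite ger0_norm// !mulr_ge0 ?powR_ge0 ?kern_ge0.
Qed.

Lemma integrable_kern_majorant : mu.-integrable setT (EFin \o kern_majorant).
Proof.
have /andP[s0 s1] := s01.
have [|C _ hC] := @kern_moment_small R n s s01 2; first by lra.
have [|C' _ hC'] := @kern_moment_large R n s s01 0; first by rewrite lexx mulr_gt0.
have i1 := integrable_moment (measurable_cube _ _) (hC 1 ltr01).
have i2 := integrable_moment (measurable_ncube _) (hC' 1 ltr01).
exact: (integrableD measurableT i1 i2).
Qed.

(** Cutting off a neighborhood of the origin yields even integrable kernels, to which
    [truncated_form] applies, and which increase to [kern]. *)
Definition tkern (m : nat) z : R := \1_(`]m.+1%:R^-1, +oo[ : set R) (enorm z) * kern z.

Lemma measurable_tkern d (T : measurableType d) m (h : T -> E) :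
  (forall i, measurable_fun setT (fun w => h w 0 i)) ->
  measurable_fun setT (fun w => tkern m (h w)).
Proof.
move=> mh; apply: measurable_funM; last exact: measurable_kern.
have mi : measurable_fun setT (\1_(`]m.+1%:R^-1, +oo[ : set R) : R -> R).
  by apply: measurable_indic; exact: measurable_itv.
exact: (measurableT_comp mi (measurable_enorm mh)).
Qed.

Lemma tkern01 m z : 0 <= tkern m z <= kern z.
Proof.
rewrite /tkern indicE; case: (_ \in _) => /=; rewrite ?mul1r ?mul0r ?lexx ?kern_ge0//.
Qed.

Lemma tkernN m z : tkern m (- z) = tkern m z.
Proof. by rewrite /tkern enormN kernN. Qed.

Lemma tkern_cvg z : tkern m z @[m --> \oo] --> kern z.
Proof.
have [->|z0] := eqVneq z 0.
  by under eq_fun do rewrite /tkern kern0// mulr0; rewrite kern0//; exact: cvg_cst.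
have ez : 0 < enorm z by apply: lt_le_trans (norm_le_enorm z); rewrite normr_gt0.
apply: cvg_near_cst; exists (Num.truncn (enorm z)^-1) => // m /= hm.
rewrite /tkern indicE mem_set ?mul1r//= in_itv/= andbT invf_plt ?posrE//.
by apply: lt_le_trans (truncnS_gt _) _; rewrite ler_nat ltnS.
Qed.

Lemma integrable_tkern m : mu.-integrable setT (EFin \o tkern m).
Proof.
(* The Euclidean norm is at most [n.+1] times the sup norm, so a Euclidean norm above [m.+1%:R^-1]
   forces the sup norm above [c]. *)
pose c : R := (m.+1%:R * n.+1%:R)^-1 / 2; have c0 : 0 < c by rewrite divr_gt0// invr_gt0 mulr_gt0.
have /andP[s0 s1] := s01.
have [|C' _ hC'] := @kern_moment_large R n s s01 0; first by rewrite lexx mulr_gt0.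
have := integrable_moment (measurable_ncube _) (hC' c c0).
apply: le_integrable; first exact: measurableT.
  by apply/measurable_EFinP; apply: (@measurable_tkern _ _ m id) => i; exact: measurable_coord.
move=> z _ /=; rewrite lee_fin ger0_norm; last by have /andP[] := tkern01 m z.
rewrite ger0_norm ?kern_moment_ge0//.
rewrite /tkern !indicE; have [|_] := boolP (enorm z \in _); last by rewrite mul0r kern_moment_ge0.
rewrite inE /= in_itv/= andbT => h.
rewrite mem_set ?mul1r ?powRr0 ?mul1r// /cube/= subr0 => zc.
have := enorm_le_norm z; have zc' : n.+1%:R * `|z| <= n.+1%:R * c by rewrite ler_pM2l.
have : n.+1%:R * c < m.+1%:R^-1.
  have e : n.+1%:R * c = m.+1%:R^-1 / 2.
    have key (a b : R) : 0 < a -> 0 < b -> b * ((a * b)^-1 / 2) = a^-1 / 2.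
      by move=> a0 b0; field; rewrite !gt_eqF.
    exact: key.
  by rewrite e ltr_pdivrMr// ltr_pMr ?invr_gt0// ltr1n.
move=> e1 e2; have := lt_le_trans h (le_trans e2 zc').
by rewrite ltNge (ltW e1).
Qed.

Variables (e : expr R n) (x0 : E) (r : R).
Hypotheses (r0 : 0 <= r) (re : forall x, r < `|x - x0| -> eval e x = 0).
Local Notation phi := (eval e).

Let me : measurable_fun setT phi.
Proof. exact/continuous_rV_measurable/continuous_eval. Qed.

Let supported0 : supported r (subst_affine 1 x0 e).
Proof. by move=> x rx; rewrite eval_subst_affine scale1r re// addrK. Qed.

Lemma eval_bounded_at : exists2 B : R, 0 < B & forall x, `|phi x| <= B.
Proof.
have [B B0 hB] := eval_bounded supported0.
exists B => // x; have := hB (x - x0); rewrite eval_subst_affine scale1r subrK.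
exact.
Qed.

Lemma eval_D2_bounded_at : exists2 B : R, 0 < B &
  forall z x, `|D2 phi z x| <= B * (if `|z| <= 1 then `|z| ^+ 2 else 1).
Proof.
have [B B0 hB] := eval_bounded_at.
have /choice[b hb] : forall ij : 'I_n.+1 * 'I_n.+1,
    exists b : R, 0 < b /\ forall x, `|eval (dexpr ij.1 (dexpr ij.2 e)) x| <= b.
  move=> [i j]; have [b b0 hb] := eval_bounded (supported_dexpr i (supported_dexpr j supported0)).
  exists b; split => // x.
  have := hb (x - x0); congr (`|_| <= _).
  rewrite -partial_eval.
  have -> : eval (dexpr j (subst_affine 1 x0 e)) = eval (subst_affine 1 x0 (dexpr j e)).
    by apply/funext => y; rewrite eval_dexpr_subst_affine eval_subst_affine mul1r.
  by rewrite partial_eval eval_dexpr_subst_affine mul1r scale1r subrK.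
pose B' := \sum_ij b ij.
have B'h i j x : `|eval (dexpr i (dexpr j e)) x| <= B'.
  apply: (le_trans ((hb (i, j)).2 x)); rewrite /B' (bigD1 (i, j))//= lerDl.
  by apply: sumr_ge0 => ij _; exact: ltW (hb ij).1.
have B'0 : 0 <= B' by apply: sumr_ge0 => ij _; exact: ltW (hb ij).1.
exists (2 * n.+1%:R ^+ 2 * B' + 4 * B).
  by rewrite ltr_wpDl ?mulr_gt0// mulr_ge0// mulr_ge0// exprn_ge0.
move=> z x; have := D2_eval_le z x B'h; have := D2_le z x hB.
have c0 : 0 <= 2 * n.+1%:R ^+ 2 * B' by rewrite mulr_ge0// mulr_ge0// exprn_ge0.
have z2 : 0 <= `|z| ^+ 2 by exact: sqr_ge0.
case: ifP => _ h4 h2; last by rewrite mulr1; lra.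
apply: (le_trans h2); rewrite mulrDl.
have : 0 <= 4 * B * `|z| ^+ 2 by rewrite !mulr_ge0// ltW.
by lra.
Qed.

Let shifted_far z x : r + `|z| < `|x - x0| -> phi (x + z) = 0.
Proof.
move=> rx; apply: re; have := ler_normB (x + z - x0) z.
by rewrite addrAC addrK; lra.
Qed.

Let difference_le : exists2 L : R, 0 <= L & forall x z, `|phi x - phi (x + z)| <= L * `|z|.
Proof.
have /choice[b hb] : forall i : 'I_n.+1,
    exists b : R, 0 < b /\ forall x, `|eval (dexpr i e) x| <= b.
  move=> i; have [b b0 hb] := eval_bounded (supported_dexpr i supported0).
  exists b; split => // x; have := hb (x - x0).
  by rewrite eval_dexpr_subst_affine mul1r scale1r subrK.
pose L := \sum_i b i; exists L; first by apply: sumr_ge0 => i _; exact: ltW (hb i).1.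
move=> x z; rewrite distrC.
have := @increment_le_cst R (fun t => eval e (x + t *: z))
  (fun t => \sum_i z 0 i * eval (dexpr i e) (x + t *: z)) (L * `|z|) 0 1 ler01.
rewrite scale1r scale0r addr0 subr0 mulr1; apply.
  by move=> t _; exact: is_derive_eval_line.
move=> t _; apply: (le_trans (ler_norm_sum _ _ _)).
rewrite /L mulr_suml; apply: ler_sum => i _.
by rewrite normrM mulrC ler_pM// ?(hb i).2// coord_le_norm.
Qed.

Let msq z : measurable_fun setT (fun x => (phi x - phi (x + z)) ^+ 2).
Proof. exact: (measurable_funX 2 (measurable_funB me (measurable_shift z me))). Qed.

(** For $|z|\le 1$ the Lipschitz bound is integrated over a fixed cube. For larger [z] the support
    spreads with [z], so the square is split and translation invariance gives a bound independent of
    [z]. *)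
Lemma integral_sqr_difference_le : exists C : R, forall z,
  (\int[mu]_x ((phi x - phi (x + z)) ^+ 2)%:E <=
    (C * (if `|z| <= 1 then `|z| ^+ 2 else 1))%:E)%E.
Proof.
have [B B0 hB] := eval_bounded_at.
have [L L0 hL] := difference_le.
have sqle (a b : R) : `|a| <= b -> a ^+ 2 <= b ^+ 2.
  move=> ab; rewrite -[a ^+ 2]real_normK ?num_real//.
  by rewrite lerXn2r ?nnegrE//; exact: le_trans (normr_ge0 a) ab.
pose V1 : R := (2 * (r + 1)) ^+ n.+1; pose V0 : R := (2 * r) ^+ n.+1.
have V10 : 0 <= V1 by rewrite exprn_ge0// mulr_ge0// addr_ge0.
have V00 : 0 <= V0 by rewrite exprn_ge0// mulr_ge0.
exists (L ^+ 2 * V1 + 4 * B ^+ 2 * V0) => z.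
have far2 x : r + `|z| < `|x - x0| -> (phi x - phi (x + z)) ^+ 2 = 0.
  move=> rx; rewrite shifted_far// re ?subrr ?expr0n//.
  by apply: le_lt_trans rx; rewrite lerDl.
have isq : mu.-integrable setT (EFin \o (fun x => (phi x - phi (x + z)) ^+ 2)).
  apply: (@integrable_bcs _ _ _ ((B + B) ^+ 2) x0 (r + `|z|)) => // x.
  rewrite ger0_norm ?sqr_ge0//; apply: sqle.
  by apply: (le_trans (ler_normB _ _)); rewrite lerD.
rewrite -(fineK (integrable_fin_num measurableT isq)) lee_fin -/(Rintegral _ _ _).
have [z1|z1] := leP `|z| 1.
  have h : `|J (fun x => (phi x - phi (x + z)) ^+ 2)| <= (L * `|z|) ^+ 2 * V1.
    apply: (@Rintegral_bcs_le _ _ _ _ x0) => //; first by rewrite addr_ge0.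
      by move=> x; rewrite ger0_norm ?sqr_ge0//; apply: sqle; exact: hL.
    move=> x rx; apply: far2; apply: le_lt_trans rx; by rewrite lerD2l.
  apply: (le_trans (ler_norm _)); apply: (le_trans h).
  have : 0 <= 4 * B ^+ 2 * V0 * `|z| ^+ 2 by rewrite !mulr_ge0// ?exprn_ge0// ltW.
  by rewrite exprMn; lra.
have ip w : mu.-integrable setT (EFin \o (fun x => phi (x + w) ^+ 2)).
  apply: (@integrable_bcs _ _ _ (B ^+ 2) x0 (r + `|w|)).
  - by apply: measurable_funX; exact: measurable_shift.
  - by move=> x; rewrite ger0_norm ?sqr_ge0// sqle.
  - by move=> x rx; rewrite shifted_far// expr0n.
have mp : measurable_fun setT (fun x => phi x ^+ 2) by exact: measurable_funX.
have hJ w : J (fun x => phi (x + w) ^+ 2) <= B ^+ 2 * V0.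
  rewrite (Rintegral_shift _ mp); apply: (le_trans (ler_norm _)).
  apply: (@Rintegral_bcs_le _ _ _ _ x0) => //.
    by move=> x; rewrite ger0_norm ?sqr_ge0// sqle.
  by move=> x rx; rewrite re// expr0n.
have ip2 w : mu.-integrable setT (EFin \o (fun x => 2 * phi (x + w) ^+ 2)).
  by have := integrableZl measurableT 2 (ip w); apply: eq_integrable.
apply: (@le_trans _ _ (J (fun x => 2 * phi (x + 0) ^+ 2 + 2 * phi (x + z) ^+ 2))).
  apply: le_Rintegral => //.
  - by have := integrableD measurableT (ip2 0) (ip2 z); apply: eq_integrable.
  - by move=> x _; rewrite addr0; have := sqr_ge0 (phi x + phi (x + z)); lra.
rewrite RintegralD// !RintegralZl// mulr1.
have := hJ 0; have := hJ z; have : 0 <= L ^+ 2 * V1 by rewrite mulr_ge0// sqr_ge0.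
by lra.
Qed.

(** The substitution $y=x+z$ and the theorem of Tonelli reduce the seminorm to the integral of
    [kern_majorant]. The bound is needed to admit expressions as test functions in the weak
    formulation. *)
Lemma gagliardo_eval_lty :
  (\int[mu \x mu]_p ((phi p.1 - phi p.2) ^+ 2 * kern (p.1 - p.2))%:E < +oo)%E.
Proof.
have [C hC] := integral_sqr_difference_le.
have k0 := @kern_ge0 R n s.
have mk := measurable_kern_id.
have m1 : measurable_fun setT (fun p : E * E => (phi p.1 - phi p.2) ^+ 2 * kern (p.1 - p.2)).
  apply: measurable_funM; last by apply: measurable_kern => i; exact: measurable_coordB.
  apply: measurable_funX; apply: measurable_funB.
  - exact: (measurableT_comp me measurable_fst).
  - exact: (measurableT_comp me measurable_snd).
have m2 : measurable_fun setT (fun p : E * E => (phi p.1 - phi (p.1 + p.2)) ^+ 2 * kern p.2).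
  apply: measurable_funM; last exact: (measurableT_comp mk measurable_snd).
  apply: measurable_funX; apply: measurable_funB.
    exact: (measurableT_comp me measurable_fst).
  by apply: (@measurable_eval _ _ _ _ e (fun p : E * E => p.1 + p.2)) => i; exact: measurable_coordD.
pose F0 (p : E * E) := ((phi p.1 - phi p.2) ^+ 2 * kern (p.1 - p.2))%:E.
have mF0 : measurable_fun setT F0 by apply/measurable_EFinP; exact: m1.
have F00 p : (0 <= F0 p)%E by rewrite lee_fin mulr_ge0// sqr_ge0.
pose G (p : E * E) := ((phi p.1 - phi (p.1 + p.2)) ^+ 2 * kern p.2)%:E.
have mG : measurable_fun setT G by apply/measurable_EFinP; exact: m2.
have G0 p : (0 <= G p)%E by rewrite lee_fin mulr_ge0// sqr_ge0.
have -> : (\int[mu \x mu]_p ((phi p.1 - phi p.2) ^+ 2 * kern (p.1 - p.2))%:E =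
    \int[mu]_x \int[mu]_z G (x, z))%E.
  apply: etrans (fubini_tonelli1 (m1 := mu) (m2 := mu) F0 mF0 F00) _.
  apply: eq_integral => x _; rewrite /fubini_F.
  rewrite -(@ge0_integral_refl_shift R n false x (fun y => ((phi x - phi y) ^+ 2 * kern (x - y))%:E)).
  - apply: eq_integral => z _; rewrite /G /refl_shift/= scale1r [z + x]addrC.
    by rewrite opprD addNKr kernN.
  - apply/measurable_EFinP; apply: measurable_funM; last by apply: measurable_refl.
    apply: measurable_funX; apply: measurable_funB => //; exact: measurable_cst.
  - by move=> y; rewrite lee_fin mulr_ge0// sqr_ge0.
rewrite (fubini_tonelli (m1 := mu) (m2 := mu) G mG G0).
have /integrableP[_] := integrableZl measurableT C integrable_kern_majorant.
apply: le_lt_trans; apply: ge0_le_integral.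
- exact: measurableT.
- by move=> z _; apply: integral_ge0 => x _; exact: G0.
- exact: (measurable_fun_fubini_tonelli_G (m1 := mu) G mG G0).
- have := measurable_int _ (integrableZl measurableT C integrable_kern_majorant).
  exact: (measurableT_comp (@abse_measurable R setT)).
move=> z _; rewrite /G/=.
under eq_integral do rewrite mulrC EFinM.
rewrite ge0_integralZl; [|exact: measurableT|exact/measurable_EFinP/msq| |].
- apply: (@le_trans _ _ ((kern z)%:E * (C * (if `|z| <= 1 then `|z| ^+ 2 else 1))%:E)%E).
    by rewrite lee_wpmul2l// lee_fin.
  rewrite -EFinM lee_fin; apply: le_trans (ler_norm _); rewrite kern_majorantE.
  by rewrite le_eqVlt; apply/orP; left; apply/eqP; ring.
- by move=> x _; rewrite lee_fin sqr_ge0.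
- by rewrite lee_fin.
Qed.

Section with_u.
Variables (u : E -> R) (M : R).
Hypotheses (mu_ : measurable_fun setT u) (uM : forall x, `|u x| <= M).

Let M0 : 0 <= M. Proof. exact: le_trans (normr_ge0 _) (uM 0). Qed.

Lemma integrable_uD2 z : mu.-integrable setT (EFin \o (fun x => u x * D2 phi z x)).
Proof.
have [B B0 hB] := eval_bounded_at.
have mD : measurable_fun setT (D2 phi z).
  apply: measurable_funB; last exact: measurable_shift.
  apply: measurable_funB; last exact: measurable_shift.
  by apply: measurable_funM; [exact: measurable_cst|].
apply: (@integrable_bcs _ _ _ (M * (4 * B)) x0 (r + `|z|)).
- exact: measurable_funM.
- by move=> x; rewrite normrM ler_pM// D2_le.
- by move=> x rx; rewrite (D2_far re)// mulr0.
Qed.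

(* Substitution in x alone moves the second difference to [u]. *)
Lemma second_difference_by_parts z :
  J (fun x => u x * D2 phi z x) = J (fun x => phi x * D2 u z x).
Proof.
have [B B0 hB] := eval_bounded_at.
have iu c (f : E -> R) : measurable_fun setT f -> (forall x, `|f x| <= M) ->
    mu.-integrable setT (EFin \o (fun x => c * (phi x * f x))).
  move=> mf fM; apply: (@integrable_bcs _ _ _ (`|c| * (B * M)) x0 r).
  - apply: measurable_funM; [exact: measurable_cst|exact: measurable_funM].
  - by move=> x; rewrite !normrM ler_wpM2l// ler_pM.
  - by move=> x rx; rewrite re// mul0r mulr0.
have ip c w : mu.-integrable setT (EFin \o (fun x => c * (u x * phi (x + w)))).
  apply: (@integrable_bcs _ _ _ (`|c| * (M * B)) x0 (r + `|w|)).
  - apply: measurable_funM; first exact: measurable_cst.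
    by apply: measurable_funM => //; exact: measurable_shift.
  - by move=> x; rewrite !normrM ler_wpM2l// ler_pM.
  - move=> x rx; rewrite re ?mulr0//.
    have := ler_normB (x + w - x0) w; rewrite addrAC addrK; lra.
have mshu w : measurable_fun setT (fun x => u (x + w)) by exact: measurable_shift.
have swap w : J (fun x => u x * phi (x + w)) = J (fun x => phi x * u (x - w)).
  rewrite -[RHS](@Rintegral_shift _ _ (fun x => phi x * u (x - w)) w).
    by apply: eq_Rintegral => x _; rewrite addrK mulrC.
  by apply: measurable_funM => //; exact: (measurable_shift (- w)).
have lin a b c : mu.-integrable setT (EFin \o a) -> mu.-integrable setT (EFin \o b) ->
   mu.-integrable setT (EFin \o c) ->
   J (fun x => a x - b x - c x) = J a - J b - J c.
  move=> ia ib ic; rewrite RintegralB//; first by rewrite RintegralB.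
  exact: (integrableB measurableT ia ib).
transitivity (J (fun x => 2 * (u x * phi (x + 0)) - 1 * (u x * phi (x + z)) - 1 * (u x * phi (x + (- z))))).
  by apply: eq_Rintegral => x _; rewrite /D2 addr0; ring.
transitivity (J (fun x => 2 * (phi x * u (x - 0)) - 1 * (phi x * u (x - z)) - 1 * (phi x * u (x + z)))); last first.
  by apply: eq_Rintegral => x _; rewrite /D2 subr0; ring.
have ip' w : mu.-integrable setT (EFin \o (fun x => u x * phi (x + w))).
  by have := ip 1 w; apply: eq_integrable => // x _ /=; rewrite mul1r.
have iu' w : mu.-integrable setT (EFin \o (fun x => phi x * u (x + w))).
  by have := iu 1 _ (mshu w) (fun x => uM _); apply: eq_integrable => // x _ /=; rewrite mul1r.
rewrite lin; [|exact: ip..].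
rewrite lin; [|exact: (iu _ _ (mshu (- 0)))|exact: (iu _ _ (mshu (- z)))|exact: (iu _ _ (mshu z))].
rewrite !RintegralZl//.
by rewrite !swap opprK.
Qed.

(** The symmetrized form converges absolutely for every bounded measurable [u], whereas the double
    integral relies on a finite seminorm of [u]. Later steps can therefore work with bounded
    functions only. *)
Definition NL : R := J (fun z => kern z * J (fun x => u x * D2 phi z x)).

(** For $|z|\le 1$ the smoothness of [phi] is used; beyond, the second difference is moved to [u],
    so that the domain of integration stays the support of [phi]. *)
Lemma uD2_bounded : exists2 C : R, 0 < C & forall z,
  `|J (fun x => u x * D2 phi z x)| <= C * (if `|z| <= 1 then `|z| ^+ 2 else 1).
Proof.
have [B B0 hB] := eval_bounded_at.
have [B2 B20 hB2] := eval_D2_bounded_at.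
pose V1 : R := (2 * (r + 1)) ^+ n.+1; pose V0 : R := (2 * r) ^+ n.+1.
have V10 : 0 <= V1 by rewrite exprn_ge0// mulr_ge0// addr_ge0.
have V00 : 0 <= V0 by rewrite exprn_ge0// mulr_ge0.
have c1 : 0 <= M * B2 * V1 by rewrite !mulr_ge0// ltW.
have c2 : 0 <= B * (4 * M) * V0 by rewrite !mulr_ge0// ltW.
exists (M * B2 * V1 + B * (4 * M) * V0 + 1); first by rewrite ltr_wpDl// addr_ge0.
move=> z; case: ifP => [z1|_].
  apply: (@le_trans _ _ (M * (B2 * `|z| ^+ 2) * V1)).
    apply: (@Rintegral_bcs_le _ _ _ _ x0); first by rewrite addr_ge0.
    - by apply/measurable_EFinP; exact: measurable_int (integrable_uD2 z).
    - move=> x; rewrite normrM ler_pM//.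
      by have := hB2 z x; rewrite z1.
    - by move=> x rx; rewrite (D2_far re) ?mulr0//; apply: le_lt_trans rx; rewrite lerD2l.
  have : 0 <= B * (4 * M) * V0 * `|z| ^+ 2 by rewrite mulr_ge0// sqr_ge0.
  by have := sqr_ge0 `|z|; lra.
rewrite second_difference_by_parts mulr1.
apply: (@le_trans _ _ (B * (4 * M) * V0)); last by lra.
apply: (@Rintegral_bcs_le _ _ _ _ x0); first exact: r0.
- apply: (measurable_funM me); apply: measurable_funB; last exact: measurable_shift.
  apply: measurable_funB; last exact: measurable_shift.
  by apply: measurable_funM; [exact: measurable_cst|].
- by move=> x; rewrite normrM ler_pM// D2_le.
- by move=> x rx; rewrite re// mul0r.
Qed.

(** The inner integral is a combination of averages at frequency 1, which are continuous in their
    center. *)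
Lemma measurable_uD2 : measurable_fun setT (fun z => J (fun x => u x * D2 phi z x)).
Proof.
have re' : supported (r + `|x0|) e.
  by move=> x rx; apply: re; have := ler_normD (x - x0) x0; rewrite subrK; lra.
have rp : 0 <= r + `|x0| by rewrite addr_ge0.
have ca := continuous_average mu_ uM rp re' ltr01.
have avE w : J (fun x => u x * phi (x + w)) = average u e 1 (- w).
  by apply: eq_Rintegral => x _; rewrite scale1r opprK.
have iw w : mu.-integrable setT (EFin \o (fun x => u x * phi (x + w))).
  have := integrable_average mu_ uM (- w) re' ltr01; apply: eq_integrable => // x _ /=.
  by rewrite scale1r opprK.
have i2 : mu.-integrable setT (EFin \o (fun x => 2 * (u x * phi (x + 0)))).
  by have := integrableZl measurableT 2 (iw 0); apply: eq_integrable.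
have -> : (fun z => J (fun x => u x * D2 phi z x)) =
   (fun z => 2 * average u e 1 0 - average u e 1 (0 - z) - average u e 1 z).
  apply/funext => z.
  transitivity (J (fun x => 2 * (u x * phi (x + 0)) - u x * phi (x + z) - u x * phi (x + - z))).
    by apply: eq_Rintegral => x _; rewrite /D2 addr0; ring.
  rewrite RintegralB//; last by have := integrableB measurableT i2 (iw z); apply: eq_integrable.
  by rewrite RintegralB// RintegralZl// !avE oppr0 opprK sub0r.
have mav : measurable_fun setT (average u e 1) by exact: continuous_rV_measurable.
apply: measurable_funB; last exact: mav.
by apply: measurable_funB; [exact: measurable_cst|exact: measurable_refl].
Qed.

Lemma integrable_NL :
  mu.-integrable setT (EFin \o (fun z => kern z * J (fun x => u x * D2 phi z x))).
Proof.
have [C C0 hC] := uD2_bounded.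
have := integrableZl measurableT C integrable_kern_majorant; apply: le_integrable.
- exact: measurableT.
- apply/measurable_EFinP; apply: measurable_funM; [exact: measurable_kern_id|exact: measurable_uD2].
- move=> z _ /=; rewrite lee_fin normrM ger0_norm ?kern_ge0//.
  apply: le_trans (ler_norm _); rewrite kern_majorantE mulrA mulrC.
  by rewrite ler_wpM2r// kern_ge0.
Qed.

(** The identity for the truncated kernels passes to the limit on both sides by dominated
    convergence, with the integrand of the double integral and that of [NL] as majorants. *)
Lemma nonlocal_form :
  (mu \x mu)%E.-integrable setT
    (EFin \o (fun p => (u p.1 - u p.2) * (phi p.1 - phi p.2) * kern (p.1 - p.2))) ->
  (\int[mu \x mu]_p ((u p.1 - u p.2) * (phi p.1 - phi p.2) * kern (p.1 - p.2))%:E = NL%:E)%E.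
Proof.
move=> iF.
pose Fm m (p : E * E) := (u p.1 - u p.2) * (phi p.1 - phi p.2) * tkern m (p.1 - p.2).
have mFm m : measurable_fun setT (Fm m).
  apply: measurable_funM; last by apply: measurable_tkern => i; exact: measurable_coordB.
  apply: measurable_funM; apply: measurable_funB.
  - exact: (measurableT_comp mu_ measurable_fst).
  - exact: (measurableT_comp mu_ measurable_snd).
  - exact: (measurableT_comp me measurable_fst).
  - exact: (measurableT_comp me measurable_snd).
pose Foo (p : E * E) := (u p.1 - u p.2) * (phi p.1 - phi p.2) * kern (p.1 - p.2).
have inF : (mu \x mu)%E.-integrable setT (EFin \o (fun p => `|Foo p|)).
  exact: (integrable_abse iF).
have domF m p : `|Fm m p| <= `|Foo p|.
  rewrite /Fm /Foo !normrM ler_wpM2l// ?mulr_ge0//.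
  have /andP[t0 tk] := tkern01 m (p.1 - p.2).
  by rewrite !ger0_norm// kern_ge0.
have cvF p : Fm ^~ p @ \oo --> Foo p.
  by apply: cvgM; [exact: cvg_cst|exact: tkern_cvg].
have [_ cvL] := Rintegral_dominated_cvg mFm inF domF cvF.
pose Gm m z := tkern m z * J (fun x => u x * D2 phi z x).
pose Goo z := kern z * J (fun x => u x * D2 phi z x).
have mGm m : measurable_fun setT (Gm m).
  apply: measurable_funM; last exact: measurable_uD2.
  by apply: (@measurable_tkern _ _ m id) => i; exact: measurable_coord.
have inG : mu.-integrable setT (EFin \o (fun z => `|Goo z|)).
  exact: (integrable_abse integrable_NL).
have domG m z : `|Gm m z| <= `|Goo z|.
  rewrite /Gm /Goo !normrM ler_wpM2r//.
  have /andP[t0 tk] := tkern01 m z.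
  by rewrite !ger0_norm// kern_ge0.
have cvG z : Gm ^~ z @ \oo --> Goo z.
  by apply: cvgM; [exact: tkern_cvg|exact: cvg_cst].
have [_ cvR] := Rintegral_dominated_cvg mGm inG domG cvG.
have e12 m : \int[(mu \x mu)%E]_p Fm m p = J (Gm m).
  rewrite /Rintegral; congr fine.
  have t2 : measurable_fun setT (fun p : E * E => tkern m (p.1 - p.2)).
    by apply: measurable_tkern => i; exact: measurable_coordB.
  exact: (truncated_form mu_ uM (tkernN m) t2 (integrable_tkern m) re).
have fL := integrable_fin_num measurableT iF.
rewrite -(fineK fL); congr EFin.
transitivity (\int[(mu \x mu)%E]_p Foo p); first by [].
transitivity (J Goo); last by [].
have eL := cvg_lim (@Rhausdorff R) cvL; have eR := cvg_lim (@Rhausdorff R) cvR.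
rewrite -[LHS]eL -[RHS]eR.
by under eq_fun do rewrite e12.
Qed.

End with_u.
End nonlocal_form.

(** * The nonlocal form of a rescaled test function *)

Section nonlocal_estimates.
Context {R : realType} {n : nat}.
Local Notation E := 'rV[R]_n.+1.
Local Notation mu := (@lebesgue_rV R n).
Local Notation J f := (\int[mu]_x f x).
Implicit Types (x y z : E).

Variable s : R.
Hypothesis s01 : 0 < s < 1.
Local Notation kern := (@kern R n s).

Lemma Rintegral_moment_le (D : set E) (p C : R) : measurable D -> 0 <= C ->
  (\int[mu]_z (\1_D z * (`|z| `^ p * kern z))%:E <= C%:E)%E ->
  J (fun z => \1_D z * (`|z| `^ p * kern z)) <= C.
Proof.
move=> mD C0 h; have i := integrable_moment mD h.
by rewrite -lee_fin /Rintegral fineK// (integrable_fin_num measurableT i).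
Qed.

(** The integral is split at $|z|=t$: the exponent $p>2s$ makes the inner part converge, $q<2s$ the
    outer one. *)
Lemma NL_le (p q : R) : 2 * s < p -> 0 <= q < 2 * s ->
  exists2 C : R, 0 < C & forall (e : expr R n) x0 (r : R) (u : E -> R) (M K1 K2 t : R),
    0 <= r -> (forall x, r < `|x - x0| -> eval e x = 0) ->
    measurable_fun setT u -> (forall x, `|u x| <= M) -> 0 <= K1 -> 0 <= K2 -> 0 < t ->
    (forall z, `|z| <= t -> `|J (fun x => u x * D2 (eval e) z x)| <= K1 * `|z| `^ p) ->
    (forall z, t < `|z| -> `|J (fun x => u x * D2 (eval e) z x)| <= K2 * `|z| `^ q) ->
    `|NL s e u| <= C * (K1 * t `^ (p - 2 * s) + K2 * t `^ (q - 2 * s)).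
Proof.
move=> sp qs.
have [C1 C10 hC1] := @kern_moment_small R n s s01 p sp.
have [C2 C20 hC2] := @kern_moment_large R n s s01 q qs.
exists (C1 + C2); first exact: addr_gt0.
move=> e x0 r u M K1 K2 t r0 re mu_ uM K10 K20 t0 small large.
have i1 := integrable_moment (measurable_cube 0 t) (hC1 _ t0).
have i2 := integrable_moment (measurable_ncube t) (hC2 _ t0).
have tp a : 0 <= t `^ a by exact: powR_ge0.
have h1 := Rintegral_moment_le (measurable_cube 0 t) (mulr_ge0 (ltW C10) (tp _)) (hC1 _ t0).
have h2 := Rintegral_moment_le (measurable_ncube t) (mulr_ge0 (ltW C20) (tp _)) (hC2 _ t0).
have iN := integrable_NL s01 r0 re mu_ uM.
pose m1 z : R := K1 * (\1_(cube (0 : E) t) z * (`|z| `^ p * kern z)).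
pose m2 z : R := K2 * (\1_(~` cube (0 : E) t) z * (`|z| `^ q * kern z)).
have im1 : mu.-integrable setT (EFin \o m1).
  by have := integrableZl measurableT K1 i1; apply: eq_integrable.
have im2 : mu.-integrable setT (EFin \o m2).
  by have := integrableZl measurableT K2 i2; apply: eq_integrable.
apply: (@le_trans _ _ (J (fun z => m1 z + m2 z))).
  apply: (le_trans (le_normr_Rintegral _ iN)) => //.
  apply: le_Rintegral => //.
  - exact: (integrable_abse iN).
  - exact: (integrableD measurableT im1 im2).
  move=> z _; rewrite normrM ger0_norm ?kern_ge0// /m1 /m2 !indicE.
  have [zt|zt] := leP `|z| t.
    rewrite (mem_set (_ : cube 0 t z)) /cube/= ?subr0//.
    rewrite memNset/=; last by rewrite subr0; exact.
    rewrite mul1r mul0r mulr0 addr0 mulrC mulrA ler_wpM2r ?kern_ge0//.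
    exact: small.
  rewrite memNset /cube/= ?subr0; last by apply/negP; rewrite -ltNge.
  rewrite mem_set/=; last by apply/negP; rewrite subr0 -ltNge.
  rewrite mul1r mul0r mulr0 add0r mulrC mulrA ler_wpM2r ?kern_ge0//.
  exact: large.
rewrite RintegralD// !RintegralZl//.
have a1 : K1 * J (fun z => \1_(cube (0 : E) t) z * (`|z| `^ p * kern z)) <= K1 * (C1 * t `^ (p - 2 * s)).
  exact: ler_wpM2l.
have a2 : K2 * J (fun z => \1_(~` cube (0 : E) t) z * (`|z| `^ q * kern z)) <= K2 * (C2 * t `^ (q - 2 * s)).
  exact: ler_wpM2l.
apply: (le_trans (lerD a1 a2)).
have b1 : 0 <= C2 * (K1 * t `^ (p - 2 * s)) by rewrite !mulr_ge0// ltW.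
have b2 : 0 <= C1 * (K2 * t `^ (q - 2 * s)) by rewrite !mulr_ge0// ltW.
by move: b1 b2; clear; lra.
Qed.

Definition test (f : expr R n) (h : R) x := subst_affine h (- (h *: x)) f.

Lemma eval_test f h x y : eval (test f h x) y = eval f (h *: (y - x)).
Proof. by rewrite eval_subst_affine scalerBr. Qed.

Lemma eval_lap_test f h x y : eval (lap (test f h x)) y = h ^+ 2 * eval (lap f) (h *: (y - x)).
Proof.
rewrite !eval_lap mulr_sumr; apply: eq_bigr => i _.
have -> : eval (dexpr i (dexpr i (test f h x))) y =
  eval (dexpr i (Mul (Const h) (subst_affine h (- (h *: x)) (dexpr i f)))) y.
  apply: (congr1 (@^~ y)); apply: eval_dexpr_ext.
  by apply/funext => w; rewrite /test eval_dexpr_subst_affine /= eval_subst_affine.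
rewrite /= mul0r add0r eval_dexpr_subst_affine mulrA -expr2.
by rewrite scalerBr.
Qed.

Lemma test_far f (r h : R) x : 0 < h -> supported r f -> forall y, r / h < `|y - x| ->
  eval (test f h x) y = 0.
Proof. by move=> h0 fr y yx; rewrite eval_test (scaled_far h0 fr). Qed.

Section one_test.
Variables (f : expr R n) (r : R).
Hypotheses (r0 : 0 <= r) (fr : supported r f).
Variable B : R.
Hypothesis fB : forall x, `|eval f x| <= B.
Hypothesis f2B : forall i j x, `|eval (dexpr i (dexpr j f)) x| <= B.

Let B0 : 0 <= B. Proof. exact: le_trans (fB 0). Qed.

Lemma D2_test_le h x z y :
  `|D2 (eval (test f h x)) z y| <= 2 * n.+1%:R ^+ 2 * B * h ^+ 2 * `|z| ^+ 2.
Proof.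
have -> : D2 (eval (test f h x)) z y = D2 (eval f) (h *: z) (h *: (y - x)).
  rewrite /D2 !eval_test -!scalerDr -scalerBr.
  by rewrite [y + z - x]addrAC [y - z - x]addrAC.
apply: (le_trans (D2_eval_le _ _ f2B)).
rewrite normrZ exprMn -[`|h| ^+ 2]normrX ger0_norm ?sqr_ge0// le_eqVlt.
by apply/orP; left; apply/eqP; ring.
Qed.

Lemma Rintegral_test_le h x : 0 < h -> J (fun y => `|eval (test f h x) y|) <= B * (2 * (r / h)) ^+ n.+1.
Proof.
move=> h0; apply: (le_trans (ler_norm _)); apply: (@Rintegral_bcs_le _ _ _ _ x).
- by rewrite divr_ge0// ltW.
- apply: measurable_norm_fun; exact/continuous_rV_measurable/continuous_eval.
- by move=> y; rewrite normr_id eval_test.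
- by move=> y yx; rewrite (test_far h0 fr yx) normr0.
Qed.

Lemma integrable_bcs_mul (u F : E -> R) (A b : R) x (q : R) : measurable_fun setT u ->
  (forall y, `|u y| <= A) -> measurable_fun setT F -> (forall y, `|F y| <= b) ->
  (forall y, q < `|y - x| -> F y = 0) -> mu.-integrable setT (EFin \o (fun y => u y * F y)).
Proof.
move=> mu_ uA mF Fb Fq; apply: (@integrable_bcs _ _ _ (A * b) x q).
- exact: measurable_funM.
- by move=> y; rewrite normrM ler_pM.
- by move=> y yx; rewrite Fq// mulr0.
Qed.

(** A weight of mean zero does not see the constant $u(x)$, and its symmetry about [x] permits
    averaging $u(x+w)$ with $u(x-w)$. Together they leave a second difference of [u] at [x]. *)
Lemma symmetric_weight (u F : E -> R) (A b : R) x (q : R) : measurable_fun setT u ->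
  (forall y, `|u y| <= A) -> measurable_fun setT F -> (forall y, `|F y| <= b) ->
  (forall y, q < `|y - x| -> F y = 0) -> (forall w, F (x - w) = F (x + w)) -> J F = 0 ->
  2 * J (fun y => u y * F y) = - J (fun w : E => D2 u w x * F (w + x)).
Proof.
move=> mu_ uA mF Fb Fq Fsym F0.
have mF' : measurable_fun setT (fun w : E => F (w + x)) by exact: measurable_shift.
have Fq' w : q < `|w - 0| -> F (w + x) = 0 by rewrite subr0 => qw; rewrite Fq// addrK.
have Fb' w : `|F (w + x)| <= b by [].
have i1 : mu.-integrable setT (EFin \o (fun w : E => u (w + x) * F (w + x))).
  by apply: (integrable_bcs_mul (measurable_shift x mu_) _ mF' Fb' Fq').
have i2 : mu.-integrable setT (EFin \o (fun w : E => u (x - w) * F (w + x))).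
  by apply: (integrable_bcs_mul (measurable_refl x mu_) _ mF' Fb' Fq').
have i3 : mu.-integrable setT (EFin \o (fun w : E => 2 * u x * F (w + x))).
  have := integrableZl measurableT (2 * u x) (integrable_bcs mF' Fb' Fq').
  by apply: eq_integrable.
have muF : measurable_fun setT (fun y => u y * F y) by exact: measurable_funM.
have e1 : J (fun w : E => u (w + x) * F (w + x)) = J (fun y => u y * F y).
  exact: (@Rintegral_shift _ _ (fun y => u y * F y) x).
have e2 : J (fun w : E => u (x - w) * F (w + x)) = J (fun y => u y * F y).
  rewrite -(Rintegral_refl x muF); apply: eq_Rintegral => w _.
  by rewrite Fsym [w + x]addrC.
have e3 : J (fun w : E => 2 * u x * F (w + x)) = 0.
  rewrite RintegralZl//; first by rewrite Rintegral_shift// F0 mulr0.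
  exact: (integrable_bcs mF' Fb' Fq').
transitivity (- J (fun w : E => 2 * u x * F (w + x) - u (w + x) * F (w + x) - u (x - w) * F (w + x))).
  have i12 : mu.-integrable setT (EFin \o (fun w : E => 2 * u x * F (w + x) - u (w + x) * F (w + x))).
    exact: (integrableB measurableT i3 i1).
  rewrite RintegralB// RintegralB// e1 e2 e3; ring.
congr (- _); apply: eq_Rintegral => w _.
by rewrite /D2 [w + x]addrC; ring.
Qed.

Lemma D2_test_sym h x z w : even_expr f ->
  D2 (eval (test f h x)) z (x - w) = D2 (eval (test f h x)) z (x + w).
Proof.
move=> fE; have tE y : eval (test f h x) (x - y) = eval (test f h x) (x + y).
  by rewrite !eval_test addrAC subrr add0r [x + y]addrC addrK scalerN fE.
rewrite /D2 tE -[x - w + z]addrA -[x - w - z]addrA -[- w - z]opprD.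
have -> : - w + z = - (w - z) by rewrite opprB addrC.
by rewrite !tE !addrA; ring.
Qed.

Lemma measurable_D2 (F : E -> R) z : measurable_fun setT F -> measurable_fun setT (D2 F z).
Proof.
move=> mF; apply: measurable_funB; last exact: measurable_shift.
apply: measurable_funB; last exact: measurable_shift.
by apply: measurable_funM; [exact: measurable_cst|].
Qed.

Lemma Rintegral_D2_test h x z : 0 < h -> J (D2 (eval (test f h x)) z) = 0.
Proof.
move=> h0.
have mt : measurable_fun setT (eval (test f h x)).
  exact/continuous_rV_measurable/continuous_eval.
have it w : mu.-integrable setT (EFin \o (fun y => eval (test f h x) (y + w))).
  apply: (@integrable_bcs _ _ _ B (x - w) (r / h)).
  - exact: measurable_shift.
  - by move=> y; rewrite eval_test.
  - by move=> y yx; rewrite (test_far h0 fr)//; move: yx; rewrite opprB addrA addrAC.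
have it0 : mu.-integrable setT (EFin \o (eval (test f h x))).
  by have := it 0; apply: eq_integrable => // y _ /=; rewrite addr0.
have it2 : mu.-integrable setT (EFin \o (fun y => 2 * eval (test f h x) y)).
  by have := integrableZl measurableT 2 it0; apply: eq_integrable.
rewrite RintegralB//; last exact: (integrableB measurableT it2 (it z)).
by rewrite RintegralB// RintegralZl// !Rintegral_shift//; ring.
Qed.

(** The second difference of the test function is of size $Bh^2|z|^2$, symmetric about [x] and of
    mean zero, so [symmetric_weight] brings in the second differences of [u] at [x]. The condition
    $|z|\le 1/h$ keeps their increments within $(r+1)/h$. *)
Lemma small_increment_le (u : E -> R) (A b h : R) x z : even_expr f -> 0 <= b -> 0 < h ->
  measurable_fun setT u -> (forall y, `|u y| <= A) ->
  (forall w, `|D2 u w x| <= A * `|w| `^ b) -> `|z| <= h^-1 ->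
  `|J (fun y => u y * D2 (eval (test f h x)) z y)| <=
    A * ((r + 1) / h) `^ b * (n.+1%:R ^+ 2 * B * h ^+ 2) * (2 * ((r + 1) / h)) ^+ n.+1 * `|z| ^+ 2.
Proof.
move=> fE b0 h0 mu_ uA D2A zh.
have A0 : 0 <= A by exact: le_trans (uA 0).
pose F := D2 (eval (test f h x)) z; pose q := (r + 1) / h.
have q0 : 0 <= q by rewrite divr_ge0 ?addr_ge0// ltW.
have mt : measurable_fun setT (eval (test f h x)).
  exact/continuous_rV_measurable/continuous_eval.
have mF : measurable_fun setT F by exact: measurable_D2.
have Fb := D2_test_le h x z.
have Fq y : q < `|y - x| -> F y = 0.
  move=> qy; rewrite /F (D2_far (test_far (x := x) h0 fr))//; apply: le_lt_trans qy.
  by rewrite /q mulrDl mul1r lerD2l.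
have := symmetric_weight mu_ uA mF Fb Fq (fun w => D2_test_sym _ _ _ _ fE) (Rintegral_D2_test _ _ h0).
move=> e2; have -> : J (fun y => u y * F y) = - 2^-1 * J (fun w : E => D2 u w x * F (w + x)).
  by lra.
rewrite normrM normrN (@gtr0_norm _ 2^-1)//.
have : `|J (fun w : E => D2 u w x * F (w + x))| <=
    (A * q `^ b) * (2 * n.+1%:R ^+ 2 * B * h ^+ 2 * `|z| ^+ 2) * (2 * q) ^+ n.+1.
  apply: (@Rintegral_bcs_le _ _ _ _ 0); first exact: q0.
  - apply: measurable_funM; last exact: measurable_shift.
    apply: measurable_funB; last exact: measurable_refl.
    apply: measurable_funB; first exact: measurable_cst.
    by under eq_fun do rewrite addrC; exact: measurable_shift.
  - move=> w; have [wq|wq] := leP `|w| q; last first.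
      rewrite Fq ?addrK// mulr0 normr0.
      rewrite mulr_ge0//; first by rewrite mulr_ge0 ?powR_ge0.
      exact: le_trans (Fb x).
    rewrite normrM ler_pM//; apply: (le_trans (D2A w)).
    by rewrite ler_wpM2l// ge0_ler_powR// nnegrE.
  - by move=> w qw; rewrite Fq ?mulr0//; move: qw; rewrite subr0 addrK.
rewrite -/q; set P := q `^ b; set Q := (2 * q) ^+ n.+1.
move=> hI; apply: (@le_trans _ _ (2^-1 * (A * P * (2 * n.+1%:R ^+ 2 * B * h ^+ 2 * `|z| ^+ 2) * Q))).
  by rewrite ler_wpM2l.
rewrite le_eqVlt; apply/orP; left; apply/eqP; by field.
Qed.

(** With the second difference moved to [u], only its size on the support of the test function, of
    volume $h^{-N}$ up to a constant, matters. *)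
Lemma large_increment_le (u : E -> R) (A b h : R) x z : 0 < h ->
  measurable_fun setT u -> (forall y, `|u y| <= A) ->
  (forall y, `|y - x| <= r / h -> `|D2 u z y| <= b) ->
  `|J (fun y => u y * D2 (eval (test f h x)) z y)| <= B * b * (2 * (r / h)) ^+ n.+1.
Proof.
move=> h0 mu_ uA D2b; have rh0 : 0 <= r / h by rewrite divr_ge0// ltW.
have b0 : 0 <= b by apply: le_trans (D2b x _); rewrite ?subrr ?normr0.
rewrite (second_difference_by_parts (test_far h0 fr) mu_ uA).
apply: (@Rintegral_bcs_le _ _ _ _ x); first exact: rh0.
- apply: measurable_funM; last exact: measurable_D2.
  exact/continuous_rV_measurable/continuous_eval.
- move=> y; have [yx|yx] := leP `|y - x| (r / h).
    by rewrite normrM ler_pM// ?eval_test//; exact: D2b.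
  by rewrite (test_far h0 fr)// mul0r normr0 mulr_ge0.
- by move=> y yx; rewrite (test_far h0 fr)// mul0r.
Qed.

(** The split at $|z|=1/h$ balances the two regimes: $h^{2-b}(1/h)^{2-2s}$ from the small increments
    and $(1/h)^{b-2s}$ from the large ones both equal $h^{2s-b}$. *)
Lemma NL_test_even_le (b : R) : even_expr f -> 0 <= b < 2 * s ->
  exists2 C : R, 0 < C & forall (u : E -> R) (A h : R) x, 0 < h ->
    measurable_fun setT u -> (forall y, `|u y| <= A) ->
    (forall y z, `|y - x| <= r / h -> `|D2 u z y| <= A * `|z| `^ b) ->
    `|NL s (test f h x) u| <= C * A * h `^ (2 * s - b) / h ^+ n.+1.
Proof.
move=> fE /andP[b0 bs].
have s2 : 2 * s < 2 by case/andP: s01; lra.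
have [C C0 hC] := NL_le s2 (introT andP (conj b0 bs)).
pose c1 := (r + 1) `^ b * (n.+1%:R ^+ 2 * B) * (2 * (r + 1)) ^+ n.+1.
pose c2 := B * (2 * r) ^+ n.+1.
have r10 : 0 <= r + 1 by rewrite addr_ge0.
have c10 : 0 <= c1 by rewrite !mulr_ge0 ?powR_ge0 ?exprn_ge0// mulr_ge0.
have c20 : 0 <= c2 by rewrite mulr_ge0// exprn_ge0// mulr_ge0.
exists (C * (c1 + c2 + 1)); first by rewrite mulr_gt0// ltr_wpDl// addr_ge0.
move=> u A h x h0 mu_ uA uP.
have A0 : 0 <= A by exact: le_trans (uA 0).
have hn0 := lt0r_neq0 h0; have hV0 : 0 < h^-1 by rewrite invr_gt0.
have hN0 : h ^+ n.+1 != 0 by rewrite expf_neq0.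
pose K1 := A * ((r + 1) / h) `^ b * (n.+1%:R ^+ 2 * B * h ^+ 2) * (2 * ((r + 1) / h)) ^+ n.+1.
pose K2 := B * A * (2 * (r / h)) ^+ n.+1.
have rh0 : 0 <= r / h by rewrite divr_ge0// ltW.
have K10 : 0 <= K1.
  have rq0 : 0 <= (r + 1) / h by rewrite divr_ge0// ltW.
  by rewrite !mulr_ge0 ?powR_ge0 ?exprn_ge0 ?mulr_ge0// ltW.
have K20 : 0 <= K2 by rewrite !mulr_ge0// exprn_ge0// mulr_ge0.
have hVp a : h^-1 `^ a = h `^ (- a) by rewrite -powR_inv1 ?ltW// -powRrM mulN1r.
have := hC (test f h x) x (r / h) u A K1 K2 h^-1 rh0 (test_far h0 fr) mu_ uA K10 K20 hV0.
have sm z : `|z| <= h^-1 -> `|J (fun y => u y * D2 (eval (test f h x)) z y)| <= K1 * `|z| `^ 2.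
  move=> zh; rewrite powR_mulrn//; apply: small_increment_le => // w.
  by apply: uP; rewrite subrr normr0.
have la z : h^-1 < `|z| -> `|J (fun y => u y * D2 (eval (test f h x)) z y)| <= K2 * `|z| `^ b.
  move=> zh; have := @large_increment_le u A (A * `|z| `^ b) h x z h0 mu_ uA.
  move=> /(_ (fun y => uP y z)) /le_trans; apply.
  by rewrite /K2 le_eqVlt; apply/orP; left; apply/eqP; ring.
move=> /(_ sm la) /le_trans; apply.
set P := h `^ (2 * s - b).
have -> : K1 * h^-1 `^ (2 - 2 * s) = c1 * A * P / h ^+ n.+1.
  rewrite /K1 powRM ?(ltW hV0)// !exprMn !exprVn !hVp.
  have -> : P = h `^ (- b) * h ^+ 2 * h `^ (- (2 - 2 * s)).
    rewrite -powR_mulrn ?ltW// -!powRD; last 2 first.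
    - by apply/implyP => /eqP; lra.
    - by apply/implyP.
    by congr (h `^ _); lra.
  by rewrite /c1 !exprMn; ring.
have -> : K2 * h^-1 `^ (b - 2 * s) = c2 * A * P / h ^+ n.+1.
  by rewrite /K2 !exprMn !exprVn hVp opprB -/P /c2 !exprMn; ring.
have w0 : 0 <= C * A * P / h ^+ n.+1.
  by rewrite !mulr_ge0 ?powR_ge0 ?invr_ge0 ?exprn_ge0// ltW.
rewrite (_ : C * (c1 + c2 + 1) * A * P / h ^+ n.+1 =
  C * (c1 * A * P / h ^+ n.+1 + c2 * A * P / h ^+ n.+1) + C * A * P / h ^+ n.+1).
  by rewrite lerDl.
by ring.
Qed.

(** Second differences of order $b>2s$ are integrable against the kernel near the origin, so the
    difference is always put on [u] and the integral is split at $|z|=1$. The bound has the order of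
    a bounded right-hand side and asks for no symmetry of [f]. *)
Lemma NL_test_le (b : R) : 2 * s < b ->
  exists2 C : R, 0 < C & forall (u : E -> R) (A h : R) x, 0 < h ->
    measurable_fun setT u -> (forall y, `|u y| <= A) ->
    (forall y z, `|y - x| <= r / h -> `|D2 u z y| <= A * `|z| `^ b) ->
    `|NL s (test f h x) u| <= C * A / h ^+ n.+1.
Proof.
move=> bs.
have s2 : (0 : R) <= 0 < 2 * s by rewrite lexx/= mulr_gt0//; case/andP: s01.
have [C C0 hC] := NL_le bs s2.
pose c1 := B * (2 * r) ^+ n.+1; pose c2 := B * 4 * (2 * r) ^+ n.+1.
have c10 : 0 <= c1 by rewrite mulr_ge0// exprn_ge0// mulr_ge0.
have c20 : 0 <= c2 by rewrite mulr_ge0 ?mulr_ge0// exprn_ge0// mulr_ge0.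
exists (C * (c1 + c2 + 1)); first by rewrite mulr_gt0// ltr_wpDl// addr_ge0.
move=> u A h x h0 mu_ uA uP.
have A0 : 0 <= A by exact: le_trans (uA 0).
pose K1 := B * A * (2 * (r / h)) ^+ n.+1; pose K2 := B * (4 * A) * (2 * (r / h)) ^+ n.+1.
have rh0 : 0 <= r / h by rewrite divr_ge0// ltW.
have K10 : 0 <= K1 by rewrite !mulr_ge0// exprn_ge0// mulr_ge0.
have K20 : 0 <= K2 by rewrite !mulr_ge0// exprn_ge0// mulr_ge0.
have := hC (test f h x) x (r / h) u A K1 K2 1 rh0 (test_far h0 fr) mu_ uA K10 K20 ltr01.
have sm z : `|z| <= 1 -> `|J (fun y => u y * D2 (eval (test f h x)) z y)| <= K1 * `|z| `^ b.
  move=> zh; have := @large_increment_le u A (A * `|z| `^ b) h x z h0 mu_ uA.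
  move=> /(_ (fun y => uP y z)) /le_trans; apply.
  by rewrite /K1 le_eqVlt; apply/orP; left; apply/eqP; ring.
have la z : 1 < `|z| -> `|J (fun y => u y * D2 (eval (test f h x)) z y)| <= K2 * `|z| `^ 0.
  move=> _; rewrite powRr0 mulr1.
  by apply: (@large_increment_le u A (4 * A) h x z h0 mu_ uA) => y _; exact: D2_le.
move=> /(_ sm la) /le_trans; apply.
rewrite !powR1 !mulr1.
have -> : K1 = c1 * A / h ^+ n.+1 by rewrite /K1 /c1 !exprMn !exprVn; ring.
have -> : K2 = c2 * A / h ^+ n.+1 by rewrite /K2 /c2 !exprMn !exprVn; ring.
have w0 : 0 <= C * A / h ^+ n.+1 by rewrite !mulr_ge0 ?invr_ge0 ?exprn_ge0// ltW.
rewrite (_ : C * (c1 + c2 + 1) * A / h ^+ n.+1 =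
  C * (c1 * A / h ^+ n.+1 + c2 * A / h ^+ n.+1) + C * A / h ^+ n.+1).
  by rewrite lerDl.
by ring.
Qed.

End one_test.

End nonlocal_estimates.

(** * Decay and convergence of averages *)

Section decay.
Context {R : realType} {n : nat}.
Local Notation E := 'rV[R]_n.+1.
Local Notation mu := (@lebesgue_rV R n).
Local Notation J f := (\int[mu]_x f x).
Implicit Types (x y z : E) (V : set E) (u : E -> R).

Definition mollifier_mass : R := J (eval (@mollifier R n)).

Let mmoll : measurable_fun setT (eval (@mollifier R n)).
Proof. exact/continuous_rV_measurable/continuous_eval. Qed.

Let radius_ge0 : 0 <= n.+2%:R :> R. Proof. exact: ler0n. Qed.

(** If the mass were zero, the mollifier would vanish almost everywhere, and the unit cube, on which
    it is positive, would be a null set, against [leb_outer_unit_cube]. *)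
Lemma mollifier_mass_gt0 : 0 < mollifier_mass.
Proof.
have [B _ hB] := eval_bounded (@supported_mollifier R n).
have re x : n.+2%:R < `|x - 0| -> eval (@mollifier R n) x = 0.
  by rewrite subr0; exact: supported_mollifier.
have im := integrable_bcs mmoll hB re.
rewrite lt_neqAle Rintegral_ge0 ?andbT//; last by move=> x _; exact: mollifier_ge0.
apply/eqP => m0.
have : (\int[mu]_x `|(eval (@mollifier R n) x)%:E| = 0)%E.
  under eq_integral do rewrite gee0_abs ?lee_fin ?mollifier_ge0//.
  by rewrite -(fineK (integrable_fin_num measurableT im)) /= -[fine _]/(mollifier_mass) -m0.
move/(ae_eq_integral_abs mu measurableT); case; first exact/measurable_EFinP.
move=> N [mN N0].
have cubeN : box (const_mx 0) (const_mx 1) `<=` N -> False.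
  move=> cN; have := le_leb_outer cN; rewrite -[leb_outer N]/(mu N) N0 => le0.
  by have := le_trans (@leb_outer_unit_cube R n) le0; rewrite lee_fin ler10.
move=> hN; apply: cubeN => x hx; apply: hN => /= /(_ I).
(* On the unit cube the sum of squares is at most $N$, below the constant $N+1$ in [radial]. *)
have rad : 0 < eval (@radial R n) x.
  rewrite eval_radial subr_gt0; apply: (@le_lt_trans _ _ n.+1%:R); last by rewrite ltr_nat.
  rewrite -[X in X%:R](@card_ord n.+1) -sum1_card natr_sum; apply: ler_sum => i _.
  have := hx i; rewrite !mxE => /andP[x0 x1]; rewrite expr2.
  by rewrite -[leRHS]mulr1 ler_pM.
by case=> /eqP; rewrite mulf_eq0 pnatr_eq0/= gt_eqF// bump1_gt0.
Qed.

Lemma average_cst e i (r h : R) x : supported r e -> 0 < h ->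
  average (cst 1) (dexpr i e) h x = 0.
Proof.
move=> re h0; have h_neq0 := lt0r_neq0 h0.
pose g : expr R n := Mul (Const h^-1) (test e h x).
have tr : supported (r / h + `|x|) g.
  move=> y yr; rewrite /= (test_far h0 re) ?mulr0//.
  by have := ler_normB (y - x) (- x); rewrite opprK subrK normrN; lra.
rewrite -[RHS](Rintegral_dexpr0 i tr); apply: eq_Rintegral => y _.
rewrite /= mul0r add0r mul1r eval_dexpr_subst_affine mulrA mulVf// mul1r.
by rewrite scalerBr.
Qed.

Lemma average_lap (u : E -> R) (A : R) e (r h : R) x : measurable_fun setT u ->
  (forall y, `|u y| <= A) -> supported r e -> 0 < h ->
  average u (lap e) h x = \sum_i average u (dexpr i (dexpr i e)) h x.
Proof.
move=> mu_ uA re h0.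
have iF i : mu.-integrable setT (EFin \o (fun y => u y * eval (dexpr i (dexpr i e)) (h *: (y - x)))).
  apply: (integrable_average mu_ uA x _ h0); apply: supported_dexpr.
  exact: supported_dexpr re.
have [_ <-] := Rintegral_sum (index_enum 'I_n.+1) measurableT iF.
by apply: eq_Rintegral => y _; rewrite eval_lap mulr_sumr.
Qed.

(** The pairing applied to $u=1$ shows independence of [h]: the frequency derivative is the integral
    of a Laplacian, hence zero. A dilation formula for Lebesgue measure is avoided in this way. *)
Lemma average_mollifier_cst (h : R) x : 0 < h ->
  scaled_average (cst 1) n.+1 (@mollifier R n) h x = mollifier_mass.
Proof.
move=> h0.
have c1 (y : E) : `|(cst 1 : E -> R) y| <= 1 by rewrite /cst normr1.
have mc := @measurable_cst _ _ E R setT 1.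
have D (t : R) : 0 < t -> is_derive t 1 (scaled_average (cst 1) n.+1 (@mollifier R n) ^~ x) 0.
  move=> t0; have := is_derive_scaled_average mc c1 x radius_ge0 (@supported_mollifier R n)
     (@supported_theta R n) t0 (@paired_mollifier R n).
  rewrite (average_lap x mc c1 (@supported_theta R n) t0) big1 ?mulr0 ?oppr0// => i _.
  exact: (average_cst i x (supported_dexpr i (@supported_theta R n)) t0).
have cst_eq (a b : R) : 0 < a -> a <= b ->
    scaled_average (cst 1) n.+1 (@mollifier R n) a x =
    scaled_average (cst 1) n.+1 (@mollifier R n) b x.
  move=> a0 ab; apply/esym/eqP; rewrite -subr_eq0 -normr_le0.
  have -> : (0 : R) = 0 * (b - a) by rewrite mul0r.
  apply: (@increment_le_cst R (scaled_average (cst 1) n.+1 (@mollifier R n) ^~ x) (fun _ => 0)) => //.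
    by move=> t /andP[ta _]; apply: D; exact: lt_le_trans ta.
  by move=> t _; rewrite normr0.
transitivity (scaled_average (cst 1) n.+1 (@mollifier R n) 1 x).
  by have [h1|/ltW h1] := leP h 1; [exact: cst_eq|apply/esym/cst_eq].
rewrite /scaled_average expr1n mul1r /average.
rewrite -[RHS](@Rintegral_shift _ _ _ (- x))//; apply: eq_Rintegral => y _.
by rewrite scale1r mul1r.
Qed.

(** Taken in the sup norm, in accordance with the cubes that contain the supports of test
    functions. *)
Definition nbd V (r : R) : set E := [set x | exists2 y, V y & `|x - y| < r].

(* [- Delta u + (- Delta)^s u = f] near [V] for some [|f| <= A], with all
   derivatives on the test function; the condition on [x0] keeps the support of
   the test function within sup-norm distance [r] of [V]. *)
Definition solves (s : R) V (r : R) u (A : R) : Prop :=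
  [/\ measurable_fun setT u, forall x, `|u x| <= A &
   forall (e : expr R n) x0 (t : R), 0 <= t -> (forall x, t < `|x - x0| -> eval e x = 0) ->
     nbd V (r - t) x0 ->
     `|J (fun x => u x * eval (lap e) x) - NL s e u| <= A * J (fun x => `|eval e x|)].

(** The point is local but the increment is arbitrary, because the nonlocal form involves all
    increments. *)
Definition second_order V (r : R) u (A b : R) : Prop :=
  forall x z, nbd V r x -> `|D2 u z x| <= A * `|z| `^ b.

Lemma nbdW V (r r' : R) x y : nbd V (r - r') x -> `|y - x| <= r' -> nbd V r y.
Proof.
move=> -[w Vw xw] yx; exists w => //; have := ler_normD (y - x) (x - w).
by rewrite addrA subrK; lra.
Qed.

Variable s : R.
Hypothesis s01 : 0 < s < 1.

Lemma average_lap_le V u (A r h B : R) f (q : R) x : 0 <= q -> supported q f ->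
  (forall y, `|eval f y| <= B) -> 0 < h -> nbd V (r - q / h) x -> solves s V r u A ->
  h ^+ 2 * `|average u (lap f) h x| <= `|NL s (test f h x) u| + A * B * (2 * q) ^+ n.+1 / h ^+ n.+1.
Proof.
move=> q0 fq fB h0 Vx [mu_ uA /(_ (test f h x) x (q / h))].
have A0 : 0 <= A by exact: le_trans (uA 0).
have -> : J (fun y => u y * eval (lap (test f h x)) y) = h ^+ 2 * average u (lap f) h x.
  rewrite -RintegralZl//; last exact: (integrable_average mu_ uA x (supported_lap fq) h0).
  by apply: eq_Rintegral => y _; rewrite eval_lap_test mulrCA.
move=> /(_ (divr_ge0 q0 (ltW h0)) (test_far h0 fq) Vx) hS.
have hT := Rintegral_test_le q0 fq fB x h0.
have : A * J (fun y => `|eval (test f h x) y|) <= A * B * (2 * q) ^+ n.+1 / h ^+ n.+1.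
  apply: (@le_trans _ _ (A * (B * (2 * (q / h)) ^+ n.+1))); first by rewrite ler_wpM2l.
  by rewrite le_eqVlt; apply/orP; left; apply/eqP; rewrite !exprMn exprVn; ring.
have -> : h ^+ 2 * `|average u (lap f) h x| = `|h ^+ 2 * average u (lap f) h x|.
  by rewrite normrM [`|h ^+ 2|]ger0_norm ?sqr_ge0.
have := ler_normD (h ^+ 2 * average u (lap f) h x - NL s (test f h x) u) (NL s (test f h x) u).
by rewrite subrK; lra.
Qed.

Lemma eval_ddexpr_bounded f (q : R) : supported q f -> exists2 B : R, 0 < B &
  (forall x, `|eval f x| <= B) /\ forall i j x, `|eval (dexpr i (dexpr j f)) x| <= B.
Proof.
move=> fq; have [B0 B00 hB0] := eval_bounded fq.
have /choice[b hb] : forall p : 'I_n.+1 * 'I_n.+1, exists c : R,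
    0 <= c /\ forall x, `|eval (dexpr p.1 (dexpr p.2 f)) x| <= c.
  move=> p; have [c c0 hc] := eval_bounded (supported_dexpr p.1 (supported_dexpr p.2 fq)).
  by exists c; split; [exact: ltW|].
have b0 : 0 <= \sum_p b p by apply: sumr_ge0 => p _; exact: (hb p).1.
exists (B0 + \sum_p b p); first by rewrite ltr_pwDl.
split=> [x|i j x]; first by apply: le_trans (hB0 x) _; rewrite lerDl.
apply: (le_trans ((hb (i, j)).2 x)); rewrite (bigD1 (i, j))//= addrCA lerDl.
by rewrite addr_ge0 ?(ltW B00)//; apply: sumr_ge0 => p _; exact: (hb p).1.
Qed.

Let s2 : 0 < 2 * s. Proof. by rewrite mulr_gt0//; case/andP: s01. Qed.

(** The Laplacian of the test function carries $h^2$, so the nonlocal bound of order $h^{2s-b}$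
    yields the rate $h^{-(b+2-2s)}$. *)
Lemma decay_even f (q h0 b : R) : 0 <= q -> supported q f -> even_expr f -> 0 < h0 ->
  0 <= b < 2 * s ->
  exists2 C : R, 0 < C & forall V u (A r h : R) x, solves s V r u A -> second_order V r u A b ->
    h0 <= h -> nbd V (r - q / h) x ->
    `|average u (lap f) h x| <= C * A * h `^ (- (b + 2 - 2 * s)) / h ^+ n.+1.
Proof.
move=> q0 fq fE h00 bs; have [B B0 [fB f2B]] := eval_ddexpr_bounded fq.
have [C C0 hC] := NL_test_even_le s01 q0 fq fB f2B fE bs.
have {}bs : b < 2 * s by case/andP : bs.
(* The bounded right-hand side is absorbed into $h^{2s-b}$, which is at least $h_0^{2s-b}$. *)
pose c := B * (2 * q) ^+ n.+1 * h0 `^ (- (2 * s - b)).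
have c0 : 0 <= c by rewrite !mulr_ge0 ?powR_ge0 ?exprn_ge0 ?mulr_ge0// ltW.
exists (C + c); first by rewrite ltr_pwDl.
move=> V u A r h x us uP h0h Vx; have h_gt0 := lt_le_trans h00 h0h.
have [mu_ uA _] := us; have A0 : 0 <= A by exact: le_trans (uA 0).
have := average_lap_le q0 fq fB h_gt0 Vx us.
have := hC u A h x h_gt0 mu_ uA (fun y z yx => uP y z (nbdW Vx yx)).
set P := h `^ (2 * s - b) => h1 h2.
have cP : B * (2 * q) ^+ n.+1 <= c * P.
  rewrite /c /P -mulrA ler_peMr//.
    by rewrite mulr_ge0 ?(ltW B0)// exprn_ge0// mulr_ge0.
  rewrite powRN mulrC ler_pdivlMr ?powR_gt0// mul1r.
  by rewrite ge0_ler_powR ?nnegrE ?subr_ge0// ltW.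
have hN : 0 < h ^+ n.+1 by rewrite exprn_gt0.
have h2_gt0 : 0 < h ^+ 2 by rewrite exprn_gt0.
rewrite -(ler_pM2l h2_gt0); apply: (le_trans h2).
have -> : h ^+ 2 * ((C + c) * A * h `^ (- (b + 2 - 2 * s)) / h ^+ n.+1) =
    C * A * P / h ^+ n.+1 + A * (c * P) / h ^+ n.+1.
  have -> : P = h ^+ 2 * h `^ (- (b + 2 - 2 * s)).
    rewrite -powR_mulrn ?ltW// -powRD; first by congr (h `^ _); lra.
    by rewrite (gt_eqF h_gt0) implybT.
  by ring.
apply: lerD; first exact: h1.
by rewrite ler_wpM2r ?invr_ge0 ?(ltW hN)// -[A * B * _]mulrA ler_wpM2l.
Qed.

(** Both contributions now give the rate $h^{-2}$. The weaker rate $h^{-g}$, which holds from [h0]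
    on, is the one that is integrated later. *)
Lemma decay_any f (q h0 b g : R) : 0 <= q -> supported q f -> 0 < h0 -> 2 * s < b -> g <= 2 ->
  exists2 C : R, 0 < C & forall V u (A r h : R) x, solves s V r u A -> second_order V r u A b ->
    h0 <= h -> nbd V (r - q / h) x ->
    `|average u (lap f) h x| <= C * A * h `^ (- g) / h ^+ n.+1.
Proof.
move=> q0 fq h00 bs g2; have [B B0 [fB f2B]] := eval_ddexpr_bounded fq.
have [C C0 hC] := NL_test_le s01 q0 fq fB bs.
pose c := h0 `^ (- (2 - g)) * (C + B * (2 * q) ^+ n.+1).
have c0 : 0 < c.
  by rewrite mulr_gt0 ?powR_gt0// ltr_pwDl// mulr_ge0 ?(ltW B0)// exprn_ge0// mulr_ge0.
exists c => // V u A r h x us uP h0h Vx; have h_gt0 := lt_le_trans h00 h0h.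
have [mu_ uA _] := us; have A0 : 0 <= A by exact: le_trans (uA 0).
have := average_lap_le q0 fq fB h_gt0 Vx us.
have := hC u A h x h_gt0 mu_ uA (fun y z yx => uP y z (nbdW Vx yx)).
set P := h `^ (2 - g) => h1 h2.
have cP : 1 <= h0 `^ (- (2 - g)) * P.
  rewrite powRN mulrC ler_pdivlMr ?powR_gt0// mul1r.
  by rewrite ge0_ler_powR ?nnegrE ?subr_ge0// ltW.
have hN : 0 < h ^+ n.+1 by rewrite exprn_gt0.
have h2_gt0 : 0 < h ^+ 2 by rewrite exprn_gt0.
rewrite -(ler_pM2l h2_gt0); apply: (le_trans h2).
have -> : h ^+ 2 * (c * A * h `^ (- g) / h ^+ n.+1) =
    (h0 `^ (- (2 - g)) * P) * (C * A / h ^+ n.+1 + A * B * (2 * q) ^+ n.+1 / h ^+ n.+1).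
  have -> : P = h ^+ 2 * h `^ (- g).
    rewrite -powR_mulrn ?ltW// -powRD; first by congr (h `^ _).
    by rewrite (gt_eqF h_gt0) implybT.
  by rewrite /c; ring.
apply: (@le_trans _ _ (C * A / h ^+ n.+1 + A * B * (2 * q) ^+ n.+1 / h ^+ n.+1)).
  by rewrite lerD2r.
rewrite ler_peMl// addr_ge0// divr_ge0 ?(ltW hN)// ?mulr_ge0 ?(ltW C0) ?(ltW B0)//.
by rewrite exprn_ge0// mulr_ge0.
Qed.

End decay.

Section limits.
Context {R : realType}.

Lemma norm_second_difference (D a b d P Q : R) : `|D| <= Q -> `|a| <= P -> `|b| <= P ->
  `|d| <= P -> `|D - 2 * a + b + d| <= 4 * P + Q.
Proof.
move=> DQ aP bP dP; have t1 := ler_normD (D - 2 * a + b) d.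
have t2 := ler_normD (D - 2 * a) b.
have t3 := ler_normB D (2 * a).
have t4 : `|2 * a| <= 2 * P by rewrite normrM [`|2|]ger0_norm// ler_wpM2l.
by lra.
Qed.

Lemma norm_difference3 (a b d P Q : R) : `|a| <= P -> `|b| <= P -> `|d| <= Q ->
  `|a - b - d| <= 2 * P + Q.
Proof.
move=> aP bP dQ; have t1 := ler_normB (a - b) d.
by have t2 := ler_normB a b; lra.
Qed.

Lemma norm_difference4 (D a b d P Q T : R) : `|D| <= Q -> `|a| <= P -> `|b| <= P ->
  `|d| <= T -> `|D - a + b - d| <= 2 * P + T + Q.
Proof.
move=> DQ aP bP dT; have t1 := ler_normB (D - a + b) d.
have t2 := ler_normD (D - a) b.
by have t3 := ler_normB D a; lra.
Qed.

(** The increment bound is uniform in the upper frequency, so it survives the limit. The integers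
    [k.+1] are a cofinal sequence of positive frequencies. *)
Lemma cauchy_limit (F : R -> R) (K g h0 : R) : 0 < g -> 0 < h0 -> 0 <= K ->
  (forall a b, h0 <= a -> a <= b -> `|F b - F a| <= K * a `^ (- g)) ->
  exists l : R, F k.+1%:R @[k --> \oo] --> l /\
    forall h, h0 <= h -> `|F h - l| <= K * h `^ (- g).
Proof.
move=> g0 h00 K0 hF.
have near_ge h : \forall k \near \oo, h <= k.+1%:R :> R.
  exists (Num.truncn `|h|) => // k /= hk.
  apply: (le_trans (ler_norm h)); apply: (le_trans (ltW (truncnS_gt _))).
  by rewrite ler_nat ltnS.
have small (e : R) : 0 < e -> exists2 h, h0 <= h & K * h `^ (- g) < e.
  move=> e0; pose t := (K + 1) / e.
  have t0 : 0 < t by rewrite divr_gt0// ltr_wpDl.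
  pose h := Num.max h0 (t `^ g^-1).
  have hh : 0 < h by rewrite lt_max h00.
  exists h; first by rewrite le_max lexx.
  have : t <= h `^ g.
    rewrite -[leLHS](powRr1 (ltW t0)) -(mulVf (lt0r_neq0 g0)) powRrM.
    by rewrite ge0_ler_powR ?(ltW g0) ?nnegrE ?powR_ge0 ?(ltW hh)// le_max lexx orbT.
  rewrite /t ler_pdivrMr// powRN ltr_pdivrMr ?powR_gt0// [e * _]mulrC.
  by lra.
have cF : cvg (F k.+1%:R @[k --> \oo]).
  apply/cauchy_cvgP/cauchy_exP => e e0.
  have [h h0h he] := small _ e0; exists (F h).
  have := near_ge h; apply: filterS => k hk; rewrite /ball/=.
  by rewrite distrC; apply: le_lt_trans he; exact: hF.
exists (lim (F k.+1%:R @[k --> \oo])); split => // h h0h.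
have cD : `|F k.+1%:R - F h| @[k --> \oo] --> `|lim (F k.+1%:R @[k --> \oo]) - F h|.
  by apply: cvg_norm; apply: cvgB => //; exact: cvg_cst.
rewrite distrC -(cvg_lim (@Rhausdorff R) cD); apply: limr_le.
  by apply/cvg_ex; eexists; exact: cD.
have := near_ge h; apply: filterS => k hk; exact: hF.
Qed.

End limits.

(** * From decay of averages to regularity of their limit *)

Section improvement.
Context {R : realType} {n : nat}.
Local Notation E := 'rV[R]_n.+1.
Local Notation mu := (@lebesgue_rV R n).
Local Notation J f := (\int[mu]_x f x).
Implicit Types (x y z : E).
Local Notation theta := (@theta R n).
Local Notation psi := (@mollifier R n).
Local Notation c := (@mollifier_mass R n).
Local Notation q := (n.+2%:R : R).

Let q0 : 0 <= q. Proof. exact: ler0n. Qed.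

Variables (u : E -> R) (A : R).
Hypotheses (mu_ : measurable_fun setT u) (uA : forall x, `|u x| <= A).
Variables (K g h0 : R).
Hypotheses (K0 : 0 <= K) (g02 : 0 < g < 2) (h00 : 0 < h0).

Let g0 : 0 < g. Proof. by case/andP: g02. Qed.
Let g2 : 0 < 2 - g. Proof. by rewrite subr_gt0; case/andP: g02. Qed.
Let A0 : 0 <= A. Proof. exact: le_trans (uA 0). Qed.

Definition decays (f : expr R n) x :=
  forall h, h0 <= h -> `|average u (lap f) h x| <= K * h `^ (- g) / h ^+ n.+1.

Lemma scaled_average_le m e (B h : R) x : supported q e -> (forall y, `|eval e y| <= B) -> 0 < h ->
  `|scaled_average u (n.+1 + m) e h x| <= A * B * (2 * q) ^+ n.+1 * h ^+ m.
Proof.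
move=> eq eB hh; rewrite /scaled_average normrM ger0_norm ?exprn_ge0 ?(ltW hh)//.
have := average_le mu_ uA q0 eq x hh eB.
have hn : h ^+ n.+1 != 0 by rewrite expf_neq0 ?lt0r_neq0.
move=> /(ler_wpM2l (exprn_ge0 (n.+1 + m) (ltW hh))) /le_trans; apply.
rewrite le_eqVlt; apply/orP; left; apply/eqP.
by rewrite exprD !exprMn exprVn; field.
Qed.

(** The powers combine as $h^{N+m-1}\cdot h^{-g-N}=h^{m-g-1}$, whose primitive is
    $h^{m-g}/(m-g)$. *)
Lemma scaled_average_increment m e f (a b : R) x : m%:R - g != 0 ->
  supported q e -> supported q f ->
  paired (n.+1 + m)%:R e f -> decays f x -> h0 <= a -> a <= b ->
  `|scaled_average u (n.+1 + m) e b x - scaled_average u (n.+1 + m) e a x| <=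
    K / (m%:R - g) * (b `^ (m%:R - g) - a `^ (m%:R - g)).
Proof.
move=> mg eq fq ef fx ha ab; have a0 : 0 < a := lt_le_trans h00 ha.
apply: (@increment_le_powR R (scaled_average u (n.+1 + m) e ^~ x)
   (fun h => - (h ^+ (n.+1 + m) * h^-1 * average u (lap f) h x)) K) => //.
- move=> h /andP[ah _]; have hh := lt_le_trans a0 ah.
  exact: (is_derive_scaled_average mu_ uA x q0 eq fq hh ef).
- move=> h /andP[ah _]; have hh := lt_le_trans a0 ah.
  have hn : h ^+ n.+1 != 0 by rewrite expf_neq0 ?lt0r_neq0.
  rewrite normrN normrM ger0_norm; last first.
    by rewrite mulr_ge0 ?exprn_ge0 ?invr_ge0 ?(ltW hh).
  have := fx h (le_trans ha ah).
  have w0 : 0 <= h ^+ (n.+1 + m) * h^-1 by rewrite mulr_ge0 ?exprn_ge0 ?invr_ge0 ?(ltW hh).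
  move=> /(ler_wpM2l w0) /le_trans; apply.
  have -> : h `^ (m%:R - g - 1) = h ^+ m * h^-1 * h `^ (- g).
    rewrite -powR_mulrn ?(ltW hh)// -(powR_inv1 (ltW hh)) -!powRD ?(gt_eqF hh) ?implybT//.
    by congr (_ `^ _); lra.
  rewrite le_eqVlt; apply/orP; left; apply/eqP.
  by rewrite exprD; field; rewrite hn lt0r_neq0.
Qed.

Lemma scaled_average_limit m e f x : m%:R < g -> supported q e -> supported q f ->
  paired (n.+1 + m)%:R e f -> decays f x ->
  exists l : R, scaled_average u (n.+1 + m) e k.+1%:R x @[k --> \oo] --> l /\
   forall h, h0 <= h ->
     `|scaled_average u (n.+1 + m) e h x - l| <= K / (g - m%:R) * h `^ (m%:R - g).
Proof.
move=> mg eq fq ef fx.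
have [|||a b ha ab|l [lc hl]] := @cauchy_limit R (scaled_average u (n.+1 + m) e ^~ x)
    (K / (g - m%:R)) (g - m%:R) h0.
- by rewrite subr_gt0.
- by [].
- by rewrite divr_ge0// subr_ge0 ltW.
- have mg' : m%:R - g != 0 by rewrite subr_eq0 lt_eqF.
  apply: (le_trans (scaled_average_increment mg' eq fq ef fx ha ab)).
  rewrite opprB -[m%:R - g]opprB invrN mulrN mulNr -mulrN opprB ler_wpM2l//.
    by rewrite divr_ge0// subr_ge0 ltW.
  by rewrite opprB gerBl powR_ge0.
exists l; split => // h hh; have := hl h hh; by rewrite opprB.
Qed.

Lemma average_taylor_le e (a L : R) x z : supported q e -> 0 < a ->
  (forall i t, 0 <= t <= 1 ->
    `|average u (dexpr i e) a (x + t *: z) - average u (dexpr i e) a x| <= L) ->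
  `|average u e a (x + z) - average u e a x + a * \sum_i z 0 i * average u (dexpr i e) a x| <=
    a * (n.+1%:R * (`|z| * L)).
Proof.
move=> eq a0 avL; pose av i (t : R) := average u (dexpr i e) a (x + t *: z).
pose m := a * \sum_i z 0 i * average u (dexpr i e) a x.
pose F (t : R) : R := average u e a (x + t *: z) + m * t.
pose dF (t : R) : R := - a * (\sum_i z 0 i * av i t) + m.
have DF (t : R) : 0 <= t <= 1 -> is_derive t 1 F (dF t).
  move=> _; have D1 := is_derive_average_line mu_ uA q0 eq x z t a0.
  have D2 : is_derive t 1 (fun t : R => m * t) m.
    have := @is_deriveZ _ _ _ id m t 1 1 (is_derive_id _ _).
    by rewrite [_ *: 1]mulr1.
  exact: (is_deriveD D1 D2).
have dFb t : 0 <= t <= 1 -> `|dF t| <= a * (n.+1%:R * (`|z| * L)).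
  move=> t01; have -> : dF t = - (a * \sum_i z 0 i * (av i t - average u (dexpr i e) a x)).
    under eq_bigr do rewrite mulrBr.
    by rewrite sumrB mulrBr opprB addrC -mulNr.
  rewrite normrN normrM (gtr0_norm a0) ler_wpM2l ?(ltW a0)//.
  apply: (le_trans (ler_norm_sum _ _ _)).
  apply: (@le_trans _ _ (\sum_(i < n.+1) (`|z| * L))).
    by apply: ler_sum => i _; rewrite normrM ler_pM ?coord_le_norm//; exact: avL.
  by rewrite big_const_ord iter_addr_0 mulr_natl.
have := increment_le_cst ler01 DF dFb; rewrite subr0 mulr1.
by rewrite /F scale1r scale0r addr0 mulr1 mulr0 addr0 addrAC.
Qed.

Let paired_psi : paired (n.+1 + 0)%:R psi theta.
Proof. by rewrite addn0; exact: paired_mollifier. Qed.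

Let paired_dpsi i : paired (n.+1 + 1)%:R (dexpr i psi) (dexpr i theta).
Proof. by rewrite natrD; apply: paired_dexpr; exact: paired_mollifier. Qed.

Let paired_ddpsi i j : paired (n.+1 + 2)%:R (dexpr i (dexpr j psi)) (dexpr i (dexpr j theta)).
Proof. by rewrite (_ : 2 = 1 + 1)%N// addnA natrD; exact: paired_dexpr. Qed.

Let spsi := @supported_mollifier R n.
Let stheta := @supported_theta R n.
Let sdpsi i := supported_dexpr i spsi.
Let sdtheta i := supported_dexpr i stheta.
Let sddpsi i j := supported_dexpr i (sdpsi j).
Let sddtheta i j := supported_dexpr i (sdtheta j).

Variable B : R.
Hypothesis B2 : forall i j y, `|eval (dexpr i (dexpr j psi)) y| <= B.

(** The first term is the growth from [h0] to [h]; the second is the size at [h0], where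
    $h_0^2=h_0^g h_0^{2-g}\le h_0^g h^{2-g}$. *)
Definition hessian_bound : R := K / (2 - g) + A * B * (2 * q) ^+ n.+1 * h0 `^ g.
Local Notation H := hessian_bound.

Lemma scaled_hessian_le i j h x : decays (dexpr i (dexpr j theta)) x -> h0 <= h ->
  `|scaled_average u (n.+1 + 2) (dexpr i (dexpr j psi)) h x| <= H * h `^ (2 - g).
Proof.
move=> fx h0h; have mg : 2%:R - g != 0 by rewrite lt0r_neq0.
have := scaled_average_increment mg (sddpsi i j) (sddtheta i j) (paired_ddpsi i j) fx (lexx _) h0h.
have := scaled_average_le 2 x (sddpsi i j) (B2 i j) h00.
set W := scaled_average _ _ _ => h1 h2.
have p1 : h0 `^ (2 - g) <= h `^ (2 - g).
  by rewrite ge0_ler_powR ?nnegrE ?(ltW g2)// ltW// (lt_le_trans h00).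
have B0 : 0 <= B by exact: le_trans (B2 i j 0).
have c0 : 0 <= A * B * (2 * q) ^+ n.+1 by rewrite !mulr_ge0// exprn_ge0// mulr_ge0.
have e2 : h0 ^+ 2 = h0 `^ g * h0 `^ (2 - g).
  rewrite -powR_mulrn ?(ltW h00)// -powRD ?(gt_eqF h00) ?implybT//.
  by congr (_ `^ _); lra.
have p2 : A * B * (2 * q) ^+ n.+1 * h0 ^+ 2 <= A * B * (2 * q) ^+ n.+1 * h0 `^ g * h `^ (2 - g).
  by rewrite e2 -[leRHS]mulrA ler_wpM2l// ler_wpM2l// powR_ge0.
have p3 : K / (2 - g) * (h `^ (2 - g) - h0 `^ (2 - g)) <= K / (2 - g) * h `^ (2 - g).
  by rewrite ler_wpM2l ?gerBl ?powR_ge0// divr_ge0// ltW.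
have := ler_normD (W h x - W h0 x) (W h0 x).
rewrite subrK mulrDl => /le_trans; apply; apply: lerD.
  exact: le_trans h2 p3.
exact: le_trans h1 p2.
Qed.

(* A representative of [u]: it agrees with [u] almost everywhere. *)
Definition recover x : R := lim (scaled_average u n.+1 psi k.+1%:R x @[k --> \oo]) / c.

(** The sign comes from differentiating $\psi(h(y-x))$ in $x$. *)
Definition recover_grad i x : R :=
  - (lim (scaled_average u (n.+1 + 1) (dexpr i psi) k.+1%:R x @[k --> \oo]) / c).

Let c0 : 0 < c. Proof. exact: mollifier_mass_gt0. Qed.

Lemma recover_cvg x : decays theta x ->
  scaled_average u n.+1 psi k.+1%:R x @[k --> \oo] --> c * recover x /\
  forall h, h0 <= h ->
    `|scaled_average u n.+1 psi h x - c * recover x| <= K / g * h `^ (- g).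
Proof.
move=> tx; have [l [lc hl]] := scaled_average_limit (m := 0) g0 spsi stheta paired_psi tx.
move: lc hl; rewrite addn0 => lc hl.
have le : c * recover x = l.
  by rewrite /recover (cvg_lim (@Rhausdorff R) lc) mulrC divfK// lt0r_neq0.
by rewrite le; split=> // h hh; have := hl h hh; rewrite subr0 sub0r.
Qed.

Lemma recover_grad_close i x : 1 < g -> decays (dexpr i theta) x ->
  forall h, h0 <= h ->
    `|scaled_average u (n.+1 + 1) (dexpr i psi) h x + c * recover_grad i x| <=
      K / (g - 1) * h `^ (1 - g).
Proof.
move=> g1 tx.
have [l [lc hl]] := scaled_average_limit (m := 1) g1 (sdpsi i) (sdtheta i) (paired_dpsi i) tx.
have le : c * recover_grad i x = - l.
  rewrite /recover_grad (cvg_lim (@Rhausdorff R) lc) mulrN mulrC divfK// lt0r_neq0//.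
by rewrite le; exact: hl.
Qed.

Let z_small z : z != 0 -> `|z| <= h0^-1 -> h0 <= `|z|^-1.
Proof.
move=> z0 zh; rewrite -[leLHS]invrK lef_pV2// posrE ?invr_gt0// normr_gt0 //.
Qed.

Let powRV (t b : R) : 0 < t -> t^-1 `^ b = t `^ (- b).
Proof. by move=> t0; rewrite -powR_inv1 ?ltW// -powRrM mulN1r. Qed.

Let sqr_powR (t : R) : 0 < t -> t^-1 `^ (2 - g) * t ^+ 2 = t `^ g.
Proof.
move=> t0; rewrite powRV// -powR_mulrn ?ltW// -powRD ?(gt_eqF t0) ?implybT//.
by congr (_ `^ _); lra.
Qed.

Variable S : set E.
Hypothesis theta_decays : forall x, S x -> decays theta x.
Hypothesis ddtheta_decays : forall i j x, S x -> decays (dexpr i (dexpr j theta)) x.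

Lemma average_hessian_le i j h x : S x -> h0 <= h ->
  `|average u (dexpr i (dexpr j psi)) h x| <= H * h `^ (2 - g) / h ^+ (n.+1 + 2).
Proof.
move=> Sx hh; have h_gt0 := lt_le_trans h00 hh.
have hn : 0 < h ^+ (n.+1 + 2) by rewrite exprn_gt0.
rewrite ler_pdivlMr// mulrC -[h ^+ _ in leLHS](ger0_norm (ltW hn)) -normrM.
exact: (scaled_hessian_le (ddtheta_decays i j Sx) hh).
Qed.

(** At the frequency $h=1/|z|$ the error $h^{-g}$ of the averages and their second differences, of
    order $h^{2-g}|z|^2$, are both of order $|z|^g$. *)
Lemma D2_recover_le x z : (forall t, -1 <= t <= 1 -> S (x + t *: z)) -> `|z| <= h0^-1 ->
  c * `|D2 recover z x| <= (4 * (K / g) + 2 * (n.+1%:R ^+ 2 * H)) * `|z| `^ g.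
Proof.
move=> Sz zh; have [->|z0] := eqVneq z 0.
  rewrite /D2 addr0 subr0 [_ - _ - _](_ : _ = 0); last by ring.
  by rewrite !normr0 mulr0 powR0 ?mulr0// lt0r_neq0.
have z_gt0 : 0 < `|z| by rewrite normr_gt0.
pose h := `|z|^-1; have h0h : h0 <= h by exact: z_small.
have h_gt0 : 0 < h := lt_le_trans h00 h0h.
pose W := scaled_average u n.+1 psi h.
have S0 : S x by have := Sz 0; rewrite scale0r addr0; apply; lra.
have S1 : S (x + z) by have := Sz 1; rewrite scale1r; apply; lra.
have S2 : S (x - z) by have := Sz (-1); rewrite scaleN1r; apply; lra.
have [_ /(_ h h0h)] := recover_cvg (theta_decays S0).
have [_ /(_ h h0h)] := recover_cvg (theta_decays S1).
have [_ /(_ h h0h)] := recover_cvg (theta_decays S2).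
rewrite -!/(W _) powRV// opprK.
set P := K / g * `|z| `^ g => e2 e1 e0.
have W2 : `|D2 W z x| <= 2 * (n.+1%:R ^+ 2 * H * `|z| `^ g).
  have -> : D2 W z x = h ^+ n.+1 * (2 * average u psi h x - average u psi h (x + z) - average u psi h (x - z)).
    by rewrite /D2 /W /scaled_average !mulrBr [in RHS]mulrCA.
  rewrite normrM ger0_norm ?exprn_ge0 ?(ltW h_gt0)//.
  have avH i j t : -1 <= t <= 1 -> `|average u (dexpr i (dexpr j psi)) h (x + t *: z)| <=
      H * h `^ (2 - g) / h ^+ (n.+1 + 2).
    by move=> t1; apply: average_hessian_le => //; exact: Sz.
  have := average_second_difference_le mu_ uA q0 spsi h_gt0 avH.
  move=> /(ler_wpM2l (exprn_ge0 n.+1 (ltW h_gt0))) /le_trans; apply.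
  rewrite -(sqr_powR z_gt0) -/h le_eqVlt; apply/orP; left; apply/eqP.
  rewrite exprD; field.
  by rewrite expf_neq0 ?andbT lt0r_neq0.
have -> : c * `|D2 recover z x| = `|c * D2 recover z x| by rewrite normrM (gtr0_norm c0).
clearbody W; have -> : c * D2 recover z x = D2 W z x - 2 * (W x - c * recover x)
   + (W (x + z) - c * recover (x + z)) + (W (x - z) - c * recover (x - z)).
  rewrite /D2; move: (recover x) (recover (x + z)) (recover (x - z)) => r0 r1 r2.
  by move: (W x) (W (x + z)) (W (x - z)) => w0 w1 w2; ring.
have -> : (4 * (K / g) + 2 * (n.+1%:R ^+ 2 * H)) * `|z| `^ g =
   4 * P + 2 * (n.+1%:R ^+ 2 * H * `|z| `^ g) by rewrite /P; ring.
exact: norm_second_difference.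
Qed.

Hypothesis g1 : 1 < g.
Hypothesis dtheta_decays : forall i x, S x -> decays (dexpr i theta) x.

Let pow1 (t : R) : 0 < t -> t^-1 `^ (2 - g) * t = t `^ (g - 1).
Proof.
move=> t0; rewrite powRV// -[X in _ * X]powRr1 ?ltW// -powRD ?(gt_eqF t0) ?implybT//.
by congr (_ `^ _); lra.
Qed.

Let mul_powR (t : R) : 0 < t -> t * t `^ (g - 1) = t `^ g.
Proof.
move=> t0; rewrite -[X in X * _](powRr1 (ltW t0)) -powRD ?(gt_eqF t0) ?implybT//.
by congr (_ `^ _); lra.
Qed.

Let average_dpsi_increment i h x z : (forall t, 0 <= t <= 1 -> S (x + t *: z)) -> h0 <= h ->
  `|average u (dexpr i psi) h (x + z) - average u (dexpr i psi) h x| <=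
    n.+1%:R * H * h `^ (2 - g) * `|z| / h ^+ (n.+1 + 1).
Proof.
move=> Sz h0h; have h_gt0 : 0 < h := lt_le_trans h00 h0h.
have avH j t : 0 <= t <= 1 -> `|average u (dexpr j (dexpr i psi)) h (x + t *: z)| <=
    H * h `^ (2 - g) / h ^+ (n.+1 + 2).
  by move=> t1; apply: average_hessian_le => //; exact: Sz.
have := average_increment_le mu_ uA q0 (sdpsi i) h_gt0 avH.
move=> /le_trans; apply; rewrite le_eqVlt; apply/orP; left; apply/eqP.
by rewrite !exprD expr1 expr2; field; rewrite expf_neq0 lt0r_neq0.
Qed.

(** Again $h=1/|z|$: the error $h^{1-g}$ and the increment $h^{2-g}|z|$ of the averages are both
    $|z|^{g-1}$. *)
Lemma recover_grad_increment i x z : (forall t, 0 <= t <= 1 -> S (x + t *: z)) -> `|z| <= h0^-1 ->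
  c * `|recover_grad i (x + z) - recover_grad i x| <=
    (2 * (K / (g - 1)) + n.+1%:R * H) * `|z| `^ (g - 1).
Proof.
move=> Sz zh; have [->|z0] := eqVneq z 0.
  by rewrite addr0 subrr !normr0 mulr0 powR0 ?mulr0// subr_eq0 gt_eqF.
have z_gt0 : 0 < `|z| by rewrite normr_gt0.
pose h := `|z|^-1; have h0h : h0 <= h by exact: z_small.
have h_gt0 : 0 < h := lt_le_trans h00 h0h.
pose W := scaled_average u (n.+1 + 1) (dexpr i psi) h.
have S0 : S x by have := Sz 0; rewrite scale0r addr0; apply; lra.
have S1 : S (x + z) by have := Sz 1; rewrite scale1r; apply; lra.
have := recover_grad_close g1 (dtheta_decays i S0) h0h.
have := recover_grad_close g1 (dtheta_decays i S1) h0h.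
rewrite -!/(W _) powRV// opprB.
set P := K / (g - 1) * `|z| `^ (g - 1) => e1 e0.
have W1 : `|W (x + z) - W x| <= n.+1%:R * H * `|z| `^ (g - 1).
  rewrite /W /scaled_average -mulrBr normrM ger0_norm ?exprn_ge0 ?(ltW h_gt0)//.
  have := average_dpsi_increment i Sz h0h.
  move=> /(ler_wpM2l (exprn_ge0 (n.+1 + 1) (ltW h_gt0))) /le_trans; apply.
  rewrite -(pow1 z_gt0) -/h le_eqVlt; apply/orP; left; apply/eqP.
  by field; rewrite expf_neq0// lt0r_neq0.
clearbody W; move: (recover_grad i (x + z)) (recover_grad i x) e0 e1 => r1 r0 e0 e1.
have -> : c * `|r1 - r0| = `|c * (r1 - r0)| by rewrite normrM (gtr0_norm c0).
have -> : c * (r1 - r0) = (W (x + z) + c * r1) - (W x + c * r0) - (W (x + z) - W x).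
  by move: (W x) (W (x + z)) => w0 w1; ring.
have -> : (2 * (K / (g - 1)) + n.+1%:R * H) * `|z| `^ (g - 1) =
   2 * P + n.+1%:R * H * `|z| `^ (g - 1) by rewrite /P; ring.
exact: norm_difference3.
Qed.

(** The first-order expansion of the average at frequency $1/|z|$ is compared with its limit.
    Differentiability of the limit, with gradient [recover_grad], is a consequence, not an
    ingredient. *)
Lemma recover_taylor x z : (forall t, 0 <= t <= 1 -> S (x + t *: z)) -> `|z| <= h0^-1 ->
  c * `|recover (x + z) - recover x - \sum_i z 0 i * recover_grad i x| <=
    (2 * (K / g) + n.+1%:R * (K / (g - 1)) + n.+1%:R ^+ 2 * H) * `|z| `^ g.
Proof.
move=> Sz zh; have [->|z0] := eqVneq z 0.
  rewrite addr0 subrr big1 ?subrr ?normr0 ?mulr0 ?powR0 ?mulr0// ?lt0r_neq0//.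
  by move=> i _; rewrite mxE mul0r.
have z_gt0 : 0 < `|z| by rewrite normr_gt0.
pose h := `|z|^-1; have h0h : h0 <= h by exact: z_small.
have h_gt0 : 0 < h := lt_le_trans h00 h0h.
pose W := scaled_average u n.+1 psi h.
pose W1 i := scaled_average u (n.+1 + 1) (dexpr i psi) h x.
have S0 : S x by have := Sz 0; rewrite scale0r addr0; apply; lra.
have S1 : S (x + z) by have := Sz 1; rewrite scale1r; apply; lra.
have [_ /(_ h h0h)] := recover_cvg (theta_decays S0).
have [_ /(_ h h0h)] := recover_cvg (theta_decays S1).
rewrite -!/(W _) powRV// opprK.
set P := K / g * `|z| `^ g => e1 e0.
have sumN (F : 'I_n.+1 -> R) (b : R) : (forall i, `|F i| <= b) -> `|\sum_i F i| <= n.+1%:R * b.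
  move=> Fb; apply: (le_trans (ler_norm_sum _ _ _)).
  apply: (@le_trans _ _ (\sum_(i < n.+1) b)); first by apply: ler_sum.
  by rewrite big_const_ord iter_addr_0 mulr_natl.
have eg : `|\sum_i z 0 i * (W1 i + c * recover_grad i x)| <= n.+1%:R * (K / (g - 1) * `|z| `^ g).
  apply: sumN => i; rewrite normrM.
  have -> : K / (g - 1) * `|z| `^ g = `|z| * (K / (g - 1) * h `^ (1 - g)).
    by rewrite powRV// opprB mulrCA mul_powR.
  apply: ler_pM => //; first exact: coord_le_norm.
  exact: (recover_grad_close g1 (dtheta_decays i S0) h0h).
have eW : `|W (x + z) - W x + \sum_i z 0 i * W1 i| <= n.+1%:R ^+ 2 * H * `|z| `^ g.
  have avL i t : 0 <= t <= 1 ->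
      `|average u (dexpr i psi) h (x + t *: z) - average u (dexpr i psi) h x| <=
      n.+1%:R * H * h `^ (2 - g) * `|z| / h ^+ (n.+1 + 1).
    move=> t01; have Stz t' : 0 <= t' <= 1 -> S (x + t' *: (t *: z)).
      move=> t'01; rewrite scalerA; apply: Sz; case/andP: t01 => ? ?; case/andP: t'01 => ? ?.
      by rewrite mulr_ge0//= mulr_ile1.
    have := average_dpsi_increment i Stz h0h.
    move=> /le_trans; apply; rewrite ler_wpM2r ?invr_ge0 ?exprn_ge0 ?(ltW h_gt0)//.
    rewrite ler_wpM2l//.
      (* The sign of the constant is read off from a bound whose left-hand side is a norm. *)
      have := average_hessian_le ord0 ord0 S0 h0h.
      move=> /(le_trans (normr_ge0 _)); rewrite pmulr_lge0 ?invr_gt0 ?exprn_gt0//.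
      by move=> HH; rewrite -mulrA mulr_ge0.
    rewrite normrZ; case/andP: t01 => t0 t1; rewrite ger0_norm//.
    by rewrite ler_piMl.
  have := average_taylor_le spsi h_gt0 avL.
  move=> /(ler_wpM2l (exprn_ge0 n.+1 (ltW h_gt0))) => hF.
  have -> : W (x + z) - W x + \sum_i z 0 i * W1 i =
     h ^+ n.+1 * (average u psi h (x + z) - average u psi h x +
       h * \sum_i z 0 i * average u (dexpr i psi) h x).
    rewrite !mulrDr mulrN; congr (_ + _).
    rewrite !mulr_sumr; apply: eq_bigr => i _.
    by rewrite /W1 /scaled_average exprD expr1 mulrCA -!mulrA; congr (_ * _).
  rewrite normrM ger0_norm ?exprn_ge0 ?(ltW h_gt0)//.
  apply: (le_trans hF); rewrite -(sqr_powR z_gt0) -/h le_eqVlt; apply/orP; left; apply/eqP.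
  by rewrite exprD expr1; field; rewrite expf_neq0 ?lt0r_neq0.
move: (recover (x + z)) (recover x) e0 e1 => r1 r0 e0 e1.
have -> : c * `|r1 - r0 - \sum_i z 0 i * recover_grad i x| =
   `|c * (r1 - r0 - \sum_i z 0 i * recover_grad i x)| by rewrite normrM (gtr0_norm c0).
have sE : \sum_i z 0 i * (W1 i + c * recover_grad i x) =
    \sum_i z 0 i * W1 i + c * \sum_i z 0 i * recover_grad i x.
  rewrite mulr_sumr -big_split; apply: eq_bigr => i _ /=; ring.
rewrite sE in eg.
have -> : (2 * (K / g) + n.+1%:R * (K / (g - 1)) + n.+1%:R ^+ 2 * H) * `|z| `^ g =
   2 * P + n.+1%:R * (K / (g - 1) * `|z| `^ g) + n.+1%:R ^+ 2 * H * `|z| `^ g by rewrite /P; ring.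
move: (\sum_i z 0 i * W1 i) (\sum_i z 0 i * recover_grad i x) eg eW => a b eg eW.
clearbody W; move: (W x) (W (x + z)) eW e0 e1 => w0 w1 eW e0 e1.
have -> : c * (r1 - r0 - b) = (w1 - w0 + a) - (w1 - c * r1) + (w0 - c * r0) - (a + c * b).
  by ring.
exact: norm_difference4.
Qed.

End improvement.

(** * The limit of the averages agrees with [u] almost everywhere *)

Section almost_everywhere.
Context {R : realType} {n : nat}.
Local Notation E := 'rV[R]_n.+1.
Local Notation mu := (@lebesgue_rV R n).
Local Notation J f := (\int[mu]_x f x).
Implicit Types (x y z : E).
Local Notation psi := (@mollifier R n).
Local Notation c := (@mollifier_mass R n).
Local Notation q := (n.+2%:R : R).

Let q0 : 0 <= q. Proof. exact: ler0n. Qed.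
Let spsi := @supported_mollifier R n.

Lemma Cc_infty_continuous (Om : set E) eta : Cc_infty Om eta -> continuous eta.
Proof. by case=> /(_ [::]) []. Qed.

Lemma Cc_infty_outside (Om : set E) eta x : Cc_infty Om eta -> ~ Om x -> eta x = 0.
Proof.
case=> _ _ sub nOm; apply: contrapT => /eqP h; apply: nOm; apply: sub.
exact: subset_closure.
Qed.

Lemma Cc_infty_bounded (Om : set E) eta : Cc_infty Om eta ->
  exists2 B : R, 0 <= B & forall x, `|eta x| <= B.
Proof.
move=> h; have ceta := Cc_infty_continuous h; case: h => _ cK _.
have cE : {within closure [set x | eta x != 0], continuous eta} by exact: continuous_subspaceT.
have /compact_bounded [M [_ hM]] := continuous_compact cE cK.
have hB := hM (`|M| + 1) (ltr_pwDr ltr01 (ler_norm M)).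
exists (`|M| + 1); first exact: addr_ge0.
move=> x; have [->|xn] := eqVneq (eta x) 0; first by rewrite normr0 addr_ge0.
by apply: hB; exists x => //; exact: subset_closure.
Qed.

Section smoothing.
Variables (u : E -> R) (A : R).
Hypotheses (mu_ : measurable_fun setT u) (uA : forall x, `|u x| <= A).
Variables (eta : E -> R) (D b : R).
Hypotheses (ceta : continuous eta) (etaD : forall x, `|eta x| <= D).
Hypothesis eta0 : forall x, b < `|x - 0| -> eta x = 0.

Let A0 : 0 <= A. Proof. exact: le_trans (uA 0). Qed.
Let D0 : 0 <= D. Proof. exact: le_trans (etaD 0). Qed.
Let meta : measurable_fun setT eta. Proof. exact: continuous_rV_measurable. Qed.

(** The theorem of Fubini and the evenness of [psi] move the smoothing to [eta], where continuity
    makes convergence elementary. *)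
Lemma smoothing_symmetric h : 0 < h ->
  J (fun x => scaled_average u n.+1 psi h x * eta x) =
  J (fun y => u y * scaled_average eta n.+1 psi h y).
Proof.
move=> h0; have [B B0 hB] := eval_bounded spsi.
pose H (p : E * E) : R := h ^+ n.+1 * (eta p.1 * (u p.2 * eval psi (h *: (p.2 - p.1)))).
have mpsi : measurable_fun setT (fun p : E * E => eval psi (h *: (p.2 - p.1))).
  apply: (@measurable_eval _ _ _ _ psi (fun p : E * E => h *: (p.2 - p.1))) => i.
  under eq_fun do rewrite !mxE; apply: measurable_funM; first exact: measurable_cst.
  apply: measurable_funB; [exact: measurable_coord_snd|exact: measurable_coord_fst].
have mH : measurable_fun setT H.
  apply: measurable_funM; first exact: measurable_cst.
  apply: measurable_funM; first exact: (measurableT_comp meta measurable_fst).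
  apply: measurable_funM; last exact: mpsi.
  exact: (measurableT_comp mu_ measurable_snd).
have iu x : mu.-integrable setT (EFin \o (fun y => u y * eval psi (h *: (y - x)))).
  exact: (integrable_average mu_ uA x spsi h0).
pose L := A * B * (2 * (q / h)) ^+ n.+1.
have L0 : 0 <= L.
  by rewrite !mulr_ge0 ?(ltW B0)// exprn_ge0// mulr_ge0// divr_ge0// ltW.
have hN0 : 0 <= h ^+ n.+1 by rewrite exprn_ge0// ltW.
have ieta : mu.-integrable setT (EFin \o (fun x => h ^+ n.+1 * L * `|eta x|)).
  apply: (@integrable_bcs _ _ _ (`|h ^+ n.+1 * L| * D) 0 b).
  - by apply: measurable_funM; [exact: measurable_cst|exact: measurable_norm_fun].
  - by move=> x; rewrite normrM normr_id ler_wpM2l.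
  - by move=> x bx; rewrite eta0// normr0 mulr0.
have iH : (mu \x mu)%E.-integrable setT (EFin \o H).
  have mEH : measurable_fun setT (EFin \o H) by exact/measurable_EFinP.
  apply/(integrable12ltyP mu mu mEH).
  case/integrableP: ieta => _; apply: le_lt_trans; apply: ge0_le_integral.
  - exact: measurableT.
  - by move=> x _; exact: integral_ge0.
  - have mn := measurableT_comp (@abse_measurable R setT) mEH.
    exact: (measurable_fun_fubini_tonelli_F (m2 := mu) _ mn (fun _ => abse_ge0 _)).
  - apply: (measurableT_comp (@abse_measurable R setT)); apply/measurable_EFinP.
    by apply: measurable_funM; [exact: measurable_cst|exact: measurable_norm_fun].
  move=> x _.
  have ia : mu.-integrable setT (EFin \o (fun y => `|u y * eval psi (h *: (y - x))|)).
    exact: (integrable_abse (iu x)).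
  have -> : (\int[mu]_y `|(EFin \o H) (x, y)| =
      ((h ^+ n.+1 * `|eta x|) * J (fun y => `|u y * eval psi (h *: (y - x))|))%:E)%E.
    rewrite EFinM /Rintegral fineK ?(integrable_fin_num measurableT ia)//.
    rewrite -integralZl//; apply: eq_integral => y _.
    by rewrite /H /= -EFinM !normrM ger0_norm ?exprn_ge0 ?(ltW h0)// !mulrA.
  rewrite /comp lee_fin [leRHS]ger0_norm; last by rewrite mulr_ge0// mulr_ge0.
  rewrite [leRHS]mulrAC ler_wpM2l ?mulr_ge0//.
  apply: (le_trans (ler_norm _)); apply: (@Rintegral_bcs_le _ _ _ _ x).
  - by rewrite divr_ge0// ltW.
  - apply: measurable_norm_fun; apply: measurable_funM; first exact: mu_.
    exact: measurable_eval_scaled.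
  - by move=> y; rewrite normr_id normrM ler_pM.
  - by move=> y yx; rewrite (scaled_far h0 spsi yx) mulr0 normr0.
have ieta2 y : mu.-integrable setT (EFin \o (fun x => eta x * eval psi (h *: (x - y)))).
  exact: (integrable_average meta etaD y spsi h0).
have factor (d : R) (f : E -> R) (k : E -> R) : mu.-integrable setT (EFin \o f) ->
    (forall y, k y = d * f y) -> (\int[mu]_y (k y)%:E = (d * J f)%:E)%E.
  move=> jf kE; under eq_integral do rewrite kE EFinM.
  rewrite integralZl// EFinM /Rintegral fineK//.
  exact: (integrable_fin_num measurableT jf).
rewrite /Rintegral; congr fine; transitivity (\int[mu]_x \int[mu]_y (EFin \o H) (x, y))%E.
  apply: eq_integral => x _.
  rewrite (@factor (h ^+ n.+1 * eta x) _ (fun y => H (x, y)) (iu x)).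
    by rewrite /scaled_average mulrAC.
  by move=> y; exact: mulrA.
rewrite (Fubini iH); apply: eq_integral => y _.
rewrite (@factor (h ^+ n.+1 * u y) _ (fun x => H (x, y)) (ieta2 y)).
  by rewrite /scaled_average mulrCA mulrA.
move=> x; rewrite -(even_mollifier (h *: (x - y))) -scalerN opprB /H -!mulrA; congr (_ * _).
by rewrite mulrCA.
Qed.

Lemma smoothing_cvg y : scaled_average eta n.+1 psi k.+1%:R y @[k --> \oo] --> c * eta y.
Proof.
have [B B0 hB] := eval_bounded spsi.
pose L := B * (2 * q) ^+ n.+1; have L0 : 0 <= L by rewrite mulr_ge0 ?(ltW B0)// exprn_ge0// mulr_ge0.
apply/cvgrPdist_le => e e0.
have L1 : 0 < L + 1 by rewrite ltr_wpDl.
have e1 : 0 < e / (L + 1) by rewrite divr_gt0.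
have cy : {for y, continuous eta} by exact: ceta.
have /cvgrPdist_le/(_ _ e1) := cy; rewrite -nbhs_nearE => /nbhs_normP[d /= d0 hd].
exists (Num.truncn (q / d)) => // k /= hk.
set h : R := k.+1%:R; have h0 : 0 < h by rewrite ltr0n.
have hd' : q / h < d.
  rewrite ltr_pdivrMr// mulrC -ltr_pdivrMr//; apply: (lt_le_trans (truncnS_gt _)).
  by rewrite ler_nat ltnS.
have m1 : measurable_fun setT (fun x => eval psi (h *: (x - y))) by exact: measurable_eval_scaled.
have i1 := integrable_average meta etaD y spsi h0.
have i0 : mu.-integrable setT (EFin \o (fun x => eval psi (h *: (x - y)))).
  apply: (@integrable_bcs _ _ _ B y (q / h)) => //.
  by move=> x xy; rewrite (scaled_far h0 spsi xy).
have i2 : mu.-integrable setT (EFin \o (fun x => eta y * eval psi (h *: (x - y)))).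
  by have := integrableZl measurableT (eta y) i0; apply: eq_integrable.
have -> : c * eta y - scaled_average eta n.+1 psi h y =
    - (h ^+ n.+1 * J (fun x => (eta x - eta y) * eval psi (h *: (x - y)))).
  under eq_Rintegral do rewrite mulrBl.
  rewrite RintegralB// RintegralZl// /scaled_average /average mulrBr opprB; congr (_ - _).
  rewrite mulrCA mulrC -(average_mollifier_cst y h0) /scaled_average /average; congr (_ * (_ * _)).
  by apply: eq_Rintegral => x _; rewrite mul1r.
rewrite normrN normrM ger0_norm ?exprn_ge0 ?(ltW h0)//.
have : `|J (fun x => (eta x - eta y) * eval psi (h *: (x - y)))| <=
    (e / (L + 1) * B) * (2 * (q / h)) ^+ n.+1.
  apply: (@Rintegral_bcs_le _ _ _ _ y); first by rewrite divr_ge0// ltW.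
  - apply: measurable_funM; last exact: m1.
    by apply: measurable_funB; [exact: meta|exact: measurable_cst].
  - move=> x; have [xy|xy] := leP `|x - y| (q / h); last first.
      by rewrite (scaled_far h0 spsi xy) mulr0 normr0 mulr_ge0 ?ltW.
    rewrite normrM ler_pM// distrC; apply: hd => /=.
    by rewrite distrC; exact: le_lt_trans hd'.
  - by move=> x xy; rewrite (scaled_far h0 spsi xy) mulr0.
move=> /(ler_wpM2l (exprn_ge0 n.+1 (ltW h0))) /le_trans; apply.
have -> : h ^+ n.+1 * (e / (L + 1) * B * (2 * (q / h)) ^+ n.+1) = e * (L / (L + 1)).
  move: (L + 1) (gt_eqF L1) => M M0; rewrite /L !exprMn exprVn; field.
  by rewrite M0 expf_neq0 ?lt0r_neq0.
rewrite ler_piMr ?(ltW e0)// ler_pdivrMr// mul1r lerDl//.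
Qed.

Lemma Rintegral_smoothing_cvg :
  J (fun x => scaled_average u n.+1 psi k.+1%:R x * eta x) @[k --> \oo] -->
  J (fun y => u y * (c * eta y)).
Proof.
have [B B0 hB] := eval_bounded spsi.
have kp (k : nat) : 0 < k.+1%:R :> R by rewrite ltr0n.
under eq_fun do rewrite smoothing_symmetric//.
pose L := D * B * (2 * q) ^+ n.+1.
have L0 : 0 <= L by rewrite !mulr_ge0 ?(ltW B0)// exprn_ge0// mulr_ge0.
(* The frequencies [k.+1] are at least 1, so every smoothing of [eta] vanishes outside this cube. *)
pose G y : R := A * L * \1_(cube (0 : E) (b + q)) y.
have mG : measurable_fun setT G.
  by apply: measurable_funM; [exact: measurable_cst|exact/measurable_indic/measurable_cube].
suff [] : mu.-integrable setT (EFin \o (fun y => u y * (c * eta y))) /\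
    J (fun y => u y * scaled_average eta n.+1 psi k.+1%:R y) @[k --> \oo] -->
    J (fun y => u y * (c * eta y)) by [].
apply: (@Rintegral_dominated_cvg R _ _ mu
  (fun k y => u y * scaled_average eta n.+1 psi k.+1%:R y) _ G).
- move=> k; apply: measurable_funM; first exact: mu_.
  apply: measurable_funM; first exact: measurable_cst.
  by apply: continuous_rV_measurable; exact: (continuous_average meta etaD q0 spsi).
- apply: (@integrable_bcs _ _ _ (A * L) 0 (b + q)) => //.
    have AL : 0 <= A * L by exact: mulr_ge0.
    move=> y; rewrite /G indicE; case: (y \in _); last by rewrite mulr0 normr0.
    by rewrite mulr1 ger0_norm.
  by move=> y yb; rewrite /G indicE memNset ?mulr0// /cube/= leNgt yb.
- move=> k y; rewrite /G indicE; have [yb|yb] := boolP (y \in _); last first.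
    have {}yb : b + q < `|y| by move/negP: yb; rewrite inE /cube/= subr0 => /negP; rewrite -ltNge.
    rewrite mulr0 /scaled_average /average.
    rewrite (@eq_Rintegral _ _ _ mu _ (fun=> 0)); first by rewrite /Rintegral integral0 !mulr0 normr0.
    move=> x _; have [xy|xy] := leP `|x - y| (q / k.+1%:R); last by rewrite (scaled_far _ spsi xy)// mulr0.
    rewrite eta0 ?mul0r// subr0.
    have kq : q / k.+1%:R <= q by rewrite ler_pdivrMr// ler_peMr// ler1n.
    have yE : x - (x - y) = y by rewrite opprB addrC subrK.
    rewrite -(ltrD2r q); apply: (lt_le_trans yb); rewrite -[y]yE.
    by apply: (le_trans (ler_normB _ _)); rewrite lerD2l; exact: le_trans kq.
  rewrite mulr1 normrM ler_pM// /scaled_average normrM ger0_norm ?exprn_ge0//.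
  have := average_le meta etaD q0 spsi y (kp k) hB.
  move=> /(ler_wpM2l (exprn_ge0 n.+1 (ltW (kp k)))) /le_trans; apply.
  rewrite le_eqVlt; apply/orP; left; apply/eqP; rewrite /L !exprMn exprVn; field.
  by rewrite expf_neq0 ?lt0r_neq0.
- by move=> y; apply: cvgM; [exact: cvg_cst|exact: smoothing_cvg].
Qed.

End smoothing.

(** Tested against [eta], the averages converge both to [c * w] (dominated convergence) and to
    [c * u] (smoothing moved to [eta]). The fundamental lemma concludes, in place of Lebesgue
    differentiation. *)
Lemma smoothing_ae (u w : E -> R) (A b : R) (Om : set E) : measurable_fun setT u ->
  (forall x, `|u x| <= A) -> open Om -> Om `<=` cube 0 b ->
  (forall x, Om x -> scaled_average u n.+1 psi k.+1%:R x @[k --> \oo] --> c * w x) ->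
  measurable_fun Om w /\ {ae mu, forall x, Om x -> u x = w x}.
Proof.
move=> mu_ uA oOm Omb wlim.
have A0 : 0 <= A by exact: le_trans (uA 0).
have [B B0 hB] := eval_bounded spsi.
have kp (k : nat) : 0 < k.+1%:R :> R by rewrite ltr0n.
have c0 : 0 < c by exact: mollifier_mass_gt0.
have mOm := open_rV_measurable oOm.
have mW k : measurable_fun setT (scaled_average u n.+1 psi k.+1%:R).
  apply: measurable_funM; first exact: measurable_cst.
  by apply: continuous_rV_measurable; exact: (continuous_average mu_ uA q0 spsi).
pose L := A * B * (2 * q) ^+ n.+1.
have L0 : 0 <= L by rewrite !mulr_ge0 ?(ltW B0)// exprn_ge0// mulr_ge0.
have WL k x : `|scaled_average u n.+1 psi k.+1%:R x| <= L.
  rewrite /scaled_average normrM ger0_norm ?exprn_ge0//.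
  have := average_le mu_ uA q0 spsi x (kp k) hB.
  move=> /(ler_wpM2l (exprn_ge0 n.+1 (ltW (kp k)))) /le_trans; apply.
  rewrite le_eqVlt; apply/orP; left; apply/eqP; rewrite /L !exprMn exprVn; field.
  by rewrite expf_neq0 ?lt0r_neq0.
have mcw : measurable_fun Om (fun x => c * w x).
  apply: (@measurable_fun_cvg _ _ R Om (fun k => scaled_average u n.+1 psi k.+1%:R)) => //.
  by move=> k; exact: measurable_funTS.
have mw : measurable_fun Om w.
  have : measurable_fun Om (fun x => c^-1 * (c * w x)) by apply: measurable_funM => //; exact: measurable_cst.
  by apply: eq_measurable_fun => x _; rewrite mulKf// lt0r_neq0.
have wL x : Om x -> `|w x| <= L / c.
  move=> Omx; rewrite ler_pdivlMr// mulrC -[X in X * _](gtr0_norm c0) -normrM.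
  have cn : `|scaled_average u n.+1 psi k.+1%:R x| @[k --> \oo] --> `|c * w x|.
    by apply: cvg_norm; exact: wlim.
  rewrite -(cvg_lim (@Rhausdorff R) cn); apply: limr_le; first by apply/cvg_ex; eexists; exact: cn.
  by apply: nearW => k; exact: WL.
have muOm : (mu Om < +oo)%E.
  apply: le_lt_trans (cube_measure_lty 0 b); apply: le_measure; rewrite ?inE//.
  exact: measurable_cube.
split=> //; have mf : measurable_fun Om (fun x => u x - w x).
  by apply: measurable_funB => //; exact: measurable_funTS.
suff : {ae mu, forall x, Om x -> u x - w x = 0}.
  by apply: filterS => x h /h /eqP; rewrite subr_eq0 => /eqP.
apply: test_ae0 => //.
  split => //; apply: (@le_lt_trans _ _ (\int[mu]_(x in Om) ((A + L / c) ^+ 2)%:E)%E).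
    apply: ge0_le_integral => //.
    - by move=> x _; rewrite lee_fin sqr_ge0.
    - by apply/measurable_EFinP; exact: measurable_funX.
    - move=> x Omx; rewrite lee_fin -[(u x - w x) ^+ 2]real_normK ?num_real//.
      have := wL x Omx => hw.
      rewrite lerXn2r ?nnegrE ?addr_ge0 ?divr_ge0 ?(ltW c0)//.
      by apply: (le_trans (ler_normB _ _)); rewrite lerD.
  by rewrite integral_cst// lte_mul_pinfty ?lee_fin ?sqr_ge0.
move=> eta heta; have ceta := Cc_infty_continuous heta.
have [D D0 etaD] := Cc_infty_bounded heta.
have eta0 x : b < `|x - 0| -> eta x = 0.
  move=> xb; apply: (Cc_infty_outside heta) => Omx.
  by have := Omb x Omx; rewrite /cube/= leNgt xb.
have meta : measurable_fun setT eta by exact: continuous_rV_measurable.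
have i_eta : mu.-integrable setT (EFin \o (fun x => L * `|eta x|)).
  apply: (@integrable_bcs _ _ _ (L * D) 0 b).
  - by apply: measurable_funM; [exact: measurable_cst|exact: measurable_norm_fun].
  - by move=> x; rewrite normrM normr_id ger0_norm// ler_wpM2l.
  - by move=> x bx; rewrite eta0// normr0 mulr0.
have [|||iw cw] := @Rintegral_dominated_cvg _ _ _ mu
   (fun k x => scaled_average u n.+1 psi k.+1%:R x * eta x) (fun x => c * w x * eta x) _ _ i_eta.
- by move=> k; apply: measurable_funM.
- by move=> k x; rewrite normrM ler_wpM2r.
- move=> x; have [Omx|nOmx] := pselect (Om x).
    by apply: cvgM; [exact: wlim|exact: cvg_cst].
  by rewrite (Cc_infty_outside heta nOmx) mulr0; under eq_fun do rewrite mulr0; exact: cvg_cst.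
have cu := Rintegral_smoothing_cvg mu_ uA ceta etaD eta0.
have eJ := cvg_unique (@Rhausdorff R) cw cu.
have iu : mu.-integrable setT (EFin \o (fun x => u x * eta x)).
  apply: (@integrable_bcs _ _ _ (A * D) 0 b).
  - exact: measurable_funM.
  - by move=> x; rewrite normrM ler_pM.
  - by move=> x bx; rewrite eta0// mulr0.
have iw' : mu.-integrable setT (EFin \o (fun x => w x * eta x)).
  have := integrableZl measurableT c^-1 iw; apply: eq_integrable => // x _ /=.
  by rewrite -EFinM -!mulrA mulKf// lt0r_neq0.
have eJ' : J (fun x => w x * eta x) = J (fun x => u x * eta x).
  apply: (mulfI (lt0r_neq0 c0)); rewrite -!RintegralZl//.
  rewrite (@eq_Rintegral _ _ _ mu _ (fun x => c * w x * eta x)); last by move=> x _; rewrite mulrA.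
  by rewrite eJ; apply: eq_Rintegral => x _; rewrite mulrCA.
rewrite Rintegral_mkcond.
rewrite (@eq_Rintegral _ _ _ mu _ (fun x => u x * eta x - w x * eta x)).
  by rewrite RintegralB// eJ' subrr.
move=> x _; rewrite patchE mulrBl; case: ifPn => // /negP; rewrite inE => nOm.
by rewrite (Cc_infty_outside heta nOm) !mulr0 subrr.
Qed.

End almost_everywhere.

(** * The bootstrap *)

Section bootstrap.
Context {R : realType} {n : nat}.
Local Notation E := 'rV[R]_n.+1.
Local Notation mu := (@lebesgue_rV R n).
Local Notation J f := (\int[mu]_x f x).
Implicit Types (x y z : E) (V : set E) (u v : E -> R).
Local Notation psi := (@mollifier R n).
Local Notation theta := (@theta R n).
Local Notation c := (@mollifier_mass R n).
Local Notation q := (n.+2%:R : R).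

Let q0 : 0 <= q. Proof. exact: ler0n. Qed.
Let c0 : 0 < c. Proof. exact: mollifier_mass_gt0. Qed.

Lemma open_nbd V (r : R) : open (nbd V r).
Proof.
rewrite openE => x [y Vy xy]; apply/nbhs_ballP; exists (r - `|x - y|) => /=.
  by rewrite subr_gt0.
move=> z; rewrite -ball_normE /= => xz; exists y => //; have := ler_normD (z - x) (x - y).
by rewrite addrA subrK; rewrite distrC in xz; lra.
Qed.

Lemma nbd_mono V (r' r : R) x : r' <= r -> nbd V r' x -> nbd V r x.
Proof. by move=> rr [y Vy xy]; exists y => //; exact: lt_le_trans rr. Qed.

Lemma nbd_cube V (b r : R) : V `<=` cube 0 b -> nbd V r `<=` cube 0 (b + r).
Proof.
move=> Vb x [y Vy xy]; have := Vb y Vy; rewrite /cube/= !subr0 => yb.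
by have := ler_normD (x - y) y; rewrite subrK; lra.
Qed.

Lemma nbd_segment V (r' r : R) x z (t : R) : nbd V r' x -> `|z| <= r - r' -> `|t| <= 1 ->
  nbd V r (x + t *: z).
Proof.
move=> [y Vy xy] zr t1; exists y => //.
have := ler_normD (x - y) (t *: z); rewrite addrAC normrZ.
have : `|t| * `|z| <= `|z| by rewrite ler_piMl.
by lra.
Qed.

Lemma powR_le1 (t p : R) : 0 <= t -> t <= 1 -> 0 <= p -> t `^ p <= 1.
Proof.
move=> t0 t1 p0; rewrite (_ : 1 = 1 `^ p); last by rewrite powR1.
by rewrite ge0_ler_powR ?nnegrE.
Qed.

Lemma powR_ge1 (t p : R) : 1 <= t -> 0 <= p -> 1 <= t `^ p.
Proof.
move=> t1 p0; rewrite (_ : 1 = 1 `^ p); last by rewrite powR1.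
by rewrite ge0_ler_powR ?nnegrE// (le_trans ler01).
Qed.

Lemma second_orderW V (r : R) u (A b b' : R) : 0 <= b' <= b -> (forall x, `|u x| <= A) ->
  second_order V r u A b -> second_order V r u (4 * A) b'.
Proof.
move=> /andP[b'0 bb'] uA uP x z Vx; have A0 : 0 <= A by exact: le_trans (uA 0).
have [z1|/ltW z1] := leP `|z| 1.
  apply: (le_trans (uP x z Vx)).
  (* At $z=0$ the conventions $0^0=1$ and $0^p=0$ for $p\ne 0$ set the exponent 0 apart. *)
  have [->|zn] := eqVneq b' 0; last first.
    have b'_gt0 : 0 < b' by rewrite lt_def zn.
    have h : `|z| `^ b <= `|z| `^ b'.
      have [z0|z0] := eqVneq `|z| 0.
        by rewrite z0 !powR0// gt_eqF// (lt_le_trans b'_gt0).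
      have zz : 0 < `|z| by rewrite lt_def z0 normr_ge0.
      rewrite -(subrK b' b) powRD ?(negbTE z0) ?implybT// ler_piMl ?powR_ge0//.
      by apply: powR_le1 => //; rewrite subr_ge0.
    have : A * `|z| `^ b <= A * `|z| `^ b' by rewrite ler_wpM2l.
    have : 0 <= A * `|z| `^ b' by rewrite mulr_ge0// powR_ge0.
    lra.
  rewrite powRr0 mulr1.
  have h : `|z| `^ b <= 1.
    by apply: powR_le1 => //; exact: le_trans b'0 _.
  have : A * `|z| `^ b <= A by rewrite ler_piMr.
  lra.
apply: (le_trans (D2_le z x uA)); rewrite ler_peMr ?mulr_ge0//.
exact: powR_ge1.
Qed.

Lemma solvesW s V (r r' : R) u (A A' : R) : r' <= r -> A <= A' -> solves s V r u A ->
  solves s V r' u A'.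
Proof.
move=> rr AA [mu_ uA uS]; split => //; first by move=> x; exact: le_trans AA.
move=> e x0 t t0 far Vx0.
apply: (le_trans (uS e x0 t t0 far _)); first by apply: nbd_mono Vx0; rewrite lerD2r.
by rewrite ler_wpM2r// Rintegral_ge0.
Qed.

Lemma Rintegral_ae_eq (f g : E -> R) : measurable_fun setT f -> measurable_fun setT g ->
  {ae mu, forall x, f x = g x} -> J f = J g.
Proof.
move=> mf mg fg; rewrite /Rintegral; congr fine; apply: ae_eq_integral.
- exact: measurableT.
- exact/measurable_EFinP.
- exact/measurable_EFinP.
- by apply: filterS fg => x fgx _; rewrite fgx.
Qed.

(** Apart from measurability and the pointwise bound, [u] enters [solves] only through integrals. *)
Lemma solves_ae s V (r : R) u v (A A' : R) : A <= A' -> measurable_fun setT v ->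
  (forall x, `|v x| <= A') -> {ae mu, forall x, u x = v x} ->
  solves s V r u A -> solves s V r v A'.
Proof.
move=> AA mv vA uv us; have [mu_ uA' uS] := solvesW (lexx r) AA us.
split; [exact: mv|exact: vA|].
move=> e x0 t t0 far Vx0.
have me (f : expr R n) : measurable_fun setT (eval f).
  exact/continuous_rV_measurable/continuous_eval.
have eqJ (f : E -> R) : measurable_fun setT f -> J (fun x => v x * f x) = J (fun x => u x * f x).
  move=> mf; apply: Rintegral_ae_eq; [exact: measurable_funM|exact: measurable_funM|].
  by apply: filterS uv => x ->.
have -> : J (fun x => v x * eval (lap e) x) = J (fun x => u x * eval (lap e) x).
  exact: (eqJ _ (me (lap e))).
have -> : NL s e v = NL s e u.
  rewrite /NL; apply: eq_Rintegral => z _; congr (_ * _).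
  exact: (eqJ _ (measurable_D2 z (me e))).
exact: (uS e x0 t t0 far Vx0).
Qed.

Variable s : R.
Hypothesis s01 : 0 < s < 1.

Lemma mollifier_bounds : exists2 B : R, 0 < B &
  [/\ forall x, `|eval psi x| <= B,
      forall i x, `|eval (dexpr i psi) x| <= B &
      forall i j x, `|eval (dexpr i (dexpr j psi)) x| <= B].
Proof.
have sp := @supported_mollifier R n.
have [B B0 [B1 B2]] := eval_ddexpr_bounded sp.
have /choice[b hb] : forall i : 'I_n.+1, exists d : R, 0 <= d /\ forall x, `|eval (dexpr i psi) x| <= d.
  move=> i; have [d d0 hd] := eval_bounded (supported_dexpr i sp).
  by exists d; split; [exact: ltW|].
have b0 : 0 <= \sum_i b i by apply: sumr_ge0 => i _; exact: (hb i).1.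
exists (B + \sum_i b i); first by rewrite ltr_pwDl.
split=> [x|i x|i j x].
- by apply: le_trans (B1 x) _; rewrite lerDl.
- apply: (le_trans ((hb i).2 x)); rewrite (bigD1 i)//= addrCA lerDl.
  by rewrite addr_ge0 ?(ltW B0)//; apply: sumr_ge0 => j _; exact: (hb j).1.
- by apply: le_trans (B2 i j x) _; rewrite lerDl.
Qed.

(** The limit of the averages is controlled only on [nbd V r''], while the nonlocal form needs a
    function on the whole space; so the limit is glued to [u]. The new constant is the bound on the
    limit, the $L^1$ size of the mollifier over its mass, plus that on [u]. *)
Lemma recover_solves (r r'' b B K g h0 : R) V u (A : R) : r'' <= r ->
  V `<=` cube 0 b -> solves s V r u A -> (forall x, `|eval psi x| <= B) ->
  0 <= K -> 0 < g < 2 -> 0 < h0 -> (forall x, nbd V r'' x -> decays u K g h0 theta x) ->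
  exists v, [/\ {ae mu, forall x, u x = v x}, forall x, nbd V r'' x -> v x = recover u x &
    solves s V r v ((1 + B * (2 * q) ^+ n.+1 / c) * A)].
Proof.
move=> rr Vb us psiB K0 g02 h00 dec; have [mu_ uA _] := us.
have A0 : 0 <= A by exact: le_trans (uA 0).
have B0 : 0 <= B by exact: le_trans (psiB 0).
pose S := nbd V r''; have oS : open S by exact: open_nbd.
have [mw ae] := smoothing_ae mu_ uA oS (nbd_cube Vb)
  (fun x Sx => (recover_cvg mu_ uA K0 g02 h00 (dec x Sx)).1).
have mS := open_rV_measurable oS.
pose v x := if x \in S then recover u x else u x.
pose L := B * (2 * q) ^+ n.+1.
have L0 : 0 <= L by rewrite mulr_ge0// exprn_ge0// mulr_ge0.
have vA x : `|v x| <= (1 + L / c) * A.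
  have LA : 0 <= L / c * A by rewrite mulr_ge0// divr_ge0// ltW.
  rewrite /v; case: ifPn => [|_]; last by rewrite mulrDl mul1r (le_trans (uA x))// lerDl.
  rewrite inE => Sx; rewrite mulrDl mul1r; apply: (@le_trans _ _ (L / c * A)); last by rewrite lerDr.
  have [lc _] := recover_cvg mu_ uA K0 g02 h00 (dec x Sx).
  rewrite mulrAC ler_pdivlMr// mulrC -[X in X * _](gtr0_norm c0) -normrM.
  have cn : `|scaled_average u n.+1 psi k.+1%:R x| @[k --> \oo] --> `|c * recover u x|.
    exact: cvg_norm.
  rewrite -(cvg_lim (@Rhausdorff R) cn); apply: limr_le; first by apply/cvg_ex; eexists; exact: cn.
  apply: nearW => k; have k0 : 0 < k.+1%:R :> R by rewrite ltr0n.
  have := scaled_average_le mu_ uA 0 x (@supported_mollifier R n) psiB k0.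
  by rewrite addn0 expr0 mulr1 => /le_trans; apply; rewrite /L [leRHS]mulrC mulrA.
have uv : {ae mu, forall x, u x = v x}.
  apply: filterS ae => x h; rewrite /v; case: ifPn => //; rewrite inE; exact: h.
have mv : measurable_fun setT v.
  rewrite -(setUv S); apply/measurable_funU => //; first exact: measurableC.
  split.
    by apply: (eq_measurable_fun (recover u)) => // x xS; rewrite /v xS.
  apply: (eq_measurable_fun u); last exact: measurable_funTS.
  by move=> x; rewrite inE => nS; rewrite /v memNset.
exists v; split => //.
  by move=> x Sx; rewrite /v mem_set.
by apply: (solves_ae _ mv vA uv us); rewrite mulrDl mul1r lerDl mulr_ge0// divr_ge0// ltW.
Qed.

Lemma hessian_boundZ (A C1 g h0 B : R) :
  hessian_bound (n := n) A (C1 * A) g h0 B = A * hessian_bound (n := n) 1 C1 g h0 B.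
Proof. by rewrite /hessian_bound; ring. Qed.

Lemma improve (b r' r : R) : 0 <= b < 2 * s -> 0 < r' < r ->
  exists2 C : R, 1 <= C & forall V (bV : R) u (A : R), V `<=` cube 0 bV ->
    solves s V r u A -> second_order V r u A b ->
    exists v, [/\ {ae mu, forall x, u x = v x}, solves s V r' v (C * A) &
      second_order V r' v (C * A) (b + 2 - 2 * s)].
Proof.
move=> bs /andP[r'0 r'r]; pose r'' := (r + r') / 2.
have r''r : 0 < r - r'' by rewrite /r''; lra.
have r'r'' : 0 < r'' - r' by rewrite /r''; lra.
have q_gt0 : 0 < q by rewrite ltr0n.
(* From this frequency on, a test function centered in [nbd V r''] has its support, of radius
   [q / h], within reach of the equation. *)
pose h0 := q / (r - r''); have h00 : 0 < h0 by rewrite divr_gt0.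
pose g := b + 2 - 2 * s.
have g02 : 0 < g < 2 by rewrite /g; case/andP: bs => ? ?; case/andP: s01 => ? ?; lra.
have [B B0 [psiB _ psi2B]] := mollifier_bounds.
have st := @supported_theta R n.
have et := @even_theta R n.
have [Ct Ct0 hCt] := decay_even s01 q0 st et h00 bs.
have /choice[Cd hCd] : forall ij : 'I_n.+1 * 'I_n.+1, exists C : R, 0 < C /\
    forall V u (A r h : R) x, solves s V r u A -> second_order V r u A b ->
    h0 <= h -> nbd V (r - q / h) x ->
    `|average u (lap (dexpr ij.1 (dexpr ij.2 theta))) h x| <= C * A * h `^ (- (b + 2 - 2 * s)) / h ^+ n.+1.
  move=> ij; have sd := supported_dexpr ij.1 (supported_dexpr ij.2 st).
  have ed := even_dexpr ij.1 (odd_dexpr ij.2 et).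
  by have [C C0 hC] := decay_even s01 q0 sd ed h00 bs; exists C.
pose C1 := Ct + \sum_ij Cd ij.
have Cd0 : 0 <= \sum_ij Cd ij by apply: sumr_ge0 => ij _; exact: ltW (hCd ij).1.
have C10 : 0 < C1 by rewrite ltr_pwDl.
have Cd_le ij : Cd ij <= C1.
  rewrite /C1 (bigD1 ij)//= addrCA lerDl addr_ge0 ?(ltW Ct0)//.
  by apply: sumr_ge0 => k _; exact: ltW (hCd k).1.
pose C2 := 1 + B * (2 * q) ^+ n.+1 / c.
have C20 : 1 <= C2.
  by rewrite lerDl divr_ge0 ?(ltW c0)// mulr_ge0 ?(ltW B0)// exprn_ge0// mulr_ge0.
pose H1 := hessian_bound (n := n) 1 C1 g h0 B.
have g2 : 0 < 2 - g by case/andP: g02; lra.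
have g0 : 0 < g by case/andP: g02.
have H10 : 0 <= H1.
  rewrite addr_ge0 ?divr_ge0 ?(ltW g2) ?(ltW C10)// mulr_ge0 ?powR_ge0//.
  by rewrite mul1r mulr_ge0 ?(ltW B0)// exprn_ge0// mulr_ge0.
pose C3 := (4 * (C1 / g) + 2 * (n.+1%:R ^+ 2 * H1)) / c.
have C30 : 0 <= C3.
  rewrite divr_ge0 ?(ltW c0)// addr_ge0 ?mulr_ge0 ?invr_ge0 ?(ltW C10) ?(ltW g0)//.
(* Increments up to [d] correspond to frequencies above [h0] and keep the segments inside
   [nbd V r'']. *)
pose d := Num.min h0^-1 (r'' - r'); have d0 : 0 < d by rewrite lt_min invr_gt0 h00.
(* For increments longer than [d], the trivial bound $4C_2A$ is at most $4C_2A\,d^{-g}|z|^g$. *)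
pose C4 := 4 * C2 * d `^ (- g).
have C40 : 0 <= C4 by rewrite !mulr_ge0 ?powR_ge0// (le_trans ler01).
exists (C2 + C3 + C4); first by rewrite -addrA ler_wpDr// addr_ge0.
move=> V bV u A Vb us uP; have [mu_ uA _] := us.
have A0 : 0 <= A by exact: le_trans (uA 0).
have Vh h x : h0 <= h -> nbd V r'' x -> nbd V (r - q / h) x.
  move=> h0h; apply: nbd_mono; have hh := lt_le_trans h00 h0h.
  have : q / h <= r - r''; last by lra.
  by rewrite ler_pdivrMr// mulrC -ler_pdivrMr.
pose K := C1 * A; have K0 : 0 <= K by rewrite mulr_ge0// ltW.
have wk (C h : R) : 0 < h -> C <= C1 ->
    C * A * h `^ (- g) / h ^+ n.+1 <= K * h `^ (- g) / h ^+ n.+1.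
  move=> hh CC; rewrite ler_wpM2r ?invr_ge0 ?exprn_ge0 ?(ltW hh)//.
  by rewrite ler_wpM2r ?powR_ge0// ler_wpM2r.
have dt x : nbd V r'' x -> decays u K g h0 theta x.
  move=> Vx h h0h; apply: (le_trans (hCt V u A r h x us uP h0h (Vh h x h0h Vx))).
  by apply: wk; [exact: lt_le_trans h0h|rewrite lerDl].
have dd i j x : nbd V r'' x -> decays u K g h0 (dexpr i (dexpr j theta)) x.
  move=> Vx h h0h; have [_ /(_ V u A r h x us uP h0h (Vh h x h0h Vx))] := hCd (i, j).
  by move=> /le_trans; apply; apply: wk; [exact: lt_le_trans h0h|exact: Cd_le].
have r''r' : r'' <= r by rewrite -subr_ge0 ltW.
have [v [uv vE vs]] := recover_solves r''r' Vb us psiB K0 g02 h00 dt.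
have C2A : C2 * A <= (C2 + C3 + C4) * A by rewrite ler_wpM2r// -addrA lerDl addr_ge0.
exists v; split => //; first by apply: solvesW vs; [exact: ltW|].
move=> x z Vx; have [zd|zd] := leP `|z| d.
  have [zh zr] : `|z| <= h0^-1 /\ `|z| <= r'' - r' by apply/andP; move: zd; rewrite le_min.
  have Sz t : -1 <= t <= 1 -> nbd V r'' (x + t *: z).
    by move=> t1; apply: (nbd_segment Vx zr); rewrite ler_norml.
  have := D2_recover_le mu_ uA K0 g02 h00 psi2B dt dd Sz zh.
  have -> : D2 v z x = D2 (recover u) z x.
    rewrite /D2 !vE//.
    - by have := Sz (-1); rewrite scaleN1r; apply; lra.
    - by have := Sz 1; rewrite scale1r; apply; lra.
    - by have := Sz 0; rewrite scale0r addr0; apply; lra.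
  have -> : (4 * (K / g) + 2 * (n.+1%:R ^+ 2 * hessian_bound (n := n) A K g h0 B)) = C3 * A * c.
    rewrite /K hessian_boundZ -/H1 /C3; field.
    by rewrite !lt0r_neq0.
  rewrite mulrC [_ * c * _]mulrAC ler_pM2r// => /le_trans; apply.
  rewrite ler_wpM2r ?powR_ge0// ler_wpM2r//.
  by rewrite addrAC lerDr addr_ge0// (le_trans ler01).
have [_ vA _] := vs; apply: (le_trans (D2_le z x vA)).
have dz : 1 <= d `^ (- g) * `|z| `^ g.
  rewrite powRN mulrC ler_pdivlMr ?powR_gt0// mul1r.
  by rewrite ge0_ler_powR ?nnegrE ?(ltW g0)// ltW.
apply: (@le_trans _ _ (C4 * A * `|z| `^ g)).
  have -> : C4 * A * `|z| `^ g = 4 * (C2 * A) * (d `^ (- g) * `|z| `^ g) by rewrite /C4; ring.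
  by rewrite ler_peMr// !mulr_ge0// (le_trans ler01).
rewrite ler_wpM2r ?powR_ge0// ler_wpM2r// lerDr addr_ge0// (le_trans ler01)//.
Qed.

(* The bootstrap runs through the exponents [k sigma]; [improve] gains
   [2 - 2 s] below [2 s], and the value [2 s] itself has to be avoided. *)
Lemma bootstrap_exponents : exists k0 : nat, exists2 sigma : R,
  0 < sigma <= 2 - 2 * s & k0%:R * sigma < 2 * s < k0.+1%:R * sigma.
Proof.
case/andP: s01 => s0 s1.
have s2 : 0 < 2 - 2 * s by lra.
pose k0 := (Num.truncn (2 * s / (2 - 2 * s))).+1.
have hk : 2 * s / (2 - 2 * s) < k0%:R by exact: truncnS_gt.
have k00 : 0 < k0%:R :> R by rewrite ltr0n.
have k1 : 0 < k0%:R + 2^-1 :> R by rewrite addr_gt0.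
(* This places $2s$ halfway between two consecutive multiples of [sigma], and $2s/(2-2s)<k_0$ gives
   $\sigma\le 2-2s$. *)
exists k0; exists (2 * s / (k0%:R + 2^-1)).
  rewrite divr_gt0 ?mulr_gt0//= ler_pdivrMr// -ler_pdivrMl// [leLHS]mulrC.
  by rewrite (le_trans (ltW hk))// lerDl.
rewrite !mulrA ltr_pdivrMr// ltr_pdivlMr//.
have : k0.+1%:R = k0%:R + 1 :> R by rewrite -natr1.
by move=> ->; apply/andP; split; nra.
Qed.

(** Each pass costs part of the neighborhood and a constant factor; of its gain $2-2s$ only [sigma]
    is kept, by [second_orderW], in order to stay on the chosen multiples. *)
Lemma bootstrap : exists2 b : R, 2 * s < b & forall r' r : R, 0 < r' < r ->
  exists2 C : R, 0 < C & forall V (bV : R) u (A : R), V `<=` cube 0 bV ->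
    solves s V r u A ->
    exists v, [/\ {ae mu, forall x, u x = v x}, solves s V r' v (C * A) &
      second_order V r' v (C * A) b].
Proof.
have [k0 [sigma /andP[s0 s2] /andP[ks sk]]] := bootstrap_exponents.
exists (k0.+1%:R * sigma) => //.
suff : forall k : nat, (k <= k0.+1)%N -> forall r' r : R, 0 < r' < r ->
  exists2 C : R, 0 < C & forall V (bV : R) u (A : R), V `<=` cube 0 bV ->
    solves s V r u A ->
    exists v, [/\ {ae mu, forall x, u x = v x}, solves s V r' v (C * A) &
      second_order V r' v (C * A) (k%:R * sigma)] by apply.
elim=> [_ r' r /andP[r'0 rr]|k IH kk0 r' r /andP[r'0 rr]].
  exists 4 => // V bV u A Vb us; have [mu_ uA _] := us.
  have A0 : 0 <= A by exact: le_trans (uA 0).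
  exists u; split; first exact: aeW.
    by apply: solvesW us; [exact: ltW|rewrite ler_peMl// ler1n].
  by move=> x z _; rewrite mul0r powRr0 mulr1; exact: D2_le.
pose r'' := (r + r') / 2.
have r''r : 0 < r'' < r by rewrite /r''; apply/andP; split; lra.
have r'r'' : 0 < r' < r'' by rewrite /r''; apply/andP; split; lra.
have [C C0 hC] := IH (ltnW kk0) r'' r r''r.
have kb : 0 <= k%:R * sigma < 2 * s.
  rewrite mulr_ge0 ?(ltW s0)//=; apply: le_lt_trans ks.
  by rewrite ler_wpM2r ?(ltW s0)// ler_nat -ltnS.
have [D D1 hD] := improve kb r'r''.
exists (4 * (D * C)); first by rewrite !mulr_gt0// (lt_le_trans ltr01).
move=> V bV u A Vb us; have [v [uv vs vP]] := hC V bV u A Vb us.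
have [w [vw ws wP]] := hD V bV v (C * A) Vb vs vP.
have [_ wA _] := ws; have DCA : 0 <= D * (C * A) by exact: le_trans (wA 0).
have -> : 4 * (D * C) * A = 4 * (D * (C * A)) by ring.
exists w; split.
- by apply: filterS2 uv vw => x -> ->.
- by apply: solvesW ws => //; rewrite ler_peMl// ler1n.
- apply: (@second_orderW _ _ _ _ (k%:R * sigma + 2 - 2 * s)) => //.
  rewrite mulr_ge0 ?(ltW s0)//= -natr1 mulrDl mul1r; lra.
Qed.

End bootstrap.

Lemma le_sum4 (R : realType) (a b c d : R) : 0 <= a -> 0 <= b -> 0 <= c -> 0 <= d ->
  [/\ a <= a + b + c + d + 1, b <= a + b + c + d + 1, c <= a + b + c + d + 1 &
     d <= a + b + c + d + 1].
Proof. by move=> *; split; lra. Qed.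

(** * First-order Taylor and gradient estimates on a smaller neighborhood *)

Section interior_regularity.
Context {R : realType} {n : nat}.
Local Notation E := 'rV[R]_n.+1.
Local Notation mu := (@lebesgue_rV R n).
Implicit Types (x y z : E) (V : set E) (u v : E -> R).
Local Notation psi := (@mollifier R n).
Local Notation theta := (@theta R n).
Local Notation c := (@mollifier_mass R n).
Local Notation q := (n.+2%:R : R).

Let q0 : 0 <= q. Proof. exact: ler0n. Qed.
Let c0 : 0 < c. Proof. exact: mollifier_mass_gt0. Qed.

Variable s : R.
Hypothesis s01 : 0 < s < 1.

Lemma interior_regularity (alpha r' r : R) : 0 < alpha < 1 -> 0 < r' < r ->
  exists C d : R, [/\ 0 < C, 0 < d & forall V (bV : R) u (A : R), V `<=` cube 0 bV ->
    solves s V r u A ->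
    exists v (w : 'I_n.+1 -> E -> R), [/\ {ae mu, forall x, u x = v x},
      forall x, `|v x| <= C * A,
      forall i x, nbd V r' x -> `|w i x| <= C * A,
      forall x z, nbd V r' x -> `|z| <= d ->
        `|v (x + z) - v x - \sum_i z 0 i * w i x| <= C * A * `|z| `^ (1 + alpha) &
      forall i x z, nbd V r' x -> `|z| <= d ->
        `|w i (x + z) - w i x| <= C * A * `|z| `^ alpha]].
Proof.
move=> /andP[al0 al1] /andP[r'0 r'r].
(* The three gaps serve the bootstrap, the supports of the test functions, and the segments along
   which increments are taken. *)
pose r1 := r' + 2 * (r - r') / 3; pose r'' := r' + (r - r') / 3.
have r1r : 0 < r1 < r by rewrite /r1; apply/andP; split; lra.
have r''r1 : 0 < r1 - r'' by rewrite /r1 /r''; lra.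
have r'r'' : 0 < r'' - r' by rewrite /r''; lra.
have [b sb hboot] := @bootstrap R n s s01.
have [Cb Cb0 hCb] := hboot _ _ r1r.
have q_gt0 : 0 < q by rewrite ltr0n.
pose h0 := q / (r1 - r''); have h00 : 0 < h0 by rewrite divr_gt0.
(* Strictly between 1 and 2, so that averages of order 0 and 1 converge and those of order 2 grow
   like $h^{1-\alpha}$. *)
pose g := 1 + alpha.
have g02 : 0 < g < 2 by rewrite /g; lra.
have g1 : 1 < g by rewrite /g; lra.
have [B B0 [psiB dpsiB psi2B]] := mollifier_bounds (R := R) (n := n).
have st := @supported_theta R n.
have gle2 : g <= 2 by rewrite /g; lra.
have [Ct Ct0 hCt] := decay_any s01 q0 st h00 sb gle2.
have /choice[C1 hC1] : forall i : 'I_n.+1, exists C : R, 0 < C /\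
    forall V u (A r h : R) x, solves s V r u A -> second_order V r u A b ->
    h0 <= h -> nbd V (r - q / h) x ->
    `|average u (lap (dexpr i theta)) h x| <= C * A * h `^ (- g) / h ^+ n.+1.
  by move=> i; have [C C0 hC] := decay_any s01 q0 (supported_dexpr i st) h00 sb gle2; exists C.
have /choice[C2 hC2] : forall ij : 'I_n.+1 * 'I_n.+1, exists C : R, 0 < C /\
    forall V u (A r h : R) x, solves s V r u A -> second_order V r u A b ->
    h0 <= h -> nbd V (r - q / h) x ->
    `|average u (lap (dexpr ij.1 (dexpr ij.2 theta))) h x| <= C * A * h `^ (- g) / h ^+ n.+1.
  move=> ij; have sd := supported_dexpr ij.1 (supported_dexpr ij.2 st).
  by have [C C0 hC] := decay_any s01 q0 sd h00 sb gle2; exists C.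
pose D := Ct + \sum_i C1 i + \sum_ij C2 ij.
have S10 : 0 <= \sum_i C1 i by apply: sumr_ge0 => i _; exact: ltW (hC1 i).1.
have S20 : 0 <= \sum_ij C2 ij by apply: sumr_ge0 => i _; exact: ltW (hC2 i).1.
have D0 : 0 < D by rewrite /D -addrA ltr_pwDl// addr_ge0.
have CtD : Ct <= D by rewrite /D -addrA lerDl addr_ge0.
have C1D i : C1 i <= D.
  apply: (@le_trans _ _ (\sum_i C1 i)).
    by rewrite (bigD1 i)//= lerDl; apply: sumr_ge0 => k _; exact: ltW (hC1 k).1.
  by rewrite /D -addrA addrCA lerDl addr_ge0// ltW.
have C2D i : C2 i <= D.
  apply: (@le_trans _ _ (\sum_ij C2 ij)).
    by rewrite (bigD1 i)//= lerDl; apply: sumr_ge0 => k _; exact: ltW (hC2 k).1.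
  by rewrite /D lerDr addr_ge0// ltW.
pose H1 := hessian_bound (n := n) 1 D g h0 B.
have g2 : 0 < 2 - g by rewrite /g; lra.
have g0 : 0 < g by case/andP: g02.
have g10 : 0 < g - 1 by rewrite /g; lra.
have H10 : 0 <= H1.
  rewrite addr_ge0 ?divr_ge0 ?(ltW g2) ?(ltW D0)// mulr_ge0 ?powR_ge0//.
  by rewrite mul1r mulr_ge0 ?(ltW B0)// exprn_ge0// mulr_ge0.
pose L := B * (2 * q) ^+ n.+1.
have L0 : 0 <= L by rewrite mulr_ge0 ?(ltW B0)// exprn_ge0// mulr_ge0.
pose M0 := 1 + L / c.
pose P0 := D / g; pose P1 := D / (g - 1).
(* The size of the gradient average at [h0], plus its distance to the limit. *)
pose M1 := (L * h0 + P1 * h0 `^ (1 - g)) / c.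
pose M2 := (2 * P0 + n.+1%:R * P1 + n.+1%:R ^+ 2 * H1) / c.
pose M3 := (2 * P1 + n.+1%:R * H1) / c.
have P00 : 0 <= P0 by rewrite divr_ge0// ltW.
have P10 : 0 <= P1 by rewrite divr_ge0// ltW.
have M00 : 0 <= M0 by rewrite addr_ge0// divr_ge0// ltW.
have N0 : 0 <= n.+1%:R :> R by exact: ler0n.
have M10 : 0 <= M1.
  exact: divr_ge0 (addr_ge0 (mulr_ge0 L0 (ltW h00)) (mulr_ge0 P10 (powR_ge0 _ _))) (ltW c0).
have M20 : 0 <= M2.
  have w := addr_ge0 (mulr_ge0 (ler0n R 2) P00) (mulr_ge0 N0 P10).
  exact: divr_ge0 (addr_ge0 w (mulr_ge0 (exprn_ge0 2 N0) H10)) (ltW c0).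
have M30 : 0 <= M3.
  exact: divr_ge0 (addr_ge0 (mulr_ge0 (ler0n R 2) P10) (mulr_ge0 N0 H10)) (ltW c0).
pose M := M0 + M1 + M2 + M3 + 1.
have M_gt0 : 0 < M by exact: ltr_wpDl (addr_ge0 (addr_ge0 (addr_ge0 M00 M10) M20) M30) ltr01.
pose d := Num.min h0^-1 (r'' - r'); have d0 : 0 < d by rewrite lt_min invr_gt0 h00.
exists (M * Cb), d; split; [exact: mulr_gt0|exact: d0|move=> V bV u0 A1 Vb us0].
have [u [u0u us uP]] := hCb V bV u0 A1 Vb us0.
rewrite -mulrA; set A := Cb * A1 in us uP *.
have [mu_ uA _] := us; have A0 : 0 <= A by exact: le_trans (uA 0).
have MA (t p : R) : 0 <= p -> t <= M -> t * A * p <= M * A * p.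
  by move=> p0 tM; rewrite ler_wpM2r// ler_wpM2r.
have [M0M M1M M2M M3M] := le_sum4 M00 M10 M20 M30.
have Vh h x : h0 <= h -> nbd V r'' x -> nbd V (r1 - q / h) x.
  move=> h0h; apply: nbd_mono; have hh := lt_le_trans h00 h0h.
  have : q / h <= r1 - r'' by rewrite ler_pdivrMr// mulrC -ler_pdivrMr.
  by lra.
pose K := D * A; have K0 : 0 <= K by rewrite mulr_ge0// ltW.
have wk (C h : R) : 0 < h -> C <= D ->
    C * A * h `^ (- g) / h ^+ n.+1 <= K * h `^ (- g) / h ^+ n.+1.
  move=> hh CC; rewrite ler_wpM2r ?invr_ge0 ?exprn_ge0 ?(ltW hh)//.
  by rewrite ler_wpM2r ?powR_ge0// ler_wpM2r.
have dt x : nbd V r'' x -> decays u K g h0 theta x.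
  move=> Vx h h0h; apply: (le_trans (hCt V u A r1 h x us uP h0h (Vh h x h0h Vx))).
  by apply: wk; [exact: lt_le_trans h0h|].
have d1 i x : nbd V r'' x -> decays u K g h0 (dexpr i theta) x.
  move=> Vx h h0h; have [_ /(_ V u A r1 h x us uP h0h (Vh h x h0h Vx))] := hC1 i.
  by move=> /le_trans; apply; apply: wk; [exact: lt_le_trans h0h|exact: C1D].
have dd i j x : nbd V r'' x -> decays u K g h0 (dexpr i (dexpr j theta)) x.
  move=> Vx h h0h; have [_ /(_ V u A r1 h x us uP h0h (Vh h x h0h Vx))] := hC2 (i, j).
  by move=> /le_trans; apply; apply: wk; [exact: lt_le_trans h0h|exact: C2D].
have r''r1' : r'' <= r1 by rewrite -subr_ge0 ltW.
have [v [uv vE [_ vA _]]] := recover_solves r''r1' Vb us psiB K0 g02 h00 dt.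
have r''r' : r' <= r'' by rewrite -subr_ge0 ltW.
exists v, (recover_grad u); split.
- by apply: filterS2 u0u uv => x -> ->.
- by move=> x; apply: (le_trans (vA x)); rewrite ler_wpM2r.
- move=> i x Vx; have Vx' := nbd_mono r''r' Vx.
  have := recover_grad_close mu_ uA K0 h00 g1 (d1 i x Vx') (lexx h0).
  have := scaled_average_le mu_ uA 1 x (supported_dexpr i (@supported_mollifier R n)) (dpsiB i) h00.
  set W := scaled_average _ _ _ _ _ => h1 h2.
  have : c * `|recover_grad u i x| <= M1 * A * c.
    have -> : c * `|recover_grad u i x| = `|(W + c * recover_grad u i x) - W|.
      by rewrite addrAC subrr add0r normrM (gtr0_norm c0).
    apply: (le_trans (ler_normB _ _)); apply: (le_trans (lerD h2 h1)).
    rewrite le_eqVlt; apply/orP; left; apply/eqP; rewrite /M1 /P1 /L /K expr1; field.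
    by rewrite !lt0r_neq0.
  rewrite mulrC ler_pM2r// => /le_trans; apply.
  by rewrite -[leLHS]mulr1 -[leRHS]mulr1 MA.
- move=> x z Vx; rewrite le_min => /andP[zh zr].
  have Sz t : 0 <= t <= 1 -> nbd V r'' (x + t *: z).
    move=> t1; apply: (nbd_segment Vx zr); rewrite ler_norml.
    by case/andP: t1 => t0 ->; rewrite andbT; apply: le_trans t0; rewrite lerN10.
  have := recover_taylor mu_ uA K0 g02 h00 psi2B dt dd g1 d1 Sz zh.
  have -> : (2 * (K / g) + n.+1%:R * (K / (g - 1)) + n.+1%:R ^+ 2 * hessian_bound (n := n) A K g h0 B)
      = M2 * A * c.
    by rewrite /K hessian_boundZ -/H1 /M2 /P0 /P1; field; rewrite !lt0r_neq0.
  rewrite !vE//; last first.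
  + by have := Sz 1; rewrite scale1r; apply; rewrite ler01 lexx.
  + by have := Sz 0; rewrite scale0r addr0; apply; rewrite lexx ler01.
  rewrite mulrC [_ * c * _]mulrAC ler_pM2r// => /le_trans; apply.
  by rewrite MA// powR_ge0.
- move=> i x z Vx; rewrite le_min => /andP[zh zr].
  have Sz t : 0 <= t <= 1 -> nbd V r'' (x + t *: z).
    move=> t1; apply: (nbd_segment Vx zr); rewrite ler_norml.
    by case/andP: t1 => t0 ->; rewrite andbT; apply: le_trans t0; rewrite lerN10.
  have := recover_grad_increment mu_ uA K0 g02 h00 psi2B dd g1 d1 i Sz zh.
  have -> : (2 * (K / (g - 1)) + n.+1%:R * hessian_bound (n := n) A K g h0 B) = M3 * A * c.
    by rewrite /K hessian_boundZ -/H1 /M3 /P1; field; rewrite !lt0r_neq0.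
  have -> : g - 1 = alpha by rewrite /g addrC addKr.
  rewrite mulrC [_ * c * _]mulrAC ler_pM2r// => /le_trans; apply.
  by rewrite MA// powR_ge0.
Qed.

End interior_regularity.

(** * From the weak formulation to test expressions *)

Section geometry.
Context {R : realType} {n : nat}.
Local Notation E := 'rV[R]_n.+1.
Implicit Types (x y z : E) (Om V : set E).

Lemma dotDl x y z : dot (x + y) z = dot x z + dot y z.
Proof. by rewrite /dot -big_split; apply: eq_bigr => i _; rewrite mxE mulrDl. Qed.

Lemma dotC x y : dot x y = dot y x.
Proof. by apply: eq_bigr => i _; rewrite mulrC. Qed.

Lemma dotZl (a : R) x y : dot (a *: x) y = a * dot x y.
Proof. by rewrite /dot mulr_sumr; apply: eq_bigr => i _; rewrite mxE mulrA. Qed.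

Lemma sqr_enorm x : enorm x ^+ 2 = dot x x.
Proof. by rewrite sqr_sqrtr ?dot_ge0. Qed.

Lemma enorm0_eq0 x : enorm x = 0 -> x = 0.
Proof.
move=> x0; apply/eqP; rewrite -normr_le0.
by have := norm_le_enorm x; rewrite x0.
Qed.

Lemma dot_le_enorm x y : dot x y <= enorm x * enorm y.
Proof.
have [/eqP y0|y0] := boolP (enorm y == 0).
  rewrite y0 mulr0 (enorm0_eq0 y0) dotC -(scale0r (0 : E)) dotZl mul0r //.
have [/eqP x0|x0] := boolP (enorm x == 0).
  rewrite x0 mul0r (enorm0_eq0 x0) -(scale0r (0 : E)) dotZl mul0r //.
have xp : 0 < enorm x by rewrite lt_def x0 enorm_ge0.
have yp : 0 < enorm y by rewrite lt_def y0 enorm_ge0.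
have := dot_ge0 (enorm y *: x + (- enorm x) *: y).
rewrite !dotDl ![dot _ (_ + _)]dotC !dotDl !dotZl ![dot _ (_ *: _)]dotC !dotZl -!sqr_enorm [dot y x]dotC.
set a := enorm x in xp *; set b := enorm y in yp *; set d := dot x y => h.
have : 0 <= a * b * (2 * (a * b - d)).
  by apply: le_trans h _; rewrite le_eqVlt; apply/orP; left; apply/eqP; ring.
by rewrite pmulr_rge0 ?mulr_gt0// pmulr_rge0// subr_ge0.
Qed.

Lemma enormD x y : enorm (x + y) <= enorm x + enorm y.
Proof.
rewrite -(@ler_pXn2r _ 2)// ?nnegrE ?addr_ge0 ?enorm_ge0//.
rewrite sqr_enorm !dotDl ![dot _ (_ + _)]dotC !dotDl -!sqr_enorm [dot y x]dotC.
by have := dot_le_enorm x y; lra.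
Qed.

Lemma enormZ (a : R) x : enorm (a *: x) = `|a| * enorm x.
Proof.
by rewrite /enorm dotZl dotC dotZl mulrA -expr2 sqrtrM ?sqr_ge0// sqrtr_sqr.
Qed.

Lemma enormB x y : enorm (x - y) = enorm (y - x).
Proof. by rewrite -enormN opprB. Qed.

Lemma boundary_open Om z : open Om -> boundary Om z -> ~ Om z.
Proof. by move=> /interior_id oOm [_]; rewrite oOm. Qed.

(* The segment from [y] to [z] is connected, so it meets the boundary. *)
Lemma segment_boundary Om y z : open Om -> Om y -> ~ Om z ->
  exists2 p, boundary Om p & enorm (y - p) <= enorm (y - z).
Proof.
move=> oOm Omy nOmz; apply: contrapT => nb; apply: nOmz.
pose f (t : R) : E := y + t *: (z - y).
have cf : continuous f.
  by move=> t; apply: cvgD; [exact: cvg_cst|apply: cvgZr_tmp; exact: cvg_id].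
have nbf t : 0 <= t <= 1 -> closure Om (f t) -> Om (f t).
  move=> t01 clf; apply: contrapT => nf; apply: nb; exists (f t).
    by split => // /interior_subset.
  rewrite /f opprD addrA subrr add0r enormN enormZ enormB.
  by case/andP: t01 => t0 t1; rewrite ger0_norm// ler_piMl// enorm_ge0.
have i1 : `[0, 1]%classic (1 : R) by rewrite /= in_itv/= ler01 lexx.
have i0 : `[0, 1]%classic (0 : R) by rewrite /= in_itv/= ler01 lexx.
have : `[0, 1]%classic `&` f @^-1` Om = `[0, 1]%classic.
  apply: (@segment_connected R 0 1).
  - by exists 0; split => //; rewrite /f/= scale0r addr0.
  - have oC : open (f @^-1` Om) by apply: open_comp => // t _; exact: cf.
    by exists (f @^-1` Om).
  - exists (f @^-1` closure Om).
      have : closed (f @^-1` closure Om); last by [].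
      by apply: preimage_closed; [move=> t _; exact: cf|exact: closed_closure].
    apply/seteqP; split => t [it ft]; split => //.
      exact: subset_closure.
    by apply: nbf => //; move: it; rewrite /= in_itv.
move=> /seteqP[_ /(_ 1 i1)[_]].
by rewrite /f/= scale1r addrC subrK.
Qed.

Lemma set_dist_le V (Om : set E) (y z : E) : V y -> boundary Om z ->
  set_dist V (boundary Om) <= enorm (y - z).
Proof.
move=> Vy bz; apply: ge_inf; last by exists y => //; exists z.
by exists 0 => _ [a _ [b _ <-]]; exact: enorm_ge0.
Qed.

(** The distance is measured to the boundary only, but a segment leaving [Om] crosses the boundary
    before reaching [z]. *)
Lemma set_dist_outside V Om y z : open Om -> closure V `<=` Om -> V y -> ~ Om z ->
  set_dist V (boundary Om) <= enorm (y - z).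
Proof.
move=> oOm VOm Vy nOmz.
have [p bp yp] := segment_boundary oOm (VOm _ (subset_closure Vy)) nOmz.
exact: le_trans (set_dist_le Vy bp) yp.
Qed.

Lemma bounded_set_cube Om : bounded_set Om -> exists2 b : R, 0 < b & Om `<=` cube 0 b.
Proof.
move=> [M [_ hM]]; exists (`|M| + 1); first by rewrite ltr_wpDl.
move=> x Omx; rewrite /cube/= subr0; apply: (hM (`|M| + 1)) => //.
by rewrite (le_lt_trans (ler_norm M))// ltrDl.
Qed.

Lemma compact_closed_cube (K : set E) (b : R) : closed K -> K `<=` cube 0 b -> compact K.
Proof. by move=> cK Kb; apply: (subclosed_compact cK _ Kb); exact: compact_cube. Qed.

(** The closure of [V] is compact, so balls of one common radius around its points stay inside [Om];
    boundary points are not in [Om]. *)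
Lemma set_dist_boundary_gt0 V Om : open Om -> bounded_set Om -> closure V `<=` Om ->
  V !=set0 -> 0 < set_dist V (boundary Om).
Proof.
move=> oOm bOm VOm [y0 Vy0].
have [b b0 Omb] := bounded_set_cube bOm.
have cV : compact (closure V).
  by apply: (@compact_closed_cube _ b); [exact: closed_closure|exact: subset_trans Omb].
have [d d0 hd] : exists2 d : R, 0 < d & forall x y, closure V x -> `|y - x| < d -> Om y.
  have /compact_near_coveringP cover := cV.
  have := cover R ((0 : R)^'+) (fun d x => forall y, `|y - x| < d -> Om y) _.
  case.
    move=> x Vx; have /nbhs_ballP[e /= e0 he] : nbhs x Om.
      by apply: open_nbhs_nbhs; split => //; exact: VOm.
    exists (ball x (e / 2), [set d | d < e / 2]) => /=.
      split; first by apply: nbhsx_ballx; rewrite divr_gt0.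
      by apply: nbhs_right_lt; rewrite divr_gt0.
    move=> [x' d] [/=]; rewrite -ball_normE /= => xx' de y yx'.
    apply: he; rewrite -ball_normE /=; have := ler_normD (x - x') (x' - y).
    by rewrite addrA subrK [`|x' - y|]distrC; lra.
  move=> e /= e0 he; exists (e / 2); first by rewrite divr_gt0.
  move=> x y Vx xy; apply: (he (e / 2) _ _ x Vx y xy) => /=.
    by rewrite sub0r normrN ger0_norm ?divr_ge0 ?ltW// ltr_pdivrMr// ltr_pMr// ltr1n.
  by rewrite divr_gt0.
apply: (lt_le_trans d0); apply: lb_le_inf.
  (* The infimum of the empty set is 0 by convention, so a boundary point has to be produced; it
     lies on a segment to this point outside [Om]. *)
  pose z : E := const_mx (b + 1).
  have nz : ~ Om z.
    move=> /Omb; rewrite /cube/= subr0 => zb; have := coord_le_norm z ord0.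
    rewrite mxE ger0_norm ?addr_ge0 ?(ltW b0)//; lra.
  have [p bp _] := segment_boundary oOm (VOm _ (subset_closure Vy0)) nz.
  by exists (enorm (y0 - p)); exists y0 => //; exists p.
move=> _ [x Vx [z bz <-]]; rewrite leNgt; apply/negP => xz.
apply: (boundary_open oOm bz); apply: (hd x) => //; first exact: subset_closure.
by apply: le_lt_trans xz; rewrite distrC; exact: norm_le_enorm.
Qed.

Section neighborhoods.
Variables (Om V : set E) (rho : R).
Hypotheses (oOm : open Om) (VOm : closure V `<=` Om).
Hypothesis rhoE : rho = set_dist V (boundary Om).
Hypothesis rho0 : 0 < rho.

(** The factor [n.+1] pays for the passage from the sup norm to the Euclidean norm. *)
Lemma nbd_neighborhood_in : nbd V (3 / 4 * rho / n.+1%:R) `<=` neighborhood_in Om V (3 / 4 * rho).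
Proof.
move=> x [y Vy xy].
have exy : enorm (x - y) < 3 / 4 * rho.
  by apply: (le_lt_trans (enorm_le_norm _)); rewrite mulrC -ltr_pdivlMr.
split; last first.
  apply: le_lt_trans exy; apply: ge_inf; last by exists y.
  by exists 0 => _ [a _ <-]; exact: enorm_ge0.
apply: contrapT => nx; have := set_dist_outside oOm VOm Vy nx.
rewrite -rhoE enormB => h; have := le_lt_trans h exy.
by rewrite ltr_pMl//; lra.
Qed.

Lemma neighborhood_in_compact (b : R) : Om `<=` cube 0 b -> V !=set0 ->
  exists K : set E, [/\ compact K, K `<=` Om & neighborhood_in Om V (3 / 4 * rho) `<=` K].
Proof.
move=> Omb V0.
(* Points within $3\rho/4$ of [V] stay at Euclidean distance at least $\rho/4$ from the complement
   of [Om]; the division by [n.+1] turns this into the sup norm. *)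
pose d := rho / 4 / n.+1%:R; have d0 : 0 < d by rewrite !divr_gt0.
pose K := cube (0 : E) b `&` [set x | forall z, ~ Om z -> d <= `|x - z|].
have KOm : K `<=` Om.
  move=> x [_ Kx]; apply: contrapT => nx; have := Kx x nx.
  by rewrite subrr normr0 leNgt d0.
exists K; split => //.
  apply: (@compact_closed_cube _ b); last by move=> x [].
  apply: closedI; first exact: closed_cube.
  rewrite (_ : [set x | _] = \bigcap_(z in ~` Om) [set x | d <= `|x - z|]); last first.
    by apply/seteqP; split => x h z; exact: h.
  apply: closed_bigI => z _.
  rewrite (_ : [set x | _] = (fun x => `|x - z|) @^-1` [set t | d <= t])//.
  apply: preimage_closed; last exact: closed_ge.
  move=> x _; apply: eps_delta_continuous => e e0; exists e => // y xy.
  apply: (le_trans (ler_dist_dist _ _)); rewrite opprB addrA subrK.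
  exact: ltW.
move=> x [Omx xV]; split; first exact: Omb.
move=> z nz /=; rewrite ler_pdivrMr// [leRHS]mulrC.
apply: le_trans (enorm_le_norm _).
have : exists2 y, V y & enorm (x - y) < 3 / 4 * rho.
  have [||_ [y Vy <-] xy] := @inf_lt _ [set enorm (x - y) | y in V] (3 / 4 * rho).
  - by case: V0 => y Vy; exists (enorm (x - y)); exists y.
  - exact: xV.
  - by exists y.
move=> [y Vy xy]; have := set_dist_outside oOm VOm Vy nz; rewrite -rhoE.
have := enormD (y - x) (x - z); rewrite addrA subrK [enorm (y - x)]enormB; lra.
Qed.

End neighborhoods.

End geometry.

(** * Weak gradients and the admissibility of expressions as test functions *)

Section weak_gradients.
Context {R : realType} {n : nat}.
Local Notation E := 'rV[R]_n.+1.
Local Notation mu := (@lebesgue_rV R n).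
Local Notation J f := (\int[mu]_x f x).
Implicit Types (x y z : E) (Om V : set E) (f psi : E -> R) (i : 'I_n.+1).

Lemma continuous_bounded_cube f x0 (r : R) : continuous f ->
  exists2 B : R, 0 <= B & forall x, `|x - x0| <= r -> `|f x| <= B.
Proof.
move=> cf; have [M [_ hM]] : bounded_set (f @` cube x0 r).
  apply: compact_bounded; apply: continuous_compact; last exact: compact_cube.
  by apply: continuous_subspaceT => x; exact: cf.
exists (`|M| + 1); first exact: addr_ge0.
move=> x xr; apply: (hM (`|M| + 1)); last by exists x.
by rewrite (le_lt_trans (ler_norm M))// ltrDl.
Qed.

Lemma is_derive_line f df x (v : E) (h : R) : is_derive (x + h *: v) v f (df : R) ->
  is_derive h 1 (fun t : R => f (x + t *: v)) df.
Proof.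
move=> [fd fE]; have e : (fun t : R => t^-1 *: (((fun t : R => f (x + t *: v)) \o shift h) (t *: 1) - f (x + h *: v))) =
    (fun t : R => t^-1 *: ((f \o shift (x + h *: v)) (t *: v) - f (x + h *: v))).
  apply/funext => t /=; congr (_ *: (f _ - _)).
  have -> : t%:A = t by exact: mulr1.
  by rewrite scalerDl addrCA.
by split; [rewrite /derivable e|rewrite /derive e].
Qed.

(** Translation invariance, as in [Rintegral_dexpr0], for functions outside the syntax: integration
    by parts involves the product of an expression with an arbitrary element of [Cc_infty]. *)
Lemma Rintegral_derive0 f (df : E -> R) i x0 (r : R) : 0 <= r ->
  (forall x, is_derive x (delta_mx 0 i) f (df x)) -> continuous f -> continuous df ->
  (forall x, r < `|x - x0| -> f x = 0) -> (forall x, r < `|x - x0| -> df x = 0) -> J df = 0.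
Proof.
move=> r0 fdf cf cdf f0 df0; pose d : E := delta_mx 0 i.
have nd : `|d| <= 1.
  apply: norm_le_coord => j; rewrite mxE eqxx /=.
  by case: (_ == _); rewrite ?normr1 ?normr0.
have mf : measurable_fun setT f by exact: continuous_rV_measurable.
have bd (g : E -> R) : continuous g -> (forall x, r < `|x - x0| -> g x = 0) ->
    exists2 B : R, 0 <= B & forall x, `|g x| <= B.
  move=> cg g0; have [B B0 hB] := continuous_bounded_cube x0 r cg.
  exists B => // x; have [/hB//|/g0 ->] := leP `|x - x0| r; by rewrite normr0.
have [B' _ hB'] := bd f cf f0; have [B B0 hB] := bd df cdf df0.
have far (h : R) x : `|h - 0| < 1 -> r + 1 < `|x - x0| -> r < `|x + h *: d - x0|.
  rewrite subr0 => h1 rx; rewrite -ltrBrDr in rx; apply: lt_le_trans rx _.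
  have hd : `|h *: d| <= 1 by rewrite normrZ mulr_ile1// ltW.
  have := ler_normB (x + h *: d - x0) (h *: d).
  by rewrite [x + _ - x0]addrAC addrK; lra.
have := @is_derive_Rintegral R n (fun h x => f (x + h *: d))
  (fun h x => df (x + h *: d)) 0 1 B (r + 1) x0 ltr01.
have -> : (fun h : R => J (fun x => f (x + h *: d))) = cst (J f).
  by apply/funext => h; apply: Rintegral_shift.
move=> H; have [||||_] := H.
- move=> h h1; apply: (@integrable_bcs _ _ _ B' x0 (r + 1)).
  + exact: measurable_shift.
  + by [].
  + by move=> y ry; apply: f0; exact: far.
- by move=> h y _; exact: is_derive_line.
- by [].
- by move=> h y h1 ry; apply: df0; exact: far.
rewrite derive_cst => /esym; under eq_Rintegral do rewrite scale0r addr0.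
by [].
Qed.

Lemma Rintegral_domain Om f : (forall x, ~ Om x -> f x = 0) -> \int[mu]_(x in Om) f x = J f.
Proof.
move=> f0; rewrite Rintegral_mkcond; apply: eq_Rintegral => x _; rewrite patchE.
by case: ifPn => // /negP; rewrite inE => /f0.
Qed.

Lemma L2_bcs Om f (B : R) x0 (r : R) : measurable Om -> measurable_fun setT f ->
  (forall y, `|f y| <= B) -> (forall y, r < `|y - x0| -> f y = 0) -> L2 Om f.
Proof.
move=> mOm mf fB f0; split; first exact: measurable_funTS.
have mf2 : measurable_fun setT (fun x => f x ^+ 2) by exact: measurable_funX.
have i2 : mu.-integrable setT (EFin \o (fun x => f x ^+ 2)).
  apply: (@integrable_bcs _ _ _ (B ^+ 2) x0 r) => //.
  - move=> y; rewrite normrX lerXn2r ?nnegrE// (le_trans (normr_ge0 (f x0)))//.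
  - by move=> y /f0 ->; rewrite expr0n.
case/integrableP : i2 => _; apply: le_lt_trans.
have -> : (\int[mu]_x `|(EFin \o (fun x => (f x ^+ 2)%R)) x| = \int[mu]_x (f x ^+ 2)%:E)%E.
  by apply: eq_integral => x _ /=; rewrite ger0_norm ?sqr_ge0.
apply: ge0_subset_integral => //.
- exact/measurable_EFinP.
- by move=> x _; rewrite lee_fin sqr_ge0.
Qed.

Lemma L2_mul_integrable Om f psi (B : R) : measurable Om -> (mu Om < +oo)%E -> L2 Om f ->
  measurable_fun setT psi -> (forall x, `|psi x| <= B) ->
  mu.-integrable Om (EFin \o (fun x => f x * psi x)).
Proof.
move=> mOm Omoo [mf f2] mpsi psiB.
have B0 : 0 <= B by exact: le_trans (psiB 0).
have i1 : mu.-integrable Om (EFin \o (fun=> B)).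
  apply/integrableP; split; first exact: measurable_cst.
  by rewrite integral_cst//= lte_mul_pinfty// lee_fin normr_ge0.
have i2 : mu.-integrable Om (EFin \o (fun x => B * f x ^+ 2)).
  have : mu.-integrable Om (EFin \o (fun x => f x ^+ 2)).
    apply/integrableP; split; first by apply/measurable_EFinP; exact: measurable_funX.
    by under eq_integral do rewrite /= ger0_norm ?sqr_ge0//.
  by move=> /(integrableZl mOm B); apply: eq_integrable.
have := integrableD mOm i1 i2; apply: le_integrable.
- exact: mOm.
- by apply/measurable_EFinP; apply: measurable_funM; [exact: mf|exact: measurable_funTS].
move=> x _ /=; rewrite lee_fin normrM [leRHS]ger0_norm; last first.
  by rewrite addr_ge0// mulr_ge0// sqr_ge0.
rewrite mulrC; apply: (@le_trans _ _ (B * `|f x|)); first by rewrite ler_wpM2r.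
have : `|f x| <= 1 + f x ^+ 2.
  by rewrite -[f x ^+ 2]real_normK ?num_real//; have := sqr_ge0 (`|f x| - 1); nra.
by move=> /(ler_wpM2l B0); rewrite mulrDr mulr1.
Qed.

(** The difference is square integrable and orthogonal to all test functions. Since [wgrad] is
    selected by choice, this is the only access to its values. *)
Lemma weak_gradient_unique Om u (G1 G2 : E -> E) : open Om -> (mu Om < +oo)%E ->
  is_weak_gradient Om u G1 -> is_weak_gradient Om u G2 ->
  {ae mu, forall x, Om x -> forall i, G1 x 0 i = G2 x 0 i}.
Proof.
move=> oOm Omoo w1 w2; have mOm := open_rV_measurable oOm.
suff : \forall x \ae mu, forall i, Om x -> G1 x 0 i = G2 x 0 i.
  by apply: filterS => x h Omx i; exact: h.
apply: filter_forall => i.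
suff : {ae mu, forall x, Om x -> G1 x 0 i - G2 x 0 i = 0}.
  by apply: filterS => x h /h /eqP; rewrite subr_eq0 => /eqP.
have [l1 h1] := w1 i; have [l2 h2] := w2 i.
apply: (test_ae0 oOm).
  have sq f : L2 Om f -> mu.-integrable Om (EFin \o (fun x => f x ^+ 2)).
    move=> [mf ff]; apply/integrableP; split; first by apply/measurable_EFinP; exact: measurable_funX.
    by under eq_integral do rewrite /= ger0_norm ?sqr_ge0//.
  have i12 := integrableD mOm (integrableZl mOm 2 (sq _ l1)) (integrableZl mOm 2 (sq _ l2)).
  split; first by apply: measurable_funB; [exact: l1.1|exact: l2.1].
  case/integrableP: i12 => _; apply: le_lt_trans; apply: ge0_le_integral.
  - exact: mOm.
  - by move=> x _; rewrite lee_fin sqr_ge0.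
  - by apply/measurable_EFinP; apply: measurable_funX; apply: measurable_funB; [exact: l1.1|exact: l2.1].
  - apply: (measurableT_comp (@abse_measurable R setT)); apply: emeasurable_funD.
    + apply/measurable_EFinP; apply: measurable_funM; first exact: measurable_cst.
      by apply: measurable_funX; exact: l1.1.
    + apply/measurable_EFinP; apply: measurable_funM; first exact: measurable_cst.
      by apply: measurable_funX; exact: l2.1.
  - move=> x _; rewrite /= lee_fin; apply: le_trans (ler_norm _).
    by have := sqr_ge0 (G1 x 0 i + G2 x 0 i); lra.
move=> psi hpsi; have [B B0 psiB] := Cc_infty_bounded hpsi.
have mpsi := continuous_rV_measurable (Cc_infty_continuous hpsi).
have j1 := L2_mul_integrable mOm Omoo l1 mpsi psiB.
have j2 := L2_mul_integrable mOm Omoo l2 mpsi psiB.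
under eq_Rintegral do rewrite mulrBl.
rewrite RintegralB//; apply/eqP; rewrite subr_eq0 -eqr_opp; apply/eqP.
by rewrite -h1// -h2.
Qed.

Lemma wgradP Om u : H1 Om u -> is_weak_gradient Om u (wgrad Om u).
Proof. by move=> [_ [G hG]]; exact: (xgetPex _ (ex_intro _ G hG)). Qed.

Section smooth_test.
Variables (e : expr R n) (x0 : E) (r : R) (Om : set E).
Hypotheses (r0 : 0 <= r) (re : forall x, r < `|x - x0| -> eval e x = 0).
Hypotheses (oOm : open Om) (cOm : cube x0 r `<=` Om) (Omoo : (mu Om < +oo)%E).
Local Notation phi := (eval e).

Let mOm : measurable Om. Proof. exact: open_rV_measurable. Qed.

Let me (f : expr R n) : measurable_fun setT (eval f).
Proof. exact/continuous_rV_measurable/continuous_eval. Qed.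

Lemma eval_dexpr_far_at i x : r < `|x - x0| -> eval (dexpr i e) x = 0.
Proof.
pose f := subst_affine 1 x0 e.
have fr : supported r f.
  by move=> y ry; rewrite eval_subst_affine scale1r re// addrK.
move=> rx; have := supported_dexpr i fr rx.
by rewrite eval_dexpr_subst_affine mul1r scale1r subrK.
Qed.

Lemma far_outside f x : (forall x, r < `|x - x0| -> f x = 0) -> ~ Om x -> f x = 0 :> R.
Proof.
move=> fr nx; apply: fr; rewrite ltNge; apply/negP => h.
by apply: nx; exact: cOm.
Qed.

Lemma Cc_infty_test : Cc_infty Om phi.
Proof. exact: Cc_infty_eval re cOm. Qed.

Lemma weak_gradient_eval : is_weak_gradient Om phi (fun x => \row_i eval (dexpr i e) x).
Proof.
move=> i; have [B B0 eB] := continuous_bounded_cube x0 r (@continuous_eval R n e).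
have [B1 B10 deB] := continuous_bounded_cube x0 r (@continuous_eval R n (dexpr i e)).
have eB' x : `|phi x| <= B by have [/eB//|/re ->] := leP `|x - x0| r; rewrite normr0.
have deB' x : `|eval (dexpr i e) x| <= B1.
  by have [/deB//|/eval_dexpr_far_at ->] := leP `|x - x0| r; rewrite normr0.
split.
  under eq_fun do rewrite mxE.
  by apply: (L2_bcs mOm _ deB'); [exact: me|exact: eval_dexpr_far_at].
move=> psi [smpsi _ _]; have [cpsi dpsi] := smpsi [::].
have [cdpsi _] := smpsi [:: i].
have {}dpsi x : is_derive x (delta_mx 0 i) psi (partial i psi x) by apply/derivableP; exact: dpsi.
under [in RHS]eq_Rintegral do rewrite mxE.
rewrite (@Rintegral_domain Om (fun x => phi x * partial i psi x)); last first.
  by move=> x nx; rewrite (far_outside re nx) mul0r.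
rewrite (@Rintegral_domain Om (fun x => eval (dexpr i e) x * psi x)); last first.
  by move=> x nx; rewrite (far_outside (eval_dexpr_far_at i) nx) mul0r.
have [P P0 psiP] := continuous_bounded_cube x0 r cpsi.
have [Q Q0 dpsiQ] := continuous_bounded_cube x0 r cdpsi.
have i1 : mu.-integrable setT (EFin \o (fun x => phi x * partial i psi x)).
  apply: (@integrable_bcs _ _ _ (B * Q) x0 r).
  - apply: measurable_funM; [exact: me|exact: continuous_rV_measurable].
  - move=> x; have [xr|/re ->] := leP `|x - x0| r; last by rewrite mul0r normr0 mulr_ge0.
    by rewrite normrM ler_pM//; exact: dpsiQ.
  - by move=> x /re ->; rewrite mul0r.
have i2 : mu.-integrable setT (EFin \o (fun x => eval (dexpr i e) x * psi x)).
  apply: (@integrable_bcs _ _ _ (B1 * P) x0 r).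
  - apply: measurable_funM; [exact: me|exact: continuous_rV_measurable].
  - move=> x; have [xr|/eval_dexpr_far_at ->] := leP `|x - x0| r; last by rewrite mul0r normr0 mulr_ge0.
    by rewrite normrM ler_pM//; exact: psiP.
  - by move=> x /eval_dexpr_far_at ->; rewrite mul0r.
apply/eqP; rewrite -addr_eq0 -RintegralD//; apply/eqP.
apply: (@Rintegral_derive0 (fun x => phi x * psi x) _ i x0 r) => //.
- move=> x; apply: (is_derive_eq (is_deriveM (is_derive_eval e x i) (dpsi x))).
  by rewrite /GRing.scale/=; ring.
- by move=> x; exact: (continuousM (@continuous_eval R n e x) (cpsi x)).
- move=> x; apply: (continuousD (continuousM (@continuous_eval R n e x) (cdpsi x))).
  exact: (continuousM (@continuous_eval R n (dexpr i e) x) (cpsi x)).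
- by move=> x /re ->; rewrite mul0r.
- by move=> x rx; rewrite re// (eval_dexpr_far_at _ rx) !mul0r addr0.
Qed.

Lemma H1_eval : H1 Om phi.
Proof.
have [B B0 eB] := continuous_bounded_cube x0 r (@continuous_eval R n e).
split; last by eexists; exact: weak_gradient_eval.
apply: (@L2_bcs Om phi B x0 r mOm (me e) _ re) => x.
by have [/eB//|/re ->] := leP `|x - x0| r; rewrite normr0.
Qed.

(** Even for the zero function the selected weak gradient is known to vanish only almost everywhere,
    through uniqueness. *)
Lemma H1_norm_cst0 (f : E -> R) : (forall x, f x = 0) -> H1_norm Om f = 0%E.
Proof.
move=> f0.
have L20 : L2 Om (fun=> 0).
  split; first exact: measurable_cst.
  by under eq_integral do rewrite expr0n/=; rewrite integral0 ltry.
have w0 : is_weak_gradient Om f (fun=> 0).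
  move=> i; split; first by under eq_fun do rewrite mxE.
  move=> psi _; rewrite /Rintegral.
  under eq_integral do rewrite f0 mul0r; under [in RHS]eq_integral do rewrite mxE mul0r.
  by rewrite !integral0 oppr0.
have wf : is_weak_gradient Om f (wgrad Om f).
  apply: wgradP; split; last by exists (fun=> 0).
  by have -> : f = (fun=> 0) by apply/funext.
have ae := weak_gradient_unique oOm Omoo wf w0.
rewrite /H1_norm.
have -> : (\int[mu]_(x in Om) (f x ^+ 2)%:E = 0)%E.
  by under eq_integral do rewrite f0 expr0n/=; rewrite integral0.
have -> : (\int[mu]_(x in Om) (enorm (wgrad Om f x) ^+ 2)%:E = 0)%E.
  rewrite -[RHS](integral0 mu Om); apply: ae_eq_integral => //.
  - have -> : (fun x => (enorm (wgrad Om f x) ^+ 2)%:E) =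
        (fun x => (\sum_i wgrad Om f x 0 i * wgrad Om f x 0 i)%:E).
      by apply/funext => x; rewrite sqr_enorm.
    apply/measurable_EFinP; apply: measurable_sum => i.
    by apply: measurable_funM; exact: (wf i).1.1.
  - apply: filterS ae => x h Omx; rewrite (_ : wgrad Om f x = 0).
      by rewrite sqr_enorm /dot big1// => i _; rewrite mxE mul0r.
    by apply/rowP => i; rewrite h.
by rewrite adde0 poweR0r// invr_eq0.
Qed.

(** Membership in [H10] is witnessed by [phi] itself as its own approximation. *)
Lemma X10_eval (s : R) : 0 < s < 1 -> X10 s Om phi.
Proof.
move=> s01; split.
- exact: me.
- split; first exact: H1_eval.
  move=> d d0; exists phi; split; first exact: Cc_infty_test.
  by rewrite H1_norm_cst0 ?lte_fin// => x /=; rewrite subrr.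
- apply: poweR_lty; exact: (gagliardo_eval_lty s01 r0 re).
- by apply: aeW => x nx; exact: far_outside re nx.
Qed.

Lemma wgrad_eval : {ae mu, forall x, Om x -> forall i, wgrad Om phi x 0 i = eval (dexpr i e) x}.
Proof.
have := weak_gradient_unique oOm Omoo (wgradP H1_eval) weak_gradient_eval.
by apply: filterS => x h Omx i; rewrite h// mxE.
Qed.

End smooth_test.
End weak_gradients.

(** * Essential suprema of functions and of the nonlinearity *)

Section sup_norms.
Context {R : realType} {n : nat}.
Local Notation E := 'rV[R]_n.+1.
Local Notation mu := (@lebesgue_rV R n).
Implicit Types (A : set E) (u : E -> R) (g : E * R -> R) (Q : set (E * R)).

(** [Lnorm] at infinity is the essential supremum on condition that the whole space has positive
    measure. *)
Lemma lebesgue_rV_gt0 : (0 < mu setT)%E.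
Proof.
apply: (lt_le_trans lte01); apply: (le_trans (@leb_outer_unit_cube R n)).
exact: le_leb_outer.
Qed.

Lemma Lnormoo (f : E -> \bar R) : Lnorm mu +oo%E f = ess_sup mu (abse \o f).
Proof. by rewrite unlock /= lebesgue_rV_gt0. Qed.

Lemma Linfty_norm_ae A u : (Linfty_norm A u < +oo)%E ->
  {ae mu, forall x, A x -> `|u x| <= fine (Linfty_norm A u)}.
Proof.
move=> Aoo; have := ess_sup_ge mu (abse \o (EFin \o (u \_ A))).
rewrite -Lnormoo -/(Linfty_norm A u); apply: filterS => x h Ax.
have fn : Linfty_norm A u \is a fin_num by rewrite ge0_fin_numE// Lnorm_ge0.
by rewrite -lee_fin fineK//; apply: le_trans h; rewrite /= patchE mem_set.
Qed.

Lemma Linfty_norm_le A u : (Linfty_norm A u <= Linfty_norm setT u)%E.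
Proof.
rewrite /Linfty_norm !Lnormoo; apply: le_ess_sup; apply: nearW => x /=.
rewrite !patchE in_setT; case: ifP => // _.
by rewrite normr0 lee_fin.
Qed.

Lemma Linfty_norm2E Q g : Linfty_norm2 Q g =
  ess_sup mu (fun x => ereal_sup (range (fun t : R => `|(g \_ Q) (x, t)|%:E))).
Proof.
rewrite /Linfty_norm2 Lnormoo; apply: eq_ess_sup; apply: nearW => x.
rewrite /comp gee0_abs//.
by apply: (@le_trans _ _ `|(g \_ Q) (x, 0)|%:E); [rewrite lee_fin|apply: ereal_sup_ubound; exists 0].
Qed.

Lemma Linfty_norm2_ge0 Q g : (0 <= Linfty_norm2 Q g)%E.
Proof. exact: Lnorm_ge0. Qed.

(** One null set of points [x] serves all values [t] at once, which permits the substitution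
    [t = u x]. *)
Lemma Linfty_norm2_ae Q g :
  {ae mu, forall x, forall t, Q (x, t) -> (`|g (x, t)|%:E <= Linfty_norm2 Q g)%E}.
Proof.
rewrite Linfty_norm2E; have := ess_sup_ge mu (fun x => ereal_sup (range (fun t : R => `|(g \_ Q) (x, t)|%:E))).
apply: filterS => x h t Qt; apply: le_trans h; apply: ereal_sup_ubound.
by exists t => //; rewrite patchE mem_set.
Qed.

Lemma Linfty_norm2_mono Q Q' g : Q `<=` Q' -> (Linfty_norm2 Q g <= Linfty_norm2 Q' g)%E.
Proof.
move=> QQ; rewrite !Linfty_norm2E; apply: le_ess_sup; apply: nearW => x.
apply: ge_ereal_sup => _ [t _ <-].
apply: (@le_trans _ _ `|(g \_ Q') (x, t)|%:E); last by apply: ereal_sup_ubound; exists t.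
rewrite lee_fin !patchE; case: ifPn => Qt; last by rewrite normr0.
by rewrite mem_set//; apply: QQ; exact: set_mem.
Qed.

End sup_norms.

Section product_null_sets.
Context {R : realType} {n : nat}.
Local Notation E := 'rV[R]_n.+1.
Local Notation mu := (@lebesgue_rV R n).

(** Used to replace [u] by a bounded representative in the double integrals. *)
Lemma ae_pair (P : E -> Prop) : {ae mu, forall x, P x} ->
  {ae (mu \x mu)%E, forall p, P p.1 /\ P p.2}.
Proof.
move=> [N [mN N0 PN]]; exists ((N `*` setT) `|` (setT `*` N)); split.
- by apply: measurableU; exact: measurableX.
- apply/eqP; rewrite -measure_le0.
  apply: (le_trans (measureU2 _ _ _)); [exact: measurableX|exact: measurableX|].
  rewrite [X in (X + _)%E](product_measure1E mu mu mN measurableT).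
  rewrite [X in (_ + X)%E](product_measure1E mu mu measurableT mN).
  by rewrite [X in (X * _ + _)%E]N0 [X in (_ + _ * X)%E]N0 mul0e mule0 adde0.
move=> [x y] /= nP; have [Px|nPx] := pselect (P x); last by left; split => //; exact: PN.
by right; split => //; apply: PN => Py; apply: nP.
Qed.

End product_null_sets.

(** * From the weak formulation to [solves] *)

Section very_weak_form.
Context {R : realType} {n : nat}.
Local Notation E := 'rV[R]_n.+1.
Local Notation mu := (@lebesgue_rV R n).
Local Notation J f := (\int[mu]_x f x).
Implicit Types (x y z : E) (i : 'I_n.+1).

Variables (s rho : R) (Om V : set E) (g : E * R -> R) (u : E -> R).
Hypotheses (s01 : 0 < s < 1) (oOm : open Om) (bOm : bounded_set Om).
Hypotheses (VOm : closure V `<=` Om) (V0 : V !=set0).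
Hypotheses (rhoE : rho = set_dist V (boundary Om)).
Hypotheses (gloc : Linfty_loc Om g) (uX : X1 s Om u).
Hypotheses (uoo : (Linfty_norm setT u < +oo)%E) (usol : weak_solution s Om g u).

Local Notation M := (fine (Linfty_norm Om u)).
Local Notation W := (neighborhood_in Om V (3 / 4 * rho)).
Local Notation Q := (W `*` `[- M, M]%classic).
Local Notation U := (fine (Linfty_norm setT u)).
Local Notation G := (fine (Linfty_norm2 Q g)).

Let rho0 : 0 < rho.
Proof. by rewrite rhoE; exact: set_dist_boundary_gt0. Qed.

Let mOm : measurable Om. Proof. exact: open_rV_measurable. Qed.

Let Omoo : (mu Om < +oo)%E.
Proof.
have [b b0 Omb] := bounded_set_cube bOm.
apply: le_lt_trans (cube_measure_lty 0 b); apply: le_measure; rewrite ?inE//.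
exact: measurable_cube.
Qed.

Let mu_ : measurable_fun setT u. Proof. by case: uX. Qed.

(** Local boundedness speaks of compact sets, so the neighborhood is first enclosed in a compact
    subset of [Om]. *)
Lemma Linfty_norm2_neighborhood_lty : (Linfty_norm2 Q g < +oo)%E.
Proof.
have [b b0 Omb] := bounded_set_cube bOm.
have [K [cK KOm WK]] := neighborhood_in_compact oOm VOm rhoE rho0 Omb V0.
apply: (@le_lt_trans _ _ (Linfty_norm2 (K `*` `[- M, M]%classic) g)).
  by apply: Linfty_norm2_mono => -[x t] [/= /WK].
apply: gloc.2; first by apply: compact_setX => //; exact: segment_compact.
by move=> [x t] [/= /KOm].
Qed.

(** Truncation at the essential bound turns [u] into a representative that is bounded everywhere, as
    [solves] requires. *)
Definition clamp (b t : R) : R := Num.max (- b) (Num.min b t).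

Lemma clamp_le (b t : R) : 0 <= b -> `|clamp b t| <= b.
Proof.
move=> b0; rewrite ler_norml /clamp le_max lexx/= ge_max ge_min lexx/= andbT.
by rewrite ge0_cp.
Qed.

Lemma clamp_id (b t : R) : `|t| <= b -> clamp b t = t.
Proof. by rewrite ler_norml => /andP[tb bt]; rewrite /clamp (min_idPr bt) (max_idPr tb). Qed.

Local Notation u1 := (fun x => clamp U (u x)).

Let U0 : 0 <= U. Proof. by rewrite fine_ge0// Lnorm_ge0. Qed.

Let G0 : 0 <= G. Proof. by rewrite fine_ge0// Linfty_norm2_ge0. Qed.

Lemma clamp_ae : {ae mu, forall x, u x = u1 x}.
Proof. by apply: filterS (Linfty_norm_ae uoo) => x /(_ I) h; rewrite clamp_id. Qed.

Let mu1 : measurable_fun setT u1.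
Proof.
apply: measurable_maxr; first exact: measurable_cst.
by apply: measurable_minr => //; exact: measurable_cst.
Qed.

Let u1U x : `|u1 x| <= U. Proof. exact: clamp_le. Qed.

Let uOm : {ae mu, forall x, Om x -> `|u x| <= M}.
Proof.
apply: Linfty_norm_ae; exact: le_lt_trans (Linfty_norm_le Om u) uoo.
Qed.

Section one_test.
Variables (e : expr R n) (x0 : E) (t : R).
Hypotheses (t0 : 0 <= t) (re : forall x, t < `|x - x0| -> eval e x = 0).
Hypothesis cW : cube x0 t `<=` W.
Local Notation phi := (eval e).

Let cOm : cube x0 t `<=` Om. Proof. by move=> x /cW []. Qed.

Let me (f : expr R n) : measurable_fun setT (eval f).
Proof. exact/continuous_rV_measurable/continuous_eval. Qed.

Let eval_bound (f : expr R n) : (forall x, t < `|x - x0| -> eval f x = 0) ->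
  exists2 B : R, 0 <= B & forall x, `|eval f x| <= B.
Proof.
move=> fr; have [B B0 fB] := continuous_bounded_cube x0 t (@continuous_eval R n f).
exists B => // x; have [/fB//|/fr ->] := leP `|x - x0| t; by rewrite normr0.
Qed.

Let re1 i x : t < `|x - x0| -> eval (dexpr i e) x = 0.
Proof. exact: eval_dexpr_far_at. Qed.

Let re2 i x : t < `|x - x0| -> eval (dexpr i (dexpr i e)) x = 0.
Proof. by apply: eval_dexpr_far_at => y; exact: re1. Qed.

(** The definition of the weak gradient of [u] is applied to each $\partial_i\varphi$, itself a test
    function; this puts all derivatives on $\varphi$. *)
Lemma local_form :
  (\int[mu]_(x in Om) (dot (wgrad Om u x) (wgrad Om phi x))%:E =
   (- J (fun x => u1 x * eval (lap e) x))%:E)%E.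
Proof.
have [_ uH _] := uX; have wu := wgradP uH.
have wphi := wgradP (H1_eval t0 re oOm cOm).
have ib i : mu.-integrable Om (EFin \o (fun x => wgrad Om u x 0 i * eval (dexpr i e) x)).
  have [B B0 hB] := eval_bound (@re1 i).
  exact: (L2_mul_integrable mOm Omoo (wu i).1 (me _) hB).
have [iS eS] := Rintegral_sum (index_enum 'I_n.+1) mOm ib.
transitivity (\int[mu]_(x in Om) (\sum_i wgrad Om u x 0 i * eval (dexpr i e) x)%:E)%E.
  apply: ae_eq_integral.
  - exact: mOm.
  - apply/measurable_EFinP; apply: measurable_sum => i.
    by apply: measurable_funM; [exact: (wu i).1.1|exact: (wphi i).1.1].
  - exact: measurable_int iS.
  - apply: filterS (wgrad_eval t0 re oOm cOm Omoo) => x h Omx.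
    by congr EFin; apply: eq_bigr => i _; rewrite h.
rewrite -(fineK (integrable_fin_num mOm iS)); congr EFin.
rewrite -/(Rintegral _ _ _) eS.
have iu i : mu.-integrable setT (EFin \o (fun x => u1 x * eval (dexpr i (dexpr i e)) x)).
  have [B B0 hB] := eval_bound (@re2 i).
  apply: (@integrable_bcs _ _ _ (U * B) x0 t).
  - exact: measurable_funM.
  - by move=> x; rewrite normrM ler_pM.
  - by move=> x /re2 ->; rewrite mulr0.
have [_ eL] := Rintegral_sum (index_enum 'I_n.+1) measurableT iu.
have -> : J (fun x => u1 x * eval (lap e) x) =
    \sum_i J (fun x => u1 x * eval (dexpr i (dexpr i e)) x).
  by rewrite -eL; apply: eq_Rintegral => x _; rewrite eval_lap mulr_sumr.
rewrite -sumrN; apply: eq_bigr => i _.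
have := (wu i).2 _ (Cc_infty_test (@re1 i) cOm).
rewrite partial_eval => h; apply: oppr_inj; rewrite opprK -[LHS]h.
rewrite Rintegral_domain; last first.
  by move=> x nx; rewrite (far_outside cOm (@re2 i) nx) mulr0.
apply: Rintegral_ae_eq.
- exact: measurable_funM.
- exact: measurable_funM.
- by apply: filterS clamp_ae => x <-.
Qed.

Let pair_ae : {ae (mu \x mu)%E, forall p : E * E, u p.1 = u1 p.1 /\ u p.2 = u1 p.2}.
Proof. exact: (ae_pair clamp_ae). Qed.

Let mdiff (f : E -> R) : measurable_fun setT f -> measurable_fun setT (fun p : E * E => f p.1 - f p.2).
Proof.
move=> mf; apply: measurable_funB.
- exact: (measurableT_comp mf measurable_fst).
- exact: (measurableT_comp mf measurable_snd).
Qed.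

Let mk : measurable_fun setT (fun p : E * E => @kern R n s (p.1 - p.2)).
Proof. by apply: measurable_kern => // i; exact: measurable_coordB. Qed.

Let sqr_integrable (f : E -> R) : measurable_fun setT f ->
  (\int[mu \x mu]_p ((f p.1 - f p.2) ^+ 2 * kern s (p.1 - p.2))%:E < +oo)%E ->
  (mu \x mu)%E.-integrable setT (EFin \o (fun p => (f p.1 - f p.2) ^+ 2 * kern s (p.1 - p.2))).
Proof.
move=> mf foo; apply/integrableP; split.
  apply/measurable_EFinP; apply: measurable_funM; last exact: mk.
  by apply: measurable_funX; exact: mdiff.
move: foo; congr (_ < _)%E; apply: eq_integral => p _ /=.
by rewrite ger0_norm// mulr_ge0 ?sqr_ge0 ?kern_ge0.
Qed.

(** The double integrand is dominated by $|ab|\le a^2+b^2$ from the finite seminorms of [u] and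
    [phi], so that [nonlocal_form] applies to the truncated [u]. *)
Lemma nonlocal_form_weak :
  (\int[mu \x mu]_p ((u p.1 - u p.2) * (phi p.1 - phi p.2) /
      enorm (p.1 - p.2) `^ (n.+1%:R + 2 * s))%:E = (NL s e u1)%:E)%E.
Proof.
have mform (f : E -> R) : measurable_fun setT f -> measurable_fun setT
    (fun p : E * E => (f p.1 - f p.2) * (phi p.1 - phi p.2) * kern s (p.1 - p.2)).
  move=> mf; apply: measurable_funM; last exact: mk.
  by apply: measurable_funM; [exact: mdiff|exact: (mdiff (me e))].
have i1 : (mu \x mu)%E.-integrable setT
    (EFin \o (fun p => (u1 p.1 - u1 p.2) ^+ 2 * kern s (p.1 - p.2))).
  apply: (sqr_integrable mu1).
  have [_ _ ug] := uX.
  have : (\int[mu \x mu]_p ((u p.1 - u p.2) ^+ 2 * kern s (p.1 - p.2))%:E < +oo)%E.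
    move: ug; rewrite /gagliardo; apply: contraTT; rewrite -!leNgt !leye_eq => /eqP h.
    by rewrite [X in (X `^ _)%E]h poweRyr// invr_eq0.
  congr (_ < _)%E; apply: ae_eq_integral.
  - exact: measurableT.
  - apply/measurable_EFinP; apply: measurable_funM; last exact: mk.
    by apply: measurable_funX; exact: mdiff.
  - apply/measurable_EFinP; apply: measurable_funM; last exact: mk.
    by apply: measurable_funX; exact: (mdiff mu1).
  - by apply: filterS pair_ae => p [h1 h2] _; rewrite {1}h1 {1}h2.
have i2 := sqr_integrable (me e) (gagliardo_eval_lty s01 t0 re).
have iF : (mu \x mu)%E.-integrable setT
    (EFin \o (fun p => (u1 p.1 - u1 p.2) * (phi p.1 - phi p.2) * kern s (p.1 - p.2))).
  have := integrableD measurableT i1 i2; apply: le_integrable.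
  - exact: measurableT.
  - by apply/measurable_EFinP; exact: (mform _ mu1).
  move=> p _ /=; rewrite lee_fin normrM [`|kern _ _|]ger0_norm ?kern_ge0//.
  apply: le_trans (ler_norm _); rewrite -mulrDl ler_wpM2r ?kern_ge0//.
  rewrite normrM; set a := u1 _ - _; set b := phi _ - _.
  rewrite -[a ^+ 2]real_normK ?num_real// -[b ^+ 2]real_normK ?num_real//.
  by have := sqr_ge0 (`|a| - `|b|); have := normr_ge0 a; have := normr_ge0 b; nra.
rewrite -(nonlocal_form s01 t0 re mu1 u1U iF); apply: ae_eq_integral.
- exact: measurableT.
- by apply/measurable_EFinP; exact: (mform u mu_).
- by apply/measurable_EFinP; exact: (mform _ mu1).
- by apply: filterS pair_ae => p [h1 h2] _; rewrite {1}h1 {1}h2.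
Qed.

Lemma very_weak_form :
  `|J (fun x => u1 x * eval (lap e) x) - NL s e u1| <= G * J (fun x => `|phi x|).
Proof.
have := usol (X10_eval t0 re oOm cOm Omoo s01); rewrite local_form nonlocal_form_weak => eq.
have mgu : measurable_fun Om (fun x => (g (x, u x) * phi x)%:E).
  apply/measurable_EFinP; apply: measurable_funM; last exact: measurable_funTS.
  apply: (measurable_comp (F := Om `*` setT) (f := g) (g := fun x => (x, u x))).
  - exact: measurableX.
  - by move=> _ [x Omx <-].
  - exact: gloc.1.
  - by apply: measurable_funTS; apply: measurable_fun_pair => //; exact: measurable_id.
have iphi : mu.-integrable setT (EFin \o (fun x => `|phi x|)).
  have [B B0 hB] := eval_bound re.
  exact: (integrable_abse (integrable_bcs (me e) hB re)).
have : (`|\int[mu]_(x in Om) (g (x, u x) * phi x)%:E| <= (G * J (fun x => `|phi x|))%:E)%E.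
  apply: (le_trans (le_abse_integral mu mOm mgu)).
  apply: (@le_trans _ _ (\int[mu]_(x in Om) (G * `|phi x|)%:E)%E).
    apply: ae_ge0_le_integral.
    - exact: mOm.
    - by [].
    - exact: (measurableT_comp (@abse_measurable R setT) mgu).
    - by move=> x _; rewrite lee_fin mulr_ge0.
    - apply/measurable_EFinP; apply: measurable_funM; first exact: measurable_cst.
      by apply: measurable_funTS; exact: measurable_norm_fun.
    apply: filterS2 (Linfty_norm2_ae Q g) uOm => x gQ uM Omx.
    rewrite /= lee_fin normrM; have [xt|/re ->] := leP `|x - x0| t; last by rewrite normr0 !mulr0.
    rewrite ler_wpM2r// -lee_fin fineK; last first.
      by rewrite ge0_fin_numE ?Linfty_norm2_ge0// Linfty_norm2_neighborhood_lty.
    (* On the support of [phi] the point lies in [W], and almost everywhere $u(x)$ lies in the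
       interval of the second variable. *)
    by apply: gQ; split; [exact: cW|rewrite /= in_itv/= -ler_norml uM].
  apply: (@le_trans _ _ (\int[mu]_x (G * `|phi x|)%:E)%E).
    apply: ge0_subset_integral; [exact: mOm|exact: measurableT| | |by []].
    + apply/measurable_EFinP; apply: measurable_funM; first exact: measurable_cst.
      exact: measurable_norm_fun.
    + by move=> x _; rewrite lee_fin mulr_ge0.
  have iG := integrableZl measurableT G iphi.
  by rewrite -RintegralZl// /Rintegral fineK ?(integrable_fin_num measurableT iG).
rewrite -eq -EFinD abse_EFin lee_fin.
by rewrite addrC distrC.
Qed.

End one_test.

(** A single number has to bound the solution and the right-hand side, whence the sum, which is also
    the quantity in the final estimate. *)
Lemma solves_clamp : solves s V (3 / 4 * rho / n.+1%:R) u1 (G + U).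
Proof.
split; first exact: mu1.
  by move=> x; apply: (le_trans (u1U x)); rewrite lerDr.
move=> e x0 t t0 re Vx0; apply: (@le_trans _ _ (G * J (fun x => `|eval e x|))).
  apply: (very_weak_form t0 re) => x xt.
  by apply: (nbd_neighborhood_in oOm VOm rhoE rho0); exact: nbdW Vx0 xt.
by rewrite ler_wpM2r ?lerDl// Rintegral_ge0.
Qed.

End very_weak_form.

(** * Hoelder estimates *)

Section holder_functions.
Context {R : realType} {n : nat}.
Local Notation E := 'rV[R]_n.+1.
Implicit Types (x y z : E) (V : set E).

Lemma powR_small (K p e : R) : 0 <= K -> 0 < p -> 0 < e ->
  exists2 d : R, 0 < d & forall t, 0 <= t -> t <= d -> K * t `^ p <= e.
Proof.
move=> K0 p0 e0; pose q := e / (K + 1).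
have q0 : 0 < q by rewrite divr_gt0// ltr_wpDl.
exists (q `^ p^-1); first exact: powR_gt0.
move=> t t0 td; apply: (@le_trans _ _ (K * q)).
  rewrite ler_wpM2l//; have := ge0_ler_powR (ltW p0) _ _ td.
  rewrite -powRrM mulVf ?gt_eqF// powRr1 ?(ltW q0)//.
  by apply; rewrite nnegrE ?powR_ge0.
by rewrite /q mulrCA ler_piMr ?(ltW e0)// ler_pdivrMr ?ltr_wpDl// mul1r lerDl.
Qed.

Lemma holder_continuous (f : E -> R) x (K d p : R) : 0 <= K -> 0 < d -> 0 < p ->
  (forall z, `|z| <= d -> `|f (x + z) - f x| <= K * `|z| `^ p) -> {for x, continuous f}.
Proof.
move=> K0 d0 p0 hf; apply: eps_delta_continuous => e e0.
have [t t0 ht] := powR_small K0 p0 e0.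
exists (Num.min d t); first by rewrite lt_min d0.
move=> y; rewrite lt_min => /andP[/ltW yd /ltW yt].
have := hf (y - x) yd; rewrite [x + _]addrC subrK => /le_trans; apply.
exact: ht.
Qed.

Lemma holder_continuous_rV (f : E -> E) x (K d p : R) : 0 <= K -> 0 < d -> 0 < p ->
  (forall i z, `|z| <= d -> `|f (x + z) 0 i - f x 0 i| <= K * `|z| `^ p) ->
  {for x, continuous f}.
Proof.
move=> K0 d0 p0 hf.
suff : forall e : R, 0 < e -> \forall y \near nbhs x, `|f x - f y| <= e.
  by move/(@cvgrPdist_le R E _ (nbhs x) (@nbhs_filter _ x) f (f x)).
move=> e e0; have [t t0 ht] := powR_small K0 p0 e0.
apply/nbhs_ballP; exists (Num.min d t); first by rewrite /= lt_min d0.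
move=> y; rewrite -ball_normE/= distrC lt_min => /andP[/ltW yd /ltW yt].
apply: norm_le_coord => i; rewrite !mxE distrC.
have := hf i (y - x) yd; rewrite [x + _]addrC subrK => /le_trans; apply.
exact: ht.
Qed.

Lemma taylor_is_derive (f : E -> R) x (w : 'I_n.+1 -> R) (K d p : R) i :
  0 <= K -> 0 < d -> 0 < p ->
  (forall z, `|z| <= d -> `|f (x + z) - f x - \sum_j z 0 j * w j| <= K * `|z| `^ (1 + p)) ->
  is_derive x (delta_mx 0 i) f (w i).
Proof.
move=> K0 d0 p0 hf; pose v : E := delta_mx 0 i.
have nv h : `|h *: v| = `|h|.
  rewrite normrZ (_ : `|v| = 1) ?mulr1//; apply/eqP; rewrite eq_le; apply/andP; split.
    apply: norm_le_coord => j; rewrite mxE eqxx /=.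
    by case: (_ == _); rewrite ?normr1 ?normr0.
  by have := coord_le_norm v i; rewrite mxE !eqxx normr1.
have cv : (fun h : R => h^-1 *: ((f \o shift x) (h *: v) - f x)) @ 0^' --> w i.
  apply/cvgrPdist_le => e e0; have [t t0 ht] := powR_small K0 p0 e0.
  apply/nbhs_ballP; exists (Num.min d t); first by rewrite /= lt_min d0.
  move=> h; rewrite -ball_normE/= sub0r normrN lt_min => /andP[/ltW hd /ltW hht] h0.
  have hp : 0 < `|h| by rewrite normr_gt0.
  rewrite -(ler_pM2l hp) -normrM.
  have -> : h * (w i - h^-1 *: (f (h *: v + x) - f x)) =
      - (f (x + h *: v) - f x - \sum_j (h *: v) 0 j * w j).
    rewrite (bigD1 i)//= big1 ?addr0; last first.
      by move=> j ji; rewrite !mxE eqxx (negbTE ji) mulr0 mul0r.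
    rewrite !mxE !eqxx mulr1 [x + _]addrC mulrBr [h * (h^-1 *: _)]mulrA mulfV// mul1r.
    by rewrite [RHS]opprB.
  rewrite normrN; have := hf (h *: v); rewrite nv => /(_ hd) /le_trans; apply.
  rewrite powRD ?(gt_eqF hp) ?implybT// powRr1// mulrCA ler_wpM2l//.
  exact: ht.
split; first by apply/cvg_ex; exists (w i).
by rewrite /derive; exact: (cvg_lim (@Rhausdorff R) cv).
Qed.

Lemma closure_nbd V (r : R) : 0 < r -> closure V `<=` nbd V r.
Proof.
move=> r0 x /(_ (ball x r)) [|y [Vy]]; first exact: nbhsx_ballx.
by rewrite -ball_normE /=; exists y.
Qed.

(** The Taylor estimate identifies [w] with the gradient. Points at distance more than [d] are
    compared by the sup bound $2K\le 2Kd^{-\alpha}|x-y|^\alpha$, and each factor [n.+1] converts sup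
    norms into Euclidean ones. *)
Lemma C1alpha_of_estimates V (alpha K d r : R) (v : E -> R) (w : 'I_n.+1 -> E -> R) :
  0 < alpha < 1 -> 0 <= K -> 0 < d -> 0 < r ->
  (forall x, `|v x| <= K) -> (forall i x, nbd V r x -> `|w i x| <= K) ->
  (forall x z, nbd V r x -> `|z| <= d ->
    `|v (x + z) - v x - \sum_i z 0 i * w i x| <= K * `|z| `^ (1 + alpha)) ->
  (forall i x z, nbd V r x -> `|z| <= d -> `|w i (x + z) - w i x| <= K * `|z| `^ alpha) ->
  C1alpha V alpha v /\
  (C1alpha_norm V alpha v <=
    ((1 + n.+1%:R + (n.+1%:R + n.+1%:R * 2 * d `^ (- alpha))) * K)%:E)%E.
Proof.
move=> /andP[al0 al1] K0 d0 r0 vK wK vT wH.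
have VV x : V x -> nbd V r x by move=> Vx; apply: closure_nbd => //; exact: subset_closure.
have dv i x : nbd V r x -> is_derive x (delta_mx 0 i) v (w i x).
  move=> Vx; apply: (taylor_is_derive i K0 d0 al0 (w := w ^~ x)) => z zd.
  exact: vT.
have gradE x : nbd V r x -> grad v x = \row_i w i x.
  by move=> Vx; apply/rowP => i; rewrite !mxE /partial; have [_ ->] := dv i x Vx.
have nrm : (C1alpha_norm V alpha v <=
    ((1 + n.+1%:R + (n.+1%:R + n.+1%:R * 2 * d `^ (- alpha))) * K)%:E)%E.
  rewrite !mulrDl mul1r !EFinD /C1alpha_norm; apply: leeD; first apply: leeD.
  - by apply: ge_ereal_sup => _ [x Vx <-]; rewrite lee_fin.
  - apply: ge_ereal_sup => _ [x Vx <-]; rewrite lee_fin.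
    apply: (le_trans (enorm_le_norm _)); rewrite ler_wpM2l//.
    by rewrite (gradE _ (VV x Vx)); apply: norm_le_coord => i; rewrite mxE; apply: wK; exact: VV.
  - rewrite -EFinD; apply: ge_ereal_sup => _ [x [y [Vx Vy xy ->]]]; rewrite lee_fin.
    have zn : 0 < `|x - y| by rewrite normr_gt0 subr_eq0.
    have zE : `|x - y| <= enorm (x - y) by exact: norm_le_enorm.
    have zp : 0 < enorm (x - y) `^ alpha by rewrite powR_gt0// (lt_le_trans zn).
    rewrite (gradE _ (VV x Vx)) (gradE _ (VV y Vy)) ler_pdivrMr//.
    apply: (le_trans (enorm_le_norm _)); rewrite -!mulrA -mulrDr -mulrA ler_wpM2l//.
    apply: norm_le_coord => i; rewrite !mxE.
    have [zd|/ltW zd] := leP `|x - y| d.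
      have := wH i y (x - y) (VV y Vy) zd; rewrite [y + _]addrC subrK => /le_trans; apply.
      rewrite mulrDl; apply: (@le_trans _ _ (K * enorm (x - y) `^ alpha)).
        by rewrite ler_wpM2l// ge0_ler_powR ?nnegrE ?(ltW al0)// enorm_ge0.
      by rewrite lerDl !mulr_ge0 ?powR_ge0.
    apply: (le_trans (ler_normB _ _)).
    apply: (@le_trans _ _ (2 * (d `^ (- alpha) * K) * enorm (x - y) `^ alpha)); last first.
      by rewrite ler_wpM2r ?(ltW zp)// lerDr.
    have wx := wK i x (VV x Vx); have wy := wK i y (VV y Vy).
    apply: (@le_trans _ _ (2 * K)); first by rewrite mulr_natl mulr2n lerD.
    have -> : 2 * (d `^ (- alpha) * K) * enorm (x - y) `^ alpha =
        2 * K * (d `^ (- alpha) * enorm (x - y) `^ alpha) by ring.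
    rewrite ler_peMr ?mulr_ge0// powRN mulrC ler_pdivlMr ?powR_gt0// mul1r.
    by rewrite ge0_ler_powR ?nnegrE ?(ltW al0) ?enorm_ge0// ?(ltW d0)// (le_trans zd).
split; last exact: nrm; split.
- apply: continuous_in_subspaceT => x; rewrite inE => /(closure_nbd r0) Vx.
  (* For $|z|\le 1$ the remainder $|z|^{1+\alpha}$ is at most $|z|$, so [v] is Lipschitz near
     [x]. *)
  have d1 : 0 < Num.min d 1 by rewrite lt_min d0 ltr01.
  apply: (@holder_continuous _ _ (n.+1%:R * K + K) (Num.min d 1) 1) => //.
    by rewrite addr_ge0// mulr_ge0.
  move=> z; rewrite le_min => /andP[zd z1]; rewrite powRr1//.
  have := vT x z Vx zd; set a := v (x + z) - v x; set b := \sum_i _ => hab.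
  have hb : `|b| <= n.+1%:R * (`|z| * K).
    apply: (le_trans (ler_norm_sum _ _ _)).
    apply: (@le_trans _ _ (\sum_(i < n.+1) (`|z| * K))).
      by apply: ler_sum => i _; rewrite normrM ler_pM ?coord_le_norm//; exact: wK.
    by rewrite big_const_ord iter_addr_0 mulr_natl.
  have hz : `|z| `^ (1 + alpha) <= `|z|.
    have [z0|z0] := eqVneq `|z| 0; first by rewrite z0 powR0// gt_eqF// addr_gt0.
    by rewrite powRD ?(negbTE z0) ?implybT// powRr1// ler_piMr// powR_le1// ltW.
  have := ler_wpM2l K0 hz; have := ler_normD (a - b) b; rewrite subrK.
  have zK : n.+1%:R * (`|z| * K) = n.+1%:R * K * `|z| by ring.
  rewrite zK in hb.
  by rewrite mulrDl; lra.
- by move=> x i Vx; have [] := dv i x (VV x Vx).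
- exists (fun x => \row_i w i x); split; last by move=> x Vx; rewrite gradE//; exact: VV.
  apply: continuous_in_subspaceT => x; rewrite inE => /(closure_nbd r0) Vx.
  apply: (@holder_continuous_rV _ _ K d alpha) => // i z zd.
  by rewrite !mxE; exact: wH.
- by apply: (le_lt_trans nrm); rewrite ltry.
Qed.

End holder_functions.

Theorem theorem1p4 (R : realType) (n : nat) (s alpha rho : R)
    (V : set 'rV[R]_n.+1) :
  0 < s < 1 -> 0 < alpha < 1 ->
  open V -> connected V -> V !=set0 ->
  exists2 C : R, 0 < C &
    forall (Om : set 'rV[R]_n.+1) (g : 'rV[R]_n.+1 * R -> R)
           (u : 'rV[R]_n.+1 -> R),
      open Om -> bounded_set Om -> closure V `<=` Om ->
      rho = set_dist V (boundary Om) ->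
      Linfty_loc Om g ->
      X1 s Om u -> (Linfty_norm setT u < +oo)%E ->
      weak_solution s Om g u ->
      let M := fine (Linfty_norm Om u) in
      let I_u : set R := `[- M, M]%classic in
      exists v : 'rV[R]_n.+1 -> R,
        [/\ {ae (@lebesgue_rV R n), forall x, closure V x -> u x = v x},
            C1alpha V alpha v &
            (C1alpha_norm V alpha v <=
             C%:E * (Linfty_norm2 (neighborhood_in Om V (3 / 4 * rho) `*` I_u) g
                     + Linfty_norm setT u))%E].
Proof.
move=> s01 al01 oV cV V0.
have [rho0|rho0] := leP rho 0.
  (* A value [rho <= 0] is never the distance from [V] to such a boundary, so any constant will
     do. *)
  exists 1 => // Om g u oOm bOm VOm rhoE.
  by have := set_dist_boundary_gt0 oOm bOm VOm V0; rewrite -rhoE ltNge rho0.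
(* The geometry enters the constant through this radius alone, so the constant is fixed before [Om],
   [g] and [u]. *)
pose r := 3 / 4 * rho / n.+1%:R; have r0 : 0 < r by rewrite divr_gt0// mulr_gt0// divr_gt0.
have r2 : 0 < r / 2 < r by apply/andP; split; lra.
have [C [d [C0 d0 hC]]] := @interior_regularity R n s s01 alpha _ _ al01 r2.
pose D := 1 + n.+1%:R + (n.+1%:R + n.+1%:R * 2 * d `^ (- alpha)).
have D0 : 0 < D.
  have h : 0 <= n.+1%:R * 2 * d `^ (- alpha) by rewrite mulr_ge0 ?powR_ge0// mulr_ge0.
  by rewrite /D -addrA ltr_wpDr// !addr_ge0.
exists (D * C); first exact: mulr_gt0.
move=> Om g u oOm bOm VOm rhoE gloc uX uoo usol M I_u.
have us := solves_clamp s01 oOm bOm VOm V0 rhoE gloc uX uoo usol.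
have uc := clamp_ae uoo.
have goo := Linfty_norm2_neighborhood_lty u oOm bOm VOm V0 rhoE gloc.
have [b b0 Omb] := bounded_set_cube bOm.
have Vb : V `<=` cube 0 b by move=> x Vx; apply/Omb/VOm; exact: subset_closure.
have [v [w [uv vA wA vT wH]]] := hC V b _ _ Vb us.
set A := _ + _ in us vA wA vT wH.
have A0 : 0 <= A by case: us => _ h _; exact: le_trans (h 0).
have r20 : 0 < r / 2 by case/andP: r2.
have [vC vn] := C1alpha_of_estimates al01 (mulr_ge0 (ltW C0) A0) d0 r20 vA wA vT wH.
exists v; split => //.
  by apply: filterS2 uc uv => x ux vx _; exact: etrans ux vx.
apply: (le_trans vn); rewrite -/D mulrA EFinM EFinD /A !fineK//.
  by rewrite ge0_fin_numE// Lnorm_ge0.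
by rewrite ge0_fin_numE// Lnorm_ge0.
Qed.
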